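(* Let $(M,g,J)$ be a 4-dimensional conformally Kähler Riemannian manifold, oriented so that its fundamental 2-form is anti-self-dual. Working locally, let $o^A$ be a spinor field representing $J$, with scaling chosen so that $o^A\nabla_{AA'}o_B=0$, and let $\iota_A=o^\dagger_A$, $\chi=o_A\iota^A$, $r=\chi^{-1}\phi$. Let $\mathcal{J}$ be a function with values in $\mathrm{GL}(n,\mathbb{C})$ and define a matrix-valued 1-form $A$ by $$A=\mathcal{J}^{-1}\tilde\partial\mathcal{J},\qquad\text{or in spinor terms}\qquad A_{AA'}=-\chi^{-1}\mathcal{J}^{-1}\iota_A o^B\nabla_{BA'}\mathcal{J}.$$ Then $A_{AA'}$ is the gauge potential of a self-dual Yang–Mills (SDYM) field (i.e. $F=\mathrm{d}A+A\wedge A$ satisfies $*F=F$) if and only if $\mathcal{J}$ satisfies $$\nabla^{A'}\big(r\,\mathcal{J}^{-1}\tilde\nabla_{A'}\mathcal{J}\big)=0,\qquad \nabla_{A'}:=\iota^A\nabla_{AA'},\quad \tilde\nabla_{A'}:=o^A\nabla_{AA'}.$$ Conversely, any SDYM field with structure group $\mathrm{GL}(n,\mathbb{C})$ can (locally, in a suitable gauge) be represented by a gauge potential of the form $A_{AA'}=-\chi^{-1}\mathcal{J}^{-1}\iota_A o^B\nabla_{BA'}\mathcal{J}$ for some matrix $\mathcal{J}$ satisfying this equation.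
   Context: All constructions are local. $(M,g)$ is an oriented 4-dimensional Riemannian manifold with an integrable orthogonal complex structure $J$; $\kappa(\cdot,\cdot)=g(J\cdot,\cdot)$ is the fundamental 2-form, and the orientation is such that $*\kappa=-\kappa$. Conformally Kähler means that there is locally a (positive) scalar field $\phi$ with $\mathrm{d}(\phi^2\kappa)=0$. Here $\mathrm{d}=\partial+\tilde\partial$ is the splitting of the exterior derivative induced by $J$: for local $J$-holomorphic coordinates $(z,w)$ with conjugates $(\tilde z,\tilde w)=(\bar z,\bar w)$, $\partial=\mathrm{d}z\,\partial_z+\mathrm{d}w\,\partial_w$ and $\tilde\partial=\mathrm{d}\tilde z\,\partial_{\tilde z}+\mathrm{d}\tilde w\,\partial_{\tilde w}$. Spinors: abstract indices in Penrose–Rindler conventions ($\psi_B=\psi^A\epsilon_{AB}$, $\psi^A=\epsilon^{AB}\psi_B$, similarly for primed indices; $g_{ab}=\epsilon_{AB}\epsilon_{A'B'}$). $\mathbb{S},\mathbb{S}'$ are the (local) unprimed/primed spin bundles, with $\Lambda^2_-\cong\mathbb{S}^*\odot\mathbb{S}^*$ (anti-self-dual) and $\Lambda^2_+\cong\mathbb{S}'^*\odot\mathbb{S}'^*$ (self-dual). $\nabla_{AA'}$ is the Levi-Civita connection of $g$ extended to spinors. $\dagger$ is Euclidean spinor conjugation: $(a,b)\mapsto(-\bar b,\bar a)$ in components. A spinor $o^A$ represents $J$ if, with $\iota^A=o^{\dagger A}$ and $\chi=o_A\iota^A$, $$J^a{}_b=i\chi^{-1}(o^A\iota_B+\iota^Ao_B)\delta^{A'}_{B'}.$$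 This determines $o^A$ up to scale; under the conformally Kähler hypothesis a local scaling with $o^A\nabla_{AA'}o_B=0$ exists. With these conventions $\partial_{\tilde z},\partial_{\tilde w}$ are of the form $o^A(\cdot)^{A'}$ and $\partial_z,\partial_w$ of the form $\iota^A(\cdot)^{A'}$. In $\nabla^{A'}(r\mathcal{J}^{-1}\tilde\nabla_{A'}\mathcal{J})$ the operator $\nabla^{A'}$ acts on the spinor-valued quantity via the Levi-Civita spin connection. Yang–Mills: $E\to M$ is a rank-$n$ complex vector bundle with structure group $\mathrm{GL}(n,\mathbb{C})$ and connection $\mathrm{D}$, written locally as $\mathrm{D}=\mathrm{d}+A$ with $A$ a matrix-valued 1-form (gauge potential) and curvature $F=\mathrm{d}A+A\wedge A$. It is a SDYM field if $*F=F$. *)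

(* Defs.v *)
(* MathComp-Analysis.  Everything is local: the manifold is an open subset U
   of R^4 (the domain of a positively oriented chart x^0, .., x^3), the bundle
   E and the spin bundles are trivialised over U, and tensors and spinors are
   given by their components.  Coordinate indices a, b, c.. range over 'I_4,
   spinor indices (primed or not) over 'I_2. *)
From HB Require Import structures.
From mathcomp Require Import all_boot all_order all_algebra.
From mathcomp Require Import complex ring.
From mathcomp Require Import all_classical all_reals all_analysis.
Set Implicit Arguments.
Unset Strict Implicit.
Unset Printing Implicit Defensive.
Import Order.TTheory GRing.Theory Num.Theory.
Import numFieldNormedType.Exports.
Local Open Scope classical_set_scope.
Local Open Scope ring_scope.
Local Open Scope complex_scope.

Section Calculus.
Context {R : realType}.
Implicit Types (U V : set 'rV[R]_4) (x : 'rV[R]_4) (a b c d : 'I_4).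

Definition pd a (f : 'rV[R]_4 -> R) (x : 'rV[R]_4) : R :=
  'D_(delta_mx ord0 a) f x.

(* C^infinity on U, when U is open *)
Definition smooth U (f : 'rV[R]_4 -> R) : Prop :=
  forall (s : seq 'I_4) x, U x -> differentiable (foldr pd f s) x.

Definition smoothC U (f : 'rV[R]_4 -> R[i]) : Prop :=
  smooth U (fun x => complex.Re (f x)) /\ smooth U (fun x => complex.Im (f x)).

Definition smoothM m n U (f : 'rV[R]_4 -> 'M[R[i]]_(m, n)) : Prop :=
  forall i j, smoothC U (fun x => f x i j).

Definition pdC a (f : 'rV[R]_4 -> R[i]) x : R[i] :=
  pd a (fun y => complex.Re (f y)) x +i* pd a (fun y => complex.Im (f y)) x.

Definition pdM m n a (f : 'rV[R]_4 -> 'M[R[i]]_(m, n)) x : 'M[R[i]]_(m, n) :=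
  \matrix_(i, j) pdC a (fun y => f y i j) x.

End Calculus.

Section Geometry.
Context {R : realType}.
Implicit Types (U V : set 'rV[R]_4) (x : 'rV[R]_4) (a b c d : 'I_4).
Implicit Types (g : 'rV[R]_4 -> 'M[R]_4) (J : 'rV[R]_4 -> 'M[R]_4).

(* g x a b = g_ab *)
Definition riemannian_metric U g : Prop :=
  (forall a b, smooth U (fun x => g x a b)) /\
  forall x, U x -> (g x)^T = g x /\
    forall v : 'rV[R]_4, v != 0 -> 0 < (v *m g x *m v^T) ord0 ord0.

(* J x a b = J^a_b *)
Definition orthogonal_almost_complex U g J : Prop :=
  (forall a b, smooth U (fun x => J x a b)) /\
  forall x, U x -> J x *m J x = - 1%:M /\ (J x)^T *m g x *m J x = g x.

Definition coord_map (z w : 'rV[R]_4 -> R[i]) x : 'rV[R]_4 :=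
  \row_k [:: complex.Re (z x); complex.Im (z x);
             complex.Re (w x); complex.Im (w x)]`_k.

(* f is J-holomorphic: df o J = i df *)
Definition holomorphic V J (f : 'rV[R]_4 -> R[i]) : Prop :=
  smoothC V f /\
  forall x a, V x -> \sum_b pdC b f x * (J x b a)%:C = 'i * pdC a f x.

(* (z, w) is a diffeomorphism from V onto an open subset of C^2 = R^4 with
   J-holomorphic components *)
Definition holomorphic_coordinates V J (z w : 'rV[R]_4 -> R[i]) : Prop :=
  [/\ open V, holomorphic V J z, holomorphic V J w, open (coord_map z w @` V) &
      exists psi : 'rV[R]_4 -> 'rV[R]_4,
        (forall a, smooth (coord_map z w @` V) (fun y => psi y ord0 a)) /\
        forall x, V x -> psi (coord_map z w x) = x].

Definition integrable_structure U J : Prop :=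
  forall x, U x -> exists V z w,
    [/\ V x, V `<=` U & holomorphic_coordinates V J z w].

(* kappa(X, Y) = g(J X, Y) *)
Definition fundamental_form g J x a b : R := \sum_c J x c a * g x c b.

Definition closed_2form U (k : 'rV[R]_4 -> 'I_4 -> 'I_4 -> R) : Prop :=
  forall x a b c, U x ->
    pd a (fun y => k y b c) x + pd b (fun y => k y c a) x
      + pd c (fun y => k y a b) x = 0.

Definition conformally_kahler_factor U g J (phi : 'rV[R]_4 -> R) : Prop :=
  [/\ smooth U phi, forall x, U x -> 0 < phi x &
      closed_2form U (fun x a b => phi x ^+ 2 * fundamental_form g J x a b)].

(* epsilon_{abcd}, with epsilon_{0123} = 1 *)
Definition levi_civita a b c d : R :=
  \det (\matrix_(i < 4, j < 4) (([:: a; b; c; d]`_i : 'I_4) == j)%:R).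

(* ( *F )_ab = \sum_cd hodge_coef (g x) a b c d * F_cd
             = 1/2 sqrt(det g) epsilon_{abpq} g^{pc} g^{qd} F_cd *)
Definition hodge_coef (gx : 'M[R]_4) a b c d : R :=
  2^-1 * Num.sqrt (\det gx) *
  \sum_p \sum_q levi_civita a b p q * invmx gx p c * invmx gx q d.

Definition hodge g x (k : 'I_4 -> 'I_4 -> R) a b : R :=
  \sum_c \sum_d hodge_coef (g x) a b c d * k c d.

Definition hodgeM n g x (F : 'I_4 -> 'I_4 -> 'M[R[i]]_n) a b : 'M[R[i]]_n :=
  \sum_c \sum_d (hodge_coef (g x) a b c d)%:C *: F c d.

Definition antiselfdual_fundamental_form U g J : Prop :=
  forall x a b, U x ->
    hodge g x (fundamental_form g J x) a b = - fundamental_form g J x a b.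

Definition christoffel g x c a b : R :=
  2^-1 * \sum_d invmx (g x) c d *
    (pd a (fun y => g y b d) x + pd b (fun y => g y a d) x
       - pd d (fun y => g y a b) x).

(* Splitting d = del + dbar into the components of type (1,0) and (0,1), that
   is alpha o J = i alpha and alpha o J = - i alpha; see dbar_coordE for the
   expression in holomorphic coordinates. *)
Definition dbar J (f : 'rV[R]_4 -> R[i]) x a : R[i] :=
  2^-1 * (pdC a f x + 'i * \sum_b pdC b f x * (J x b a)%:C).

Definition dbarM n J (f : 'rV[R]_4 -> 'M[R[i]]_n) x a : 'M[R[i]]_n :=
  \matrix_(i, j) dbar J (fun y => f y i j) x a.

(* The coefficients of df in the coframe dz, dw, d\bar z, d\bar w are the
   partial derivatives f_z, f_w, f_zb, f_wb, and
   dbar f = d\bar z f_zb + d\bar w f_wb. *)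
Lemma dbar_coordE V J z w (f : 'rV[R]_4 -> R[i]) x (fz fw fzb fwb : R[i]) :
  holomorphic_coordinates V J z w -> V x ->
  (forall a, pdC a f x = pdC a z x * fz + pdC a w x * fw
                         + (pdC a z x)^* * fzb + (pdC a w x)^* * fwb) ->
  forall a, dbar J f x a = (pdC a z x)^* * fzb + (pdC a w x)^* * fwb.
Proof.
case=> _ [_ hz] [_ hw] _ _ Vx fE a.
have conjJ (h : 'rV[R]_4 -> R[i]) :
    \sum_b pdC b h x * (J x b a)%:C = 'i * pdC a h x ->
    \sum_b (pdC b h x)^* * (J x b a)%:C = - 'i * (pdC a h x)^*.
  have conj_i : ('i : R[i])^* = - 'i.
    by apply/eqP; rewrite eq_complex /= oppr0 !eqxx.
  rewrite -conj_i -rmorphM => <-; rewrite rmorph_sum.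
  by apply: eq_bigr => b _; rewrite rmorphM /= oppr0.
have ii : 'i * 'i = -1 :> R[i] by rewrite -expr2 sqr_i.
have Jf : \sum_b pdC b f x * (J x b a)%:C =
    'i * (pdC a z x * fz + pdC a w x * fw)
    - 'i * ((pdC a z x)^* * fzb + (pdC a w x)^* * fwb).
  transitivity (\sum_b (pdC b z x * (J x b a)%:C * fz
      + pdC b w x * (J x b a)%:C * fw
      + (pdC b z x)^* * (J x b a)%:C * fzb
      + (pdC b w x)^* * (J x b a)%:C * fwb)).
    by apply: eq_bigr => b _; rewrite fE; ring.
  rewrite !big_split /= -!mulr_suml hz // hw //.
  by rewrite (conjJ _ (hz x a Vx)) (conjJ _ (hw x a Vx)); ring.
by rewrite /dbar Jf fE mulrBr !mulrA ii; field.
Qed.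

End Geometry.

Section Spinors.
Context {R : realType}.
Implicit Types (U V : set 'rV[R]_4) (x : 'rV[R]_4) (a b c d : 'I_4).
Implicit Types (g : 'rV[R]_4 -> 'M[R]_4) (J : 'rV[R]_4 -> 'M[R]_4).
Implicit Types (A B : 'I_2).

(* eps_{AB} = eps^{AB} = eps_{A'B'} = eps^{A'B'}, eps_{01} = 1 *)
Definition eps2 A B : R[i] := (A < B)%:R - (B < A)%:R.

(* psi_B = psi^A eps_AB *)
Definition lower (psi : 'I_2 -> R[i]) B : R[i] := \sum_A psi A * eps2 A B.

(* (p, q) |-> (- \bar q, \bar p) *)
Definition dagger (psi : 'I_2 -> R[i]) A : R[i] :=
  if A == ord0 then - (psi ord_max)^* else (psi ord0)^*.

(* s x a A A' = s_a^{AA'} identifies TM (x) C with S (x) S'.  Real vectors are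
   those fixed by the antilinear conjugation of S (x) S' sending psi^A xi^A' to
   (dagger psi)^A (dagger xi)^A'; as (dagger psi)^A = - eps^{AB} \bar{psi^B}, the
   two signs cancel.  The last clause says that the forms psi_AB eps_A'B', psi
   symmetric, are anti-self-dual. *)
Definition spin_frame U g (s : 'rV[R]_4 -> 'I_4 -> 'M[R[i]]_2) : Prop :=
  (forall a, smoothM U (fun x => s x a)) /\
  forall x, U x ->
  [/\ forall a b, (g x a b)%:C = \sum_A \sum_A' \sum_B \sum_B'
        eps2 A B * eps2 A' B' * s x a A A' * s x b B B',
      forall a A A', s x a A A' =
        \sum_B \sum_B' eps2 A B * eps2 A' B' * (s x a B B')^* &
      forall psi : 'M[R[i]]_2, psi^T = psi ->
        let k a b := \sum_A \sum_A' \sum_B \sum_B'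
          psi A B * eps2 A' B' * s x a A A' * s x b B B' in
        forall a b,
          \sum_c \sum_d (hodge_coef (g x) a b c d)%:C * k c d = - k a b].

(* s^a_{AA'} = g^{ab} eps_BA eps_B'A' s_b^{BB'}, so that
   V_{AA'} = s^a_{AA'} V_a and V_a = s_a^{AA'} V_{AA'} *)
Definition inv_frame g (s : 'rV[R]_4 -> 'I_4 -> 'M[R[i]]_2) x a A A' : R[i] :=
  \sum_b (invmx (g x) a b)%:C *
    \sum_B \sum_B' eps2 B A * eps2 B' A' * s x b B B'.

(* Gam x a C B = Gamma_{aB}^C: nabla_a psi_B = d_a psi_B - Gamma_{aB}^C psi_C
   and nabla_a psi^B = d_a psi^B + Gamma_{aC}^B psi^C *)
Definition nabla_low (Gam : 'rV[R]_4 -> 'I_4 -> 'M[R[i]]_2)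
    (psi : 'rV[R]_4 -> 'I_2 -> R[i]) x a B : R[i] :=
  pdC a (fun y => psi y B) x - \sum_C Gam x a C B * psi x C.

Definition nabla_lowM n (Gam : 'rV[R]_4 -> 'I_4 -> 'M[R[i]]_2)
    (Y : 'rV[R]_4 -> 'I_2 -> 'M[R[i]]_n) x a B : 'M[R[i]]_n :=
  pdM a (fun y => Y y B) x - \sum_C Gam x a C B *: Y x C.

Definition preserves_eps U (Gam : 'rV[R]_4 -> 'I_4 -> 'M[R[i]]_2) : Prop :=
  forall x a A B, U x ->
    \sum_C (Gam x a C A * eps2 C B + Gam x a C B * eps2 A C) = 0.

(* The Levi-Civita connection on S (Gam) and S' (Gam'): eps_AB, eps_A'B' and
   the frame s_b^{AA'} are parallel. *)
Definition spin_connection U g (s : 'rV[R]_4 -> 'I_4 -> 'M[R[i]]_2)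
    (Gam Gam' : 'rV[R]_4 -> 'I_4 -> 'M[R[i]]_2) : Prop :=
  [/\ preserves_eps U Gam, preserves_eps U Gam' &
      forall x a b A A', U x ->
        pdC a (fun y => s y b A A') x
        - \sum_c (christoffel g x c a b)%:C * s x c A A'
        + \sum_B Gam x a A B * s x b B A'
        + \sum_B' Gam' x a A' B' * s x b A B' = 0].

Definition chi (o : 'rV[R]_4 -> 'I_2 -> R[i]) x : R[i] :=
  \sum_A lower (o x) A * dagger (o x) A.

(* J^a_b = i chi^-1 (o^A iota_B + iota^A o_B) delta^A'_B', iota = dagger o *)
Definition represents U g J s (o : 'rV[R]_4 -> 'I_2 -> R[i]) : Prop :=
  forall x a b, U x ->
    (J x a b)%:C = \sum_A \sum_A' \sum_B \sum_B'
      inv_frame g s x a A A' *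
      ('i * (chi o x)^-1 *
         (o x A * lower (dagger (o x)) B + dagger (o x) A * lower (o x) B) *
         (A' == B')%:R) *
      s x b B B'.

(* o^A nabla_{AA'} o_B = 0 *)
Definition shear_scaled U g s Gam (o : 'rV[R]_4 -> 'I_2 -> R[i]) : Prop :=
  forall x A' B, U x ->
    \sum_A \sum_a o x A * inv_frame g s x a A A' *
      nabla_low Gam (fun y => lower (o y)) x a B = 0.

End Spinors.

Section YangMills.
Context {R : realType} {n : nat}.
Implicit Types (U V : set 'rV[R]_4) (x : 'rV[R]_4) (a b c d : 'I_4).
Implicit Types (g : 'rV[R]_4 -> 'M[R]_4) (J : 'rV[R]_4 -> 'M[R]_4).
Implicit Types (s : 'rV[R]_4 -> 'I_4 -> 'M[R[i]]_2).
Implicit Types (o : 'rV[R]_4 -> 'I_2 -> R[i]).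
Implicit Types (Y h : 'rV[R]_4 -> 'M[R[i]]_n).
Implicit Types (P : 'rV[R]_4 -> 'I_4 -> 'M[R[i]]_n).

Definition smoothGL U h : Prop :=
  smoothM U h /\ forall x, U x -> h x \in unitmx.

(* F = dP + P /\ P for the gauge potential P = P_a dx^a *)
Definition curvature P x a b : 'M[R[i]]_n :=
  pdM a (fun y => P y b) x - pdM b (fun y => P y a) x
    + (P x a *m P x b - P x b *m P x a).

Definition self_dual_YM U g P : Prop :=
  forall x a b, U x -> hodgeM g x (curvature P x) a b = curvature P x a b.

Definition gauge_transform h P x a : 'M[R[i]]_n :=
  invmx (h x) *m P x a *m h x + invmx (h x) *m pdM a h x.

(* P_{AA'} *)
Definition spinor_components g s P x (A A' : 'I_2) : 'M[R[i]]_n :=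
  \sum_a inv_frame g s x a A A' *: P x a.

(* nabla_{AA'} Y *)
Definition nablaM g s Y x (A A' : 'I_2) : 'M[R[i]]_n :=
  \sum_a inv_frame g s x a A A' *: pdM a Y x.

(* Y^-1 dbar Y *)
Definition dbar_potential J Y x a : 'M[R[i]]_n := invmx (Y x) *m dbarM J Y x a.

(* - chi^-1 Y^-1 iota_A o^B nabla_{BA'} Y *)
Definition spinor_potential g s o Y x (A A' : 'I_2) : 'M[R[i]]_n :=
  - ((chi o x)^-1 * lower (dagger (o x)) A) *:
    (invmx (Y x) *m \sum_B o x B *: nablaM g s Y x B A').

(* r Y^-1 o^A nabla_{AA'} Y,  r = chi^-1 phi *)
Definition scaled_current g s o (phi : 'rV[R]_4 -> R) Y x (A' : 'I_2) :
    'M[R[i]]_n :=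
  ((chi o x)^-1 * (phi x)%:C) *:
    (invmx (Y x) *m \sum_A o x A *: nablaM g s Y x A A').

(* nabla^{A'} X_{A'} = 0 with nabla^{A'} = iota^A nabla_A^{A'}
   = eps^{A'B'} iota^A nabla_{AB'} *)
Definition current_equation U g s (Gam' : 'rV[R]_4 -> 'I_4 -> 'M[R[i]]_2)
    o phi Y : Prop :=
  forall x, U x ->
    \sum_A' \sum_B' \sum_A \sum_a
      (eps2 A' B' * dagger (o x) A * inv_frame g s x a A B') *:
        nabla_lowM Gam' (scaled_current g s o phi Y) x a A' = 0.

End YangMills.

(* Main.v *)
(** Put L_A' = o^A nabla_AA' and N_A' = iota^A nabla_AA': these span the vectors
    of type (0,1) and (1,0), and a 2-form F is self-dual iff F(L_0,L_1) = 0,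
    F(N_0,N_1) = 0 and F(L_0,N_1) = F(L_1,N_0).  For A = Y^-1 dbar Y the first
    two equations hold because A is pure gauge along the (0,1) vectors and zero
    along the (1,0) vectors.  The scaling of o makes o parallel along the L_A',
    hence its conjugate iota parallel along the N_A', and then
    F(L_0,N_1) - F(L_1,N_0) is a linear combination of the N_A'-derivatives of
    f_B' = Y^-1 L_B' Y and of the f_B' themselves; the coefficients of the latter
    are exactly the N_A'-derivatives of log r, by closedness of phi^2 kappa, so
    that the whole expression is - r^-1 nabla^A' (r f_A').

    Conversely a self-dual connection is flat along the (0,1) vectors and along
    the (1,0) vectors, so the Koszul-Malgrange theorem yields frames k2 and k1
    parallel in these directions; in the frame k1 the potential is
    Y^-1 dbar Y with Y = k2^-1 k1.  The Koszul-Malgrange theorem in two complex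
    variables follows from two applications of the one-variable equation
    dbar k = P k with smooth parameters, which is solved on a small box by a
    Neumann series for the Cauchy transform of a cut-off of P. *)
Require Import Defs.
From HB Require Import structures.
From mathcomp Require Import all_boot all_order all_algebra.
From mathcomp Require Import perm complex ring lra.
From mathcomp Require Import all_classical all_reals all_analysis.
Set Implicit Arguments.
Unset Strict Implicit.
Unset Printing Implicit Defensive.
Import Order.TTheory GRing.Theory Num.Theory.
Import numFieldNormedType.Exports.
Local Open Scope classical_set_scope.
Local Open Scope ring_scope.
Local Open Scope complex_scope.

(** * Calculus on open subsets of R^4 *)

Section RealCalculus.
Context {R : realType}.
Implicit Types (U V : set 'rV[R]_4) (f g : 'rV[R]_4 -> R) (x : 'rV[R]_4).

(** The Cauchy transform is truncated to a disc and written in polar coordinates about the point of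
    evaluation: the Jacobian cancels the pole, leaving 2r times the mean over the unit square of
    exp(-2 pi i t) f(x - s r exp(2 pi i t)). There is no singular integral, the operator commutes
    with all derivatives, and it inverts dbar at each point whose circle of radius r avoids the
    support of f. Its norm is proportional to r, so a small box makes the series converge. Smallness
    is required only once: by Leibniz the highest derivative of a term meets the undifferentiated
    coefficient, so all derivatives converge geometrically under the same condition. The obstacle in
    two variables is that solving the second equation must not spoil the first. It is solved in the
    frame given by the first, where the compatibility condition makes its coefficient holomorphic in
    the first variable; a cut-off that is a product of functions of one coordinate preserves this.
    On the spinor side, the Hodge star is fixed up to one constant by antisymmetry alone, and the
    constant is read off the orientation clause of the spin frame. *)

Definition covec (c : 'I_4 -> R) (h : 'rV[R]_4) : R := \sum_a h ord0 a * c a.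

Lemma covec_is_linear c : linear (covec c).
Proof.
move=> k u v; transitivity (k * covec c u + covec c v) => //.
rewrite /covec mulr_sumr -big_split /=.
by apply: eq_bigr => a _; rewrite !mxE mulrDl mulrA.
Qed.

HB.instance Definition _ c :=
  GRing.isLinear.Build R 'rV[R]_4 R *:%R (covec c) (covec_is_linear c).

Lemma covec_continuous c : continuous (covec c).
Proof.
move=> h; have -> : covec c = \sum_a ((fun h : 'rV[R]_4 => h ord0 a) * cst (c a)).
  by apply/funext => y; rewrite fct_sumE.
elim/big_ind: _ => [||a _]; first exact: cst_continuous.
  by move=> u v cu cv; apply: continuousD.
apply: continuousM; first exact: coord_continuous.
exact: cst_continuous.
Qed.

Lemma covec_delta c a : covec c (delta_mx ord0 a) = c a.
Proof.
rewrite /covec (bigD1 a) //= mxE !eqxx mul1r big1 ?addr0// => b ba.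
by rewrite mxE (negPf ba) mul0r.
Qed.

Lemma covecE (l : {linear 'rV[R]_4 -> R}) h :
  l h = covec (fun a => l (delta_mx ord0 a)) h.
Proof.
rewrite {1}[h]row_sum_delta linear_sum; apply: eq_bigr => a _.
by rewrite linearZ.
Qed.

Lemma coord_le_norm (h : 'rV[R]_4) a : `|h ord0 a| <= `|h|.
Proof.
rewrite [leRHS]/Num.norm /= mx_normrE.
by apply: le_trans (le_bigmax _ _ (ord0, a)).
Qed.

Lemma covec_le c C h : (forall a, `|c a| <= C) -> `|covec c h| <= 4 * C * `|h|.
Proof.
move=> cC; rewrite /covec (le_trans (ler_norm_sum _ _ _))//.
apply: le_trans (_ : \sum_(a < 4) C * `|h| <= _).
  apply: ler_sum => a _; rewrite normrM mulrC.
  by apply: ler_pM => //; exact: coord_le_norm.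
by rewrite sumr_const card_ord -[leLHS]mulr_natl mulrA.
Qed.

(** Uniqueness of the differential: a candidate gradient with remainder o(h) is the gradient. Every
    derivative that is not obtained from the algebraic rules is computed this way. *)
Lemma differentiable_crit f (c : 'I_4 -> R) x :
  (forall e : R, 0 < e -> \forall h \near (0 : 'rV[R]_4),
     `|f (h + x) - f x - covec c h| <= e * `|h|) ->
  differentiable f x /\ forall a, pd a f x = c a.
Proof.
move=> H.
have E : (f : 'rV[R]_4 -> R^o) \o shift x =
    cst (f x : R^o) + (covec c : 'rV[R]_4 -> R^o) +o_ (0 : 'rV[R]_4) id.
  apply/eqaddoP => e e0; near=> h.
  rewrite /= !fctE /= opprD addrA.
  by near: h; exact: H.
have D := diff_unique (@covec_continuous c) E.
have df : differentiable f x.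
  by apply/diff_locallyP; rewrite D; split => //; exact: covec_continuous.
by split => // a; rewrite /pd deriveE // D; exact: covec_delta.
Unshelve. all: by end_near. Qed.

Lemma differentiable_pdE f x h : differentiable f x ->
  'd f x h = covec (fun a => pd a f x) h.
Proof.
move=> df; rewrite covecE; apply: eq_bigr => a _.
by rewrite /pd deriveE.
Qed.

Lemma differentiable_pd_crit f x : differentiable f x ->
  forall e : R, 0 < e -> \forall h \near (0 : 'rV[R]_4),
     `|f (h + x) - f x - covec (fun a => pd a f x) h| <= e * `|h|.
Proof.
move=> df e e0; have := diff_locally df.
move=> /eqaddoP /(_ _ e0); apply: filterS => h /=.
by rewrite !fctE /= opprD addrA differentiable_pdE.
Qed.

Lemma near_differentiable f g x : (\forall y \near x, f y = g y) ->
  differentiable f x -> differentiable g x.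
Proof.
move=> fg df.
apply: (@differentiable_crit _ (fun a => pd a f x) x _).1 => e e0.
have fgx := nbhs_singleton fg.
move: fg; rewrite (near_shift 0) subr0 => fg.
apply: filterS2 fg (differentiable_pd_crit df e0) => h /= ->.
by rewrite fgx.
Qed.

Lemma near_pd f g x a : (\forall y \near x, f y = g y) -> pd a f x = pd a g x.
Proof. exact: near_eq_derive. Qed.

Lemma open_near U (P : 'rV[R]_4 -> Prop) x : open U -> U x ->
  (forall y, U y -> P y) -> \forall y \near x, P y.
Proof.
move=> oU Ux UP; apply: filterS UP _; exact: open_nbhs_nbhs.
Qed.

Lemma pdD f g x a : differentiable f x -> differentiable g x ->
  pd a (fun y => f y + g y) x = pd a f x + pd a g x.
Proof. by move=> df dg; rewrite /pd deriveD //; exact: diff_derivable. Qed.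

Lemma pdN f x a : differentiable f x -> pd a (fun y => - f y) x = - pd a f x.
Proof. by move=> df; rewrite /pd deriveN //; exact: diff_derivable. Qed.

Lemma pd_mul f g x a : differentiable f x -> differentiable g x ->
  pd a (fun y => f y * g y) x = pd a f x * g x + f x * pd a g x.
Proof.
move=> df dg; rewrite /pd deriveM; [|exact: diff_derivable..].
by rewrite addrC /= mulrC.
Qed.

Lemma pd_cst k x a : pd a (fun=> k) x = 0.
Proof. exact: derive_cst. Qed.

Lemma pdV f x a : differentiable f x -> f x != 0 ->
  pd a (fun y => (f y)^-1) x = - (f x) ^- 2 * pd a f x.
Proof.
by move=> df f0; rewrite /pd deriveV //; exact: diff_derivable.
Qed.

Lemma pd_coord a b x : pd a (fun y : 'rV[R]_4 => y ord0 b) x = (a == b)%:R.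
Proof.
have [] := @differentiable_crit (fun y => y ord0 b) (fun a => (a == b)%:R) x.
  move=> e e0; near=> h; rewrite /covec (bigD1 b) //= eqxx mulr1 big1.
    rewrite mxE addr0.
    by rewrite addrK subrr normr0 mulr_ge0 // ltW.
  by move=> c /negPf ->; rewrite mulr0.
by move=> _; exact.
Unshelve. all: by end_near. Qed.

Lemma differentiable_coord_rV b x :
  differentiable (fun y : 'rV[R]_4 => y ord0 b) x.
Proof. exact: differentiable_coord. Qed.

(** Smoothness graded by order. Products and inverses are treated by induction on [m], since a first
    derivative of a product is again a sum of products, whereas no simple closed formula exists for
    [foldr pd] along a list. *)
Fixpoint Sm m U f : Prop :=
  (forall x, U x -> differentiable f x) /\
  if m is m'.+1 then forall a, Sm m' U (pd a f) else True.

Lemma smooth_pd U f a : smooth U f -> smooth U (pd a f).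
Proof. by move=> sf s x Ux; have := sf (rcons s a) x Ux; rewrite foldr_rcons. Qed.

Lemma smooth_differentiable U f x : smooth U f -> U x -> differentiable f x.
Proof. by move=> sf; exact: (sf [::]). Qed.

Lemma smoothP U f : smooth U f <-> forall m, Sm m U f.
Proof.
split.
  move=> sf m; elim: m f sf => [|m IH] f sf /=; split => //.
  - by move=> x; exact: smooth_differentiable.
  - by move=> x; exact: smooth_differentiable.
  - by move=> a; apply: IH; exact: smooth_pd.
move=> H s; have := H (size s); elim/last_ind: s f {H} => [|s a IH] f /=.
  by move=> [].
by rewrite size_rcons foldr_rcons => -[_ /(_ a)]; exact: IH.
Qed.

Lemma SmW m U f : Sm m.+1 U f -> Sm m U f.
Proof.
elim: m f => [|m IH] f [df Hf]; split => // a.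
by apply: IH; exact: Hf.
Qed.

Lemma Sm_eq m U f g : open U -> (forall x, U x -> f x = g x) ->
  Sm m U f -> Sm m U g.
Proof.
move=> oU; elim: m f g => [|m IH] f g fg [df Hf]; split => //.
- by move=> x Ux; apply: near_differentiable (df x Ux); exact: open_near fg.
- by move=> x Ux; apply: near_differentiable (df x Ux); exact: open_near fg.
- move=> a; apply: IH (Hf a) => x Ux.
  by apply: near_pd; exact: open_near fg.
Qed.

Lemma Sm_cst m U k : Sm m U (fun=> k).
Proof.
elim: m k => [|m IH] k; split => //.
move=> a; rewrite (_ : pd a _ = fun=> 0)//.
by apply/funext => x; exact: pd_cst.
Qed.

Lemma SmD m U f g : open U -> Sm m U f -> Sm m U g ->
  Sm m U (fun x => f x + g x).
Proof.
move=> oU; elim: m f g => [|m IH] f g [df Hf] [dg Hg]; split => //.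
- by move=> x Ux; apply: differentiableD; [exact: df|exact: dg].
- by move=> x Ux; apply: differentiableD; [exact: df|exact: dg].
- move=> a; apply: (@Sm_eq _ _ (fun x => pd a f x + pd a g x)) => //.
    by move=> x Ux; rewrite pdD//; [exact: df|exact: dg].
  by apply: IH; [exact: Hf|exact: Hg].
Qed.

Lemma SmM m U f g : open U -> Sm m U f -> Sm m U g ->
  Sm m U (fun x => f x * g x).
Proof.
move=> oU; elim: m f g => [|m IH] f g Hf Hg.
  split => // x Ux; exact: differentiableM (Hf.1 x Ux) (Hg.1 x Ux).
have [df Hf'] := Hf; have [dg Hg'] := Hg.
split; first by move=> x Ux; exact: differentiableM (df x Ux) (dg x Ux).
move=> a; apply: (@Sm_eq _ _ (fun x => pd a f x * g x + f x * pd a g x)) => //.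
  by move=> x Ux; rewrite pd_mul//; [exact: df|exact: dg].
by apply: SmD => //; apply: IH; [exact: Hf'|exact: SmW|exact: SmW|exact: Hg'].
Qed.

Lemma SmV m U f : open U -> (forall x, U x -> f x != 0) -> Sm m U f ->
  Sm m U (fun x => (f x)^-1).
Proof.
move=> oU f0; elim: m => [|m IH] Hf.
  by split => // x Ux; apply: differentiableV; [exact: Hf.1|exact: f0].
have [df Hf'] := Hf.
split; first by move=> x Ux; apply: differentiableV; [exact: df|exact: f0].
move=> a; apply: (@Sm_eq _ _ (fun x => (-1) * ((f x)^-1 * (f x)^-1) * pd a f x)) => //.
  move=> x Ux; rewrite pdV//; [|exact: df|exact: f0].
  by rewrite mulN1r -invfM -expr2.
have IHm := IH (SmW Hf).
apply: SmM => //; last exact: Hf'.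
by apply: SmM => //; [exact: Sm_cst|exact: SmM].
Qed.

Lemma smooth_eq U f g : open U -> (forall x, U x -> f x = g x) ->
  smooth U f -> smooth U g.
Proof. by move=> oU fg /smoothP H; apply/smoothP => m; exact: Sm_eq (H m). Qed.

Lemma smooth_cst U k : smooth U (fun=> k).
Proof. by apply/smoothP => m; exact: Sm_cst. Qed.

Lemma smoothD U f g : open U -> smooth U f -> smooth U g ->
  smooth U (fun x => f x + g x).
Proof. by move=> oU /smoothP H /smoothP K; apply/smoothP => m; exact: SmD. Qed.

Lemma smoothMr U f g : open U -> smooth U f -> smooth U g ->
  smooth U (fun x => f x * g x).
Proof. by move=> oU /smoothP H /smoothP K; apply/smoothP => m; exact: SmM. Qed.

Lemma smoothN U f : open U -> smooth U f -> smooth U (fun x => - f x).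
Proof.
move=> oU H; apply: (@smooth_eq _ (fun x => (-1) * f x)) => //.
  by move=> x _; rewrite mulN1r.
by apply: smoothMr => //; exact: smooth_cst.
Qed.

Lemma smoothV U f : open U -> (forall x, U x -> f x != 0) -> smooth U f ->
  smooth U (fun x => (f x)^-1).
Proof. by move=> oU f0 /smoothP H; apply/smoothP => m; exact: SmV. Qed.

Lemma smooth_coord U b : smooth U (fun x => x ord0 b).
Proof.
apply/smoothP => m; case: m => [|m]; split => //; try by
  move=> x _; exact: differentiable_coord_rV.
move=> a; rewrite (_ : pd a _ = fun=> (a == b)%:R); first exact: Sm_cst.
by apply/funext => x; exact: pd_coord.
Qed.

Lemma smoothS U V f : V `<=` U -> smooth U f -> smooth V f.
Proof. by move=> VU H s x /VU; exact: H. Qed.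

Lemma differentiable_rV (G : 'rV[R]_4 -> 'rV[R]_4) x :
  (forall b, differentiable (fun y => G y ord0 b) x) -> differentiable G x.
Proof.
move=> dG.
rewrite (_ : G = \sum_b (fun y => G y ord0 b *: delta_mx ord0 b)); last first.
  by apply/funext => y; rewrite fct_sumE -row_sum_delta.
elim/big_rec: _ => [|b F _ dF]; first exact: differentiable_cst.
apply: differentiableD => //.
exact: (@differentiableZl _ _ _ (fun y => G y ord0 b)).
Qed.

Lemma differentiable_comp_rV f (G : 'rV[R]_4 -> 'rV[R]_4) x :
  (forall b, differentiable (fun y => G y ord0 b) x) ->
  differentiable f (G x) -> differentiable (fun y => f (G y)) x.
Proof.
by move=> dG df; apply: (@differentiable_comp _ _ _ _ G f) => //; exact: differentiable_rV.
Qed.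

Lemma diff_coordE (G : 'rV[R]_4 -> 'rV[R]_4) x v b :
  differentiable G x ->
  ('d G x v) ord0 b = 'D_v (fun y => G y ord0 b) x.
Proof.
move=> dG; rewrite -deriveE// derive_mx; last exact: diff_derivable.
by rewrite mxE.
Qed.

Lemma pd_comp_rV f (G : 'rV[R]_4 -> 'rV[R]_4) x a :
  (forall b, differentiable (fun y => G y ord0 b) x) ->
  differentiable f (G x) ->
  pd a (fun y => f (G y)) x =
  \sum_b pd a (fun y => G y ord0 b) x * pd b f (G x).
Proof.
move=> dG df; have dG' := differentiable_rV dG.
rewrite /pd deriveE; last exact: differentiable_comp_rV.
rewrite (@diff_comp _ _ _ _ G f)//= differentiable_pdE//.
by apply: eq_bigr => b _; rewrite diff_coordE.
Qed.

Lemma derive_line f x v t : differentiable f (x + t *: v) ->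
  is_derive t 1 (fun t => f (x + t *: v)) (covec (fun a => pd a f (x + t *: v)) v).
Proof.
move=> df.
have dl : is_diff t (fun t : R => x + t *: v) ( *:%R^~ v).
  have := is_diffD (is_diff_cst x t) (is_diff_scalel t v).
  by rewrite add0r.
have dfl : differentiable ((f : 'rV[R]_4 -> R^o) \o (fun t : R^o => x + t *: v)) t.
  exact: (differentiable_comp (ex_diff (is_diff_def := dl)) df).
apply: DeriveDef; first exact/derivable1_diffP.
rewrite (deriveE _ dfl).
have -> := diff_comp (ex_diff (is_diff_def := dl)) df.
by rewrite /= differentiable_pdE // (diff_val (is_diff_def := dl)) scale1r.
Qed.

Lemma Sm_sum (I : Type) (r : seq I) m U (F : I -> 'rV[R]_4 -> R) :
  open U -> (forall i, Sm m U (F i)) ->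
  Sm m U (fun x => \sum_(i <- r) F i x).
Proof.
move=> oU HF; elim: r => [|i r IH].
  apply: (@Sm_eq _ _ (fun=> 0)) => //; last exact: Sm_cst.
  by move=> x _; rewrite big_nil.
apply: (@Sm_eq _ _ (fun x => F i x + \sum_(j <- r) F j x)) => //.
  by move=> x _; rewrite big_cons.
exact: SmD.
Qed.

Lemma smooth_comp_rV U V f (G : 'rV[R]_4 -> 'rV[R]_4) :
  open U -> (forall b, smooth U (fun y => G y ord0 b)) ->
  (forall x, U x -> V (G x)) -> smooth V f -> smooth U (fun y => f (G y)).
Proof.
move=> oU sG UV /smoothP sf; apply/smoothP => m.
elim: m f sf => [|m IH] f sf.
  split => // x Ux; apply: differentiable_comp_rV.
    by move=> b; exact: smooth_differentiable (sG b) Ux.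
  by have [+ _] := sf 0%N; apply; exact: UV.
have df x : U x -> differentiable f (G x).
  by move=> Ux; have [+ _] := sf 0%N; apply; exact: UV.
have dG x b : U x -> differentiable (fun y => G y ord0 b) x.
  by move=> Ux; exact: smooth_differentiable (sG b) Ux.
split; first by move=> x Ux; apply: differentiable_comp_rV; auto.
move=> a; apply: (@Sm_eq _ _ (fun x => \sum_b
    pd a (fun y => G y ord0 b) x * pd b f (G x))) => //.
  by move=> x Ux; rewrite pd_comp_rV; auto.
apply: Sm_sum => // b; apply: SmM => //.
  by have /smoothP := smooth_pd a (sG b); exact.
by apply: IH => k; have [_] := sf k.+1; exact.
Qed.

End RealCalculus.

(** * Symmetry of second partial derivatives *)

Section Clairaut.
Context {R : realType}.
Implicit Types (U : set 'rV[R]_4) (f : 'rV[R]_4 -> R) (x : 'rV[R]_4).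

Lemma near0_ball (P : 'rV[R]_4 -> Prop) : (\forall h \near (0 : 'rV[R]_4), P h) ->
  exists2 d : R, 0 < d & forall h : 'rV[R]_4, `|h| < d -> P h.
Proof.
move=> /nbhs_ballP[d d0 Hd]; exists d => // h hd; apply: Hd.
by rewrite -ball_normE /= sub0r normrN.
Qed.

Lemma norm_delta a : `|delta_mx ord0 a : 'rV[R]_4| <= 1.
Proof.
rewrite [leLHS]/Num.norm /= mx_normrE; apply: bigmax_le => // i _.
by rewrite mxE; case: (_ && _); rewrite ?normr0 ?normr1.
Qed.

(** The mean value theorem is applied along direction [a] to the increment of [f] in direction [b];
    it leaves a difference of two values of [pd a f], each of which is expanded to first order at
    [x]. Differentiability of [pd a f] at the single point [x] is enough. *)
Lemma second_difference f x a b e : 0 < e ->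
  (\forall y \near x, differentiable f y) -> differentiable (pd a f) x ->
  exists2 d : R, 0 < d & forall h, 0 < h < d ->
    `|f (h *: delta_mx ord0 a + h *: delta_mx ord0 b + x)
      - f (h *: delta_mx ord0 a + x) - f (h *: delta_mx ord0 b + x) + f x
      - h ^+ 2 * pd b (pd a f) x| <= 3 * e * h ^+ 2.
Proof.
move=> e0 df da; rewrite (near_shift 0) subr0 in df.
have [d1 d10 Hd1] := near0_ball df.
have [d2 d20 Hd2] := near0_ball (differentiable_pd_crit da e0).
set ea : 'rV[R]_4 := delta_mx ord0 a; set eb : 'rV[R]_4 := delta_mx ord0 b.
have nab t s h : 0 <= t <= h -> 0 <= s <= h ->
    `|t *: ea + s *: eb| <= h + h.
  move=> /andP[t0 th] /andP[s0 sh].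
  apply: (le_trans (ler_normD _ _)); rewrite !normrZ !ger0_norm//.
  by apply: lerD; rewrite -[leRHS]mulr1; apply: ler_pM => //; exact: norm_delta.
have [d d0 [dd1 dd2]] : exists2 d : R, 0 < d & d + d <= d1 /\ d + d <= d2.
  exists (Num.min d1 d2 / 2); first by rewrite divr_gt0 // lt_min d10.
  by rewrite -splitr; split; rewrite ge_min lexx // orbT.
exists d => // h /andP[h0 hd].
pose phi t := f (t *: ea + h *: eb + x) - f (t *: ea + x).
have dphi t : 0 <= t <= h -> is_derive t 1 phi
    (pd a f (t *: ea + h *: eb + x) - pd a f (t *: ea + x)).
  move=> th; rewrite /phi.
  have D k : `|t *: ea + k| < d1 -> is_derive t 1 (fun t => f (t *: ea + k + x))
      (pd a f (t *: ea + k + x)).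
    move=> lt; have := @derive_line _ f (k + x) ea t.
    have E s : k + x + s *: ea = s *: ea + k + x by rewrite addrC addrA.
    rewrite E => /(_ (Hd1 _ lt)); rewrite covec_delta.
    by under eq_fun do rewrite E.
  have D1 := D (h *: eb); have D2 := D 0.
  have e0' s : s *: ea + 0 = s *: ea by rewrite addr0.
  rewrite e0' (_ : (fun s => f (s *: ea + 0 + x)) = fun s => f (s *: ea + x)) in D2;
    last by apply/funext => s; rewrite e0'.
  have hd1 : h + h < d1 by apply: lt_le_trans dd1; exact: ltrD.
  have hh : 0 <= h <= h by rewrite lexx ltW.
  have K := nab t 0 h th; rewrite scale0r addr0 in K.
  apply: (@is_deriveB R R^o R^o (fun s => f (s *: ea + h *: eb + x))
    (fun s => f (s *: ea + x))).
    exact: D1 (le_lt_trans (nab _ _ h th hh) hd1).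
  by apply: D2; apply: le_lt_trans (K _) hd1; rewrite lexx ltW.
have [||c cI] := @MVT_segment _ phi (fun t => pd a f (t *: ea + h *: eb + x) -
    pd a f (t *: ea + x)) 0 h (ltW h0).
- by move=> t; rewrite in_itv /= => /andP[t0 th]; apply: dphi; rewrite (ltW t0) (ltW th).
- apply: derivable_within_continuous => t; rewrite in_itv /= => th.
  exact: (ex_derive (is_derive := dphi t th)).
rewrite /phi scale0r !add0r subr0; move: cI; rewrite in_itv /= => cI E.
have -> : f (h *: ea + h *: eb + x) - f (h *: ea + x) - f (h *: eb + x) + f x =
    (pd a f (c *: ea + h *: eb + x) - pd a f (c *: ea + x)) * h.
  by rewrite -E; ring.
have h2 : h + h < d2 by apply: lt_le_trans dd2; exact: ltrD.
have hh : 0 <= h <= h by rewrite lexx ltW.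
have B1 := Hd2 _ (le_lt_trans (nab _ _ _ cI hh) h2).
have B2 : `|pd a f (c *: ea + x) - pd a f x -
   covec (fun b => pd b (pd a f) x) (c *: ea)| <= e * `|c *: ea|.
  apply: Hd2; have := nab c 0 h cI; rewrite scale0r addr0 => K.
  by apply: le_lt_trans (K _) h2; rewrite lexx ltW.
rewrite linearD !linearZ /= !covec_delta in B1.
rewrite linearZ /= !covec_delta in B2.
set u := pd a f (c *: ea + x) in B1 B2 *.
set v := pd a f (c *: ea + h *: eb + x) in B1 B2 *.
set w := pd a f x in B1 B2.
set A := pd a (pd a f) x in B1 B2 *; set B := pd b (pd a f) x in B1 B2 *.
have -> : (v - u) * h - h ^+ 2 * B =
  h * ((v - w - (c *: A + h *: B)) - (u - w - c *: A)).
  by rewrite /GRing.scale /=; ring.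
rewrite normrM gtr0_norm// mulrC expr2 mulrA ler_pM2r//.
apply: (le_trans (ler_normB _ _)); apply: (le_trans (lerD B1 B2)).
have K1 := nab c h h cI hh.
have K2 : `|c *: ea| <= h.
  have := nab c 0 h cI; rewrite normrZ.
  move: cI => /andP[c0 ch] _; rewrite ger0_norm// -[leRHS]mulr1.
  by apply: ler_pM => //; exact: norm_delta.
(* The two displacements have norms at most 2h and h, whence the constant 3. *)
rewrite -mulrDr (_ : 3 * e * h = e * (h + h + h)); last by ring.
by rewrite ler_pM2l// lerD.
Qed.

Lemma pd_comm U f x a b : open U -> smooth U f -> U x ->
  pd a (pd b f) x = pd b (pd a f) x.
Proof.
move=> oU sf Ux.
have ndf : \forall y \near x, differentiable f y.
  by apply: (open_near oU Ux) => y; exact: smooth_differentiable.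
have dpd c : differentiable (pd c f) x.
  exact: smooth_differentiable (smooth_pd c sf) Ux.
apply/eqP; rewrite -subr_eq0 -normr_le0; apply/ler_addgt0Pl => e e0.
rewrite addr0.
(* Two second differences, each with error 3 (e/6) h^2, are the same quantity up to exchanging [a]
   and [b]. *)
have e6 : 0 < e / 6 by rewrite divr_gt0.
have [d1 d10 H1] := second_difference b e6 ndf (dpd a).
have [d2 d20 H2] := second_difference a e6 ndf (dpd b).
pose h := Num.min d1 d2 / 2.
have h0 : 0 < h by rewrite divr_gt0 // lt_min d10.
have hm : h < Num.min d1 d2.
  by rewrite /h ltr_pdivrMr // ltr_pMr ?ltr1n // lt_min d10.
move: (H1 h) (H2 h); rewrite h0 /=; move: hm; rewrite lt_min => /andP[-> ->].
move=> /(_ isT) B1 /(_ isT) B2.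
have h2 : 0 < h ^+ 2 by rewrite exprn_gt0.
rewrite -(ler_pM2l h2) -[X in X * `|_|]gtr0_norm// -normrM.
set F := f _ in B1; set F1 := f _ in B1; set F2 := f _ in B1.
rewrite [h *: delta_mx _ b + _]addrC -/F -/F1 -/F2 in B2.
set A := pd a _ x in B2 *; set B := pd b _ x in B1 *.
have -> : h ^+ 2 * (A - B) = (F - F1 - F2 + f x - h ^+ 2 * B) -
   (F - F2 - F1 + f x - h ^+ 2 * A) by ring.
apply: (le_trans (ler_normB _ _)); apply: (le_trans (lerD B1 B2)).
by rewrite le_eqVlt; apply/orP; left; apply/eqP; field.
Qed.

End Clairaut.

(** * Complex-valued and matrix-valued functions *)

Section ComplexCalculus.
Context {R : realType}.
Implicit Types (U V : set 'rV[R]_4) (f g : 'rV[R]_4 -> R[i]) (x : 'rV[R]_4).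

Definition diffC f x := differentiable (fun y => complex.Re (f y)) x /\
  differentiable (fun y => complex.Im (f y)) x.

Lemma Re_M (u v : R[i]) : complex.Re (u * v) =
  complex.Re u * complex.Re v - complex.Im u * complex.Im v.
Proof. by case: u v => [? ?] []. Qed.

Lemma Im_M (u v : R[i]) : complex.Im (u * v) =
  complex.Re u * complex.Im v + complex.Im u * complex.Re v.
Proof. by case: u v => [? ?] []. Qed.

Lemma Re_D (u v : R[i]) : complex.Re (u + v) = complex.Re u + complex.Re v.
Proof. by case: u v => [? ?] []. Qed.

Lemma Im_D (u v : R[i]) : complex.Im (u + v) = complex.Im u + complex.Im v.
Proof. by case: u v => [? ?] []. Qed.

Lemma complex_eq (u v : R[i]) : complex.Re u = complex.Re v ->
  complex.Im u = complex.Im v -> u = v.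
Proof. by case: u v => [a b] [c d] /= -> ->. Qed.

Lemma smoothC_diffC U f x : smoothC U f -> U x -> diffC f x.
Proof. by move=> [? ?] Ux; split; exact: smooth_differentiable Ux. Qed.

Lemma smoothC_pdC U f a : smoothC U f -> smoothC U (pdC a f).
Proof. by move=> [sr si]; split; exact: smooth_pd. Qed.

Lemma smoothCS U V f : V `<=` U -> smoothC U f -> smoothC V f.
Proof. by move=> VU [? ?]; split; exact: smoothS VU _. Qed.

Lemma pdC_comm U f x a b : open U -> smoothC U f -> U x ->
  pdC a (pdC b f) x = pdC b (pdC a f) x.
Proof. by move=> oU [? ?] Ux; apply: complex_eq; exact: pd_comm Ux. Qed.

Lemma pdC_near a f g x : (\forall y \near x, f y = g y) -> pdC a f x = pdC a g x.
Proof.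
by move=> fg; rewrite /pdC; congr (_ +i* _); apply: near_pd;
  apply: filterS fg => y ->.
Qed.

Lemma pdC_eq U a f g x : open U -> U x -> (forall y, U y -> f y = g y) ->
  pdC a f x = pdC a g x.
Proof. by move=> oU Ux fg; apply: pdC_near; exact: open_near fg. Qed.

Lemma smoothC_eq U f g : open U -> (forall x, U x -> f x = g x) ->
  smoothC U f -> smoothC U g.
Proof.
by move=> oU fg [sr si]; split; [apply: smooth_eq sr|apply: smooth_eq si] => //
  x Ux; rewrite fg.
Qed.

Lemma diffC_D f g x : diffC f x -> diffC g x -> diffC (fun y => f y + g y) x.
Proof.
move=> [fr fi] [gr gi]; split.
  by under eq_fun do rewrite Re_D; exact: differentiableD.
by under eq_fun do rewrite Im_D; exact: differentiableD.
Qed.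

Lemma pdC_D f g x a : diffC f x -> diffC g x ->
  pdC a (fun y => f y + g y) x = pdC a f x + pdC a g x.
Proof.
move=> [fr fi] [gr gi]; rewrite /pdC.
under [X in pd a X x +i* _]eq_fun do rewrite Re_D.
under [X in _ +i* pd a X x]eq_fun do rewrite Im_D.
by rewrite !pdD.
Qed.

Lemma diffC_M f g x : diffC f x -> diffC g x -> diffC (fun y => f y * g y) x.
Proof.
move=> [fr fi] [gr gi]; split.
  by under eq_fun do rewrite Re_M; apply: differentiableB; exact: differentiableM.
by under eq_fun do rewrite Im_M; apply: differentiableD; exact: differentiableM.
Qed.

Lemma pdC_M f g x a : diffC f x -> diffC g x ->
  pdC a (fun y => f y * g y) x = pdC a f x * g x + f x * pdC a g x.
Proof.
move=> [fr fi] [gr gi]; rewrite /pdC.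
under [X in pd a X x +i* _]eq_fun do rewrite Re_M.
under [X in _ +i* pd a X x]eq_fun do rewrite Im_M.
have dM (u v : 'rV[R]_4 -> R) : differentiable u x -> differentiable v x ->
  differentiable (fun y => u y * v y) x by exact: differentiableM.
rewrite !pdD ?pdN ?pd_mul //; try by [exact: dM|apply: differentiableN; exact: dM].
by apply: complex_eq; rewrite !(Re_D, Im_D, Re_M, Im_M) /=; ring.
Qed.

Lemma diffC_cst k x : diffC (fun=> k) x.
Proof. by split; exact: differentiable_cst. Qed.

Lemma pdC_cst k x a : pdC a (fun=> k) x = 0.
Proof. by rewrite /pdC !pd_cst. Qed.

Lemma pdC_conj f x a : diffC f x -> pdC a (fun y => (f y)^*) x = (pdC a f x)^*.
Proof.
have E y : complex.Re (f y)^* = complex.Re (f y) /\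
  complex.Im (f y)^* = - complex.Im (f y) by case: (f y).
move=> [fr fi]; rewrite /pdC /=.
under [X in pd a X x +i* _]eq_fun do rewrite (E _).1.
under [X in _ +i* pd a X x]eq_fun do rewrite (E _).2.
by rewrite pdN.
Qed.

Lemma pdC_real (f : 'rV[R]_4 -> R) x a :
  pdC a (fun y => (f y)%:C) x = (pd a f x)%:C.
Proof. by rewrite /pdC /= pd_cst. Qed.

Lemma diffC_N f x : diffC f x -> diffC (fun y => - f y) x.
Proof.
move=> df; have := diffC_M (diffC_cst (-1) x) df.
by under eq_fun do rewrite mulN1r.
Qed.

Lemma pdC_N f x a : diffC f x -> pdC a (fun y => - f y) x = - pdC a f x.
Proof.
move=> df; have := pdC_M a (diffC_cst (-1) x) df.
under eq_fun do rewrite mulN1r.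
by rewrite pdC_cst mul0r add0r mulN1r.
Qed.

Lemma diffC_sum (I : Type) (r : seq I) (P : pred I) (F : I -> 'rV[R]_4 -> R[i]) x :
  (forall i, P i -> diffC (F i) x) ->
  diffC (fun y => \sum_(i <- r | P i) F i y) x.
Proof.
move=> HF; elim: r => [|i r IH].
  by under eq_fun do rewrite big_nil; exact: diffC_cst.
under eq_fun do rewrite big_cons; case Pi: (P i) => //.
by apply: diffC_D => //; exact: HF.
Qed.

Lemma pdC_sum (I : Type) (r : seq I) (P : pred I) (F : I -> 'rV[R]_4 -> R[i]) x a :
  (forall i, P i -> diffC (F i) x) ->
  pdC a (fun y => \sum_(i <- r | P i) F i y) x = \sum_(i <- r | P i) pdC a (F i) x.
Proof.
move=> HF; elim: r => [|i r IH].
  by under eq_fun do rewrite big_nil; rewrite big_nil pdC_cst.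
rewrite big_cons; under eq_fun do rewrite big_cons.
case Pi: (P i) => //; rewrite -IH pdC_D //; first exact: HF.
exact: diffC_sum.
Qed.

Lemma smoothC_cst U k : smoothC U (fun=> k).
Proof. by split; exact: smooth_cst. Qed.

Lemma smoothC_real U (f : 'rV[R]_4 -> R) : smooth U f ->
  smoothC U (fun x => (f x)%:C).
Proof. by move=> sf; split => //=; exact: smooth_cst. Qed.

Lemma smoothC_D U f g : open U -> smoothC U f -> smoothC U g ->
  smoothC U (fun x => f x + g x).
Proof.
move=> oU [fr fi] [gr gi]; split.
  by under eq_fun do rewrite Re_D; exact: smoothD.
by under eq_fun do rewrite Im_D; exact: smoothD.
Qed.

Lemma smoothC_M U f g : open U -> smoothC U f -> smoothC U g ->
  smoothC U (fun x => f x * g x).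
Proof.
move=> oU [fr fi] [gr gi]; split.
  under eq_fun do rewrite Re_M; apply: smoothD => //; first exact: smoothMr.
  by apply: smoothN => //; exact: smoothMr.
by under eq_fun do rewrite Im_M; apply: smoothD => //; exact: smoothMr.
Qed.

Lemma smoothC_N U f : open U -> smoothC U f -> smoothC U (fun x => - f x).
Proof.
move=> oU sf; have := smoothC_M oU (smoothC_cst U (-1)) sf.
by under eq_fun do rewrite mulN1r.
Qed.

Lemma smoothC_conj U f : open U -> smoothC U f -> smoothC U (fun x => (f x)^*).
Proof.
have E y : complex.Re (f y)^* = complex.Re (f y) /\
  complex.Im (f y)^* = - complex.Im (f y) by case: (f y).
move=> oU [fr fi]; split.
  by under eq_fun do rewrite (E _).1.
by under eq_fun do rewrite (E _).2; exact: smoothN.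
Qed.

Lemma smoothC_sum (I : Type) (r : seq I) (P : pred I) U
    (F : I -> 'rV[R]_4 -> R[i]) : open U ->
  (forall i, P i -> smoothC U (F i)) ->
  smoothC U (fun y => \sum_(i <- r | P i) F i y).
Proof.
move=> oU HF; elim: r => [|i r IH].
  by under eq_fun do rewrite big_nil; exact: smoothC_cst.
under eq_fun do rewrite big_cons; case Pi: (P i) => //.
by apply: smoothC_D => //; exact: HF.
Qed.

Lemma smoothC_prod (I : Type) (r : seq I) (P : pred I) U
    (F : I -> 'rV[R]_4 -> R[i]) : open U ->
  (forall i, P i -> smoothC U (F i)) ->
  smoothC U (fun y => \prod_(i <- r | P i) F i y).
Proof.
move=> oU HF; elim: r => [|i r IH].
  by under eq_fun do rewrite big_nil; exact: smoothC_cst.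
under eq_fun do rewrite big_cons; case Pi: (P i) => //.
by apply: smoothC_M => //; exact: HF.
Qed.

Lemma smoothC_V U f : open U -> (forall x, U x -> f x != 0) -> smoothC U f ->
  smoothC U (fun x => (f x)^-1).
Proof.
move=> oU f0 sf; pose n x := complex.Re (f x) ^+ 2 + complex.Im (f x) ^+ 2.
have [fr fi] := sf.
have n0 x : U x -> n x != 0.
  move=> /f0; rewrite /n; case: (f x) => a b /=.
  by rewrite eq_complex /= paddr_eq0 ?sqr_ge0// !sqrf_eq0.
have sn : smooth U n.
  by apply: smoothD => //; exact: smoothMr.
apply: (@smoothC_eq _ (fun x => (f x)^* * ((n x)^-1)%:C)) => //.
  move=> x Ux; have := n0 x Ux; rewrite /n; case: (f x) => a b /= nx0.
  apply: complex_eq => /=; first by rewrite mulr0 subr0.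
  by rewrite mulr0 add0r mulNr.
apply: smoothC_M => //; first exact: smoothC_conj.
by apply: smoothC_real; exact: smoothV.
Qed.

Lemma pdC_V U f x a : open U -> (forall x, U x -> f x != 0) -> smoothC U f ->
  U x -> pdC a (fun x => (f x)^-1) x = - (f x)^-1 ^+ 2 * pdC a f x.
Proof.
move=> oU f0 sf Ux; have sV := smoothC_V oU f0 sf.
have := pdC_M a (smoothC_diffC sf Ux) (smoothC_diffC sV Ux).
(* The derivative of the inverse comes from differentiating f f^-1 = 1, smoothness of f^-1 being
   known already. *)
rewrite (@pdC_eq U a _ (fun=> 1) x oU Ux); last by move=> y /f0 ?; rewrite divff.
rewrite pdC_cst => /eqP; rewrite eq_sym addrC addr_eq0 => /eqP E.
apply: (mulfI (f0 x Ux)); rewrite E expr2 mulNr mulrN !mulrA divff ?mul1r//.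
  by rewrite mulrC.
exact: f0.
Qed.

End ComplexCalculus.

Section MatrixCalculus.
Context {R : realType}.
Implicit Types (U V : set 'rV[R]_4) (x : 'rV[R]_4).

Definition diffM m n (F : 'rV[R]_4 -> 'M[R[i]]_(m, n)) x :=
  forall i j, diffC (fun y => F y i j) x.

Lemma smoothM_diffM U m n (F : 'rV[R]_4 -> 'M[R[i]]_(m, n)) x :
  smoothM U F -> U x -> diffM F x.
Proof. by move=> sF Ux i j; exact: smoothC_diffC (sF i j) Ux. Qed.

Lemma smoothMS U V m n (F : 'rV[R]_4 -> 'M[R[i]]_(m, n)) :
  V `<=` U -> smoothM U F -> smoothM V F.
Proof. by move=> VU sF i j; exact: smoothCS VU (sF i j). Qed.

Lemma smoothM_eq U m n (F G : 'rV[R]_4 -> 'M[R[i]]_(m, n)) : open U ->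
  (forall x, U x -> F x = G x) -> smoothM U F -> smoothM U G.
Proof.
by move=> oU FG sF i j; apply: smoothC_eq (sF i j) => // x Ux; rewrite FG.
Qed.

Lemma smoothM_pdM U m n (F : 'rV[R]_4 -> 'M[R[i]]_(m, n)) a :
  smoothM U F -> smoothM U (pdM a F).
Proof.
move=> sF i j; rewrite /pdM; under eq_fun do rewrite mxE.
exact: smoothC_pdC.
Qed.

Lemma pdM_eq U m n (F G : 'rV[R]_4 -> 'M[R[i]]_(m, n)) a x : open U -> U x ->
  (forall y, U y -> F y = G y) -> pdM a F x = pdM a G x.
Proof.
move=> oU Ux FG; apply/matrixP => i j; rewrite !mxE.
by apply: pdC_eq oU Ux _ => y Uy; rewrite FG.
Qed.

Lemma pdM_entry m n (F : 'rV[R]_4 -> 'M[R[i]]_(m, n)) a i j :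
  (fun y => pdM a F y i j) = pdC a (fun y => F y i j).
Proof. by apply/funext => y; rewrite mxE. Qed.

Lemma pdM_comm U m n (F : 'rV[R]_4 -> 'M[R[i]]_(m, n)) x a b :
  open U -> smoothM U F -> U x -> pdM a (pdM b F) x = pdM b (pdM a F) x.
Proof.
move=> oU sF Ux; apply/matrixP => i j; rewrite [LHS]mxE [RHS]mxE !pdM_entry.
exact: pdC_comm oU (sF i j) Ux.
Qed.

Lemma pdM_D m n (F G : 'rV[R]_4 -> 'M[R[i]]_(m, n)) x a :
  diffM F x -> diffM G x ->
  pdM a (fun y => F y + G y) x = pdM a F x + pdM a G x.
Proof.
move=> dF dG; apply/matrixP => i j; rewrite !mxE.
by under eq_fun do rewrite mxE; exact: pdC_D.
Qed.

Lemma pdM_cst m n (K : 'M[R[i]]_(m, n)) x a : pdM a (fun=> K) x = 0.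
Proof. by apply/matrixP => i j; rewrite !mxE pdC_cst. Qed.

Lemma pdM_sum (I : Type) (r : seq I) m n (F : I -> 'rV[R]_4 -> 'M[R[i]]_(m, n)) x a :
  (forall i, diffM (F i) x) ->
  pdM a (fun y => \sum_(i <- r) F i y) x = \sum_(i <- r) pdM a (F i) x.
Proof.
move=> dF; apply/matrixP => i j; rewrite mxE summxE.
under eq_fun do rewrite summxE.
rewrite pdC_sum; last by move=> k _; exact: dF.
by apply: eq_bigr => k _; rewrite mxE.
Qed.

Lemma diffM_scale (f : 'rV[R]_4 -> R[i]) m n (F : 'rV[R]_4 -> 'M[R[i]]_(m, n)) x :
  diffC f x -> diffM F x -> diffM (fun y => f y *: F y) x.
Proof.
by move=> df dF i j; under eq_fun do rewrite mxE; exact: diffC_M.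
Qed.

Lemma pdM_scale (f : 'rV[R]_4 -> R[i]) m n (F : 'rV[R]_4 -> 'M[R[i]]_(m, n)) x a :
  diffC f x -> diffM F x ->
  pdM a (fun y => f y *: F y) x = pdC a f x *: F x + f x *: pdM a F x.
Proof.
move=> df dF; apply/matrixP => i j; rewrite !mxE.
by under eq_fun do rewrite mxE; exact: pdC_M.
Qed.

Lemma pdM_mul m n p (F : 'rV[R]_4 -> 'M[R[i]]_(m, n))
    (G : 'rV[R]_4 -> 'M[R[i]]_(n, p)) x a :
  diffM F x -> diffM G x ->
  pdM a (fun y => F y *m G y) x = pdM a F x *m G x + F x *m pdM a G x.
Proof.
move=> dF dG; apply/matrixP => i j; rewrite !mxE.
under eq_fun do rewrite mxE.
rewrite pdC_sum -?big_split; last by move=> k _; exact: diffC_M.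
by apply: eq_bigr => k _; rewrite !mxE pdC_M.
Qed.

Lemma smoothM_D U m n (F G : 'rV[R]_4 -> 'M[R[i]]_(m, n)) : open U ->
  smoothM U F -> smoothM U G -> smoothM U (fun x => F x + G x).
Proof.
by move=> oU sF sG i j; under eq_fun do rewrite mxE; exact: smoothC_D.
Qed.

Lemma smoothM_scale U (f : 'rV[R]_4 -> R[i]) m n
    (F : 'rV[R]_4 -> 'M[R[i]]_(m, n)) : open U ->
  smoothC U f -> smoothM U F -> smoothM U (fun x => f x *: F x).
Proof.
by move=> oU sf sF i j; under eq_fun do rewrite mxE; exact: smoothC_M.
Qed.

Lemma smoothM_sum U (I : Type) (r : seq I) m n
    (F : I -> 'rV[R]_4 -> 'M[R[i]]_(m, n)) : open U ->
  (forall i, smoothM U (F i)) -> smoothM U (fun x => \sum_(i <- r) F i x).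
Proof.
move=> oU sF i j; under eq_fun do rewrite summxE.
by apply: smoothC_sum => // k _; exact: sF.
Qed.

Lemma smoothM_mul U m n p (F : 'rV[R]_4 -> 'M[R[i]]_(m, n))
    (G : 'rV[R]_4 -> 'M[R[i]]_(n, p)) : open U ->
  smoothM U F -> smoothM U G -> smoothM U (fun x => F x *m G x).
Proof.
move=> oU sF sG i j; under eq_fun do rewrite mxE.
by apply: smoothC_sum => // k _; exact: smoothC_M.
Qed.

Lemma smoothC_det U n (F : 'rV[R]_4 -> 'M[R[i]]_n) : open U ->
  smoothM U F -> smoothC U (fun x => \det (F x)).
Proof.
move=> oU sF; apply: smoothC_sum => // s _.
apply: smoothC_M => //; first exact: smoothC_cst.
by apply: smoothC_prod => // i _; exact: sF.
Qed.

Lemma smoothM_inv U n (F : 'rV[R]_4 -> 'M[R[i]]_n) : open U ->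
  smoothM U F -> (forall x, U x -> F x \in unitmx) ->
  smoothM U (fun x => invmx (F x)).
Proof.
move=> oU sF uF; apply: (@smoothM_eq _ _ _
    (fun x => (\det (F x))^-1 *: \adj (F x))) => //.
  by move=> x Ux; rewrite /invmx uF.
have d0 x : U x -> \det (F x) != 0 by move=> /uF; rewrite unitmxE unitfE.
apply: (smoothM_scale oU (smoothC_V oU d0 (smoothC_det oU sF))).
move=> i j; apply: (@smoothC_eq _ _ 
    (fun y => (-1) ^+ (j + i) * \det (row' j (col' i (F y))))) => //.
  by move=> y _; rewrite mxE.
apply: smoothC_M => //; first exact: smoothC_cst.
apply: smoothC_det => // k l.
by apply: (smoothC_eq oU _ (sF (lift j k) (lift i l))) => y _; rewrite !mxE.
Qed.

Lemma pdM_inv U n (F : 'rV[R]_4 -> 'M[R[i]]_n) a x : open U ->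
  smoothM U F -> (forall x, U x -> F x \in unitmx) -> U x ->
  pdM a (fun x => invmx (F x)) x = - (invmx (F x) *m pdM a F x *m invmx (F x)).
Proof.
move=> oU sF uF Ux; have sV := smoothM_inv oU sF uF.
have := pdM_mul a (smoothM_diffM sV Ux) (smoothM_diffM sF Ux).
rewrite (@pdM_eq U _ _ _ (fun=> 1%:M) a x oU Ux); last first.
  by move=> y Uy; rewrite mulVmx // uF.
rewrite pdM_cst => /eqP; rewrite eq_sym addr_eq0 => /eqP E.
have := congr1 (mulmx^~ (invmx (F x))) E.
by rewrite /= -[X in X = _]mulmxA (mulmxV (uF x Ux)) mulmx1 mulNmx.
Qed.

End MatrixCalculus.

(** * Functions with all derivatives bounded, and differentiation under a linear functional *)

Section BoundedSmooth.
Context {R : realType}.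
Implicit Types (f g : 'rV[R]_4 -> R) (x h : 'rV[R]_4).

(** The working class of the analytic part: global bounds on the derivatives give Taylor remainders
    uniform in the base point, so integrals and series can be differentiated without dominated
    convergence. *)
Definition bsmooth f := smooth setT f /\
  forall s : seq 'I_4, exists C : R, forall x, `|foldr pd f s x| <= C.

Lemma bsmooth_pd f a : bsmooth f -> bsmooth (pd a f).
Proof.
move=> [sf bf]; split; first exact: smooth_pd.
by move=> s; have [C HC] := bf (rcons s a); exists C; rewrite foldr_rcons in HC.
Qed.

Lemma bsmooth_foldr f s : bsmooth f -> bsmooth (foldr pd f s).
Proof. by move=> bf; elim: s => //= a s; exact: bsmooth_pd. Qed.

Lemma bsmooth_diff f x : bsmooth f -> differentiable f x.
Proof. by move=> [sf _]; exact: smooth_differentiable sf _. Qed.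

Lemma bsmooth_cst k : bsmooth (fun=> k).
Proof.
split; first exact: smooth_cst.
elim/last_ind => [|s a _]; first by exists `|k|.
exists 0 => x; rewrite foldr_rcons (_ : pd a _ = fun=> 0); last first.
  by apply/funext => y; rewrite pd_cst.
elim: s x => [|b s IH] x /=; first by rewrite normr0.
rewrite (_ : foldr pd _ s = fun=> 0) ?pd_cst ?normr0//.
by apply/funext => y; apply/eqP; rewrite -normr_le0.
Qed.

Lemma foldr_pdD f g s : smooth setT f -> smooth setT g ->
  foldr pd (fun x => f x + g x) s = fun x => foldr pd f s x + foldr pd g s x.
Proof.
move=> sf sg; elim: s => //= a s ->; apply/funext => x.
by rewrite pdD; [|exact: sf|exact: sg].
Qed.

Lemma bsmoothD f g : bsmooth f -> bsmooth g -> bsmooth (fun x => f x + g x).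
Proof.
move=> [sf bf] [sg bg]; split; first by apply: smoothD => //; exact: openT.
move=> s; have [C HC] := bf s; have [D HD] := bg s; exists (C + D) => x.
by rewrite foldr_pdD// (le_trans (ler_normD _ _))// lerD.
Qed.

Lemma bsmoothM f g : bsmooth f -> bsmooth g -> bsmooth (fun x => f x * g x).
Proof.
move=> bf bg; split.
  by apply: smoothMr; [exact: openT|exact: bf.1|exact: bg.1].
move=> s; elim/last_ind: s f g bf bg => [|s a IH] f g bf bg /=.
  have [C HC] := bf.2 [::]; have [D HD] := bg.2 [::]; exists (C * D) => x.
  by rewrite normrM; exact: ler_pM.
have [C HC] := IH _ _ (bsmooth_pd a bf) bg.
have [D HD] := IH _ _ bf (bsmooth_pd a bg).
exists (C + D) => x; rewrite foldr_rcons.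
rewrite (_ : pd a _ = fun x => pd a f x * g x + f x * pd a g x); last first.
  by apply/funext => y; rewrite pd_mul //; exact: bsmooth_diff.
rewrite foldr_pdD.
- by rewrite (le_trans (ler_normD _ _))// lerD.
- by apply: smoothMr; [exact: openT|exact: (bsmooth_pd a bf).1|exact: bg.1].
- by apply: smoothMr; [exact: openT|exact: bf.1|exact: (bsmooth_pd a bg).1].
Qed.

Lemma bsmoothN f : bsmooth f -> bsmooth (fun x => - f x).
Proof.
move=> bf; rewrite (_ : (fun x => - f x) = fun x => (-1) * f x).
  by apply: bsmoothM => //; exact: bsmooth_cst.
by apply/funext => x; rewrite mulN1r.
Qed.

Lemma mean_value f x h : smooth setT f -> exists2 c : R, 0 <= c <= 1 &
  f (x + h) - f x = covec (fun a => pd a f (x + c *: h)) h.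
Proof.
move=> sf; pose phi t := f (x + t *: h).
have dphi (t : R) : is_derive t 1 phi (covec (fun a => pd a f (x + t *: h)) h).
  by apply: derive_line; exact: smooth_differentiable sf _.
have [|c cI E] := @MVT_segment _ phi _ 0 1 ler01 (fun t _ => dphi t).
  apply: derivable_within_continuous => t _.
  exact: (ex_derive (is_derive := dphi t)).
exists c; first by move: cI; rewrite in_itv.
by move: E; rewrite /phi scale1r scale0r addr0 subr0 mulr1.
Qed.

Lemma lipschitz_pd f C x h : smooth setT f ->
  (forall a y, `|pd a f y| <= C) -> `|f (x + h) - f x| <= 4 * C * `|h|.
Proof.
by move=> sf HC; have [c _ ->] := mean_value x h sf; exact: covec_le.
Qed.

(** The mean value theorem replaces the increment by the gradient at an intermediate point, and each
    component of the gradient is Lipschitz with constant 4C; summing over four directions gives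
    16C. *)
Lemma taylor_pd f C x h : smooth setT f ->
  (forall a b y, `|pd a (pd b f) y| <= C) ->
  `|f (x + h) - f x - covec (fun a => pd a f x) h| <= 16 * C * `|h| ^+ 2.
Proof.
move=> sf HC; have [c /andP[c0 c1] ->] := mean_value x h sf.
rewrite /covec -sumrB.
under eq_bigr do rewrite -mulrBr.
have C0 : 0 <= C := le_trans (normr_ge0 _) (HC ord0 ord0 x).
have := @covec_le _ (fun a => pd a f (x + c *: h) - pd a f x) (4 * C * `|h|) h.
rewrite /covec => H; apply: le_trans (H _) _.
  move=> a; apply: le_trans (lipschitz_pd x (c *: h) (smooth_pd a sf) _) _.
    by move=> b y; exact: HC.
  rewrite normrZ ger0_norm// ler_wpM2l ?mulr_ge0//.
  by rewrite ler_piMl.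
by rewrite expr2 !mulrA -natrM.
Qed.

Lemma differentiable_quadratic f (c : 'I_4 -> R) C x :
  (forall h, `|f (x + h) - f x - covec c h| <= C * `|h| ^+ 2) ->
  differentiable f x /\ forall a, pd a f x = c a.
Proof.
move=> HC; apply: differentiable_crit => e e0.
have C1 : 0 < `|C| + 1 by rewrite ltr_wpDl.
near=> h; rewrite [h + x]addrC; apply: le_trans (HC h) _.
rewrite expr2 mulrA ler_wpM2r //.
apply: (@le_trans _ _ ((`|C| + 1) * `|h|)).
  by rewrite ler_wpM2r// (le_trans (ler_norm _))// lerDl.
rewrite mulrC -ler_pdivlMr//; near: h; apply/nbhs_ballP.
exists (e / (`|C| + 1)); first by rewrite /= divr_gt0.
by move=> h /=; rewrite -ball_normE /= sub0r normrN => /ltW.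
Unshelve. all: by end_near. Qed.

Section Parametric.
Variables (Om : Type) (D : (Om -> R) -> Prop) (Lam : (Om -> R) -> R).
Variables (rho : Om -> R) (K : R).
Hypothesis rho0 : forall w, 0 <= rho w.
Hypothesis DD : forall u v, D u -> D v -> D (fun w => u w + v w).
Hypothesis DZ : forall k u, D u -> D (fun w => k * u w).
Hypothesis LD : forall u v, D u -> D v ->
  Lam (fun w => u w + v w) = Lam u + Lam v.
Hypothesis LZ : forall k u, D u -> Lam (fun w => k * u w) = k * Lam u.
Hypothesis Lle : forall u C, D u -> (forall w, `|u w| <= C * rho w) ->
  `|Lam u| <= K * C.
Variable v : Om -> 'rV[R]_4 -> R.
Hypothesis sv : forall w, smooth setT (v w).
Hypothesis Dv : forall s x, D (fun w => foldr pd (v w) s x).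
Hypothesis bv : forall s, exists C, forall w x,
  `|foldr pd (v w) s x| <= C * rho w.

Lemma parametric_sum (k : 'I_4 -> R) (u : 'I_4 -> Om -> R) :
  (forall a, D (u a)) -> D (fun w => \sum_a k a * u a w) /\
  Lam (fun w => \sum_a k a * u a w) = \sum_a k a * Lam (u a).
Proof.
move=> Du; elim: (index_enum _) => [|a r [IH1 IH2]].
  rewrite (_ : (fun w => _) = fun w => 0 * u ord0 w).
    by rewrite big_nil LZ // mul0r; split => //; exact: DZ.
  by apply/funext => w; rewrite big_nil mul0r.
rewrite (_ : (fun w => _) = fun w => k a * u a w + \sum_(a <- r) k a * u a w).
  rewrite big_cons LD ?LZ ?IH2 //; last exact: DZ.
  by split => //; apply: DD => //; exact: DZ.
by apply/funext => w; rewrite big_cons.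
Qed.

(** One argument for integrals and series alike. [Lam] is linear on the class [D] and bounded
    relative to the weight [rho]; the second-order Taylor remainder of each [v w] is at most 16 C
    rho(w) |h|^2, and applying [Lam] bounds the remainder of the whole by a multiple of |h|^2. *)
Lemma parametric_differentiable t x :
  differentiable (fun x => Lam (fun w => foldr pd (v w) t x)) x /\
  forall a, pd a (fun x => Lam (fun w => foldr pd (v w) t x)) x =
      Lam (fun w => foldr pd (v w) (a :: t) x).
Proof.
(* A single constant for all pairs of directions: the sum of the absolute values of the sixteen
   constants. *)
have [c Hc] := choice (fun ab : 'I_4 * 'I_4 => bv [:: ab.1, ab.2 & t]).
pose C := \sum_ab `|c ab|.
have HC a b w y : `|foldr pd (v w) [:: a, b & t] y| <= C * rho w.
  apply: le_trans (Hc (a, b) w y) _.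
  rewrite ler_wpM2r// /C (bigD1 (a, b))//= (le_trans (ler_norm _))// lerDl.
  by apply: sumr_ge0.
have svt w : smooth setT (foldr pd (v w) t).
  by elim: t {c Hc C HC} => //= a t; exact: smooth_pd.
apply: (@differentiable_quadratic _ _ (K * (16 * C))) => h.
have [S1 S2] := @parametric_sum (fun a => - h ord0 a)
  (fun a w => foldr pd (v w) (a :: t) x) (fun a => Dv (a :: t) x).
have D1 := Dv t (x + h); have D2 := DZ (-1) (Dv t x).
have D12 := DD D1 D2; have D3 := DD D12 S1.
(* The Taylor remainder, written with sums and scalings only so that the closure properties of [D]
   and the linearity of [Lam] apply. *)
pose u w := foldr pd (v w) t (x + h) + (-1) * foldr pd (v w) t x
  + \sum_a - h ord0 a * foldr pd (v w) (a :: t) x.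
have -> : Lam (fun w => foldr pd (v w) t (x + h)) -
    Lam (fun w => foldr pd (v w) t x) -
    covec (fun a => Lam (fun w => foldr pd (v w) (a :: t) x)) h = Lam u.
  rewrite /u !LD // LZ // S2 mulN1r; congr (_ + _).
  by rewrite /covec -sumrN; apply: eq_bigr => a _; rewrite mulNr.
rewrite -!mulrA; apply: Lle => // w.
rewrite /u mulN1r (_ : \sum_a _ = - covec (fun a => pd a (foldr pd (v w) t) x) h).
  rewrite (_ : _ * rho w = 16 * (C * rho w) * `|h| ^+ 2); last by ring.
  by apply: taylor_pd => // a b y; exact: HC.
by rewrite /covec -sumrN; apply: eq_bigr => a _; rewrite mulNr.
Qed.

Lemma parametric_foldr_pd s :
  foldr pd (fun x => Lam (v ^~ x)) s = fun x => Lam (fun w => foldr pd (v w) s x).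
Proof.
elim: s => //= a s ->; apply/funext => x.
by have [_ ->] := parametric_differentiable s x.
Qed.

Lemma parametric_bsmooth : bsmooth (fun x => Lam (v ^~ x)).
Proof.
split=> s; rewrite parametric_foldr_pd.
  by move=> x _; have [] := parametric_differentiable s x.
by have [C HC] := bv s; exists (K * C) => x; exact: Lle.
Qed.

End Parametric.
End BoundedSmooth.

(** * Iterated integrals over the unit square *)

Section DoubleIntegral.
Context {R : realType}.
Implicit Types (u : R -> R) (F G : R -> R -> R).

Definition int01 u : R := \int[lebesgue_measure]_(x in `[0, 1]) u x.

Lemma int01_integrable u : continuous u ->
  lebesgue_measure.-integrable `[0, 1] (EFin \o u).
Proof.
move=> cu; apply: continuous_compact_integrable.
  exact: segment_compact.
exact: continuous_subspaceT.
Qed.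

Lemma int01D u v : continuous u -> continuous v ->
  int01 (fun t => u t + v t) = int01 u + int01 v.
Proof. by move=> cu cv; rewrite /int01 RintegralD//; exact: int01_integrable. Qed.

Lemma int01Z k u : continuous u -> int01 (fun t => k * u t) = k * int01 u.
Proof. by move=> cu; rewrite /int01 RintegralZl//; exact: int01_integrable. Qed.

Lemma int01_cst k : int01 (fun=> k) = k.
Proof.
rewrite /int01 Rintegral_cst//= lebesgue_measure_itv /= lte_fin ltr01.
by rewrite -EFinB /= subr0 mulr1.
Qed.

Lemma int01_le u C : continuous u -> (forall t, `|u t| <= C) -> `|int01 u| <= C.
Proof.
move=> cu uC; apply: le_trans (le_normr_Rintegral _ (int01_integrable cu)) _ => //.
rewrite -[leRHS]int01_cst; apply: le_Rintegral => //.
- apply: int01_integrable => t.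
  by apply: continuous_comp; [exact: cu|exact: norm_continuous].
- by apply: int01_integrable; exact: cst_continuous.
Qed.

Lemma int01_derive (u U : R -> R) : continuous u ->
  (forall t : R, is_derive t 1 U (u t)) -> int01 u = U 1 - U 0.
Proof.
move=> cu dU; rewrite /int01 /Rintegral.
have cU (t : R) : {for t, continuous U}.
  apply: differentiable_continuous; apply/derivable1_diffP.
  exact: (ex_derive (is_derive := dU t)).
rewrite (@continuous_FTC2 _ _ U) //=.
- exact: continuous_subspaceT.
- split.
  + by move=> t _; exact: (ex_derive (is_derive := dU t)).
  + exact: cvg_at_right_filter (cU 0).
  + exact: cvg_at_left_filter (cU 1).
- by move=> t _; rewrite derive1E; exact: (derive_val (is_derive := dU t)).
Qed.

Definition lip1 F := exists L : R, forall s s' t, `|F s t - F s' t| <= L * `|s - s'|.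

(** The uniform Lipschitz condition in the outer variable makes the inner integral continuous, so
    the iterated integral is always meaningful. The order of integration is fixed and never
    exchanged. *)
Definition integrand F := (forall s, continuous (F s)) /\ lip1 F.

Definition int2 F := int01 (fun s => int01 (F s)).

Lemma lipschitz_continuous (u : R -> R) L :
  (forall s s', `|u s - u s'| <= L * `|s - s'|) -> continuous u.
Proof.
move=> HL s; apply/cvgrPdist_le => e e0; near=> s'.
have L1 : 0 < `|L| + 1 by rewrite ltr_wpDl.
apply: le_trans (HL s s') _; apply: (@le_trans _ _ ((`|L| + 1) * `|s - s'|)).
  by rewrite ler_wpM2r// (le_trans (ler_norm _))// lerDl.
rewrite mulrC -ler_pdivlMr//; near: s'.
by apply: cvgr_dist_le => //; rewrite divr_gt0.
Unshelve. all: by end_near. Qed.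

Lemma continuous_add u v : continuous u -> continuous v ->
  continuous (fun t : R => u t + v t).
Proof. by move=> cu cv t; apply: continuousD; [exact: cu|exact: cv]. Qed.

Lemma continuous_mul u v : continuous u -> continuous v ->
  continuous (fun t : R => u t * v t).
Proof. by move=> cu cv t; apply: continuousM; [exact: cu|exact: cv]. Qed.

Lemma continuous_scale k u : continuous u -> continuous (fun t : R => k * u t).
Proof. by apply: continuous_mul; exact: cst_continuous. Qed.

Lemma int01_lipschitz F : integrand F -> exists L : R, forall s s',
  `|int01 (F s) - int01 (F s')| <= L * `|s - s'|.
Proof.
move=> [cF [L HL]]; exists L => s s'.
have -> : int01 (F s) - int01 (F s') = int01 (fun t => F s t + (-1) * F s' t).
  rewrite int01D ?int01Z ?mulN1r//.
  exact: continuous_scale.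
apply: int01_le => [|t]; last by rewrite mulN1r; exact: HL.
by apply: continuous_add => //; exact: continuous_scale.
Qed.

Lemma int01_integrand F : integrand F -> continuous (fun s => int01 (F s)).
Proof. by move=> /int01_lipschitz[L HL]; exact: lipschitz_continuous HL. Qed.

Lemma integrandD F G : integrand F -> integrand G ->
  integrand (fun s t => F s t + G s t).
Proof.
move=> [cF [L HL]] [cG [M HM]]; split.
  by move=> s; apply: continuous_add.
exists (L + M) => s s' t; rewrite mulrDl opprD addrACA.
by apply: (le_trans (ler_normD _ _)); apply: lerD.
Qed.

Lemma integrandZ k F : integrand F -> integrand (fun s t => k * F s t).
Proof.
move=> [cF [L HL]]; split.
  by move=> s; exact: continuous_scale.
exists (`|k| * L) => s s' t; rewrite -mulrBr normrM -mulrA.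
by rewrite ler_wpM2l.
Qed.

Lemma int2D F G : integrand F -> integrand G ->
  int2 (fun s t => F s t + G s t) = int2 F + int2 G.
Proof.
move=> iF iG; rewrite /int2 -int01D; try exact: int01_integrand.
congr int01; apply/funext => s; rewrite int01D //; [exact: iF.1|exact: iG.1].
Qed.

Lemma int2Z k F : integrand F -> int2 (fun s t => k * F s t) = k * int2 F.
Proof.
move=> iF; rewrite /int2 -int01Z; last exact: int01_integrand.
by congr int01; apply/funext => s; rewrite int01Z //; exact: iF.1.
Qed.

Lemma int2_le F C : integrand F -> (forall s t, `|F s t| <= C) -> `|int2 F| <= C.
Proof.
move=> iF FC; apply: int01_le; first exact: int01_integrand.
by move=> s; apply: int01_le => //; exact: iF.1.
Qed.

(** [F] is the derivative of [G] in the outer variable with a remainder uniform in the inner one;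
    hence the inner integral of [G] is a primitive of that of [F], and the fundamental theorem of
    calculus applies to the outer integral. *)
Lemma int2_derive F G C : integrand F -> (forall s, continuous (G s)) ->
  (forall s h t, `|G (s + h) t - G s t - h * F s t| <= C * `|h| ^+ 2) ->
  int2 F = int01 (G 1) - int01 (G 0).
Proof.
move=> iF cG GF.
rewrite /int2; apply: (@int01_derive _ (fun s => int01 (G s))).
  exact: int01_integrand.
move=> s; set I := int01 (F s).
have H h : `|int01 (G (s + h)) - int01 (G s) - h * I| <= C * `|h| ^+ 2.
  rewrite (_ : _ - _ = int01 (fun t => G (s + h) t + ((-1) * G s t
     + (- h) * F s t))).
    apply: int01_le => [|t]; last by rewrite mulN1r mulNr addrA; exact: GF.
    apply: continuous_add => //.
    by apply: continuous_add; apply: continuous_scale => //; exact: iF.1.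
  have c1 := continuous_scale (k := -1) (cG s).
  have c2 := continuous_scale (k := - h) (iF.1 s).
  rewrite !int01D //; last exact: continuous_add.
  by rewrite !int01Z ?mulN1r ?mulNr ?addrA//; exact: iF.1.
have lim : (fun h => h^-1 *: (int01 (G (h *: 1 + s)) - int01 (G s))) @ 0^' --> I.
  apply/cvgrPdist_le => e e0; near=> h.
  have h0 : h != 0 by near: h; exact: nbhs_dnbhs_neq.
  rewrite [h *: 1]mulr1 [h + s]addrC /GRing.scale /=.
  rewrite -[X in X - _](mulKf h0) -mulrBr normrM normfV.
  rewrite ler_pdivrMl ?normr_gt0// distrC; apply: le_trans (H h) _.
  rewrite expr2 mulrA mulrC ler_wpM2l//.
  apply: (@le_trans _ _ ((`|C| + 1) * `|h|)).
    by rewrite ler_wpM2r// (le_trans (ler_norm _))// lerDl.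
  rewrite mulrC -ler_pdivlMr ?ltr_wpDl//; near: h.
  by apply: dnbhs0_le; rewrite divr_gt0// ltr_wpDl.
by apply: DeriveDef; [apply/cvg_ex; exists I|exact/cvg_lim].
Unshelve. all: by end_near. Qed.

End DoubleIntegral.

(** * The Cauchy transform and the dbar equation *)

Section CauchyTransform.
Context {R : realType}.
Implicit Types (f g : 'rV[R]_4 -> R) (x h : 'rV[R]_4) (k : R -> R).
Variables (a b : 'I_4) (r : R).
Hypothesis r0 : 0 < r.

Lemma regular_scaleE (u v : R) : u *: (v : R^o) = u * v.
Proof. by []. Qed.

Definition ccos (t : R) : R := cos (2 * pi * t).
Definition csin (t : R) : R := sin (2 * pi * t).

Lemma is_derive_ccos (t : R) : is_derive t 1 ccos (- (2 * pi) * csin t).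
Proof.
have H : is_derive t 1 (fun t : R => 2 * pi * t) (2 * pi).
  have := @is_deriveZ R R^o R^o id (2 * pi) t 1 1 _.
  by rewrite [_ *: 1]mulr1; apply.
have := @is_derive1_comp R cos (fun t => 2 * pi * t) t _ _ (is_derive_cos _) H.
by congr is_derive; rewrite /csin; ring.
Qed.

Lemma is_derive_csin (t : R) : is_derive t 1 csin (2 * pi * ccos t).
Proof.
have H : is_derive t 1 (fun t : R => 2 * pi * t) (2 * pi).
  have := @is_deriveZ R R^o R^o id (2 * pi) t 1 1 _.
  by rewrite [_ *: 1]mulr1; apply.
have := @is_derive1_comp R sin (fun t => 2 * pi * t) t _ _ (is_derive_sin _) H.
by congr is_derive; rewrite /ccos; ring.
Qed.

Lemma continuous_ccos : continuous ccos.
Proof.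
move=> t; apply: differentiable_continuous; apply/derivable1_diffP.
exact: (ex_derive (is_derive := is_derive_ccos t)).
Qed.

Lemma continuous_csin : continuous csin.
Proof.
move=> t; apply: differentiable_continuous; apply/derivable1_diffP.
exact: (ex_derive (is_derive := is_derive_csin t)).
Qed.

Lemma ccos_le t : `|ccos t| <= 1.
Proof. by rewrite ler_norml cos_geN1 cos_le1. Qed.

Lemma csin_le t : `|csin t| <= 1.
Proof. by rewrite ler_norml sin_geN1 sin_le1. Qed.

Lemma ccos1 : ccos 1 = ccos 0.
Proof. by rewrite /ccos mulr1 mulr0 cos0 mulr_natl cos2pi. Qed.

Lemma csin1 : csin 1 = csin 0.
Proof. by rewrite /csin mulr1 mulr0 sin0 mulr_natl sin2pi. Qed.

(** The vector -r exp(2 pi i t) of the plane of the coordinates [a] and [b]; the sign is that of the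
    convolution f(x - zeta). *)
Definition circle (t : R) : 'rV[R]_4 :=
  (- r * ccos t) *: delta_mx ord0 a + (- r * csin t) *: delta_mx ord0 b.

Lemma circle_le t : `|circle t| <= r + r.
Proof.
have H (u : R) i : `|u| <= 1 -> `|(- r * u) *: (delta_mx ord0 i : 'rV[R]_4)| <= r.
  move=> u1; rewrite normrZ -[leRHS]mulr1; apply: ler_pM => //.
    rewrite normrM normrN (gtr0_norm r0) -[leRHS]mulr1.
    by apply: ler_pM => //; exact: ltW.
  exact: norm_delta.
apply: (le_trans (ler_normD _ _)); apply: lerD; apply: H.
  exact: ccos_le.
exact: csin_le.
Qed.

Lemma circle1 : circle 1 = circle 0.
Proof. by rewrite /circle ccos1 csin1. Qed.

Lemma covec_circle (c : 'I_4 -> R) t :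
  covec c (circle t) = - r * (ccos t * c a + csin t * c b).
Proof.
by rewrite linearD !linearZ /= !covec_delta ?regular_scaleE mulrDr !mulrA.
Qed.

Lemma derive_circle g x (s t : R) : smooth setT g ->
  is_derive t 1 (fun t => g (x + s *: circle t))
    (- (s * r * (2 * pi)) * (ccos t * pd b g (x + s *: circle t)
      - csin t * pd a g (x + s *: circle t))).
Proof.
move=> sg; pose p (t : R) := x + s *: circle t.
have dp i j : is_derive t 1 (fun t => p t i j)
    ((s * r * (2 * pi) * csin t) * (delta_mx ord0 a : 'rV[R]_4) i j +
     (- (s * r * (2 * pi)) * ccos t) * (delta_mx ord0 b : 'rV[R]_4) i j).
  have -> : (fun t => p t i j) = cst (x i j) +
      ((- s * r * (delta_mx ord0 a : 'rV[R]_4) i j) \*: ccos +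
       (- s * r * (delta_mx ord0 b : 'rV[R]_4) i j) \*: csin).
    by apply/funext => u; rewrite /p /circle !fctE !mxE /= ?regular_scaleE; ring.
  have := is_deriveD (is_derive_cst (x i j) t (1 : R)) (is_deriveD
    (is_deriveZ (- s * r * (delta_mx ord0 a : 'rV[R]_4) i j) (is_derive_ccos t))
    (is_deriveZ (- s * r * (delta_mx ord0 b : 'rV[R]_4) i j) (is_derive_csin t))).
  by congr is_derive; rewrite /= ?regular_scaleE; ring.
have derp : derivable p t 1.
  by apply/derivable_mxP => i j; exact: (ex_derive (is_derive := dp i j)).
have difp : differentiable p t by apply/derivable1_diffP.
have difg : differentiable g (p t) by exact: smooth_differentiable sg _.
have difgp : differentiable (g \o p) t by exact: differentiable_comp.
apply: DeriveDef; first exact/derivable1_diffP.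
rewrite (deriveE _ difgp).
have -> := diff_comp difp difg.
rewrite /= differentiable_pdE // -deriveE // derive_mx //.
rewrite (_ : \matrix_(i, j) _ = (s * r * (2 * pi) * csin t) *: delta_mx ord0 a
   + (- (s * r * (2 * pi)) * ccos t) *: delta_mx ord0 b); last first.
  by apply/matrixP => i j; rewrite mxE (derive_val (is_derive := dp i j)) !mxE.
by rewrite linearD !linearZ /= !covec_delta ?regular_scaleE -/(p t); ring.
Qed.

Lemma continuous_circle g x (s : R) : smooth setT g ->
  continuous (fun t => g (x + s *: circle t)).
Proof.
move=> sg t; apply: differentiable_continuous; apply/derivable1_diffP.
exact: (ex_derive (is_derive := derive_circle x s t sg)).
Qed.

Lemma foldr_pd_affine g (c : R) h s x : smooth setT g ->
  foldr pd (fun x => c * g (x + h)) s x = c * foldr pd g s (x + h).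
Proof.
move=> sg; elim: s x => //= i s IH x.
have -> : foldr pd (fun x => c * g (x + h)) s = fun x => c * foldr pd g s (x + h).
  by apply/funext.
have dg : differentiable (foldr pd g s) (x + h) by exact: sg.
have dG j : differentiable (fun y : 'rV[R]_4 => (y + h) ord0 j) x.
  under eq_fun do rewrite mxE; apply: differentiableD => //.
  exact: differentiable_coord_rV.
rewrite pd_mul; [|exact: differentiable_cst|exact: differentiable_comp_rV].
rewrite pd_cst mul0r add0r (@pd_comp_rV _ _ (fun y => y + h)) //.
rewrite (bigD1 i) //= big1 ?addr0; last first.
  move=> j ji; under eq_fun do rewrite mxE.
  by rewrite pdD ?pd_coord ?pd_cst ?addr0 1?eq_sym ?(negPf ji) ?mul0r//; exact: differentiable_coord_rV.
under eq_fun do rewrite mxE.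
by rewrite pdD ?pd_coord ?pd_cst ?addr0 ?eqxx ?mul1r//; exact: differentiable_coord_rV.
Qed.

Lemma smooth_affine g (c : R) h : smooth setT g ->
  smooth setT (fun x => c * g (x + h)).
Proof.
move=> sg; apply: smoothMr; [exact: openT|exact: smooth_cst|].
apply: (@smooth_comp_rV _ setT setT g (fun x => x + h)) => //; first exact: openT.
move=> j; apply: (@smooth_eq _ _ (fun x => x ord0 j + h ord0 j)).
- exact: openT.
- by move=> x _; rewrite mxE.
- by apply: smoothD; [exact: openT|exact: smooth_coord|exact: smooth_cst].
Qed.

Section Average.
Variable k : R -> R.
Hypothesis ck : continuous k.
Hypothesis k1 : forall t, `|k t| <= 1.

(** Mean over a disc in polar coordinates, with [s] the radius divided by r and [t] the angle
    divided by 2 pi, but for the measure ds dt: the factor s of the area element has cancelled the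
    modulus of the Cauchy kernel. The angular factor of the kernel is [k]. *)
Definition average f x := int2 (fun s t => k t * f (x + s *: circle t)).

Lemma average_integrand f x : bsmooth f ->
  integrand (fun s t => k t * f (x + s *: circle t)).
Proof.
move=> bf; split.
  by move=> s; apply: continuous_mul => //; exact: continuous_circle bf.1.
have [C HC] : exists C : R, forall a y, `|pd a f y| <= C.
  have [c Hc] := choice (fun a => bf.2 [:: a]).
  exists (\sum_a `|c a|) => i y; apply: le_trans (Hc i y) _.
  by rewrite (bigD1 i)//= (le_trans (ler_norm _))// lerDl sumr_ge0.
have C0 : 0 <= C := le_trans (normr_ge0 _) (HC ord0 0).
exists (4 * C * (r + r)) => s s' t; rewrite -mulrBr normrM.
apply: (@le_trans _ _ (1 * (4 * C * `|(s - s') *: circle t|))).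
  apply: ler_pM => //.
  have := lipschitz_pd (x + s' *: circle t) ((s - s') *: circle t) bf.1 HC.
  by rewrite -addrA -scalerDl subrKC.
rewrite mul1r normrZ -[leRHS]mulrA [X in _ <= _ * X]mulrC.
by apply: ler_wpM2l; [exact: mulr_ge0|apply: ler_wpM2l => //; exact: circle_le].
Qed.

Lemma average_props f : bsmooth f -> bsmooth (average f) /\
  forall s, foldr pd (average f) s = average (foldr pd f s).
Proof.
(* Differentiation under the functional with parameters w = (s, t), weight 1 and bound K = 1. *)
move=> bf; pose v (w : R * R) x := k w.2 * f (x + w.1 *: circle w.2).
have vE s w x : foldr pd (v w) s x = k w.2 * foldr pd f s (x + w.1 *: circle w.2).
  by rewrite foldr_pd_affine//; exact: bf.1.
pose D (u : R * R -> R) := integrand (fun s t => u (s, t)).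
pose Lam (u : R * R -> R) := int2 (fun s t => u (s, t)).
have DD u u' : D u -> D u' -> D (fun w => u w + u' w) by exact: integrandD.
have DZ c u : D u -> D (fun w => c * u w) by exact: integrandZ.
have LD u u' : D u -> D u' -> Lam (fun w => u w + u' w) = Lam u + Lam u'.
  by move=> Du Du'; rewrite /Lam int2D.
have LZ c u : D u -> Lam (fun w => c * u w) = c * Lam u.
  by move=> Du; rewrite /Lam int2Z.
have Lle u C : D u -> (forall w, `|u w| <= C * 1) -> `|Lam u| <= 1 * C.
  by move=> Du uC; rewrite mul1r; apply: int2_le => // s t; rewrite -[C]mulr1.
have sv w : smooth setT (v w) by apply: smooth_affine; exact: bf.1.
have Dv s x : D (fun w => foldr pd (v w) s x).
  have := average_integrand x (bsmooth_foldr s bf).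
  by congr integrand; apply/funext => s'; apply/funext => t; rewrite vE.
have bv s : exists C, forall w x, `|foldr pd (v w) s x| <= C * 1.
  have [C HC] := bf.2 s; exists C => w x; rewrite vE normrM mulr1.
  by rewrite -[C]mul1r; apply: ler_pM.
have rho0 (w : R * R) : (0 : R) <= 1 by [].
split; first exact: (parametric_bsmooth rho0 DD DZ LD LZ Lle sv Dv bv).
move=> s; have -> := parametric_foldr_pd rho0 DD DZ LD LZ Lle sv Dv bv s.
apply/funext => x; rewrite /Lam /average; congr int2.
by apply/funext => s'; apply/funext => t; rewrite vE.
Qed.

Lemma averageD f g x : bsmooth f -> bsmooth g ->
  average (fun x => f x + g x) x = average f x + average g x.
Proof.
move=> bf bg; rewrite /average -int2D; [|exact: average_integrand..].
by congr int2; apply/funext => s; apply/funext => t; rewrite mulrDr.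
Qed.

Lemma averageZ (c : R) f x : bsmooth f ->
  average (fun x => c * f x) x = c * average f x.
Proof.
move=> bf; rewrite /average -int2Z; last exact: average_integrand.
by congr int2; apply/funext => s; apply/funext => t; rewrite mulrCA.
Qed.

Lemma average_local (Z : set 'rV[R]_4) f x :
  (forall y s t, Z y -> Z (y + s *: circle t)) ->
  (forall y, Z y -> f y = 0) -> Z x -> average f x = 0.
Proof.
move=> ZZ f0 Zx; rewrite /average (_ : (fun s t => _) = fun _ _ => 0).
  by rewrite /int2 !int01_cst.
by apply/funext => s; apply/funext => t; rewrite f0 ?mulr0//; exact: ZZ.
Qed.

Lemma average_le f C x : bsmooth f -> (forall y, `|f y| <= C) ->
  `|average f x| <= C.
Proof.
move=> bf fC; apply: int2_le; first exact: average_integrand.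
by move=> s t; rewrite normrM -[C]mul1r; apply: ler_pM.
Qed.

End Average.

(** The s-derivative of g(x + s circle(t)) is -r times the sum of the two integrands. Its integral
    is the mean of [g] over the outer circle, which vanishes, minus g(x). *)
Lemma average_radial g x : bsmooth g -> (forall t, g (x + circle t) = 0) ->
  average ccos (pd a g) x + average csin (pd b g) x = r^-1 * g x.
Proof.
move=> bg g0; have ba := bsmooth_pd a bg; have bb := bsmooth_pd b bg.
have i1 := average_integrand continuous_ccos ccos_le x ba.
have i2 := average_integrand continuous_csin csin_le x bb.
rewrite /average -int2D //; set F := fun s t => _.
have iF : integrand F by exact: integrandD.
suff : int2 (fun s t => - r * F s t) = - g x.
  rewrite int2Z// => /eqP; rewrite mulNr eqr_opp => /eqP <-.
  by rewrite mulKf// gt_eqF.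
have [C HC] : exists C : R, forall a b y, `|pd a (pd b g) y| <= C.
  have [c Hc] := choice (fun ij : 'I_4 * 'I_4 => bg.2 [:: ij.1; ij.2]).
  exists (\sum_ij `|c ij|) => i j y; apply: le_trans (Hc (i, j) y) _.
  by rewrite (bigD1 (i, j))//= (le_trans (ler_norm _))// lerDl sumr_ge0.
have C0 : 0 <= C := le_trans (normr_ge0 _) (HC ord0 ord0 0).
rewrite (@int2_derive _ _ (fun s t => g (x + s *: circle t))
    (16 * C * (r + r) ^+ 2)).
- rewrite (_ : (fun t => _) = fun=> 0); last first.
    by apply/funext => t; rewrite scale1r.
  rewrite (_ : (fun t => g (x + 0 *: _)) = fun=> g x); last first.
    by apply/funext => t; rewrite scale0r addr0.
  by rewrite !int01_cst sub0r.
- exact: integrandZ.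
- by move=> s; exact: continuous_circle bg.1.
- move=> s h t.
  have := taylor_pd (x + s *: circle t) (h *: circle t) bg.1 HC.
  rewrite -[x + _ + _]addrA -scalerDl linearZ /= covec_circle => H.
  rewrite /F; apply: le_trans H _.
  rewrite normrZ exprMn [_ * `|circle _| ^+ 2]mulrC mulrA.
  apply: ler_wpM2r; first exact: exprn_ge0.
  apply: ler_wpM2l; first by rewrite mulr_ge0.
  by rewrite lerXn2r ?nnegrE ?circle_le// addr_ge0// ltW.
Qed.

(** For each radius the integrand is, up to a factor, the t-derivative of the periodic function g(x
    + s circle(t)), so the inner integral is already zero. *)
Lemma average_angular g x : bsmooth g ->
  average ccos (pd b g) x - average csin (pd a g) x = 0.
Proof.
move=> bg; have ba := bsmooth_pd a bg; have bb := bsmooth_pd b bg.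
have i1 := average_integrand continuous_ccos ccos_le x bb.
have i2 := average_integrand continuous_csin csin_le x ba.
rewrite /average -mulN1r -int2Z// -int2D //; last exact: integrandZ.
rewrite /int2 (_ : (fun s => _) = fun=> 0) ?int01_cst//.
(* The factor just mentioned is proportional to 1/s. At s = 0 the integrand is a combination of sine
   and cosine with constant coefficients and has an explicit periodic primitive. *)
apply/funext => s; have [->|s0] := eqVneq s 0.
  pose U t := (2 * pi)^-1 * (csin t * pd b g x + ccos t * pd a g x).
  have pi0 : 2 * pi != 0 :> R by rewrite mulf_neq0// gt_eqF// pi_gt0.
  transitivity (U 1 - U 0); last by rewrite /U ccos1 csin1 subrr.
  apply: (@int01_derive _ _ U).
  - under eq_fun do rewrite scale0r addr0.
    apply: continuous_add; first apply: continuous_mul.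
    + exact: continuous_ccos.
    + exact: cst_continuous.
    + apply: continuous_scale; apply: continuous_mul.
        exact: continuous_csin.
      exact: cst_continuous.
  - move=> t; rewrite scale0r addr0.
    have -> : U = ((2 * pi)^-1 * pd b g x) \*: csin + ((2 * pi)^-1 * pd a g x) \*: ccos.
      by apply/funext => u; rewrite /U !fctE /= ?regular_scaleE; ring.
    have := is_deriveD
     (is_deriveZ ((2 * pi)^-1 * pd b g x) (is_derive_csin t))
     (is_deriveZ ((2 * pi)^-1 * pd a g x) (is_derive_ccos t)).
    congr is_derive; rewrite /= ?regular_scaleE.
    by move: (2 * pi) pi0 => q q0; field.
pose c := - (s * r * (2 * pi)).
have c0 : c != 0.
  by rewrite oppr_eq0 !mulf_neq0// gt_eqF// pi_gt0.
pose U t := c^-1 * g (x + s *: circle t).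
transitivity (U 1 - U 0); last by rewrite /U circle1 subrr.
apply: (@int01_derive _ _ U).
- apply: continuous_add; first exact: i1.1.
  by apply: continuous_scale; exact: i2.1.
- move=> t; have := is_deriveZ c^-1 (derive_circle x s t bg.1).
  by congr is_derive; rewrite /= ?regular_scaleE -/c mulKf// mulN1r.
Qed.

End CauchyTransform.

(* Otherwise unification compares averages of distinct functions by unfolding
   the integrals. *)
Opaque average ccos csin.

(** * Series dominated by a geometric one *)

Section GeometricSeries.
Context {R : realType}.
Implicit Types (u v : nat -> R).

Definition half_pow k : R := 2^-1 ^+ k.

Lemma half_pow_ge0 k : 0 <= half_pow k.
Proof. by rewrite exprn_ge0. Qed.

Definition geometric_bound u := exists C, forall k, `|u k| <= C * half_pow k.

Definition rsum u : R := limn (series u).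

Lemma geometric_bound_cvg u : geometric_bound u -> cvgn (series u).
Proof.
move=> [C HC]; apply: normed_cvg.
apply: (@series_le_cvg _ _ (geometric C (2^-1))) => //.
- by move=> k; exact: normr_ge0.
- by move=> k; exact: le_trans (normr_ge0 _) (HC k).
- by apply: is_cvg_geometric_series; rewrite ger0_norm ?invr_ge0// invf_lt1 ?ltr1n.
Qed.

Lemma geometric_boundD u v : geometric_bound u -> geometric_bound v ->
  geometric_bound (fun k => u k + v k).
Proof.
move=> [C HC] [D HD]; exists (C + D) => k; rewrite mulrDl.
by apply: (le_trans (ler_normD _ _)); apply: lerD.
Qed.

Lemma geometric_boundZ c u : geometric_bound u ->
  geometric_bound (fun k => c * u k).
Proof.
move=> [C HC]; exists (`|c| * C) => k; rewrite normrM -mulrA.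
exact: ler_wpM2l.
Qed.

Lemma rsumD u v : geometric_bound u -> geometric_bound v ->
  rsum (fun k => u k + v k) = rsum u + rsum v.
Proof.
by move=> /geometric_bound_cvg cu /geometric_bound_cvg cv; exact: lim_seriesD.
Qed.

Lemma rsumZ c u : geometric_bound u -> rsum (fun k => c * u k) = c * rsum u.
Proof. by move=> /geometric_bound_cvg cu; exact: lim_seriesZ. Qed.

Lemma rsum_tail u C N : geometric_bound u ->
  (forall k, (N <= k)%N -> `|u k| <= C * half_pow k) ->
  `|rsum u - series u N| <= 2 * C * half_pow N.
Proof.
move=> gu HC; have cu := geometric_bound_cvg gu.
have C0 : 0 <= C.
  have := le_trans (normr_ge0 _) (HC N (leqnn N)).
  by rewrite pmulr_lge0// exprn_gt0.
(* The sharper bound with a difference of powers is what makes the induction on [m] close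
   exactly. *)
have H m : `|series u (N + m)%N - series u N|
    <= 2 * C * (half_pow N - half_pow (N + m)).
  elim: m => [|m IH]; first by rewrite addn0 !subrr normr0 mulr0.
  rewrite addnS seriesSr.
  rewrite [_ + u _]addrC -addrA; apply: (le_trans (ler_normD _ _)).
  apply: (le_trans (lerD (HC _ (leq_addr _ _)) IH)).
  rewrite le_eqVlt; apply/orP; left; apply/eqP.
  by rewrite /half_pow exprS; field.
have H' M : (N <= M)%N -> `|series u M - series u N| <= 2 * C * half_pow N.
  move=> NM; rewrite -(subnKC NM); apply: le_trans (H _) _.
  rewrite mulrBr lerBlDr lerDl; apply: mulr_ge0; last exact: half_pow_ge0.
  by rewrite mulr_ge0.
rewrite ler_distl; apply/andP; split.
  apply: limr_ge => //; near=> M.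
  have /H' : (N <= M)%N by near: M; exact: nbhs_infty_ge.
  by rewrite ler_distl => /andP[].
apply: limr_le => //; near=> M.
have /H' : (N <= M)%N by near: M; exact: nbhs_infty_ge.
by rewrite ler_distl => /andP[].
Unshelve. all: by end_near. Qed.

Lemma rsum_le u C : geometric_bound u -> (forall k, `|u k| <= C * half_pow k) ->
  `|rsum u| <= 2 * C.
Proof.
move=> gu HC; have := rsum_tail gu (fun k (_ : (0 <= k)%N) => HC k).
by rewrite /series /= big_geq// subr0 /half_pow expr0 mulr1.
Qed.

(** Termwise differentiation is differentiation under the functional [rsum], with the index as
    parameter and [half_pow] as weight. *)
Lemma rsum_bsmooth (v : nat -> 'rV[R]_4 -> R) :
  (forall k, smooth setT (v k)) ->
  (forall s, exists C, forall k x, `|foldr pd (v k) s x| <= C * half_pow k) ->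
  bsmooth (fun x => rsum (v ^~ x)) /\
  forall s x, foldr pd (fun x => rsum (v ^~ x)) s x =
    rsum (fun k => foldr pd (v k) s x).
Proof.
move=> sv bv.
have Dv s x : geometric_bound (fun k => foldr pd (v k) s x).
  by have [C HC] := bv s; exists C.
split.
  exact: (parametric_bsmooth half_pow_ge0 geometric_boundD geometric_boundZ
    rsumD rsumZ rsum_le sv Dv bv).
move=> s x; have -> // := parametric_foldr_pd half_pow_ge0 geometric_boundD
  geometric_boundZ rsumD rsumZ rsum_le sv Dv bv s.
Qed.

End GeometricSeries.

Section ComplexBounded.
Context {R : realType}.
Implicit Types (f g : 'rV[R]_4 -> R[i]) (x : 'rV[R]_4) (u v z : R[i]).

(** The l1 norm on the real and imaginary parts: it takes values in [R], is submultiplicative, and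
    fits the componentwise estimates. *)
Definition cnorm z : R := `|complex.Re z| + `|complex.Im z|.

Lemma cnorm_ge0 z : 0 <= cnorm z.
Proof. by rewrite addr_ge0. Qed.

Lemma cnorm0 : cnorm 0 = 0.
Proof. by rewrite /cnorm /= normr0 addr0. Qed.

Lemma cnormN z : cnorm (- z) = cnorm z.
Proof. by case: z => p q; rewrite /cnorm /= !normrN. Qed.

Lemma cnormD u v : cnorm (u + v) <= cnorm u + cnorm v.
Proof. by rewrite /cnorm Re_D Im_D addrACA lerD// ler_normD. Qed.

Lemma cnormM u v : cnorm (u * v) <= cnorm u * cnorm v.
Proof.
rewrite /cnorm Re_M Im_M mulrDl !mulrDr -!normrM.
apply: le_trans (lerD (ler_normB _ _) (ler_normD _ _)) _.
by rewrite le_eqVlt; apply/orP; left; apply/eqP; ring.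
Qed.

Lemma cnorm_sum (I : Type) (s : seq I) (F : I -> R[i]) :
  cnorm (\sum_(i <- s) F i) <= \sum_(i <- s) cnorm (F i).
Proof.
elim: s => [|i s IH]; first by rewrite !big_nil cnorm0.
by rewrite !big_cons (le_trans (cnormD _ _))// lerD.
Qed.

Lemma cnorm_Re z : `|complex.Re z| <= cnorm z.
Proof. by rewrite lerDl. Qed.

Lemma cnorm_Im z : `|complex.Im z| <= cnorm z.
Proof. by rewrite lerDr. Qed.

Lemma cnorm_eq0 z : cnorm z <= 0 -> z = 0.
Proof.
move=> z0; apply: complex_eq => /=; apply/eqP; rewrite -normr_le0.
  exact: le_trans (cnorm_Re z) z0.
exact: le_trans (cnorm_Im z) z0.
Qed.

Definition bsmoothC f := bsmooth (fun x => complex.Re (f x)) /\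
  bsmooth (fun x => complex.Im (f x)).

Lemma bsmoothC_smoothC f : bsmoothC f -> smoothC setT f.
Proof. by move=> [[? _] [? _]]. Qed.

Lemma bsmoothC_diffC f x : bsmoothC f -> diffC f x.
Proof. by move=> [bp bq]; split; exact: bsmooth_diff. Qed.

Lemma bsmoothC_pdC f a : bsmoothC f -> bsmoothC (pdC a f).
Proof. by move=> [bp bq]; split; exact: bsmooth_pd. Qed.

Lemma bsmoothC_foldr f s : bsmoothC f -> bsmoothC (foldr pdC f s).
Proof. by move=> bf; elim: s => //= a s; exact: bsmoothC_pdC. Qed.

Lemma bsmoothC_cst z : bsmoothC (fun=> z).
Proof. by split; exact: bsmooth_cst. Qed.

Lemma bsmoothC_D f g : bsmoothC f -> bsmoothC g -> bsmoothC (fun x => f x + g x).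
Proof.
move=> [fr fi] [gr gi]; split.
  by under eq_fun do rewrite Re_D; exact: bsmoothD.
by under eq_fun do rewrite Im_D; exact: bsmoothD.
Qed.

Lemma bsmoothC_M f g : bsmoothC f -> bsmoothC g -> bsmoothC (fun x => f x * g x).
Proof.
move=> [fr fi] [gr gi]; split.
  under eq_fun do rewrite Re_M.
  by apply: bsmoothD; [exact: bsmoothM|apply: bsmoothN; exact: bsmoothM].
by under eq_fun do rewrite Im_M; apply: bsmoothD; exact: bsmoothM.
Qed.

Lemma bsmoothC_sum (I : Type) (s : seq I) (F : I -> 'rV[R]_4 -> R[i]) :
  (forall i, bsmoothC (F i)) -> bsmoothC (fun x => \sum_(i <- s) F i x).
Proof.
move=> bF; elim: s => [|i s IH].
  by under eq_fun do rewrite big_nil; exact: bsmoothC_cst.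
by under eq_fun do rewrite big_cons; exact: bsmoothC_D.
Qed.

Lemma foldr_pdCE f s x : foldr pdC f s x =
  foldr pd (fun x => complex.Re (f x)) s x +i*
  foldr pd (fun x => complex.Im (f x)) s x.
Proof.
elim: s x => [|a s IH] x /=; first by case: (f x).
rewrite (_ : foldr pdC f s = fun y => foldr pd (fun x => complex.Re (f x)) s y +i*
  foldr pd (fun x => complex.Im (f x)) s y) //.
by apply/funext.
Qed.

Lemma bsmoothC_bound f s : bsmoothC f ->
  exists2 C : R, 0 <= C & forall x, cnorm (foldr pdC f s x) <= C.
Proof.
move=> [[_ bp] [_ bq]]; have [C HC] := bp s; have [D HD] := bq s.
exists (C + D); last by move=> x; rewrite foldr_pdCE /cnorm /=; apply: lerD.
by apply: addr_ge0; [apply: le_trans (HC 0)|apply: le_trans (HD 0)].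
Qed.

Lemma pdC_funD f g a : bsmoothC f -> bsmoothC g ->
  pdC a (fun x => f x + g x) = fun x => pdC a f x + pdC a g x.
Proof.
by move=> bf bg; apply/funext => x; rewrite pdC_D //; exact: bsmoothC_diffC.
Qed.

Lemma pdC_funM f g a : bsmoothC f -> bsmoothC g ->
  pdC a (fun x => f x * g x) = fun x => pdC a f x * g x + f x * pdC a g x.
Proof.
by move=> bf bg; apply/funext => x; rewrite pdC_M //; exact: bsmoothC_diffC.
Qed.

Lemma foldr_pdC_D f g s : bsmoothC f -> bsmoothC g ->
  foldr pdC (fun x => f x + g x) s = fun x => foldr pdC f s x + foldr pdC g s x.
Proof.
by move=> bf bg; elim: s => //= a s ->; rewrite pdC_funD //; exact: bsmoothC_foldr.
Qed.

Lemma foldr_pdC_sum (I : Type) (r : seq I) (F : I -> 'rV[R]_4 -> R[i]) s :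
  (forall i, bsmoothC (F i)) ->
  foldr pdC (fun x => \sum_(i <- r) F i x) s =
  fun x => \sum_(i <- r) foldr pdC (F i) s x.
Proof.
move=> bF; elim: s => //= a s ->; apply/funext => x.
by rewrite pdC_sum // => i _; apply: bsmoothC_diffC; exact: bsmoothC_foldr.
Qed.

(** Commuting an iterated derivative with multiplication by [f] costs only derivatives of [g] of
    strictly lower order, and [M] depends on [f] and [s] alone. The induction peels off the
    innermost derivative, so it is applied both to [pdC a f] and to [pdC a g]. *)
Lemma leibniz_remainder s f : bsmoothC f -> exists2 M : R, 0 <= M &
  forall g c, bsmoothC g ->
    (forall t, (size t < size s)%N -> forall x, cnorm (foldr pdC g t x) <= c) ->
    forall x, cnorm (foldr pdC (fun x => f x * g x) s x - f x * foldr pdC g s x)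
      <= M * c.
Proof.
elim/last_ind: s f => [|s a IH] f bf.
  by exists 0 => // g c _ _ x; rewrite /= subrr cnorm0 mul0r.
have bfa := bsmoothC_pdC a bf.
have [M1 M10 H1] := IH _ bfa; have [M2 M20 H2] := IH _ bf.
have [b b0 Hb] := bsmoothC_bound [::] bfa.
exists (b + M1 + M2); first by rewrite !addr_ge0.
move=> g c bg gc x; have bga := bsmoothC_pdC a bg.
have gc1 t : (size t < size s)%N -> forall x, cnorm (foldr pdC g t x) <= c.
  by move=> ts; apply: gc; rewrite size_rcons (ltn_trans ts).
have gc2 t : (size t < size s)%N -> forall x, cnorm (foldr pdC (pdC a g) t x) <= c.
  by move=> ts y; rewrite -foldr_rcons; apply: gc; rewrite !size_rcons ltnS.
have := H1 g c bg gc1 x; have := H2 _ c bga gc2 x.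
rewrite !foldr_rcons pdC_funM // foldr_pdC_D; try exact: bsmoothC_M.
set A := foldr _ _ s x; set B := foldr _ _ s x; set G := foldr _ _ s x.
set A' := foldr _ _ s x => K2 K1.
have K3 : cnorm (pdC a f x * A') <= b * c.
  apply: le_trans (cnormM _ _) _; apply: ler_pM; try exact: cnorm_ge0.
    exact: Hb.
  by apply: gc; rewrite size_rcons.
rewrite !mulrDl.
rewrite (_ : _ - _ = pdC a f x * A' + (G - pdC a f x * A') + (A - f x * B)); last by ring.
apply: le_trans (cnormD _ _) _; apply: lerD => //.
by apply: le_trans (cnormD _ _) _; apply: lerD.
Qed.

End ComplexBounded.

(** * The Cauchy transform over a disc *)

Section ComplexCauchy.
Context {R : realType}.
Implicit Types (f : 'rV[R]_4 -> R[i]) (g : 'rV[R]_4 -> R) (x : 'rV[R]_4).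
Variables (a b : 'I_4) (r : R).
Hypothesis r0 : 0 < r.

(** Real and imaginary parts of (1/pi) times the integral of f(x - zeta) / zeta over |zeta| < r.
    With zeta = s r exp(2 pi i t) this is 2r times the integral of exp(-2 pi i t) f over the unit
    square. *)
Definition cauchy f x : R[i] :=
  (2 * r * (average a b r ccos (fun y => complex.Re (f y)) x
            + average a b r csin (fun y => complex.Im (f y)) x)) +i*
  (2 * r * (average a b r ccos (fun y => complex.Im (f y)) x
            - average a b r csin (fun y => complex.Re (f y)) x)).

Let ac := average_props a b r0 (@continuous_ccos R) (@ccos_le R).
Let as_ := average_props a b r0 (@continuous_csin R) (@csin_le R).

Lemma cauchy_bsmooth f : bsmoothC f -> bsmoothC (cauchy f).
Proof.
move=> [fr fi]; split => /=; apply: bsmoothM; try exact: bsmooth_cst.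
  by apply: bsmoothD; [exact: (ac fr).1|exact: (as_ fi).1].
by apply: bsmoothD; [exact: (ac fi).1|apply: bsmoothN; exact: (as_ fr).1].
Qed.

Lemma pd_ac g c x : bsmooth g ->
  pd c (average a b r ccos g) x = average a b r ccos (pd c g) x.
Proof. by move=> bg; have [_ /(_ [:: c]) /= ->] := ac bg. Qed.

Lemma pd_as g c x : bsmooth g ->
  pd c (average a b r csin g) x = average a b r csin (pd c g) x.
Proof. by move=> bg; have [_ /(_ [:: c]) /= ->] := as_ bg. Qed.

Lemma pdC_cauchy f c : bsmoothC f -> pdC c (cauchy f) = cauchy (pdC c f).
Proof.
move=> [fr fi]; apply/funext => x; rewrite /cauchy /pdC /=.
have d1 := bsmooth_diff x (ac fr).1; have d2 := bsmooth_diff x (ac fi).1.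
have d3 := bsmooth_diff x (as_ fr).1; have d4 := bsmooth_diff x (as_ fi).1.
have pdK (K : R) (u : 'rV[R]_4 -> R) : differentiable u x ->
    pd c (fun y => K * u y) x = K * pd c u x.
  by move=> du; rewrite pd_mul // pd_cst mul0r add0r.
have dN (u : 'rV[R]_4 -> R) : differentiable u x -> differentiable (fun y => - u y) x.
  exact: differentiableN.
have dD (u v : 'rV[R]_4 -> R) : differentiable u x -> differentiable v x ->
  differentiable (fun y => u y + v y) x by exact: differentiableD.
rewrite (pdK _ _ (dD _ _ d1 d4)) (pdK _ _ (dD _ _ d2 (dN _ d3))).
rewrite (pdD _ d1 d4) (pdD _ d2 (dN _ d3)) (pdN _ d3).
by congr (_ * (_ + _) +i* (_ * (_ - _)));
  [exact: pd_ac|exact: pd_as|exact: pd_ac|exact: pd_as].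
Qed.

Lemma cauchyD f (g : 'rV[R]_4 -> R[i]) x : bsmoothC f -> bsmoothC g ->
  cauchy (fun x => f x + g x) x = cauchy f x + cauchy g x.
Proof.
move=> [fr fi] [gr gi]; rewrite /cauchy.
have er : (fun y => complex.Re (f y + g y)) =
  fun y => complex.Re (f y) + complex.Re (g y) by apply/funext => y; rewrite Re_D.
have ei : (fun y => complex.Im (f y + g y)) =
  fun y => complex.Im (f y) + complex.Im (g y) by apply/funext => y; rewrite Im_D.
rewrite er ei.
have cc := @continuous_ccos R; have cs := @continuous_csin R.
have lc := @ccos_le R; have ls := @csin_le R.
rewrite !(averageD a b r0 cc lc) ?(averageD a b r0 cs ls) //.
apply: complex_eq; rewrite (Re_D, Im_D) /= -mulrDr; congr (_ * _).
  by rewrite addrACA.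
by rewrite opprD addrACA.
Qed.

(** Each component is 2r times two averages bounded by C; two components give 8rC. *)
Lemma cauchy_le f C x : bsmoothC f -> (forall y, cnorm (f y) <= C) ->
  cnorm (cauchy f x) <= 8 * r * C.
Proof.
move=> [fr fi] fC.
have K k (g : 'rV[R]_4 -> R) (ck : continuous k) (k1 : forall t, `|k t| <= 1) :
    bsmooth g -> (forall y, `|g y| <= C) -> `|average a b r k g x| <= C.
  by move=> bg gC; exact: average_le.
have cr y : `|complex.Re (f y)| <= C := le_trans (cnorm_Re _) (fC y).
have ci y : `|complex.Im (f y)| <= C := le_trans (cnorm_Im _) (fC y).
have r2 : 0 <= 2 * r by rewrite mulr_ge0// ltW.
have H u v : `|u| <= C -> `|v| <= C -> `|2 * r * (u + v)| <= 2 * r * (C + C).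
  move=> uC vC; rewrite normrM ger0_norm//; apply: ler_wpM2l => //.
  by apply: le_trans (ler_normD _ _) _; exact: lerD.
rewrite (_ : 8 * r * C = 2 * r * (C + C) + 2 * r * (C + C)); last by ring.
have cc := @continuous_ccos R; have cs := @continuous_csin R.
have lc := @ccos_le R; have ls := @csin_le R.
have A1 := K _ _ cc lc fr cr; have A2 := K _ _ cs ls fi ci.
have A3 := K _ _ cc lc fi ci; have A4 := K _ _ cs ls fr cr.
rewrite /cnorm /=; apply: lerD; first exact: (H _ _ A1 A2).
by apply: (H _ _ A3); rewrite normrN; exact: A4.
Qed.

Lemma cauchyZ z f x : bsmoothC f -> cauchy (fun x => z * f x) x = z * cauchy f x.
Proof.
move=> [fr fi]; rewrite /cauchy; case: z => p q.
have AZ k (ck : continuous k) (k1 : forall t, `|k t| <= 1) c d :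
  average a b r k (fun y => c * complex.Re (f y) + d * complex.Im (f y)) x =
  c * average a b r k (fun y => complex.Re (f y)) x +
  d * average a b r k (fun y => complex.Im (f y)) x.
  have bc := @bsmooth_cst R c; have bd := @bsmooth_cst R d.
  rewrite (averageD _ _ r0 ck k1 _ (bsmoothM bc fr) (bsmoothM bd fi)).
  by rewrite !averageZ.
have er : (fun y => complex.Re ((p +i* q) * f y)) =
  fun y => p * complex.Re (f y) + (- q) * complex.Im (f y).
  by apply/funext => y; rewrite Re_M /=; ring.
have ei : (fun y => complex.Im ((p +i* q) * f y)) =
  fun y => q * complex.Re (f y) + p * complex.Im (f y).
  by apply/funext => y; rewrite Im_M /=; ring.
have cc := @continuous_ccos R; have cs := @continuous_csin R.
have lc := @ccos_le R; have ls := @csin_le R.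
rewrite er ei !(AZ _ cc lc) !(AZ _ cs ls).
move: (average a b r ccos _ x) (average a b r ccos _ x) => u1 u2.
move: (average a b r csin _ x) (average a b r csin _ x) => v1 v2.
by apply: complex_eq => /=; ring.
Qed.

Lemma cauchy_local (Z : set 'rV[R]_4) f x :
  (forall y s t, Z y -> Z (y + s *: circle a b r t)) ->
  (forall y, Z y -> f y = 0) -> Z x -> cauchy f x = 0.
Proof.
move=> ZZ f0 Zx; rewrite /cauchy.
have A0 k (g : 'rV[R]_4 -> R) : (forall y, Z y -> g y = 0) ->
    average a b r k g x = 0 by move=> g0; exact: average_local ZZ g0 Zx.
rewrite !A0; try by move=> y /f0 ->.
by rewrite subrr addr0 mulr0.
Qed.

(** After differentiating under the averages, the radial identities for the real and imaginary parts
    produce 2f and the angular identities kill the rest. The only boundary term is the mean of [f]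
    over the circle about [x]. *)
Lemma cauchy_dbar f x : bsmoothC f -> (forall t, f (x + circle a b r t) = 0) ->
  pdC a (cauchy f) x + 'i * pdC b (cauchy f) x = 2 * f x.
Proof.
move=> bf f0; rewrite !pdC_cauchy //; case: bf => fr fi.
have r0' : r != 0 by rewrite gt_eqF.
move: fr fi; set fr' := fun y => complex.Re (f y); set fi' := fun y => complex.Im (f y).
move=> fr fi.
have H1 := average_radial r0 fr (fun t => congr1 (@complex.Re R) (f0 t)).
have H2 := average_radial r0 fi (fun t => congr1 (@complex.Im R) (f0 t)).
have H3 := @average_angular R a b r r0 fr' x fr.
have H4 := @average_angular R a b r r0 fi' x fi.
have re : complex.Re (f x) + complex.Re (f x) = 2 * r * (r^-1 * complex.Re (f x)) by field.
have im : complex.Im (f x) + complex.Im (f x) = 2 * r * (r^-1 * complex.Im (f x)) by field.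
rewrite /cauchy /=.
rewrite -/(pd a fr') -/(pd a fi') -/(pd b fr') -/(pd b fi').
move: H1 H2 H3 H4.
generalize (average a b r ccos (pd a fr') x) (average a b r csin (pd b fr') x)
  (average a b r ccos (pd a fi') x) (average a b r csin (pd b fi') x)
  (average a b r ccos (pd b fr') x) (average a b r csin (pd a fr') x)
  (average a b r ccos (pd b fi') x) (average a b r csin (pd a fi') x).
move=> u1 u2 u3 u4 u5 u6 u7 u8 H1 H2 /subr0_eq H3 /subr0_eq H4.
apply: complex_eq; rewrite !(Re_D, Im_D, Re_M, Im_M) /=.
- transitivity (complex.Re (f x) + complex.Re (f x)); last by ring.
  by apply: etrans (esym re); rewrite -[r^-1 * _]H1 H4; ring.
- transitivity (complex.Im (f x) + complex.Im (f x)); last by ring.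
  by apply: etrans (esym im); rewrite -[r^-1 * _]H2 H3; ring.
Qed.

End ComplexCauchy.

(** * The Neumann series of an operator commuting with derivatives *)

Section Neumann.
Context {R : realType} {n : nat}.
Implicit Types (f g : 'rV[R]_4 -> R[i]) (x : 'rV[R]_4).
Variables (T : ('rV[R]_4 -> R[i]) -> 'rV[R]_4 -> R[i]) (K q beta : R).
Variable B : 'rV[R]_4 -> 'M[R[i]]_n.
Hypothesis T_bs : forall f, bsmoothC f -> bsmoothC (T f).
Hypothesis T_pd : forall f c, bsmoothC f -> pdC c (T f) = T (pdC c f).
Hypothesis T_D : forall f g x, bsmoothC f -> bsmoothC g ->
  T (fun y => f y + g y) x = T f x + T g x.
Hypothesis T_le : forall f C x, bsmoothC f -> (forall y, cnorm (f y) <= C) ->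
  cnorm (T f x) <= K * C.
Hypothesis K0 : 0 <= K.
Hypothesis beta0 : 0 <= beta.
Hypothesis B_bs : forall i j, bsmoothC (fun x => B x i j).
Hypothesis B_le : forall x i j, cnorm (B x i j) <= beta.
Hypothesis q_ge : n%:R * K * beta <= q.
Hypothesis q_le : q <= 4^-1.

(** The k-th iterate of F |-> T (B F) on the identity matrix, [T] acting entrywise. *)
Fixpoint neumann_term k : 'rV[R]_4 -> 'M[R[i]]_n :=
  if k is k'.+1 then
    fun x => \matrix_(i, j) T (fun y => (B y *m neumann_term k' y) i j) x
  else fun=> 1%:M.

Let u k i j x := neumann_term k x i j.

Lemma neumann_termS k i j :
  u k.+1 i j = T (fun y => \sum_l B y i l * u k l j y).
Proof.
apply/funext => x; rewrite /u /= mxE; congr (T _ x).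
by apply/funext => y; rewrite mxE.
Qed.

Lemma B_mul_bs (v : 'I_n -> 'I_n -> 'rV[R]_4 -> R[i]) i j :
  (forall l j, bsmoothC (v l j)) -> bsmoothC (fun y => \sum_l B y i l * v l j y).
Proof. by move=> bv; apply: bsmoothC_sum => l; exact: bsmoothC_M. Qed.

Lemma neumann_term_bs k i j : bsmoothC (u k i j).
Proof.
elim: k i j => [|k IH] i j; first exact: bsmoothC_cst.
by rewrite neumann_termS; apply: T_bs; exact: B_mul_bs.
Qed.

Lemma T_foldr f s : bsmoothC f -> foldr pdC (T f) s = T (foldr pdC f s).
Proof.
by move=> bf; elim: s => //= a s ->; rewrite T_pd //; exact: bsmoothC_foldr.
Qed.

Lemma sum_le_const (F : 'I_n -> R) C : (forall l, F l <= C) ->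
  \sum_l F l <= n%:R * C.
Proof.
move=> FC; apply: le_trans (ler_sum _ (fun l _ => FC l)) _.
by rewrite sumr_const card_ord mulr_natl.
Qed.

(** Since [T] commutes with derivatives, the s-derivative of the next term is [T] of [B] times the
    s-derivative of the present one, contributing at most A/4, plus a Leibniz remainder governed by
    shorter derivatives. Hence q <= 1/4 suffices for derivatives of every order. *)
Lemma neumann_bound_step s C : 0 <= C ->
  (forall t, (size t < size s)%N -> forall k i j x,
    cnorm (foldr pdC (u k i j) t x) <= C * half_pow k) ->
  exists2 A : R, 0 <= A & forall k i j x,
    cnorm (foldr pdC (u k i j) s x) <= A * half_pow k.
Proof.
move=> C0 HC.
have H0 (ij : 'I_n * 'I_n) : exists c : R, 0 <= c /\
    forall x, cnorm (foldr pdC (u 0 ij.1 ij.2) s x) <= c.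
  have [c c0 Hc] := bsmoothC_bound s (neumann_term_bs 0 ij.1 ij.2).
  by exists c.
have HL (ij : 'I_n * 'I_n) : exists M : R, 0 <= M /\ forall g c, bsmoothC g ->
    (forall t, (size t < size s)%N -> forall x, cnorm (foldr pdC g t x) <= c) ->
    forall x, cnorm (foldr pdC (fun x => B x ij.1 ij.2 * g x) s x
      - B x ij.1 ij.2 * foldr pdC g s x) <= M * c.
  by have [M M0 HM] := leibniz_remainder s (B_bs ij.1 ij.2); exists M.
have [c Hc] := choice H0; have [M HM] := choice HL.
pose c1 := \sum_ij c ij; pose M1 := \sum_ij M ij.
have c10 : 0 <= c1 by apply: sumr_ge0 => ij _; exact: (Hc ij).1.
have M10 : 0 <= M1 by apply: sumr_ge0 => ij _; exact: (HM ij).1.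
have cle ij : c ij <= c1.
  by rewrite /c1 (bigD1 ij)//= lerDl sumr_ge0// => *; exact: (Hc _).1.
have Mle ij : M ij <= M1.
  by rewrite /M1 (bigD1 ij)//= lerDl sumr_ge0// => *; exact: (HM _).1.
pose D := K * (n%:R * (M1 * C)).
have D0 : 0 <= D by rewrite !mulr_ge0.
(* [c1] bounds the term of index 0, and A >= 4D makes the recursion A/4 + D <= A/2 hold. *)
pose A := c1 + 4 * D.
have A0 : 0 <= A by rewrite addr_ge0 // mulr_ge0.
exists A => //; elim=> [|k IH] i j x.
  rewrite /half_pow expr0 mulr1 /A; apply: le_trans ((Hc (i, j)).2 x) _.
  by apply: le_trans (cle _) _; rewrite lerDl mulr_ge0.
have bu := neumann_term_bs k.
rewrite neumann_termS T_foldr; last exact: B_mul_bs.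
rewrite foldr_pdC_sum; last by move=> l; exact: bsmoothC_M.
have bF l : bsmoothC (foldr pdC (fun x => B x i l * u k l j x) s).
  by apply: bsmoothC_foldr; exact: bsmoothC_M.
apply: le_trans (_ : K * (n%:R * ((beta * A + M1 * C) * half_pow k)) <= _).
  apply: T_le; first exact: bsmoothC_sum.
  move=> y; apply: le_trans (cnorm_sum _ _) _; apply: sum_le_const => l.
  have H := (HM (i, l)).2 (u k l j) (C * half_pow k) (bu l j)
    (fun t ts => HC t ts k l j) y.
  rewrite /= in H; set G := foldr _ _ s y in H *.
  rewrite (_ : G = B y i l * foldr pdC (u k l j) s y
      + (G - B y i l * foldr pdC (u k l j) s y)); last by rewrite addrC subrK.
  apply: le_trans (cnormD _ _) _; rewrite mulrDl -!mulrA; apply: lerD.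
    apply: le_trans (cnormM _ _) _.
    by apply: ler_pM => //; exact: cnorm_ge0.
  apply: le_trans H _; apply: ler_wpM2r => //.
  by rewrite mulr_ge0// half_pow_ge0.
rewrite {2}/half_pow exprS -/(half_pow k).
rewrite [leRHS]mulrA mulrA [X in X <= _]mulrA; apply: ler_wpM2r.
  exact: half_pow_ge0.
rewrite (_ : _ * _ = n%:R * K * beta * A + D); last by rewrite /D; ring.
have : n%:R * K * beta * A <= 4^-1 * A.
  by apply: ler_wpM2r => //; exact: le_trans q_ge q_le.
by rewrite /A; lra.
Qed.

Lemma neumann_bound s : exists2 C : R, 0 <= C & forall k i j x,
  cnorm (foldr pdC (u k i j) s x) <= C * half_pow k.
Proof.
suff H m : exists2 C : R, 0 <= C & forall s, (size s < m)%N -> forall k i j x,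
    cnorm (foldr pdC (u k i j) s x) <= C * half_pow k.
  by have [C C0 HC] := H (size s).+1; exists C => // k i j x; exact: HC.
elim: m => [|m [C C0 HC]]; first by exists 0.
(* Lists of a given length form a finite type, so their constants can be added. *)
have Ht (t : m.-tuple 'I_4) : exists A : R, 0 <= A /\ forall k i j x,
    cnorm (foldr pdC (u k i j) t x) <= A * half_pow k.
  have [|A A0 HA] := @neumann_bound_step t C C0; last by exists A.
  by move=> t' ts; apply: HC; rewrite size_tuple in ts.
have [A HA] := choice Ht.
have SA0 : 0 <= \sum_t A t by apply: sumr_ge0 => t _; exact: (HA t).1.
exists (C + \sum_t A t); first exact: addr_ge0.
move=> t; rewrite ltnS leq_eqVlt => /orP[/eqP tm|tm] k i j x; rewrite mulrDl.
  apply: le_trans (_ : (\sum_t A t) * half_pow k <= _); last first.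
    by rewrite lerDr mulr_ge0// half_pow_ge0.
  move/eqP : tm => tm; apply: le_trans ((HA (Tuple tm)).2 k i j x) _.
  apply: ler_wpM2r; first exact: half_pow_ge0.
  by rewrite (bigD1 (Tuple tm))//= lerDl sumr_ge0// => *; exact: (HA _).1.
apply: le_trans (HC _ tm _ _ _ _) _.
by rewrite lerDl mulr_ge0// half_pow_ge0.
Qed.

(** Unlike the constant of [neumann_bound], this one is proportional to [q]; it is what makes the
    sum close to the identity and therefore invertible. *)
Lemma neumann_small k i j x : cnorm (u k.+1 i j x) <= 2 * q * half_pow k.+1.
Proof.
have q0 : 0 <= q by apply: le_trans q_ge; rewrite !mulr_ge0.
have step C k' : 0 <= C -> (forall i j x, cnorm (u k' i j x) <= C) ->
    forall i j x, cnorm (u k'.+1 i j x) <= q * C.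
  move=> C0 HC i' j' x'; rewrite neumann_termS.
  apply: le_trans (_ : K * (n%:R * (beta * C)) <= _).
    apply: T_le; first by apply: B_mul_bs => *; exact: neumann_term_bs.
    move=> y; apply: le_trans (cnorm_sum _ _) _; apply: sum_le_const => l.
    apply: le_trans (cnormM _ _) _.
    by apply: ler_pM => //; exact: cnorm_ge0.
  rewrite (_ : K * _ = n%:R * K * beta * C); last by ring.
  exact: ler_wpM2r.
elim: k i j x => [|k IH] i j x.
  rewrite /half_pow expr1 (_ : 2 * q * _ = q * 1); last by field.
  apply: step => // i' j' x'; rewrite /u /= mxE /cnorm.
  by case: (i' == j'); rewrite /= ?normr0 ?normr1 addr0.
have hp : 0 <= 2 * q * half_pow k.+1 by rewrite !mulr_ge0// half_pow_ge0.
apply: le_trans (step _ _ hp IH i j x) _.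
rewrite [leRHS](_ : _ = 2^-1 * (2 * q * half_pow k.+1)); last first.
  by rewrite /half_pow [in LHS]exprS; ring.
apply: ler_wpM2r => //; apply: le_trans q_le _.
by rewrite lef_pV2 ?posrE// ler_nat.
Qed.

Definition csum (phi : nat -> R[i]) : R[i] :=
  rsum (fun k => complex.Re (phi k)) +i* rsum (fun k => complex.Im (phi k)).

Lemma csum_tail (phi : nat -> R[i]) C D N : (forall k, cnorm (phi k) <= D * half_pow k) ->
  (forall k, (N <= k)%N -> cnorm (phi k) <= C * half_pow k) ->
  cnorm (csum phi - \sum_(k < N) phi k) <= 4 * C * half_pow N.
Proof.
move=> HD HC.
have gr : geometric_bound (fun k => complex.Re (phi k)).
  by exists D => k; exact: le_trans (cnorm_Re _) _.
have gi : geometric_bound (fun k => complex.Im (phi k)).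
  by exists D => k; exact: le_trans (cnorm_Im _) _.
have sRe : complex.Re (\sum_(k < N) phi k) = series (fun k => complex.Re (phi k)) N.
  rewrite /series /= big_mkord; elim/big_rec2: _ => // k y1 y2 _ <-.
  by rewrite Re_D.
have sIm : complex.Im (\sum_(k < N) phi k) = series (fun k => complex.Im (phi k)) N.
  rewrite /series /= big_mkord; elim/big_rec2: _ => // k y1 y2 _ <-.
  by rewrite Im_D.
have t1 := rsum_tail gr (fun k Nk => le_trans (cnorm_Re _) (HC k Nk)).
have t2 := rsum_tail gi (fun k Nk => le_trans (cnorm_Im _) (HC k Nk)).
rewrite -sRe in t1; rewrite -sIm in t2.
rewrite (_ : 4 * C * _ = 2 * C * half_pow N + 2 * C * half_pow N); last by ring.
rewrite {1}/cnorm; move: t1 t2; case: (\sum_(k < N) phi k) => p p' /=.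
exact: lerD.
Qed.

Definition neumann_sum x : 'M[R[i]]_n := \matrix_(i, j) csum (fun k => u k i j x).

Let S i j x := neumann_sum x i j.

Lemma neumann_sumE i j x : S i j x = csum (fun k => u k i j x).
Proof. by rewrite /S mxE. Qed.

Lemma neumann_sum_props i j : bsmoothC (S i j) /\
  forall s x, foldr pdC (S i j) s x = csum (fun k => foldr pdC (u k i j) s x).
Proof.
have bs k := neumann_term_bs k i j.
have HRe s : exists C, forall k x,
    `|foldr pd (fun y => complex.Re (u k i j y)) s x| <= C * half_pow k.
  have [C _ HC] := neumann_bound s; exists C => k x.
  by apply: le_trans (HC k i j x); rewrite foldr_pdCE; exact: (cnorm_Re (_ +i* _)).
have HIm s : exists C, forall k x,
    `|foldr pd (fun y => complex.Im (u k i j y)) s x| <= C * half_pow k.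
  have [C _ HC] := neumann_bound s; exists C => k x.
  by apply: le_trans (HC k i j x); rewrite foldr_pdCE; exact: (cnorm_Im (_ +i* _)).
have [b1 f1] := rsum_bsmooth (fun k => (bs k).1.1) HRe.
have [b2 f2] := rsum_bsmooth (fun k => (bs k).2.1) HIm.
have eRe : (fun x => complex.Re (S i j x)) = fun x => rsum (fun k => complex.Re (u k i j x)).
  by apply/funext => x; rewrite neumann_sumE.
have eIm : (fun x => complex.Im (S i j x)) = fun x => rsum (fun k => complex.Im (u k i j x)).
  by apply/funext => x; rewrite neumann_sumE.
split; first by split; rewrite ?eRe ?eIm.
move=> s x; rewrite foldr_pdCE eRe eIm f1 f2 /csum.
by congr (rsum _ +i* rsum _); apply/funext => k; rewrite foldr_pdCE.
Qed.

Lemma T_0 x : T (fun=> 0) x = 0.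
Proof.
have b0 := bsmoothC_cst (0 : R[i]).
have := T_D x b0 b0; under eq_fun do rewrite addr0.
by move=> /eqP; rewrite -subr_eq0 opprD addrA subrr sub0r oppr_eq0 => /eqP.
Qed.

Lemma T_sum (I : Type) (r : seq I) (F : I -> 'rV[R]_4 -> R[i]) x :
  (forall i, bsmoothC (F i)) ->
  T (fun y => \sum_(i <- r) F i y) x = \sum_(i <- r) T (F i) x.
Proof.
move=> bF; elim: r => [|i r IH].
  by rewrite big_nil -[RHS](T_0 x); congr (T _ x); apply/funext => y; rewrite big_nil.
rewrite big_cons -IH -T_D //; last exact: bsmoothC_sum.
by congr (T _ x); apply/funext => y; rewrite big_cons.
Qed.

(** The partial sums satisfy P(N+1) = 1 + T(B P(N)); both sides converge because [T] is bounded and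
    the tails are O(2^-N). Only finite additivity of [T] is used before the limit. *)
Lemma neumann_fixpoint i j x :
  S i j x = (i == j)%:R + T (fun y => \sum_l B y i l * S l j y) x.
Proof.
have [C C0 HC] := neumann_bound [::].
have bS l j' := (neumann_sum_props l j').1.
pose P N l j' y := \sum_(k < N) u k l j' y.
have bP N l j' : bsmoothC (P N l j').
  by apply: bsmoothC_sum => k; exact: neumann_term_bs.
have tail N l j' y : cnorm (S l j' y - P N l j' y) <= 4 * C * half_pow N.
  rewrite neumann_sumE; apply: (@csum_tail _ C C); first by move=> k; exact: HC.
  by move=> k _; exact: HC.
have PS N : P N.+1 i j x = (i == j)%:R + T (fun y => \sum_l B y i l * P N l j y) x.
  rewrite /P big_ord_recl; congr (_ + _); first by rewrite /u /= mxE.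
  transitivity (\sum_(k < N) T (fun y => \sum_l B y i l * u k l j y) x).
    by apply: eq_bigr => k _; rewrite lift0 neumann_termS.
  rewrite -T_sum; last by move=> k; apply: B_mul_bs => *; exact: neumann_term_bs.
  congr (T _ x); apply/funext => y; rewrite exchange_big /=.
  by apply: eq_bigr => l _; rewrite mulr_sumr.
set Z := RHS.
have diff N : cnorm (S i j x - Z) <= (4 * C + K * (n%:R * (beta * (4 * C)))) * half_pow N.
  have bSP l j' : bsmoothC (fun y => S l j' y - P N l j' y).
    apply: bsmoothC_D => //; rewrite (_ : (fun y => - _) = fun y => (-1) * P N l j' y).
      by apply: bsmoothC_M => //; exact: bsmoothC_cst.
    by apply/funext => y; rewrite mulN1r.
  have b1 := @B_mul_bs (fun l j y => S l j y - P N l j y) i j bSP.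
  have b2 := @B_mul_bs (P N) i j (bP N).
  have TB : Z - P N.+1 i j x = T (fun y => \sum_l B y i l * (S l j y - P N l j y)) x.
    rewrite PS /Z opprD addrACA subrr add0r.
    apply/eqP; rewrite subr_eq -T_D //.
    apply/eqP; congr (T _ x); apply/funext => y; rewrite -big_split /=.
    by apply: eq_bigr => l _; rewrite -mulrDr subrK.
  rewrite (_ : S i j x - Z = (S i j x - P N.+1 i j x) - (Z - P N.+1 i j x)); last by ring.
  apply: le_trans (cnormD _ _) _; rewrite cnormN mulrDl; apply: lerD.
    apply: le_trans (tail _ _ _ _) _; apply: ler_wpM2l; first by rewrite mulr_ge0.
    by rewrite /half_pow exprS ler_piMl ?exprn_ge0// invf_le1 ?ler1n.
  rewrite TB -!mulrA; apply: T_le => //.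
  move=> y; apply: le_trans (cnorm_sum _ _) _; apply: sum_le_const => l.
  apply: le_trans (cnormM _ _) _.
  apply: ler_pM; [exact: cnorm_ge0|exact: cnorm_ge0|exact: B_le|].
  by rewrite mulrA; exact: tail.
apply/eqP; rewrite -subr_eq0; apply/eqP; apply: cnorm_eq0.
move: (4 * C + _) diff => E diff.
have : (fun N => E * half_pow N) @ \oo --> (0 : R).
  have := @cvg_geometric R E 2^-1; rewrite /geometric; apply.
  by rewrite ger0_norm ?invr_ge0// invf_lt1 ?ltr1n.
move=> cE; rewrite -(cvg_lim _ cE) //; apply: limr_ge; first by apply/cvg_ex; exists 0.
by near=> N; exact: diff.
Unshelve. all: by end_near. Qed.

Lemma neumann_sum_near1 i j x : cnorm ((neumann_sum x - 1%:M) i j) <= 4 * q.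
Proof.
have [C C0 HC] := neumann_bound [::].
have q0 : 0 <= q by apply: le_trans q_ge; rewrite !mulr_ge0.
have := @csum_tail (fun k => u k i j x) (2 * q) C 1 (fun k => HC k i j x).
rewrite big_ord1 -neumann_sumE /half_pow expr1.
(* The tail from index 1 on, the term of index 0 being the identity. *)
rewrite (_ : 4 * (2 * q) * _ = 4 * q); last by field.
rewrite !mxE /S mxE /u /= mxE; apply; case=> // k _; exact: neumann_small.
Qed.

Hypothesis T_Z : forall z f x, bsmoothC f -> T (fun y => z * f y) x = z * T f x.
Variables (c d : 'I_4) (Z : set 'rV[R]_4).
Hypothesis T_local : forall f x, (forall y, Z y -> f y = 0) -> Z x -> T f x = 0.
Hypothesis B_hol : forall x i j, Z x ->
  pdC c (fun y => B y i j) x + 'i * pdC d (fun y => B y i j) x = 0.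

(** The operator d_c + i d_d passes through [T], which is complex linear, and annihilates the
    product B u on [Z] by induction; [T_local] then carries the vanishing on [Z] through [T]. *)
Lemma neumann_term_hol k i j x : Z x ->
  pdC c (u k i j) x + 'i * pdC d (u k i j) x = 0.
Proof.
elim: k i j x => [|k IH] i j x Zx.
  by rewrite /u /= !pdC_cst mulr0 addr0.
have bu := neumann_term_bs k.
have bBu := @B_mul_bs (u k) i j bu.
rewrite neumann_termS !T_pd // -T_Z; last exact: bsmoothC_pdC.
rewrite -T_D; last 2 first.
- exact: bsmoothC_pdC.
- by apply: bsmoothC_M; [exact: bsmoothC_cst|exact: bsmoothC_pdC].
apply: T_local => // y Zy.
have dBu l : diffC (fun y => B y i l * u k l j y) y.
  by apply: bsmoothC_diffC; exact: bsmoothC_M.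
rewrite !pdC_sum // mulr_sumr -big_split big1 //= => l _.
rewrite !pdC_M; try by apply: bsmoothC_diffC.
have := IH l j y Zy; have := B_hol i l Zy.
move: (pdC c (u k l j) y) (pdC d (u k l j) y) => p p'.
move: (pdC c _ y) (pdC d _ y) => r r' /eqP; rewrite addr_eq0 => /eqP ->.
by move=> /eqP; rewrite addr_eq0 => /eqP ->; ring.
Qed.

Lemma neumann_sum_hol i j x : Z x ->
  pdC c (S i j) x + 'i * pdC d (S i j) x = 0.
Proof.
move=> Zx; have [_ H] := neumann_sum_props i j.
have Hc : pdC c (S i j) x = csum (fun k => pdC c (u k i j) x) := H [:: c] x.
have Hd : pdC d (S i j) x = csum (fun k => pdC d (u k i j) x) := H [:: d] x.
rewrite Hc Hd.
have E k := neumann_term_hol k i j Zx.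
have Er k : complex.Re (pdC c (u k i j) x) = complex.Im (pdC d (u k i j) x).
  have := congr1 (@complex.Re R) (E k); rewrite Re_D Re_M.
  by case: (pdC d _ x) => p p' /= /eqP; rewrite mul0r mul1r sub0r subr_eq0 => /eqP.
have Ei k : complex.Im (pdC c (u k i j) x) = - complex.Re (pdC d (u k i j) x).
  have := congr1 (@complex.Im R) (E k); rewrite Im_D Im_M.
  case: (pdC d _ x) => p p' /= /eqP; rewrite mul0r mul1r add0r addr_eq0.
  by move=> /eqP.
have gd : geometric_bound (fun k => complex.Re (pdC d (u k i j) x)).
  have [C _ HC] := neumann_bound [:: d]; exists C => k.
  exact: le_trans (cnorm_Re _) (HC k i j x).
apply: complex_eq; rewrite /csum !(Re_D, Im_D, Re_M, Im_M) /=.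
  rewrite (_ : (fun k => complex.Re (pdC c _ x)) = fun k => complex.Im (pdC d (u k i j) x)).
    by rewrite mul0r mul1r sub0r subrr.
  by apply/funext => k; exact: Er.
rewrite (_ : (fun k => complex.Im (pdC c _ x)) = fun k => (-1) * complex.Re (pdC d (u k i j) x)).
  by rewrite rsumZ // mul0r mul1r add0r mulN1r addNr.
by apply/funext => k; rewrite mulN1r; exact: Ei.
Qed.

End Neumann.

(** * Bump functions and cut-offs *)

Section Bump.
Context {R : realType}.
Implicit Types (t : R) (k : nat) (x c : 'rV[R]_4) (U : set 'rV[R]_4).

(** Indexing exp(-1/t) by a power of 1/t gives a family whose linear span is stable under
    differentiation, so that smoothness follows by induction on the order. *)
Definition flat k t : R := if 0 < t then t^-1 ^+ k * expR (- t^-1) else 0.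

Lemma flat_ge0 k t : 0 <= flat k t.
Proof.
rewrite /flat; case: ifPn => // t0.
by rewrite mulr_ge0 ?expR_ge0// exprn_ge0// invr_ge0 ltW.
Qed.

(** From exp(y) >= y^(k+2) / (k+2)! at y = 1/t; the quadratic bound yields the zero derivative at
    the origin. *)
Lemma flat_le k t : flat k t <= (k.+2)`!%:R * t ^+ 2.
Proof.
rewrite /flat; case: ifPn => [t0|_]; last by rewrite mulr_ge0// sqr_ge0.
have s0 : 0 < t^-1 by rewrite invr_gt0.
have H := expR_ge1Dxn k.+1 (ltW s0).
have E0 : 0 < expR t^-1 by exact: expR_gt0.
rewrite expRN ler_pdivrMr//.
have f0 : (0 : R) < (k.+2)`!%:R by rewrite ltr0n fact_gt0.
have H2 : t^-1 ^+ k.+2 <= (k.+2)`!%:R * expR t^-1.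
  rewrite mulrC -ler_pdivrMr//; apply: le_trans H; by rewrite lerDr.
have -> : t^-1 ^+ k = t^-1 ^+ k.+2 * t ^+ 2.
  by rewrite -addn2 exprD -mulrA -exprMn mulVf ?expr1n ?mulr1// gt_eqF.
by rewrite [leRHS]mulrAC; apply: ler_wpM2r => //; exact: sqr_ge0.
Qed.

Lemma is_derive_flat k t :
  is_derive t 1 (flat k) (flat k.+2 t - k%:R * flat k.+1 t).
Proof.
have [t0|t0|t0] := ltgtP 0 t.
- rewrite /flat t0.
  apply: (@near_eq_is_derive _ _ _ (fun t => t^-1 ^+ k * expR (- t^-1))).
    near=> s; have -> // : 0 < s.
    by near: s; exact: lt_nbhsr.
  have t0' : t != 0 by rewrite gt_eqF.
  have dV : is_derive t 1 (fun s : R => s^-1) (- t ^- 2).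
    apply: DeriveDef; first exact: derivableV.
    by rewrite deriveV// derive_id [_ *: 1]mulr1.
  have dN : is_derive t 1 (fun s : R => - s^-1) (t ^- 2).
    by have := is_deriveN dV; rewrite opprK.
  have dE := @is_derive1_comp R expR (fun s => - s^-1) t _ _ (is_derive_expR _) dN.
  have dP : is_derive t 1 (fun s : R => s^-1 ^+ k) (- k%:R * t^-1 ^+ k.+1).
    case: k => [|m].
      rewrite oppr0 mul0r.
      have -> : (fun s : R => s^-1 ^+ 0) = cst 1 by apply/funext => s; rewrite expr0.
      exact: is_derive_cst.
    have := is_deriveX m.+1 dV; congr is_derive.
      by rewrite exprfctE.
    by rewrite /= -exprVn regular_scaleE !exprS; ring.
  have := is_deriveM dP dE; congr is_derive.
  by rewrite /= !regular_scaleE -exprVn !exprS /=; ring.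
- rewrite /flat ltNge (ltW t0) /= mulr0 subr0.
  apply: (@near_eq_is_derive _ _ _ (cst (0 : R))).
  near=> s; rewrite /= ltNge (_ : s <= 0) //.
  by apply: ltW; near: s; apply: open_nbhs_nbhs; split => //; exact: open_lt.
rewrite -t0 /flat ltxx mulr0 subr0.
have lim : (fun h => h^-1 *: (flat k (h *: 1 + 0) - flat k 0)) @ 0^' --> (0 : R).
  apply/cvgrPdist_le => e e0; near=> h.
  have h0 : h != 0 by near: h; exact: nbhs_dnbhs_neq.
  rewrite sub0r normrN addr0 [h *: 1]mulr1 /flat ltxx subr0 -/(flat k h).
  rewrite normrM normfV ler_pdivrMl ?normr_gt0// ger0_norm ?flat_ge0//.
  apply: le_trans (flat_le k h) _.
  rewrite -real_normK ?num_real// expr2 mulrA mulrC ler_wpM2l//.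
  rewrite mulrC -ler_pdivlMr ?ltr0n ?fact_gt0//; near: h.
  by apply: dnbhs0_le; rewrite divr_gt0// ltr0n fact_gt0.
by apply: DeriveDef; [apply/cvg_ex; exists 0|exact/cvg_lim].
Unshelve. all: by end_near. Qed.

Lemma smooth_flat k U (G : 'rV[R]_4 -> R) : open U -> smooth U G ->
  smooth U (fun x => flat k (G x)).
Proof.
move=> oU sG; apply/smoothP => m.
have dflat j t : differentiable (flat j : R -> R) t.
  by apply/derivable1_diffP; exact: (ex_derive (is_derive := is_derive_flat j t)).
have dfG j x : U x -> differentiable (fun x => flat j (G x)) x.
  move=> Ux; apply: (@differentiable_comp _ _ _ _ G (flat j)) => //.
  exact: smooth_differentiable sG Ux.
elim: m k => [|m IH] k; first by split => // x; exact: dfG.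
split; first by move=> x; exact: dfG.
move=> a; apply: (@Sm_eq _ _ _ (fun x =>
  (flat k.+2 (G x) + (- k%:R) * flat k.+1 (G x)) * pd a G x)) => //.
  move=> x Ux; have dG := smooth_differentiable sG Ux.
  have dk := dflat k (G x).
  rewrite /pd (deriveE _ (dfG k x Ux)) (deriveE _ dG).
  have -> := diff_comp dG dk.
  rewrite /= deriv1E; last by apply/derivable1_diffP.
  rewrite derive1E (derive_val (is_derive := is_derive_flat k (G x))).
  by rewrite regular_scaleE mulrC mulNr.
apply: SmM => //; last by have /smoothP := smooth_pd a sG; exact.
apply: SmD => //; apply: SmM => //; exact: Sm_cst.
Qed.

Definition step t : R := flat 0 t / (flat 0 t + flat 0 (1 - t)).

Lemma flat0_gt0 t : 0 < t -> 0 < flat 0 t.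
Proof. by move=> t0; rewrite /flat t0 expr0 mul1r expR_gt0. Qed.

Lemma step_den t : 0 < flat 0 t + flat 0 (1 - t).
Proof.
case: (ltP 0 t) => t0; first by rewrite ltr_wpDr ?flat_ge0 ?flat0_gt0.
by rewrite ltr_wpDl ?flat_ge0// flat0_gt0// subr_gt0 (le_lt_trans t0).
Qed.

Lemma step_eq0 t : t <= 0 -> step t = 0.
Proof. by move=> t0; rewrite /step {1}/flat ltNge t0 mul0r. Qed.

Lemma step_eq1 t : 1 <= t -> step t = 1.
Proof.
move=> t1; have t0 : 0 < t := lt_le_trans ltr01 t1.
rewrite /step [flat 0 (1 - t)]/flat ltNge subr_le0 t1 /= addr0 divff//.
by rewrite gt_eqF// flat0_gt0.
Qed.

Lemma step_ge0 t : 0 <= step t.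
Proof. by rewrite /step divr_ge0 ?flat_ge0// ltW// step_den. Qed.

Lemma step_le1 t : step t <= 1.
Proof. by rewrite /step ler_pdivrMr ?step_den// mul1r lerDl flat_ge0. Qed.

Lemma smooth_step U (G : 'rV[R]_4 -> R) : open U -> smooth U G ->
  smooth U (fun x => step (G x)).
Proof.
move=> oU sG; have s1 := smooth_flat 0 oU sG.
have s2 : smooth U (fun x => flat 0 (1 - G x)).
  apply: smooth_flat => //; apply: smoothD => //; first exact: smooth_cst.
  exact: smoothN.
apply: smoothMr => //; apply: smoothV => //; last exact: smoothD.
by move=> x _; rewrite gt_eqF// step_den.
Qed.

Variables (c : 'rV[R]_4) (e : R).
Hypothesis e0 : 0 < e.

(** The square avoids the corner of the absolute value; (4 - y^2)/3 is at least 1 for |y| <= 1 and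
    at most 0 for |y| >= 2. *)
Definition bump1 a x : R :=
  step ((4 - ((x ord0 a - c ord0 a) / e) * ((x ord0 a - c ord0 a) / e)) / 3).

Definition bump x : R := \prod_a bump1 a x.

Lemma bump1_eq1 a x : `|x ord0 a - c ord0 a| <= e -> bump1 a x = 1.
Proof.
move=> xe; apply: step_eq1; rewrite ler_pdivlMr// mul1r -expr2.
have : ((x ord0 a - c ord0 a) / e) ^+ 2 <= 1.
  rewrite -real_normK ?num_real// expr_le1// normrM normfV (gtr0_norm e0).
  by rewrite ler_pdivrMr// mul1r.
lra.
Qed.

Lemma bump1_eq0 a x : 2 * e <= `|x ord0 a - c ord0 a| -> bump1 a x = 0.
Proof.
move=> xe; apply: step_eq0; rewrite ler_pdivrMr// mul0r -expr2.
have : 2 ^+ 2 <= ((x ord0 a - c ord0 a) / e) ^+ 2.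
  rewrite -[leRHS]real_normK ?num_real// lerXn2r ?nnegrE// normrM normfV (gtr0_norm e0).
  by rewrite ler_pdivlMr.
lra.
Qed.

Lemma bump_eq0 a x : 2 * e <= `|x ord0 a - c ord0 a| -> bump x = 0.
Proof. by move=> xe; rewrite /bump (bigD1 a)//= bump1_eq0// mul0r. Qed.

Lemma bump_eq1 x : (forall a, `|x ord0 a - c ord0 a| <= e) -> bump x = 1.
Proof. by move=> xe; rewrite /bump big1// => a _; exact: bump1_eq1. Qed.

Lemma bump_ge0 x : 0 <= bump x.
Proof. by rewrite /bump prodr_ge0// => a _; exact: step_ge0. Qed.

Lemma bump_le1 x : bump x <= 1.
Proof.
by rewrite /bump prodr_ile1// => a _; rewrite step_ge0 step_le1.
Qed.

Lemma smooth_bump1 a : smooth setT (bump1 a).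
Proof.
have oT := @openT 'rV[R]_4.
have sl : smooth setT (fun x => (x ord0 a - c ord0 a) / e).
  apply: smoothMr => //; last exact: smooth_cst.
  by apply: smoothD => //; [exact: smooth_coord|exact: smooth_cst].
apply: smooth_step => //; apply: smoothMr => //; last exact: smooth_cst.
apply: smoothD => //; first exact: smooth_cst.
by apply: smoothN => //; exact: smoothMr.
Qed.

Lemma smooth_prod (I : Type) (r : seq I) U (F : I -> 'rV[R]_4 -> R) : open U ->
  (forall i, smooth U (F i)) -> smooth U (fun x => \prod_(i <- r) F i x).
Proof.
move=> oU HF; elim: r => [|i r IH].
  by under eq_fun do rewrite big_nil; exact: smooth_cst.
by under eq_fun do rewrite big_cons; exact: smoothMr.
Qed.

Lemma smooth_bump : smooth setT bump.
Proof. by apply: smooth_prod; [exact: openT|exact: smooth_bump1]. Qed.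

Lemma pd_eq0 (f : 'rV[R]_4 -> R) a x (d : R) : 0 < d ->
  (forall t, `|t| < d -> f (t *: delta_mx ord0 a + x) = f x) -> pd a f x = 0.
Proof.
move=> d0 fx; rewrite /pd /derive.
have lim : (fun h => h^-1 *: ((f \o shift x) (h *: delta_mx ord0 a) - f x)) @ 0^'
    --> (0 : R).
  apply/cvgrPdist_le => r r0; near=> h.
  rewrite /= fx ?subrr ?scaler0 ?subrr ?normr0 ?ltW//.
  by near: h; apply: dnbhs0_lt.
exact/cvg_lim.
Unshelve. all: by end_near. Qed.

(** Only the coordinate [a] is constrained: the factor depending on it is locally constant and the
    others do not see it. This is the reason for a product cut-off, which keeps holomorphy in a pair
    of coordinates over a whole slab. *)
Lemma pd_bump_eq0 a x : `|x ord0 a - c ord0 a| < e -> pd a bump x = 0.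
Proof.
move=> xe; apply: (@pd_eq0 _ _ _ (e - `|x ord0 a - c ord0 a|)).
  by rewrite subr_gt0.
move=> t tl; rewrite /bump; apply: eq_bigr => b _.
have [->|ba] := eqVneq b a; last first.
  by rewrite /bump1 !mxE (negPf ba) andbF mulr0 add0r.
rewrite !bump1_eq1 ?(ltW xe)//.
rewrite !mxE !eqxx mulr1 -addrA; apply: ltW; apply: le_lt_trans (ler_normD _ _) _.
by rewrite -ltrBrDr.
Qed.

End Bump.

Section Cutoff.
Context {R : realType}.
Implicit Types (U W : set 'rV[R]_4) (x c : 'rV[R]_4).

Definition box c (e : R) : set 'rV[R]_4 := [set x | forall a, `|x ord0 a - c ord0 a| < e].

Lemma continuous_dist c (a : 'I_4) :
  continuous (fun x : 'rV[R]_4 => `|x ord0 a - c ord0 a|).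
Proof.
move=> x; apply: (@continuous_comp _ _ _ (fun x : 'rV[R]_4 => x ord0 a - c ord0 a) Num.norm).
  by apply: continuousB; [exact: coord_continuous|exact: cst_continuous].
exact: norm_continuous.
Qed.

Lemma open_box c e : open (box c e).
Proof.
rewrite openE => x bx.
pose P (a : 'I_4) (y : 'rV[R]_4) := `|y ord0 a - c ord0 a| < e.
suff H : \forall y \near x, forall a, P a y by exact: H.
apply: (@filter_forall _ _ P (nbhs x) (nbhs_filter x)) => a.
have o : open ((fun x : 'rV[R]_4 => `|x ord0 a - c ord0 a|) @^-1` [set t | t < e]).
  by apply: open_comp; [move=> y _; exact: continuous_dist|exact: open_lt].
exact: (open_nbhs_nbhs (conj o (bx a))).
Qed.

Lemma box_norm c e d x : (forall a, `|x ord0 a - c ord0 a| <= e) -> 0 <= e ->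
  e < d -> `|x - c| < d.
Proof.
move=> xe e0 ed; apply: le_lt_trans ed.
rewrite [leLHS]/Num.norm /= mx_normrE; apply: bigmax_le => // -[i a] _ /=.
by rewrite ord1 !mxE.
Qed.

Lemma foldr_pd_zero U (f : 'rV[R]_4 -> R) s x : open U ->
  (forall x, U x -> f x = 0) -> U x -> foldr pd f s x = 0.
Proof.
move=> oU f0; elim: s x => [|a s IH] x Ux /=; first exact: f0.
have -> : pd a (foldr pd f s) x = pd a (fun=> 0) x.
  by apply: near_pd; exact: open_near oU Ux IH.
exact: pd_cst.
Qed.

Variables (c : 'rV[R]_4) (e : R).
Hypothesis e0 : 0 < e.

Let far a := [set x : 'rV[R]_4 | 2 * e < `|x ord0 a - c ord0 a|].

Lemma open_far a : open (far a).
Proof.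
apply: (@open_comp _ _ (fun x : 'rV[R]_4 => `|x ord0 a - c ord0 a|)
  [set t | 2 * e < t]); last exact: open_gt.
by move=> x _; exact: continuous_dist.
Qed.

(** The product is smooth on [W] and zero on the open sets [far a], and these cover the space,
    whatever values [f] takes outside [W]. *)
Lemma cutoff_bsmooth W (f : 'rV[R]_4 -> R) : open W -> smooth W f ->
  (forall x, (forall a, `|x ord0 a - c ord0 a| <= 2 * e) -> W x) ->
  bsmooth (fun x => bump c e x * f x).
Proof.
move=> oW sf boxW; set F := fun x => _.
have F0 a x : far a x -> F x = 0.
  by move=> ax; rewrite /F (@bump_eq0 _ c e e0 a) ?mul0r// ltW.
have sWF : smooth W F.
  by apply: smoothMr => //; apply: (@smoothS _ setT) => //; exact: smooth_bump.
have cover x : W x \/ exists a, far a x.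
  have [Wx|nWx] := pselect (W x); [by left|right].
  apply: contrapT => nfar; apply: nWx; apply: boxW => a.
  by rewrite leNgt; apply/negP => ax; apply: nfar; exists a.
have sF : smooth setT F.
  move=> s x _; case: (cover x) => [|[a ax]]; first exact: sWF.
  have : smooth (far a) F.
    apply: (@smooth_eq _ _ (fun=> 0)); first exact: open_far.
      by move=> y /F0 ->.
    exact: smooth_cst.
  exact.
split => // s.
(* Derivatives are bounded on this compact cube by the extreme value theorem, and vanish off it. *)
pose K := [set v : 'rV[R]_4 | forall a, `[c ord0 a - 2 * e, c ord0 a + 2 * e]%classic (v ord0 a)].
have cK : compact K.
  by apply: (@rV_compact _ _ (fun a => `[c ord0 a - 2 * e, c ord0 a + 2 * e]%classic)) => a;
    exact: segment_compact.
have KP (v : 'rV[R]_4) : (forall a, `|v ord0 a - c ord0 a| <= 2 * e) -> K v.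
  by move=> H a; rewrite /= in_itv /= -ler_distl; exact: H.
have Kc : K c by apply: KP => a; rewrite subrr normr0 mulr_ge0// ltW.
have [|||m Km Hm] := @EVT_max_rV _ _ (fun x => `|foldr pd F s x|) K.
- by exists c.
- exact: cK.
- apply: continuous_subspaceT => x.
  apply: (@continuous_comp _ _ _ (foldr pd F s) Num.norm); last exact: norm_continuous.
  apply: differentiable_continuous; exact: sF.
exists (`|foldr pd F s m|) => x.
have [Kx|nKx] := pselect (K x); first by apply: Hm; rewrite inE.
have [a ax] : exists a, far a x.
  apply: contrapT => nfar; apply: nKx; apply: KP => a.
  by rewrite leNgt; apply/negP => ax; apply: nfar; exists a.
by rewrite (@foldr_pd_zero (far a)) ?normr0//; [exact: open_far|exact: F0].
Qed.

Lemma cutoff_bsmoothC W (f : 'rV[R]_4 -> R[i]) : open W -> smoothC W f ->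
  (forall x, (forall a, `|x ord0 a - c ord0 a| <= 2 * e) -> W x) ->
  bsmoothC (fun x => (bump c e x)%:C * f x).
Proof.
move=> oW [sr si] boxW; split.
  rewrite (_ : (fun x => _) = fun x => bump c e x * complex.Re (f x)).
    exact: cutoff_bsmooth oW sr boxW.
  by apply/funext => x; rewrite Re_M /= mul0r subr0.
rewrite (_ : (fun x => _) = fun x => bump c e x * complex.Im (f x)).
  exact: cutoff_bsmooth oW si boxW.
by apply/funext => x; rewrite Im_M /= mul0r addr0.
Qed.

End Cutoff.

(** * The dbar equation on a box and the Koszul-Malgrange system *)

Section ComplexDirections.
Context {R : realType}.
Implicit Types (U : set 'rV[R]_4) (x : 'rV[R]_4) (a b : 'I_4).

(** Twice the derivative with respect to the conjugate of x^a + i x^b. *)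
Definition pdMi m n a b (F : 'rV[R]_4 -> 'M[R[i]]_(m, n)) x : 'M[R[i]]_(m, n) :=
  pdM a F x + 'i *: pdM b F x.

Lemma pdMi_mul m n p a b (F : 'rV[R]_4 -> 'M[R[i]]_(m, n))
    (G : 'rV[R]_4 -> 'M[R[i]]_(n, p)) x : diffM F x -> diffM G x ->
  pdMi a b (fun y => F y *m G y) x = pdMi a b F x *m G x + F x *m pdMi a b G x.
Proof.
move=> dF dG; rewrite /pdMi !pdM_mul // mulmxDl mulmxDr scalerDr.
by rewrite -scalemxAl -scalemxAr addrACA.
Qed.

Lemma pdMi_D m n a b (F G : 'rV[R]_4 -> 'M[R[i]]_(m, n)) x : diffM F x -> diffM G x ->
  pdMi a b (fun y => F y + G y) x = pdMi a b F x + pdMi a b G x.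
Proof. by move=> dF dG; rewrite /pdMi !pdM_D // scalerDr addrACA. Qed.

Lemma pdMi_scale m n a b (z : R[i]) (F : 'rV[R]_4 -> 'M[R[i]]_(m, n)) x :
  diffM F x -> pdMi a b (fun y => z *: F y) x = z *: pdMi a b F x.
Proof.
move=> dF.
have E d : pdM d (fun y => z *: F y) x = z *: pdM d F x.
  by rewrite (pdM_scale d (diffC_cst z x) dF) pdC_cst scale0r add0r.
by rewrite /pdMi (E a) (E b) scalerDr !scalerA mulrC.
Qed.

Lemma pdMi_eq U m n a b (F G : 'rV[R]_4 -> 'M[R[i]]_(m, n)) x : open U -> U x ->
  (forall y, U y -> F y = G y) -> pdMi a b F x = pdMi a b G x.
Proof.
by move=> oU Ux FG; rewrite /pdMi !(@pdM_eq _ U _ _ F G _ x).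
Qed.

Lemma smoothM_pdMi U m n a b (F : 'rV[R]_4 -> 'M[R[i]]_(m, n)) : open U ->
  smoothM U F -> smoothM U (pdMi a b F).
Proof.
move=> oU sF; apply: smoothM_D => //; first exact: smoothM_pdM.
apply: smoothM_scale => //; first exact: smoothC_cst.
exact: smoothM_pdM.
Qed.

Lemma pdM_pdMi U m n a b d (F : 'rV[R]_4 -> 'M[R[i]]_(m, n)) x : open U ->
  smoothM U F -> U x ->
  pdM d (pdMi a b F) x = pdM d (pdM a F) x + 'i *: pdM d (pdM b F) x.
Proof.
move=> oU sF Ux; have dF k := smoothM_diffM (smoothM_pdM k sF) Ux.
have dc : diffC (fun=> 'i : R[i]) x by exact: diffC_cst.
rewrite /pdMi pdM_D //; last exact: diffM_scale.
by rewrite pdM_scale // pdC_cst scale0r add0r.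
Qed.

Lemma pdMi_comm U m n a b d e (F : 'rV[R]_4 -> 'M[R[i]]_(m, n)) x : open U ->
  smoothM U F -> U x -> pdMi a b (pdMi d e F) x = pdMi d e (pdMi a b F) x.
Proof.
move=> oU sF Ux; rewrite {1 3}/pdMi !(pdM_pdMi _ _ _ oU sF Ux).
have alg (V : lmodType R[i]) (G : 'I_4 -> 'I_4 -> V) : (forall i j, G i j = G j i) ->
    (G a d + 'i *: G a e) + 'i *: (G b d + 'i *: G b e) =
    (G d a + 'i *: G d b) + 'i *: (G e a + 'i *: G e b).
  move=> C; rewrite (C d a) (C d b) (C e a) (C e b) !scalerDr !addrA.
  by congr (_ + _); rewrite addrAC.
exact: (alg _ (fun i j => pdM i (pdM j F) x) (fun i j => pdM_comm i j oU sF Ux)).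
Qed.

Lemma pdMi_inv U n a b (F : 'rV[R]_4 -> 'M[R[i]]_n) x : open U ->
  smoothM U F -> (forall x, U x -> F x \in unitmx) -> U x ->
  pdMi a b (fun x => invmx (F x)) x =
    - (invmx (F x) *m pdMi a b F x *m invmx (F x)).
Proof.
move=> oU sF uF Ux; rewrite /pdMi !(pdM_inv _ oU sF uF Ux).
by rewrite mulmxDr mulmxDl opprD scalerN -scalemxAr -scalemxAl.
Qed.

(** A row vector [v] in the left kernel equals -v (h - 1); comparing entries of largest norm forces
    that norm to be zero. *)
Lemma unitmx_near1 n (h : 'M[R[i]]_n) (eta : R) : n%:R * eta < 1 ->
  (forall i j, cnorm ((h - 1%:M) i j) <= eta) -> h \in unitmx.
Proof.
move=> neta Hh; rewrite -row_free_unit -kermx_eq0; apply/eqP/row_matrixP => l.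
rewrite row0; set v := row l _.
have vh : v *m h = 0.
  by apply/eqP; rewrite -sub_kermx row_sub.
clearbody v.
have E : v = - (v *m (h - 1%:M)) by rewrite mulmxBr vh mulmx1 sub0r opprK.
have [n0|n0] := posnP n.
  by apply/rowP => j; have := ltn_ord j; rewrite [X in (_ < X)%N]n0.
have [j _ Hj] : exists2 j : 'I_n, true & forall k, cnorm (v ord0 k) <= cnorm (v ord0 j).
  case: (arg_maxP (fun k => cnorm (v ord0 k)) (isT : xpredT (Ordinal n0))) => j _ Hj.
  by exists j => // k; exact: Hj.
have : cnorm (v ord0 j) <= n%:R * eta * cnorm (v ord0 j).
  rewrite {1}E !mxE cnormN; apply: le_trans (cnorm_sum _ _) _.
  rewrite -mulrA; apply: sum_le_const => k.
  apply: le_trans (cnormM _ _) _; rewrite [leLHS]mulrC.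
  apply: ler_pM; [exact: cnorm_ge0|exact: cnorm_ge0| |exact: Hj].
  by have := Hh k j; rewrite !mxE.
rewrite -subr_ge0 -{2}[cnorm _]mul1r -mulrBl nmulr_rge0 ?subr_lt0// => vj0.
by apply/rowP => k; rewrite mxE; apply: cnorm_eq0; exact: le_trans (Hj k) vj0.
Qed.

End ComplexDirections.

Section KoszulMalgrange.
Context {R : realType}.
Implicit Types (U W : set 'rV[R]_4) (x c : 'rV[R]_4) (a b : 'I_4).

Lemma smoothC_continuous W (f : 'rV[R]_4 -> R[i]) c : open W -> W c ->
  smoothC W f -> \forall x \near c, cnorm (f x) <= cnorm (f c) + 2.
Proof.
move=> oW Wc [sr si].
have H (g : 'rV[R]_4 -> R) : smooth W g -> \forall x \near c, `|g c - g x| <= 1.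
  move=> sg; have cg : {for c, continuous g}.
    by apply: differentiable_continuous; exact: smooth_differentiable sg Wc.
  by move/cvgrPdist_le : cg => /(_ 1 ltr01).
near=> x; rewrite /cnorm.
have h1 : `|complex.Re (f c) - complex.Re (f x)| <= 1.
  by near: x; exact: (H (fun x => complex.Re (f x))).
have h2 : `|complex.Im (f c) - complex.Im (f x)| <= 1.
  by near: x; exact: (H (fun x => complex.Im (f x))).
have D (u v : R) : `|u - v| <= 1 -> `|v| <= `|u| + 1.
  move=> uv; rewrite -[v](subrK u); apply: le_trans (ler_normD _ _) _.
  by rewrite addrC lerD2l distrC.
have := D _ _ h1; have := D _ _ h2; lra.
Unshelve. all: by end_near. Qed.

(** Cosine and sine cannot both be smaller than 1/2 in absolute value, as their squares would add up
    to less than 1. *)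
Lemma circle_far a b r (t : R) : a != b -> 0 < r ->
  r / 2 <= `|circle a b r t ord0 a| \/ r / 2 <= `|circle a b r t ord0 b|.
Proof.
move=> ab r0; have ba : (b == a) = false by rewrite eq_sym (negPf ab).
rewrite /circle !mxE !eqxx (negPf ab) ba /= !mulr0 !mulr1 addr0 add0r.
rewrite !normrM !normrN (gtr0_norm r0) ![r / 2]mulrC ![r * _]mulrC !ler_pM2r//.
case: (leP 2^-1 `|ccos t|) => [|h1]; [by left|right].
rewrite leNgt; apply/negP => h2.
have := cos2Dsin2 (2 * pi * t); rewrite -/(ccos t) -/(csin t).
rewrite -[ccos t ^+ 2]real_normK ?num_real// -[csin t ^+ 2]real_normK ?num_real//.
move=> E.
have S (u : R) : 0 <= u -> u < 2^-1 -> u ^+ 2 < 2^-1.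
  by move=> u0 uh; nra.
have := S _ (normr_ge0 _) h1; have := S _ (normr_ge0 _) h2.
by move: E; lra.
Qed.

(** The factors are the number of summands in a matrix product, the norm 8r of the Cauchy transform
    for r = 8e, and the bound M/2 on half the coefficient. *)
Lemma small_radius (n : nat) (M d : R) : 0 <= M -> 0 < d -> exists e : R,
  [/\ 0 < e, 2 * e < d & n%:R * (8 * (8 * e)) * (M / 2) <= (8 * n.+1%:R)^-1].
Proof.
move=> M0 d0; set q : R := (8 * n.+1%:R)^-1.
have q0 : 0 < q by rewrite invr_gt0 mulr_gt0.
pose D := 32 * n%:R * M + 1.
have D0 : 0 < D by rewrite ltr_wpDl// !mulr_ge0.
exists (Num.min (d / 4) (q / D)); split.
- by rewrite lt_min !divr_gt0.
- have : Num.min (d / 4) (q / D) <= d / 4 by rewrite ge_min lexx.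
  lra.
- set e := Num.min _ _.
  have e0 : 0 < e by rewrite lt_min !divr_gt0.
  have : e <= q / D by rewrite ge_min lexx orbT.
  rewrite ler_pdivlMr// => eD; apply: le_trans eD.
  rewrite (_ : _ * _ * _ = e * (32 * n%:R * M)); last by field.
  by apply: ler_wpM2l; [exact: ltW|rewrite /D lerDl].
Qed.

(** The solution is the Neumann series of the Cauchy transform composed with half the cut-off
    coefficient. The last clause is the dependence on parameters needed for systems: holomorphy of
    [Q] in a complementary pair of coordinates is inherited by [h]. *)
Lemma dbar_solve n W c (Q : 'rV[R]_4 -> 'M[R[i]]_n) a b : a != b ->
  open W -> W c -> smoothM W Q ->
  exists2 e : R, 0 < e & exists h : 'rV[R]_4 -> 'M[R[i]]_n,
  [/\ forall x, box c e x -> W x, smoothM setT h, forall x, h x \in unitmx,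
      forall x, box c e x -> pdMi a b h x = Q x *m h x &
      forall p d, p != a -> p != b -> d != a -> d != b ->
        (forall x, W x -> pdMi p d Q x = 0) ->
        forall x, box c e x -> pdMi p d h x = 0].
Proof.
move=> ab oW Wc sQ.
pose M := \sum_(ij : 'I_n * 'I_n) (cnorm (Q c ij.1 ij.2) + 2).
have M0 : 0 <= M by apply: sumr_ge0 => ij _; rewrite addr_ge0 ?cnorm_ge0.
have nearM : \forall x \near c, forall ij : 'I_n * 'I_n, cnorm (Q x ij.1 ij.2) <= M.
  pose P (ij : 'I_n * 'I_n) x := cnorm (Q x ij.1 ij.2) <= M.
  apply: (@filter_forall _ _ P (nbhs c) (nbhs_filter c)) => ij.
  have := smoothC_continuous oW Wc (sQ ij.1 ij.2); apply: filterS => x H.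
  apply: le_trans H _; rewrite /M (bigD1 ij)//= lerDl.
  by apply: sumr_ge0 => k _; rewrite addr_ge0 ?cnorm_ge0.
have nearW : \forall x \near c, W x by exact: (open_nbhs_nbhs (conj oW Wc)).
have [d d0 Hd] : exists2 d : R, 0 < d & forall x, `|x - c| < d ->
    W x /\ forall ij : 'I_n * 'I_n, cnorm (Q x ij.1 ij.2) <= M.
  have N : nbhs c (fun x => W x /\ forall ij : 'I_n * 'I_n, cnorm (Q x ij.1 ij.2) <= M).
    exact: filterI nearW nearM.
  have /nbhs_ballP[d d0 Hd] := N; exists d => // x xd.
  by apply: Hd; rewrite -ball_normE /= distrC.
have [e [e0 ed qe]] := small_radius n M0 d0.
set q := (8 * n.+1%:R)^-1 in qe.
have q0 : 0 < q by rewrite invr_gt0 mulr_gt0.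
have box2 x : (forall k, `|x ord0 k - c ord0 k| <= 2 * e) -> `|x - c| < d.
  by move=> H; apply: box_norm H _ ed; rewrite mulr_ge0// ltW.
have box2W x : (forall k, `|x ord0 k - c ord0 k| <= 2 * e) -> W x.
  by move=> /box2 /Hd[].
(* The factor 1/2 compensates the 2 of [cauchy_dbar]. *)
pose B x : 'M[R[i]]_n := (2^-1 * (bump c e x)%:C) *: Q x.
have BE i j : (fun x => B x i j) = fun x => (2^-1 : R[i]) * ((bump c e x)%:C * Q x i j).
  by apply/funext => x; rewrite mxE mulrA.
have B_bs i j : bsmoothC (fun x => B x i j).
  rewrite BE; apply: bsmoothC_M; first exact: bsmoothC_cst.
  exact: (cutoff_bsmoothC e0 oW (sQ i j) box2W).
have cn (u : R) z : 0 <= u -> cnorm (u%:C * z) = u * cnorm z.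
  by move=> u0; rewrite /cnorm Re_M Im_M /= !mul0r subr0 addr0 !normrM ger0_norm// mulrDr.
have half : (2^-1 : R[i]) = (2^-1 : R)%:C.
  by rewrite fmorphV rmorph_nat.
have B_le x i j : cnorm (B x i j) <= M / 2.
  rewrite -[B x i j]/((fun y => B y i j) x) BE half !cn ?bump_ge0// mulrC.
  apply: ler_wpM2r => //.
  have [far|near] := pselect (exists k, 2 * e < `|x ord0 k - c ord0 k|).
    by case: far => k /ltW /(bump_eq0 e0) ->; rewrite mul0r.
  have xd : `|x - c| < d.
    apply: box2 => k; rewrite leNgt; apply/negP => ?; apply: near; by exists k.
  rewrite -[M]mul1r; apply: ler_pM; [exact: bump_ge0|exact: cnorm_ge0| |].
    exact: bump_le1.
  exact: ((Hd x xd).2 (i, j)).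
(* Radius 8e: from a point of the box of half-side e, some coordinate moves by at least 4e along the
   circle, hence ends at distance at least 3e from the centre, outside the support of the
   cut-off. *)
have r0 : 0 < 8 * e by rewrite mulr_gt0.
pose T := cauchy a b (8 * e).
have T_bs f : bsmoothC f -> bsmoothC (T f) by exact: cauchy_bsmooth.
have T_pd f k : bsmoothC f -> pdC k (T f) = T (pdC k f) by exact: pdC_cauchy.
have T_D f g x : bsmoothC f -> bsmoothC g ->
  T (fun y => f y + g y) x = T f x + T g x by exact: cauchyD.
have T_le f C x : bsmoothC f -> (forall y, cnorm (f y) <= C) ->
  cnorm (T f x) <= 8 * (8 * e) * C by exact: cauchy_le.
have K0 : 0 <= 8 * (8 * e) by rewrite !mulr_ge0// ltW.
have b0 : 0 <= M / 2 by rewrite divr_ge0.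
have q4 : q <= 4^-1.
  rewrite /q lef_pV2 ?posrE ?mulr_gt0// -[leLHS]mulr1.
  by apply: ler_pM => //; rewrite ?ler_nat// ler1n.
have bE x : box c e x -> bump c e x = 1.
  by move=> bx; apply: bump_eq1 => // k; exact: ltW.
pose h := neumann_sum T B.
have NP := neumann_sum_props T_bs T_pd T_le K0 B_bs B_le qe q4.
have hbs i j : bsmoothC (fun x => h x i j) by have [] := NP i j.
exists e => //; exists h; split.
- by move=> x bx; apply: box2W => k; apply: le_trans (ltW (bx k)) _; rewrite ler_peMl ?ler1n// ltW.
- by move=> i j; apply: bsmoothC_smoothC.
(* With q = 1 / (8 (n + 1)), n times 4q is n / (2 (n + 1)) < 1. *)
- move=> x; apply: (@unitmx_near1 _ _ _ (4 * q)); last first.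
    move=> i j; exact: (neumann_sum_near1 T_bs T_pd T_le K0 b0 B_bs B_le qe q4).
  have nn : (n%:R : R) < n.+1%:R by rewrite ltr_nat.
  have n0 := ler0n R n; rewrite /q.
  move: (n.+1%:R : R) nn => m nm; have m0 : 0 < m by exact: le_lt_trans nm.
  rewrite (_ : _ * _ = n%:R / (2 * m)); last by field; rewrite gt_eqF.
  by rewrite ltr_pdivrMr ?mulr_gt0//; lra.
- move=> x bx; apply/matrixP => i j.
  have fix_h : (fun x => h x i j) =
      fun x => (i == j)%:R + T (fun y => \sum_l B y i l * h y l j) x.
    apply/funext => y.
    exact: (neumann_fixpoint T_bs T_pd T_D T_le K0 B_bs B_le qe q4).
  set f := fun y => \sum_l B y i l * h y l j in fix_h.
  have bf : bsmoothC f by apply: bsmoothC_sum => l; exact: bsmoothC_M.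
  have dT : diffC (T f) x by apply: bsmoothC_diffC; exact: T_bs.
  have E m : pdC m (fun x => h x i j) x = pdC m (T f) x.
    rewrite fix_h (pdC_D m (diffC_cst _ x) dT) (pdC_cst _ x m).
    exact: add0r.
  have f0 t : f (x + circle a b (8 * e) t) = 0.
    rewrite /f big1// => l _.
    suff B0 : bump c e (x + circle a b (8 * e) t) = 0.
      by rewrite mxE B0 mulr0 mul0r mul0r.
    have [ha|hb] := circle_far t ab r0.
    + apply: (bump_eq0 e0 (a := a)); rewrite mxE addrAC.
      have := bx a; have := lerB_normD (circle a b (8 * e) t ord0 a) (x ord0 a - c ord0 a).
      by rewrite [circle _ _ _ _ _ _ + _]addrC; lra.
    + apply: (bump_eq0 e0 (a := b)); rewrite mxE addrAC.
      have := bx b; have := lerB_normD (circle a b (8 * e) t ord0 b) (x ord0 b - c ord0 b).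
      by rewrite [circle _ _ _ _ _ _ + _]addrC; lra.
  have main : (pdMi a b h x) i j = 2 * f x.
    rewrite -(cauchy_dbar r0 bf f0) -/T -(E a) -(E b).
    by rewrite mxE mxE; congr (_ + _); rewrite !mxE.
  rewrite main.
  rewrite /f mxE mulr_sumr; apply: eq_bigr => l _.
  by rewrite /B mxE bE// mulr1 !mulrA divff ?mul1r// pnatr_eq0.
- move=> p d' pa pb da db hol x bx; apply/matrixP => i j.
  (* A slab unbounded in the directions [a] and [b], hence stable under the displacements used by
     the Cauchy transform. *)
  pose Z := [set y : 'rV[R]_4 | `|y ord0 p - c ord0 p| < e /\ `|y ord0 d' - c ord0 d'| < e].
  have ZT y s t : Z y -> Z (y + s *: circle a b (8 * e) t).
    move=> [zp zd]; rewrite /Z /= /circle !mxE (negPf pa) (negPf pb) (negPf da) (negPf db).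
    by rewrite !andbF !mulr0 addr0 mulr0 !addr0.
  have T_Z z f y : bsmoothC f -> T (fun y => z * f y) y = z * T f y by exact: cauchyZ.
  have T_local f y : (forall y, Z y -> f y = 0) -> Z y -> T f y = 0.
    by move=> f0 Zy; exact: (cauchy_local ZT f0 Zy).
  have Zx : Z x by split; exact: bx.
  have sb : smoothC setT (fun x => (bump c e x)%:C).
    exact/smoothC_real/smooth_bump.
  have B_hol y i' j' : Z y ->
      pdC p (fun y => B y i' j') y + 'i * pdC d' (fun y => B y i' j') y = 0.
    move=> [zp zd].
    (* Where [Q] is not controlled, [B] vanishes in a neighbourhood; elsewhere the cut-off has zero
       derivative in the directions [p] and [d'], so only the derivatives of [Q] remain. *)
    have [far|near] := pselect (exists k, 2 * e < `|y ord0 k - c ord0 k|).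
      case: far => k yk.
      have oF := @open_far _ c e k.
      have E m : pdC m (fun y => B y i' j') y = 0.
        rewrite (@pdC_eq _ _ m _ (fun=> 0) y oF yk) ?pdC_cst// => u /ltW uk.
        by rewrite mxE (bump_eq0 e0 uk) mulr0 mul0r.
      by rewrite !E mulr0 addr0.
    have Wy : W y.
      apply: box2W => k; rewrite leNgt; apply/negP => ?; apply: near; by exists k.
    have dQ : diffC (fun y => Q y i' j') y := smoothC_diffC (sQ i' j') Wy.
    have db' : diffC (fun y => (bump c e y)%:C) y by exact: smoothC_diffC sb _.
    have E m : `|y ord0 m - c ord0 m| < e -> pdC m (fun y => B y i' j') y =
        2^-1 * ((bump c e y)%:C * pdC m (fun y => Q y i' j') y).
      move=> ym; rewrite BE (pdC_M m (diffC_cst _ y) (diffC_M db' dQ)).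
      by rewrite pdC_cst mul0r add0r (pdC_M m db' dQ) pdC_real (pd_bump_eq0 e0 ym) mul0r add0r.
    have H : pdC p (fun y => Q y i' j') y + 'i * pdC d' (fun y => Q y i' j') y = 0.
      have := congr1 (fun A : 'M[R[i]]_n => A i' j') (hol y Wy).
      by rewrite /pdMi !mxE.
    rewrite (E p zp) (E d' zd); move: H.
    move: (pdC p _ y) (pdC d' _ y) ((bump c e y)%:C) => u v w H.
    transitivity (2^-1 * (w * (u + 'i * v))); first by ring.
    by rewrite H !mulr0.
  rewrite /pdMi !mxE.
  exact: (neumann_sum_hol T_bs T_pd T_D T_le K0 B_bs B_le qe q4 T_Z T_local B_hol).
Qed.

End KoszulMalgrange.

Section KoszulMalgrangeSystem.
Context {R : realType}.
Implicit Types (U W : set 'rV[R]_4) (x c : 'rV[R]_4) (a b : 'I_4).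

(** Let D1 and D2 be the two operators and k an invertible solution of D1 k = P k. A solution k m of
    both equations needs D2 m = S m with S = k^-1 (Q k - D2 k). Compatibility gives D1 S = 0, so m
    can be chosen with D1 m = 0, and then D1 (k m) = P k m survives. *)
Lemma koszul_malgrange n W c (P Q : 'rV[R]_4 -> 'M[R[i]]_n) a b d e :
  a != b -> d != e -> a != d -> a != e -> b != d -> b != e ->
  open W -> W c -> smoothM W P -> smoothM W Q ->
  (forall x, W x -> pdMi a b Q x + Q x *m P x = pdMi d e P x + P x *m Q x) ->
  exists V, [/\ open V, V c, V `<=` W & exists h : 'rV[R]_4 -> 'M[R[i]]_n,
    [/\ smoothM V h, forall x, V x -> h x \in unitmx,
        forall x, V x -> pdMi a b h x = P x *m h x &
        forall x, V x -> pdMi d e h x = Q x *m h x]].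
Proof.
move=> ab de ad ae bd be oW Wc sP sQ comp.
have [r1 r10 [k [b1W sk uk Dk _]]] := dbar_solve ab oW Wc sP.
set V1 := box c r1 in b1W Dk.
have oV1 : open V1 by exact: open_box.
have V1c : V1 c by move=> i; rewrite subrr normr0.
have sk1 : smoothM V1 k by apply: smoothMS sk => // x.
have sQ1 : smoothM V1 Q := smoothMS b1W sQ.
have sP1 : smoothM V1 P := smoothMS b1W sP.
have uk1 x : V1 x -> k x \in unitmx by [].
pose kd := pdMi d e k.
have skd : smoothM V1 kd by exact: smoothM_pdMi.
pose G x := Q x *m k x + (-1) *: kd x.
have sG : smoothM V1 G.
  apply: smoothM_D => //; first exact: smoothM_mul.
  by apply: smoothM_scale => //; exact: smoothC_cst.
have sI : smoothM V1 (fun x => invmx (k x)) by exact: smoothM_inv.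
pose S x := invmx (k x) *m G x.
have sS : smoothM V1 S by exact: smoothM_mul.
have DS x : V1 x -> pdMi a b S x = 0.
  move=> Vx; have dm m p (F : 'rV[R]_4 -> 'M[R[i]]_(m, p)) := @smoothM_diffM _ V1 m p F x.
  rewrite pdMi_mul; [|exact: dm sI Vx|exact: dm sG Vx].
  rewrite (pdMi_inv a b oV1 sk1 uk1 Vx) Dk // mulmxA.
  rewrite -[invmx (k x) *m P x *m k x *m invmx (k x)]mulmxA mulmxV ?uk// mulmx1.
  (* [G] = Q k - D2 k satisfies the same equation as [k]: D1 and D2 commute and the compatibility
     condition absorbs the derivatives of [P] and [Q]. Hence k^-1 G is annihilated by D1. *)
  have -> : pdMi a b G x = P x *m G x.
    rewrite pdMi_D; [|exact: dm (smoothM_mul oV1 sQ1 sk1) Vx|]; last first.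
      by apply: diffM_scale; [exact: diffC_cst|exact: dm skd Vx].
    rewrite pdMi_mul; [|exact: dm sQ1 Vx|exact: dm sk1 Vx].
    have -> : pdMi a b (fun y => (-1) *: kd y) x = - pdMi d e (fun y => P y *m k y) x.
      have dkd := dm _ _ _ skd Vx.
      rewrite (pdMi_scale a b (-1) dkd) scaleN1r /kd (pdMi_comm a b d e oV1 sk1 Vx).
      congr (- _).
      exact: pdMi_eq oV1 Vx Dk.
    rewrite pdMi_mul; [|exact: dm sP1 Vx|exact: dm sk1 Vx].
    rewrite (Dk x Vx) /G -/(kd x) mulmxDr -scalemxAr scaleN1r !mulmxA opprD addrA.
    congr (_ - _); rewrite -mulmxDl comp; last exact: b1W.
    by rewrite mulmxDl addrAC subrr add0r.
  by rewrite /G mulNmx !mulmxA addNr.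
have [r2 r20 [m [b2V sm um Dm hm]]] := dbar_solve de oV1 V1c sS.
have Hm := hm a b ad ae bd be DS.
set V2 := box c r2 in b2V Dm Hm.
have oV2 : open V2 by exact: open_box.
have sk2 : smoothM V2 k := smoothMS b2V sk1.
have sm2 : smoothM V2 m by apply: smoothMS sm => // x.
exists V2; split => //.
- by move=> i; rewrite subrr normr0.
- exact: subset_trans b2V b1W.
exists (fun x => k x *m m x); split.
- exact: smoothM_mul.
- by move=> x _; rewrite unitmx_mul uk um.
- move=> x Vx; rewrite pdMi_mul; [|exact: smoothM_diffM sk2 Vx|exact: smoothM_diffM sm2 Vx].
  by rewrite Hm // mulmx0 addr0 Dk ?mulmxA//; exact: b2V.
- move=> x Vx; rewrite pdMi_mul; [|exact: smoothM_diffM sk2 Vx|exact: smoothM_diffM sm2 Vx].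
  rewrite Dm // /S !mulmxA mulmxV ?uk// mul1mx /G mulmxDl -scalemxAl scaleN1r.
  by rewrite addrC -/(kd x) subrK.
Qed.

End KoszulMalgrangeSystem.

(** * Spin frames and the Hodge star *)

Section TwoIndices.
Context {R : realType}.

Lemma sum_ord2 (V : nmodType) (F : 'I_2 -> V) :
  \sum_A F A = F ord0 + F ord_max.
Proof.
rewrite !big_ord_recl big_ord0 addr0; congr (_ + F _).
exact: val_inj.
Qed.

Lemma ord2_ind (P : 'I_2 -> Prop) : P ord0 -> P ord_max -> forall A, P A.
Proof.
move=> P0 P1 [[|[|//]] i].
  by rewrite (_ : Ordinal i = ord0) //; exact: val_inj.
by rewrite (_ : Ordinal i = ord_max) //; exact: val_inj.
Qed.

Lemma eps2_00 : eps2 ord0 ord0 = 0 :> R[i].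
Proof. by rewrite /eps2 subrr. Qed.
Lemma eps2_11 : eps2 ord_max ord_max = 0 :> R[i].
Proof. by rewrite /eps2 subrr. Qed.
Lemma eps2_01 : eps2 ord0 ord_max = 1 :> R[i].
Proof. by rewrite /eps2 /= subr0. Qed.
Lemma eps2_10 : eps2 ord_max ord0 = -1 :> R[i].
Proof. by rewrite /eps2 /= sub0r. Qed.

Definition eps2E := (eps2_00, eps2_11, eps2_01, eps2_10).

Lemma conjcD (u v : R[i]) : (u + v)^* = (u^*)%C + (v^*)%C.
Proof. exact: rmorphD. Qed.
Lemma conjcM (u v : R[i]) : (u * v)^* = (u^*)%C * (v^*)%C.
Proof. exact: rmorphM. Qed.
Lemma conjcN (u : R[i]) : (- u)^* = - (u^*)%C.
Proof. exact: rmorphN. Qed.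

Lemma conjc_sum (I : finType) (F : I -> R[i]) : (\sum_i F i)^* = \sum_i (F i)^*%C.
Proof. exact: rmorph_sum. Qed.
Lemma num_conjE (u : R[i]) : (u^*)%R = (u^*)%C. Proof. by []. Qed.

End TwoIndices.

Section LeviCivita.
Context {R : realType}.
Implicit Types (u v w t : 'I_4 -> R[i]) (a b c d : 'I_4).

Lemma det_xrow (A : 'M[R]_4) (i j : 'I_4) : i != j -> \det (xrow i j A) = - \det A.
Proof.
by move=> ij; rewrite /xrow row_permE det_mulmx det_perm odd_tperm ij expr1 mulN1r.
Qed.

Let o1 : 'I_4 := inord 1.
Let o2 : 'I_4 := inord 2.
Let o3 : 'I_4 := inord 3.

Let ord4_ind (P : 'I_4 -> Prop) : P ord0 -> P o1 -> P o2 -> P o3 -> forall i, P i.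
Proof.
move=> p0 p1 p2 p3 [[|[|[|[|//]]]] i].
- by rewrite (_ : Ordinal i = ord0) //; exact: val_inj.
- by rewrite (_ : Ordinal i = o1) //; apply: val_inj; rewrite /= inordK.
- by rewrite (_ : Ordinal i = o2) //; apply: val_inj; rewrite /= inordK.
- by rewrite (_ : Ordinal i = o3) //; apply: val_inj; rewrite /= inordK.
Qed.

Let ord4_neq : ((ord0 == o1) = false) * ((ord0 == o2) = false) * ((ord0 == o3) = false)
  * ((o1 == o2) = false) * ((o1 == o3) = false) * ((o2 == o3) = false).
Proof. by do !split; rewrite -val_eqE /= !inordK. Qed.

Lemma levi_civita_swap a b c d :
  [/\ levi_civita b a c d = - levi_civita a b c d :> R,
      levi_civita a c b d = - levi_civita a b c d :> R &
      levi_civita a b d c = - levi_civita a b c d :> R].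
Proof.
have v1 : (o1 : nat) = 1%N by rewrite inordK.
have v2 : (o2 : nat) = 2%N by rewrite inordK.
have v3 : (o3 : nat) = 3%N by rewrite inordK.
split.
- rewrite -[RHS](@det_xrow _ ord0 o1) ?ord4_neq//; congr (\det _).
  apply/matrixP => i j; rewrite !mxE; elim/ord4_ind: i.
  + by rewrite tpermL v1.
  + by rewrite tpermR v1.
  + by rewrite tpermD ?ord4_neq// v2.
  + by rewrite tpermD ?ord4_neq// v3.
- rewrite -[RHS](@det_xrow _ o1 o2) ?ord4_neq//; congr (\det _).
  apply/matrixP => i j; rewrite !mxE; elim/ord4_ind: i.
  + by rewrite tpermD ?[_ == ord0]eq_sym ?ord4_neq.
  + by rewrite tpermL v1 v2.
  + by rewrite tpermR v1 v2.
  + by rewrite tpermD ?ord4_neq// v3.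
- rewrite -[RHS](@det_xrow _ o2 o3) ?ord4_neq//; congr (\det _).
  apply/matrixP => i j; rewrite !mxE; elim/ord4_ind: i.
  + by rewrite tpermD ?[_ == ord0]eq_sym ?ord4_neq.
  + by rewrite tpermD ?[_ == o1]eq_sym ?ord4_neq// v1.
  + by rewrite tpermL v2 v3.
  + by rewrite tpermR v2 v3.
Qed.

(** The alternating coordinate form on complex vectors, without the factor sqrt(det g). *)
Definition volume u v w t : R[i] :=
  \sum_a \sum_b \sum_p \sum_q (levi_civita a b p q)%:C * (u a * v b * w p * t q).

Lemma volume_swap12 u v w t : volume v u w t = - volume u v w t.
Proof.
rewrite /volume exchange_big -sumrN /=; apply: eq_bigr => a _.
rewrite -sumrN; apply: eq_bigr => b _; rewrite -sumrN; apply: eq_bigr => p _.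
rewrite -sumrN; apply: eq_bigr => q _.
have [-> _ _] := levi_civita_swap a b p q; rewrite rmorphN /=; ring.
Qed.

Lemma volume_swap23 u v w t : volume u w v t = - volume u v w t.
Proof.
rewrite /volume -sumrN /=; apply: eq_bigr => a _.
rewrite exchange_big -sumrN; apply: eq_bigr => b _; rewrite -sumrN; apply: eq_bigr => p _.
rewrite -sumrN; apply: eq_bigr => q _.
have [_ -> _] := levi_civita_swap a b p q; rewrite rmorphN /=; ring.
Qed.

Lemma volume_swap34 u v w t : volume u v t w = - volume u v w t.
Proof.
rewrite /volume -sumrN /=; apply: eq_bigr => a _.
rewrite -sumrN; apply: eq_bigr => b _.
rewrite exchange_big -sumrN; apply: eq_bigr => p _; rewrite -sumrN; apply: eq_bigr => q _.
have [_ _ ->] := levi_civita_swap a b p q; rewrite rmorphN /=; ring.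
Qed.

Lemma eq_opp0 (z : R[i]) : z = - z -> z = 0.
Proof.
move=> /eqP; rewrite -subr_eq0 opprK -mulr2n -mulr_natl mulf_eq0 pnatr_eq0 /=.
by move/eqP.
Qed.

Lemma volume_eq12 u w t : volume u u w t = 0.
Proof. by apply: eq_opp0; rewrite -volume_swap12. Qed.
Lemma volume_eq23 u w t : volume w u u t = 0.
Proof. by apply: eq_opp0; rewrite -volume_swap23. Qed.
Lemma volume_eq34 u w t : volume w t u u = 0.
Proof. by apply: eq_opp0; rewrite -volume_swap34. Qed.
Lemma volume_eq13 u v t : volume u v u t = 0.
Proof. by rewrite volume_swap23 volume_eq12 oppr0. Qed.
Lemma volume_eq24 u v t : volume v u t u = 0.
Proof. by rewrite volume_swap34 volume_eq23 oppr0. Qed.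
Lemma volume_eq14 u v t : volume u v t u = 0.
Proof. by rewrite volume_swap34 volume_eq13 oppr0. Qed.

Lemma volumeN12 u v w t : volume (fun i => - u i) (fun i => - v i) w t = volume u v w t.
Proof.
apply: eq_bigr => a _; apply: eq_bigr => b _; apply: eq_bigr => p _.
by apply: eq_bigr => q _; rewrite mulrNN.
Qed.

Lemma volumeN1 u v w t : volume (fun i => - u i) v w t = - volume u v w t.
Proof.
rewrite /volume -sumrN; apply: eq_bigr => a _; rewrite -sumrN.
apply: eq_bigr => b _; rewrite -sumrN; apply: eq_bigr => p _.
by rewrite -sumrN; apply: eq_bigr => q _; rewrite !mulNr mulrN.
Qed.

Lemma volumeN2 u v w t : volume u (fun i => - v i) w t = - volume u v w t.
Proof. by rewrite volume_swap12 volumeN1 volume_swap12 opprK. Qed.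

Lemma volume_perms (v0 v1 v2 v3 : 'I_4 -> R[i]) (c : R[i]) :
  volume v0 v1 v2 v3 = c ->
  [/\ volume v3 v2 v0 v1 = - c, volume v3 v1 v0 v2 = c, volume v2 v1 v0 v3 = - c,
      volume v3 v0 v1 v2 = - c & volume v2 v0 v1 v3 = c /\ volume v1 v0 v2 v3 = - c].
Proof.
move=> c0; have c1 : volume v1 v0 v2 v3 = - c by rewrite volume_swap12 c0.
have c2 : volume v2 v0 v1 v3 = c.
  by rewrite volume_swap12 volume_swap23 opprK c0.
have c3 : volume v2 v1 v0 v3 = - c by rewrite volume_swap23 c2.
have c4 : volume v3 v0 v1 v2 = - c.
  by rewrite volume_swap12 volume_swap23 opprK volume_swap34 c0.
have c5 : volume v3 v1 v0 v2 = c by rewrite volume_swap23 c4 opprK.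
by split => //; rewrite volume_swap23 volume_swap34 opprK.
Qed.

End LeviCivita.

Section PointFrame.
Context {R : realType}.
Variables (g : 'rV[R]_4 -> 'M[R]_4) (s : 'rV[R]_4 -> 'I_4 -> 'M[R[i]]_2).
Variable x : 'rV[R]_4.
Hypothesis g_unit : g x \in unitmx.
Hypothesis g_sym : (g x)^T = g x.
Hypothesis gE : forall a b, (g x a b)%:C = \sum_A \sum_A' \sum_B \sum_B'
  eps2 A B * eps2 A' B' * s x a A A' * s x b B B'.

Notation E := (inv_frame g s x).
Notation j0 := (ord0 : 'I_2).
Notation j1 := (ord_max : 'I_2).
Let gi a b : R[i] := (invmx (g x) a b)%:C.

Lemma inv_frameE a : [/\ E a j0 j0 = \sum_b gi a b * s x b j1 j1,
  E a j0 j1 = - \sum_b gi a b * s x b j1 j0,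
  E a j1 j0 = - \sum_b gi a b * s x b j0 j1 &
  E a j1 j1 = \sum_b gi a b * s x b j0 j0].
Proof.
by rewrite /inv_frame; split; rewrite -?sumrN; apply: eq_bigr => b _;
  rewrite !sum_ord2 !eps2E /gi; ring.
Qed.

Lemma gi_mul_g a c : \sum_b gi a b * (g x b c)%:C = (a == c)%:R.
Proof.
transitivity (((invmx (g x) *m g x) a c)%:C); last first.
  by rewrite mulVmx // mxE; case: (a == c).
by rewrite mxE rmorph_sum; apply: eq_bigr => b _; rewrite rmorphM.
Qed.

Lemma frame_complete a b :
  \sum_A \sum_A' s x a A A' * E b A A' = (a == b)%:R.
Proof.
rewrite eq_sym -gi_mul_g !sum_ord2.
have [-> -> -> ->] := inv_frameE b.
rewrite !mulrN !mulr_sumr -!sumrN -!big_split /=.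
apply: eq_bigr => c _; have -> : g x c a = g x a c by rewrite -{1}g_sym mxE.
by rewrite gE !sum_ord2 !eps2E; ring.
Qed.

Lemma sum_mxvec (F : 'I_(2 * 2) -> R[i]) :
  \sum_m F m = \sum_A \sum_A' F (mxvec_index A A').
Proof.
by rewrite pair_bigA (reindex _ (curry_mxvec_bij _ _)); apply: eq_bigr => -[].
Qed.

(** Flattening the pairs AA' turns [frame_complete] into a product of two square matrices equal to
    the identity; the product in the other order is then the identity too. *)
Lemma frame_dual A A' B B' :
  \sum_a E a A A' * s x a B B' = ((A == B) && (A' == B'))%:R.
Proof.
pose SM : 'M[R[i]]_(4, 2 * 2) := \matrix_(a < 4) mxvec (s x a).
pose EM : 'M[R[i]]_(4, 2 * 2) := \matrix_(a < 4) mxvec (\matrix_(A, A') E a A A').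
have SME a (C C' : 'I_2) : SM a (mxvec_index C C') = s x a C C' by rewrite mxE mxvecE.
have EME a (C C' : 'I_2) : EM a (mxvec_index C C') = E a C C' by rewrite mxE mxvecE mxE.
have SE : SM *m EM^T = 1%:M.
  apply/matrixP => a b.
  rewrite [LHS]mxE [RHS]mxE -frame_complete (sum_mxvec (fun m => SM a m * EM^T m b)).
  by apply: eq_bigr => C _; apply: eq_bigr => C' _; rewrite SME [EM^T _ _]mxE EME.
have /matrixP /(_ (mxvec_index A A') (mxvec_index B B')) := mulmx1C SE.
rewrite [LHS]mxE [RHS]mxE => H.
transitivity (\sum_a EM^T (mxvec_index A A') a * SM a (mxvec_index B B')).
  by apply: eq_bigr => a _; rewrite SME [EM^T _ _]mxE EME.
rewrite H; congr (_ %:R); congr nat_of_bool.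
have [f fK _] := curry_mxvec_bij 2 2.
rewrite -xpair_eqE; apply/eqP/eqP => [e|[-> ->]//].
by have := fK (A, A') isT; have := fK (B, B') isT; rewrite /= e => -> ->.
Qed.

Hypothesis s_real : forall a A A', s x a A A' =
  \sum_B \sum_B' eps2 A B * eps2 A' B' * (s x a B B')^*.

Lemma s_realE a : (s x a j0 j0)^* = s x a j1 j1 /\ (s x a j0 j1)^* = - s x a j1 j0
  /\ (s x a j1 j0)^* = - s x a j0 j1 /\ (s x a j1 j1)^* = s x a j0 j0.
Proof.
have e00 : s x a j1 j1 = (s x a j0 j0)^* by rewrite s_real !sum_ord2 !eps2E; ring.
have e01 : s x a j1 j0 = - ((s x a j0 j1)^*)%C by rewrite s_real !sum_ord2 !eps2E; ring.
by rewrite e00 e01 conjcN !conjcK opprK.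
Qed.

Lemma inv_frame_real a : (E a j0 j0)^* = E a j1 j1 /\ (E a j0 j1)^* = - E a j1 j0.
Proof.
have [-> -> -> ->] := inv_frameE a; rewrite conjcN opprK !conjc_sum -sumrN.
have gr b : (gi a b)^* = gi a b by rewrite /gi conjc_real.
by split; apply: eq_bigr => b _; rewrite conjcM gr;
  have [e0 [e1 [e2 e3]]] := s_realE b; rewrite ?e0 ?e1 ?e2 ?e3 ?mulrN ?opprK.
Qed.

End PointFrame.

(** * The Hodge star in a spin frame *)

Section HodgeFrame.
Context {R : realType}.
Variables (g : 'rV[R]_4 -> 'M[R]_4) (s : 'rV[R]_4 -> 'I_4 -> 'M[R[i]]_2).
Variable x : 'rV[R]_4.
Hypothesis g_unit : g x \in unitmx.
Hypothesis g_sym : (g x)^T = g x.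
Hypothesis gE : forall a b, (g x a b)%:C = \sum_A \sum_A' \sum_B \sum_B'
  eps2 A B * eps2 A' B' * s x a A A' * s x b B B'.
Hypothesis s_asd : forall psi : 'M[R[i]]_2, psi^T = psi ->
  let k a b := \sum_A \sum_A' \sum_B \sum_B'
    psi A B * eps2 A' B' * s x a A A' * s x b B B' in
  forall a b, \sum_c \sum_d (hodge_coef (g x) a b c d)%:C * k c d = - k a b.

Notation E := (inv_frame g s x).
Notation j0 := (ord0 : 'I_2).
Notation j1 := (ord_max : 'I_2).
Implicit Types (k : 'I_4 -> 'I_4 -> R[i]) (u w : 'I_4 -> R[i]).

Let gi a b : R[i] := (invmx (g x) a b)%:C.
Let v A A' p := \sum_c gi p c * s x c A A'.
Let K : R[i] := (2^-1 * Num.sqrt (\det (g x)))%:C.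

Definition star k a b : R[i] := \sum_c \sum_d (hodge_coef (g x) a b c d)%:C * k c d.

Definition contract k u w : R[i] := \sum_a \sum_b u a * w b * k a b.

Definition frame_comp k A A' B B' : R[i] :=
  contract k (fun a => E a A A') (fun a => E a B B').

Lemma contract_sum (I : finType) (F : I -> 'I_4 -> 'I_4 -> R[i]) u w :
  contract (fun a b => \sum_i F i a b) u w = \sum_i contract (F i) u w.
Proof.
rewrite /contract [RHS]exchange_big /=; apply: eq_bigr => a _.
by rewrite [RHS]exchange_big /=; apply: eq_bigr => b _; rewrite mulr_sumr.
Qed.

Lemma star_sum (I : finType) (F : I -> 'I_4 -> 'I_4 -> R[i]) a b :
  star (fun a b => \sum_i F i a b) a b = \sum_i star (F i) a b.
Proof.
rewrite /star [RHS]exchange_big /=; apply: eq_bigr => c _.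
by rewrite [RHS]exchange_big /=; apply: eq_bigr => d _; rewrite mulr_sumr.
Qed.

Lemma frame_expand k a b : k a b = \sum_A \sum_A' \sum_B \sum_B'
  frame_comp k A A' B B' * s x a A A' * s x b B B'.
Proof.
transitivity (\sum_c \sum_d (a == c)%:R * ((b == d)%:R * k c d)).
  rewrite (bigD1 a)//= (bigD1 b)//= !eqxx !mul1r !big1 ?addr0// => c ca;
    rewrite ?(eq_sym _ c) (negPf ca) ?mul0r ?mulr0//.
  by apply: big1 => d _; rewrite mul0r.
transitivity (\sum_c \sum_d (\sum_A \sum_A' s x a A A' * E c A A') *
    ((\sum_B \sum_B' s x b B B' * E d B B') * k c d)).
  by apply: eq_bigr => c _; apply: eq_bigr => d _;
    rewrite !(frame_complete g_unit g_sym gE).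
rewrite /frame_comp /contract !sum_ord2 !mulr_suml -!big_split /=.
apply: eq_bigr => c _; rewrite !mulr_suml -!big_split /=.
by apply: eq_bigr => d _; rewrite !sum_ord2; ring.
Qed.

Let hcE a b c d : (hodge_coef (g x) a b c d)%:C =
  K * \sum_p \sum_q (levi_civita a b p q)%:C * gi p c * gi q d.
Proof.
rewrite /hodge_coef rmorphM /=; congr (_ * _).
rewrite (rmorph_sum (real_complex R)); apply: eq_bigr => p _ /=.
rewrite (rmorph_sum (real_complex R)); apply: eq_bigr => q _ /=.
by rewrite !rmorphM.
Qed.

Lemma star_rank1 (e : R[i]) u w a b : star (fun c d => e * u c * w d) a b =
  K * e * \sum_p \sum_q (levi_civita a b p q)%:C *
    ((\sum_c gi p c * u c) * \sum_d gi q d * w d).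
Proof.
rewrite mulr_sumr.
transitivity (\sum_p \sum_c \sum_d \sum_q
    K * e * (levi_civita a b p q)%:C * gi p c * gi q d * u c * w d).
  rewrite /star [RHS]exchange_big /=; apply: eq_bigr => c _.
  rewrite [RHS]exchange_big /=; apply: eq_bigr => d _.
  rewrite hcE mulr_sumr mulr_suml; apply: eq_bigr => p _.
  rewrite mulr_sumr mulr_suml.
  by apply: eq_bigr => q _; ring.
apply: eq_bigr => p _; rewrite mulr_sumr.
rewrite [LHS](eq_bigr (fun c => \sum_q \sum_d
    K * e * (levi_civita a b p q)%:C * gi p c * gi q d * u c * w d)); last first.
  by move=> c _; rewrite exchange_big.
rewrite exchange_big /=; apply: eq_bigr => q _.
rewrite big_distrl /= !mulr_sumr; apply: eq_bigr => c _.
by rewrite !mulr_sumr; apply: eq_bigr => d _; ring.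
Qed.

(** Expanding [k] in the frame and raising the indices by the inverse metric leaves the volume form
    on [u], [w] and two raised frame covectors. *)
Lemma contract_star k u w : contract (star k) u w =
  K * \sum_A \sum_A' \sum_B \sum_B'
    frame_comp k A A' B B' * volume u w (v A A') (v B B').
Proof.
transitivity (contract (fun a b => \sum_A \sum_A' \sum_B \sum_B'
   star (fun c d => frame_comp k A A' B B' * s x c A A' * s x d B B') a b) u w).
  congr contract; apply/funext => a; apply/funext => b.
  have ke : k = fun c d => \sum_A \sum_A' \sum_B \sum_B'
      frame_comp k A A' B B' * s x c A A' * s x d B B'.
    by apply/funext => c; apply/funext => d; exact: frame_expand.
  rewrite [in LHS]ke star_sum; apply: eq_bigr => A _; rewrite star_sum; apply: eq_bigr => A' _.
  by rewrite star_sum; apply: eq_bigr => B _; rewrite star_sum.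
rewrite contract_sum mulr_sumr; apply: eq_bigr => A _.
rewrite contract_sum mulr_sumr; apply: eq_bigr => A' _.
rewrite contract_sum mulr_sumr; apply: eq_bigr => B _.
rewrite contract_sum mulr_sumr; apply: eq_bigr => B' _.
rewrite /contract /volume !mulr_sumr; apply: eq_bigr => a _.
rewrite !mulr_sumr; apply: eq_bigr => b _.
have -> : star (fun c d => frame_comp k A A' B B' * s x c A A' * s x d B B') a b =
    K * frame_comp k A A' B B' * \sum_p \sum_q (levi_civita a b p q)%:C *
      (v A A' p * v B B' q) by exact: star_rank1.
move: (frame_comp _ _ _ _ _) (v A A') (v B B') K => e v1 v2 K'.
rewrite !mulr_sumr; apply: eq_bigr => p _; rewrite !mulr_sumr; apply: eq_bigr => q _.
by ring.
Qed.

Lemma frame_compN k A A' B B' : (forall a b, k a b = - k b a) ->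
  frame_comp k A A' B B' = - frame_comp k B B' A A'.
Proof.
move=> kN; rewrite /frame_comp /contract exchange_big /= -sumrN.
apply: eq_bigr => a _; rewrite -sumrN; apply: eq_bigr => b _.
by rewrite (kN b a); ring.
Qed.

Let EvE : [/\ (fun a => E a j0 j0) = v j1 j1, (fun a => E a j0 j1) = (fun a => - v j1 j0 a),
  (fun a => E a j1 j0) = (fun a => - v j0 j1 a) & (fun a => E a j1 j1) = v j0 j0].
Proof. by split; apply/funext => a; have [? ? ? ?] := inv_frameE g s x a. Qed.

Let c : R[i] := K * 2%:R * volume (v j0 j0) (v j0 j1) (v j1 j0) (v j1 j1).

(** The vectors E_AA' are, up to sign and order, the raised covectors [v], so a volume survives only
    if its four entries are distinct. All survivors equal the volume of the frame up to sign, and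
    the star acts through the single constant [c]; its factor 2 counts both orders of each pair. *)
Lemma frame_star k : (forall a b, k a b = - k b a) ->
  [/\ frame_comp (star k) j0 j0 j0 j1 = c * frame_comp k j0 j0 j0 j1,
      frame_comp (star k) j0 j0 j1 j0 = - c * frame_comp k j0 j0 j1 j0,
      frame_comp (star k) j0 j0 j1 j1 = - c * frame_comp k j0 j1 j1 j0,
      frame_comp (star k) j0 j1 j1 j0 = - c * frame_comp k j0 j0 j1 j1 &
      frame_comp (star k) j0 j1 j1 j1 = - c * frame_comp k j0 j1 j1 j1 /\
      frame_comp (star k) j1 j0 j1 j1 = c * frame_comp k j1 j0 j1 j1].
Proof.
move=> kN; rewrite ![frame_comp (star k) _ _ _ _]contract_star !sum_ord2.
have [-> -> -> ->] := EvE.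
rewrite !(frame_compN j0 j1 j0 j0 kN) !(frame_compN j1 j0 j0 j0 kN)
  !(frame_compN j1 j1 j0 j0 kN) !(frame_compN j1 j0 j0 j1 kN)
  !(frame_compN j1 j1 j0 j1 kN) !(frame_compN j1 j1 j1 j0 kN) /c.
move: (frame_comp k j0 j0 j0 j1) (frame_comp k j0 j0 j1 j0) (frame_comp k j0 j0 j1 j1)
 (frame_comp k j0 j1 j1 j0) (frame_comp k j0 j1 j1 j1) (frame_comp k j1 j0 j1 j1).
move: K (v j0 j0) (v j0 j1) (v j1 j0) (v j1 j1) => K' v0 v1 v2 v3 k1 k2 k3 k4 k5 k6.
have [p1 p2 p3 p4 [p5 p6]] := volume_perms (erefl (volume v0 v1 v2 v3)).
have q1 : volume v3 v2 v1 v0 = volume v0 v1 v2 v3 by rewrite volume_swap34 p1 opprK.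
have q2 : volume v3 v1 v2 v0 = - volume v0 v1 v2 v3 by rewrite volume_swap34 p2.
have q3 : volume v2 v1 v3 v0 = volume v0 v1 v2 v3 by rewrite volume_swap34 p3 opprK.
have q4 : volume v3 v0 v2 v1 = volume v0 v1 v2 v3 by rewrite volume_swap34 p4 opprK.
have q5 : volume v2 v0 v3 v1 = - volume v0 v1 v2 v3 by rewrite volume_swap34 p5.
have q6 : volume v1 v0 v3 v2 = volume v0 v1 v2 v3 by rewrite volume_swap34 p6 opprK.
rewrite !volumeN12 !volumeN1 !volumeN2 !volume_eq13 !volume_eq14 !volume_eq23 !volume_eq24 !volume_eq34
  ?p1 ?p2 ?p3 ?p4 ?p5 ?p6 ?q1 ?q2 ?q3 ?q4 ?q5 ?q6.
by do ![split]; ring.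
Qed.
Lemma contract_rank1 (p q u w : 'I_4 -> R[i]) :
  contract (fun a b => p a * q b) u w = (\sum_a u a * p a) * \sum_b w b * q b.
Proof.
rewrite /contract big_distrl /=; apply: eq_bigr => a _.
by rewrite mulr_sumr; apply: eq_bigr => b _; ring.
Qed.

Lemma contractB k k' u w :
  contract (fun a b => k a b - k' a b) u w = contract k u w - contract k' u w.
Proof.
rewrite /contract -sumrB; apply: eq_bigr => a _; rewrite -sumrB.
by apply: eq_bigr => b _; rewrite mulrBr.
Qed.

(** Neither the determinant of the frame nor sqrt(det g) is evaluated: the form psi_AB eps_A'B' with
    psi concentrated at A = B = 0 is anti-self-dual by assumption and has component 1 at 00', 01',
    which determines [c]. *)
Let c_eq : c = -1.
Proof.
pose psi : 'M[R[i]]_2 := delta_mx j0 j0.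
have psiT : psi^T = psi by rewrite trmx_delta.
pose k a b := s x a j0 j0 * s x b j0 j1 - s x a j0 j1 * s x b j0 j0.
have kE a b : k a b = \sum_A \sum_A' \sum_B \sum_B'
    psi A B * eps2 A' B' * s x a A A' * s x b B B'.
  by rewrite !sum_ord2 !eps2E !mxE /= /k; ring.
have kN a b : k a b = - k b a by rewrite /k; ring.
have [+ _ _ _ _] := frame_star kN.
have -> : star k = fun a b => - k a b.
  apply/funext => a; apply/funext => b; rewrite [in RHS]kE -(s_asd psiT a b).
  by apply: eq_bigr => d _; apply: eq_bigr => e _; rewrite kE.
have -> : frame_comp k j0 j0 j0 j1 = 1.
  rewrite /frame_comp contractB !contract_rank1 !(frame_dual g_unit g_sym gE) /=.
  by rewrite mulr1 mul0r subr0.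
rewrite mulr1 => <-.
rewrite /frame_comp (_ : (fun _ _ => _) = fun a b =>
    s x a j0 j1 * s x b j0 j0 - s x a j0 j0 * s x b j0 j1); last first.
  by apply/funext => a; apply/funext => b; rewrite /k opprB.
rewrite contractB !contract_rank1 !(frame_dual g_unit g_sym gE) /=.
by rewrite mulr1 mul0r sub0r.
Qed.

Lemma starN k a b : star k a b = - star k b a.
Proof.
rewrite /star -sumrN; apply: eq_bigr => d _; rewrite -sumrN; apply: eq_bigr => e _.
rewrite !hcE -mulNr -mulrN -sumrN; congr (_ * _ * _); apply: eq_bigr => p _.
rewrite -sumrN; apply: eq_bigr => q _.
by have [-> _ _] := @levi_civita_swap R b a p q; rewrite rmorphN /=; ring.
Qed.

(** The three conditions express the vanishing of the symmetric unprimed spinor of [k]; the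
    remaining components are fixed by the star with c = -1. *)
Lemma star_self_dualP k : (forall a b, k a b = - k b a) ->
  (forall a b, star k a b = k a b) <->
  [/\ frame_comp k j0 j0 j0 j1 = 0, frame_comp k j1 j0 j1 j1 = 0 &
      frame_comp k j0 j0 j1 j1 = frame_comp k j0 j1 j1 j0].
Proof.
move=> kN; have := frame_star kN; rewrite c_eq => -[e1 e2 e3 e4 [e5 e6]]; split.
  move=> sk; have ske : star k = k by apply/funext => a; apply/funext => b.
  by move: e1 e3 e6; rewrite ske !mulN1r opprK mul1r => /eq_opp0 -> -> /eq_opp0 ->.
move=> [k1 k6 k34] a b.
rewrite (frame_expand (star k)) [RHS]frame_expand !sum_ord2.
have d k' C C' : (forall a b, k' a b = - k' b a) -> frame_comp k' C C' C C' = 0.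
  by move=> k'N; apply: eq_opp0; rewrite -frame_compN.
have sN := starN k.
rewrite !(d (star k)) // !(d k) //.
rewrite !(frame_compN j0 j1 j0 j0 sN) !(frame_compN j1 j0 j0 j0 sN)
  !(frame_compN j1 j1 j0 j0 sN) !(frame_compN j1 j0 j0 j1 sN)
  !(frame_compN j1 j1 j0 j1 sN) !(frame_compN j1 j1 j1 j0 sN).
rewrite !(frame_compN j0 j1 j0 j0 kN) !(frame_compN j1 j0 j0 j0 kN)
  !(frame_compN j1 j1 j0 j0 kN) !(frame_compN j1 j0 j0 j1 kN)
  !(frame_compN j1 j1 j0 j1 kN) !(frame_compN j1 j1 j1 j0 kN).
by rewrite e1 e2 e3 e4 e5 e6 k1 k6 k34; ring.
Qed.
End HodgeFrame.

Section HodgeMatrix.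
Context {R : realType} {n : nat}.
Variables (U : set 'rV[R]_4) (g : 'rV[R]_4 -> 'M[R]_4).
Variable s : 'rV[R]_4 -> 'I_4 -> 'M[R[i]]_2.
Hypothesis g_metric : riemannian_metric U g.
Hypothesis s_frame : spin_frame U g s.
Implicit Types F : 'I_4 -> 'I_4 -> 'M[R[i]]_n.

Definition contractM F (u w : 'I_4 -> R[i]) : 'M[R[i]]_n :=
  \sum_a \sum_b (u a * w b) *: F a b.

Lemma metric_unit x : U x -> g x \in unitmx.
Proof.
move=> Ux; have [_ /(_ x Ux)[_ gpos]] := g_metric.
rewrite unitmxE unitfE; apply/negP => /det0P[v v0 vg].
by have := gpos v v0; rewrite vg mul0mx mxE ltxx.
Qed.

Lemma metric_sym x : U x -> (g x)^T = g x.
Proof. by move=> Ux; have [_ /(_ x Ux)[]] := g_metric. Qed.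

Lemma frame_metric x : U x -> forall a b, (g x a b)%:C = \sum_A \sum_A' \sum_B \sum_B'
  eps2 A B * eps2 A' B' * s x a A A' * s x b B B'.
Proof. by move=> Ux; have [_ /(_ x Ux)[]] := s_frame. Qed.

Lemma frame_real x : U x -> forall a A A', s x a A A' =
  \sum_B \sum_B' eps2 A B * eps2 A' B' * ((s x a B B')^*)%C.
Proof. by move=> Ux; have [_ /(_ x Ux)[]] := s_frame. Qed.

Lemma contractM_entry F u w i j :
  contractM F u w i j = contract (fun a b => F a b i j) u w.
Proof.
rewrite /contractM summxE; apply: eq_bigr => a _; rewrite summxE.
by apply: eq_bigr => b _; rewrite mxE.
Qed.

Lemma hodgeM_self_dualP x F : U x -> (forall a b, F a b = - F b a) ->
  let f A A' B B' := contractM F (fun a => inv_frame g s x a A A')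
    (fun a => inv_frame g s x a B B') in
  (forall a b, hodgeM g x F a b = F a b) <->
  [/\ f ord0 ord0 ord0 ord_max = 0, f ord_max ord0 ord_max ord_max = 0 &
      f ord0 ord0 ord_max ord_max = f ord0 ord_max ord_max ord0].
Proof.
move=> Ux FN f.
have [_ /(_ x Ux)[_ _ s_asd]] := s_frame.
have FN' i j a b : F a b i j = - F b a i j by rewrite FN mxE.
have H i j := star_self_dualP (metric_unit Ux) (metric_sym Ux) (frame_metric Ux) s_asd
  (FN' i j).
have hE a b i j : hodgeM g x F a b i j = star g x (fun a b => F a b i j) a b.
  rewrite /hodgeM summxE; apply: eq_bigr => c _; rewrite summxE.
  by apply: eq_bigr => d _; rewrite mxE.
split.
  move=> hF; have sF i j a b : star g x (fun a b => F a b i j) a b = F a b i j.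
    by rewrite -hE hF.
  split; apply/matrixP => i j; rewrite ?mxE !contractM_entry;
    by have [+ _] := H i j => /(_ (sF i j))[].
move=> [f1 f2 f3] a b; apply/matrixP => i j; rewrite hE.
by have [_ ->] := H i j => //; split; rewrite /frame_comp -!contractM_entry
  -?[contractM _ _ _]/(f _ _ _ _) ?f1 ?f2 ?f3 ?mxE.
Qed.

End HodgeMatrix.

(** * The spin connection *)

Section Contraction.
Context {R : realType}.
Implicit Types (k : 'I_4 -> 'I_4 -> R[i]) (u w : 'I_4 -> R[i]).

Lemma contractD k k' u w :
  contract (fun a b => k a b + k' a b) u w = contract k u w + contract k' u w.
Proof.
rewrite /contract -big_split; apply: eq_bigr => a _; rewrite -big_split /=.
by apply: eq_bigr => b _; rewrite mulrDr.
Qed.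

Lemma contractT k u w : contract (fun a b => k b a) u w = contract k w u.
Proof.
rewrite /contract exchange_big /=; apply: eq_bigr => a _.
by apply: eq_bigr => b _; rewrite [u _ * _]mulrC.
Qed.

End Contraction.

Section Directional.
Context {R : realType}.
Implicit Types (U : set 'rV[R]_4) (x : 'rV[R]_4) (u : 'I_4 -> R[i]).

(** [u] is a list of constant components: a vector field is inserted through its value at the point,
    and its own derivatives never enter. *)
Definition dirC u (f : 'rV[R]_4 -> R[i]) x : R[i] := \sum_a u a * pdC a f x.

Definition dirM m n u (F : 'rV[R]_4 -> 'M[R[i]]_(m, n)) x : 'M[R[i]]_(m, n) :=
  \sum_a u a *: pdM a F x.

Lemma dirM_entry m n u (F : 'rV[R]_4 -> 'M[R[i]]_(m, n)) x i j :
  dirM u F x i j = dirC u (fun y => F y i j) x.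
Proof. by rewrite /dirM summxE; apply: eq_bigr => a _; rewrite !mxE. Qed.

Lemma dirC_eq U u f h x : open U -> U x -> (forall y, U y -> f y = h y) ->
  dirC u f x = dirC u h x.
Proof. by move=> oU Ux fh; apply: eq_bigr => a _; rewrite (pdC_eq a oU Ux fh). Qed.

Lemma dirC_cst u k x : dirC u (fun=> k) x = 0.
Proof. by rewrite /dirC big1// => a _; rewrite pdC_cst mulr0. Qed.

Lemma dirC_D U u f h x : smoothC U f -> smoothC U h -> U x ->
  dirC u (fun y => f y + h y) x = dirC u f x + dirC u h x.
Proof.
move=> sf sh Ux; rewrite /dirC -big_split; apply: eq_bigr => a _ /=.
by rewrite (pdC_D a (smoothC_diffC sf Ux) (smoothC_diffC sh Ux)) mulrDr.
Qed.

Lemma dirC_M U u f h x : smoothC U f -> smoothC U h -> U x ->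
  dirC u (fun y => f y * h y) x = dirC u f x * h x + f x * dirC u h x.
Proof.
move=> sf sh Ux; rewrite /dirC mulr_suml mulr_sumr -big_split.
apply: eq_bigr => a _ /=.
by rewrite (pdC_M a (smoothC_diffC sf Ux) (smoothC_diffC sh Ux)); ring.
Qed.

Lemma dirC_N U u f x : smoothC U f -> U x ->
  dirC u (fun y => - f y) x = - dirC u f x.
Proof.
move=> sf Ux; rewrite /dirC -sumrN; apply: eq_bigr => a _ /=.
by rewrite (pdC_N a (smoothC_diffC sf Ux)) mulrN.
Qed.

Lemma dirC_conj U u f x : smoothC U f -> U x ->
  dirC u (fun y => (f y)^*%C) x = (dirC (fun a => (u a)^*%C) f x)^*%C.
Proof.
move=> sf Ux; rewrite /dirC conjc_sum; apply: eq_bigr => a _ /=.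
by rewrite (pdC_conj a (smoothC_diffC sf Ux)) conjcM conjcK.
Qed.

Lemma dirC_V U u f x : open U -> (forall y, U y -> f y != 0) -> smoothC U f ->
  U x -> dirC u (fun y => (f y)^-1) x = - (f x)^-1 ^+ 2 * dirC u f x.
Proof.
move=> oU f0 sf Ux; rewrite /dirC mulr_sumr; apply: eq_bigr => a _.
by rewrite (pdC_V a oU f0 sf Ux); ring.
Qed.

Lemma dirC_linear u w k f x :
  dirC (fun a => u a + k * w a) f x = dirC u f x + k * dirC w f x.
Proof.
rewrite /dirC mulr_sumr -big_split; apply: eq_bigr => a _ /=; ring.
Qed.

Lemma dirM_mul U m n p u (F : 'rV[R]_4 -> 'M[R[i]]_(m, n))
    (G : 'rV[R]_4 -> 'M[R[i]]_(n, p)) x : smoothM U F -> smoothM U G -> U x ->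
  dirM u (fun y => F y *m G y) x = dirM u F x *m G x + F x *m dirM u G x.
Proof.
move=> sF sG Ux; rewrite /dirM mulmx_suml mulmx_sumr -big_split.
apply: eq_bigr => a _ /=.
rewrite (pdM_mul a (smoothM_diffM sF Ux) (smoothM_diffM sG Ux)) scalerDr.
by rewrite -scalemxAl -scalemxAr.
Qed.

Lemma dirM_inv U n u (F : 'rV[R]_4 -> 'M[R[i]]_n) x : open U -> smoothM U F ->
  (forall x, U x -> F x \in unitmx) -> U x ->
  dirM u (fun x => invmx (F x)) x = - (invmx (F x) *m dirM u F x *m invmx (F x)).
Proof.
move=> oU sF uF Ux; rewrite /dirM mulmx_sumr mulmx_suml -sumrN.
apply: eq_bigr => a _; rewrite (pdM_inv a oU sF uF Ux) scalerN.
by rewrite -scalemxAr -scalemxAl.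
Qed.

End Directional.

Section LeviCivitaConnection.
Context {R : realType}.
Variables (U : set 'rV[R]_4) (g : 'rV[R]_4 -> 'M[R]_4).
Variables (s Gam Gam' : 'rV[R]_4 -> 'I_4 -> 'M[R[i]]_2).
Hypothesis U_open : open U.
Hypothesis g_metric : riemannian_metric U g.
Hypothesis s_frame : spin_frame U g s.
Hypothesis Gam_LC : spin_connection U g s Gam Gam'.
Implicit Types (u w : 'I_4 -> R[i]) (x : 'rV[R]_4) (a b c d : 'I_4).

Lemma smoothC_invmx_metric a b : smoothC U (fun y => (invmx (g y) a b)%:C).
Proof.
pose gC y : 'M[R[i]]_4 := map_mx (real_complex R) (g y).
have sg : smoothM U gC.
  move=> i j; apply: (@smoothC_eq _ _ (fun y => (g y i j)%:C)) => //.
    by move=> y _; rewrite mxE.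
  by apply: smoothC_real; have [+ _] := g_metric.
have ug y : U y -> gC y \in unitmx.
  by move=> Uy; rewrite map_unitmx (metric_unit g_metric).
apply: smoothC_eq (smoothM_inv U_open sg ug a b) => // y Uy.
by rewrite -map_invmx mxE.
Qed.

Lemma smoothC_frame a B B' : smoothC U (fun y => s y a B B').
Proof. by have [+ _] := s_frame => /(_ a B B'). Qed.

Lemma smoothC_inv_frame a A A' : smoothC U (fun y => inv_frame g s y a A A').
Proof.
apply: smoothC_sum => // b _; apply: smoothC_M => //; first exact: smoothC_invmx_metric.
apply: smoothC_sum => // B _; apply: smoothC_sum => // B' _; apply: smoothC_M => //.
  exact: smoothC_cst.
exact: smoothC_frame.
Qed.

Lemma christoffel_sym x c a b : U x -> christoffel g x c a b = christoffel g x c b a.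
Proof.
move=> Ux; congr (_ * _); apply: eq_bigr => d _; congr (_ * _).
rewrite [pd a _ x + _]addrC; congr (_ - _).
apply: near_pd; apply: (open_near U_open Ux) => y Uy.
by have [_ /(_ y Uy)[+ _]] := g_metric => gs; rewrite -{1}gs mxE.
Qed.

Definition frame_vec u x B B' : R[i] := \sum_a u a * s x a B B'.

Definition conn (G : 'rV[R]_4 -> 'I_4 -> 'M[R[i]]_2) u x C B : R[i] :=
  \sum_a u a * G x a C B.

Lemma torsion_free u w x B B' : U x ->
  \sum_a \sum_b u a * w b *
    (pdC a (fun y => s y b B B') x - pdC b (fun y => s y a B B') x) =
  - (\sum_C conn Gam u x B C * frame_vec w x C B' +
     \sum_C' conn Gam' u x B' C' * frame_vec w x B C') +
  (\sum_C conn Gam w x B C * frame_vec u x C B' +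
     \sum_C' conn Gam' w x B' C' * frame_vec u x B C').
Proof.
move=> Ux; have [_ _ H] := Gam_LC.
have {}H a b : pdC a (fun y => s y b B B') x =
    \sum_c (christoffel g x c a b)%:C * s x c B B' -
    (\sum_C Gam x a B C * s x b C B') - \sum_C' Gam' x a B' C' * s x b B C'.
  by apply: subr0_eq; rewrite -[RHS](H x a b B B' Ux); ring.
pose X a b := (\sum_C Gam x a B C * s x b C B') + \sum_C' Gam' x a B' C' * s x b B C'.
transitivity (contract (fun a b => X b a - X a b) u w).
  apply: eq_bigr => a _; apply: eq_bigr => b _; rewrite !H /X; congr (_ * _).
  rewrite (_ : \sum_c (christoffel g x c b a)%:C * s x c B B' =
    \sum_c (christoffel g x c a b)%:C * s x c B B'); first by ring.
  by apply: eq_bigr => c _; rewrite christoffel_sym.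
rewrite contractB (contractT X) addrC; congr (- _ + _);
  rewrite /X contractD !contract_sum; congr (_ + _); apply: eq_bigr => C _;
  exact: contract_rank1.
Qed.

(** The formula dP(u, w) = w . nabla_u P - u . nabla_w P with P given by its spinor components; the
    derivatives of the frame are supplied by [torsion_free]. *)
Lemma exterior_derivative (p : 'rV[R]_4 -> 'I_2 -> 'I_2 -> R[i]) u w x : U x ->
  (forall B B', smoothC U (fun y => p y B B')) ->
  let P b y := \sum_B \sum_B' s y b B B' * p y B B' in
  let nabla v B B' := dirC v (fun y => p y B B') x - (\sum_C conn Gam v x C B * p x C B')
    - \sum_C' conn Gam' v x C' B' * p x B C' in
  contract (fun a b => pdC a (P b) x - pdC b (P a) x) u w =
    (\sum_B \sum_B' frame_vec w x B B' * nabla u B B') -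
    \sum_B \sum_B' frame_vec u x B B' * nabla w B B'.
Proof.
move=> Ux sp P nabla.
have dP a b : pdC a (P b) x = \sum_B \sum_B'
    (pdC a (fun y => s y b B B') x * p x B B' + s x b B B' * pdC a (fun y => p y B B') x).
  rewrite pdC_sum => [|B _].
    apply: eq_bigr => B _; rewrite pdC_sum => [|B' _].
      apply: eq_bigr => B' _; apply: pdC_M; first exact: smoothC_diffC (smoothC_frame _ _ _) Ux.
      exact: smoothC_diffC (sp _ _) Ux.
    by apply: diffC_M; [exact: smoothC_diffC (smoothC_frame _ _ _) Ux|
      exact: smoothC_diffC (sp _ _) Ux].
  apply: diffC_sum => B' _.
  by apply: diffC_M; [exact: smoothC_diffC (smoothC_frame _ _ _) Ux|
    exact: smoothC_diffC (sp _ _) Ux].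
transitivity (\sum_B \sum_B' (p x B B' * (\sum_a \sum_b u a * w b *
      (pdC a (fun y => s y b B B') x - pdC b (fun y => s y a B B') x)) +
    (frame_vec w x B B' * dirC u (fun y => p y B B') x -
     frame_vec u x B B' * dirC w (fun y => p y B B') x))).
  rewrite (_ : (fun a b => _ - _) = fun a b => \sum_B \sum_B'
    (p x B B' * (pdC a (fun y => s y b B B') x - pdC b (fun y => s y a B B') x) +
     (pdC a (fun y => p y B B') x * s x b B B' - s x a B B' * pdC b (fun y => p y B B') x))).
    rewrite contract_sum; apply: eq_bigr => B _; rewrite contract_sum; apply: eq_bigr => B' _.
    rewrite contractD contractB !contract_rank1; congr (_ + _).
      rewrite /contract mulr_sumr; apply: eq_bigr => a _; rewrite mulr_sumr.
      by apply: eq_bigr => b _; rewrite mulrCA.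
    by rewrite mulrC.
  apply/funext => a; apply/funext => b; rewrite !dP -sumrB; apply: eq_bigr => B _.
  by rewrite -sumrB; apply: eq_bigr => B' _; ring.
rewrite /nabla -sumrB; have tf B B' := torsion_free u w B B' Ux.
under eq_bigr do under eq_bigr do rewrite tf.
rewrite !sum_ord2; ring.
Qed.

End LeviCivitaConnection.

Section SpinorAlgebra.
Context {R : realType}.
Implicit Types (psi : 'I_2 -> R[i]).
Notation j0 := (ord0 : 'I_2).
Notation j1 := (ord_max : 'I_2).

Lemma lowerE psi : lower psi j0 = - psi j1 /\ lower psi j1 = psi j0.
Proof. by rewrite /lower !sum_ord2 !eps2E; split; ring. Qed.

Lemma daggerE psi : dagger psi j0 = - (psi j1)^*%C /\ dagger psi j1 = (psi j0)^*%C.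
Proof. by []. Qed.

(** The complex vector psi^A e_AA': for psi = o or iota it is the L_A' or N_A' of the overview. *)
Definition spinor_vec (g : 'rV[R]_4 -> 'M[R]_4) (s : 'rV[R]_4 -> 'I_4 -> 'M[R[i]]_2)
  psi x A' : 'I_4 -> R[i] := fun a => \sum_A psi A * inv_frame g s x a A A'.

End SpinorAlgebra.

Section SpinorCalculus.
Context {R : realType}.
Variables (U : set 'rV[R]_4) (g J : 'rV[R]_4 -> 'M[R]_4).
Variables (s Gam Gam' : 'rV[R]_4 -> 'I_4 -> 'M[R[i]]_2) (o : 'rV[R]_4 -> 'I_2 -> R[i]).
Hypothesis U_open : open U.
Hypothesis g_metric : riemannian_metric U g.
Hypothesis J_orthogonal : orthogonal_almost_complex U g J.
Hypothesis s_frame : spin_frame U g s.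
Hypothesis Gam_LC : spin_connection U g s Gam Gam'.
Hypothesis o_smooth : forall A, smoothC U (fun x => o x A).
Hypothesis o_J : represents U g J s o.
Hypothesis o_scaling : shear_scaled U g s Gam o.
Implicit Types (u w : 'I_4 -> R[i]) (x : 'rV[R]_4) (a b c d : 'I_4) (A B : 'I_2).
Notation j0 := (ord0 : 'I_2).
Notation j1 := (ord_max : 'I_2).
Notation io := (fun x => dagger (o x)).
Notation tv := (spinor_vec g s).
Notation fv := (frame_vec s).

Lemma frame_spinor_vec psi x A' B B' : U x ->
  fv (tv psi x A') x B B' = psi B * (A' == B')%:R.
Proof.
move=> Ux; rewrite /frame_vec /spinor_vec.
transitivity (\sum_A psi A * \sum_a inv_frame g s x a A A' * s x a B B').
  under eq_bigr do rewrite mulr_suml; rewrite exchange_big /=.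
  apply: eq_bigr => A _; rewrite mulr_sumr; apply: eq_bigr => a _; ring.
under eq_bigr do rewrite (frame_dual (metric_unit g_metric Ux) (metric_sym g_metric Ux)
  (frame_metric s_frame Ux)).
by rewrite !sum_ord2; elim/ord2_ind: B; rewrite /= ?mulr0 ?addr0 ?add0r.
Qed.

Lemma spinor_vec_conj psi x a : U x ->
  (tv psi x j0 a)^*%C = tv (dagger psi) x j1 a /\
  (tv psi x j1 a)^*%C = - tv (dagger psi) x j0 a.
Proof.
move=> Ux; have [e0 e1] := inv_frame_real g (frame_real s_frame Ux) a.
have e2 : ((inv_frame g s x a j1 j0)^*)%C = - inv_frame g s x a j0 j1.
  by apply: (canRL opprK); rewrite -conjcN -e1 conjcK.
have e3 : ((inv_frame g s x a j1 j1)^*)%C = inv_frame g s x a j0 j0.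
  by rewrite -e0 conjcK.
have [d0 d1] := daggerE psi.
by rewrite /spinor_vec !sum_ord2 d0 d1 !conjcD !conjcM e0 e1 e2 e3; split; ring.
Qed.

Lemma chiE x : chi o x = o x j0 * io x j1 - o x j1 * io x j0.
Proof. by rewrite /chi sum_ord2; have [-> ->] := lowerE (o x); ring. Qed.

(** If chi were 0, its inverse would be 0 by convention and the formula representing [J] would give
    J = 0, against J^2 = -1. *)
Lemma chi_neq0 x : U x -> chi o x != 0.
Proof.
move=> Ux; apply/eqP => c0.
have J0 : J x = 0.
  apply/matrixP => a b; rewrite mxE; apply: (@complexI R).
  rewrite (o_J a b Ux) c0 invr0 rmorph0.
  do 4 (apply: big1 => ? _); ring.
have [_ /(_ x Ux)[+ _]] := J_orthogonal.
rewrite J0 mul0mx => /matrixP /(_ ord0 ord0); rewrite !mxE /= => /eqP.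
by rewrite eq_sym oppr_eq0 oner_eq0.
Qed.

Lemma smoothC_dagger A : smoothC U (fun x => io x A).
Proof.
elim/ord2_ind: A.
  apply: (@smoothC_eq _ _ (fun y => - ((o y j1)^*)%C)) => //.
  by apply: smoothC_N => //; exact: smoothC_conj.
apply: (@smoothC_eq _ _ (fun y => ((o y j0)^*)%C)) => //; exact: smoothC_conj.
Qed.

Lemma smoothC_chi : smoothC U (chi o).
Proof.
apply: (@smoothC_eq _ _ (fun y => o y j0 * io y j1 + - (o y j1 * io y j0))) => //.
  by move=> y _; rewrite chiE.
apply: smoothC_D => //; last apply: smoothC_N => //.
  exact: smoothC_M U_open (o_smooth _) (smoothC_dagger _).
exact: smoothC_M U_open (o_smooth _) (smoothC_dagger _).
Qed.

Lemma smoothC_invchi : smoothC U (fun y => (chi o y)^-1).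
Proof. apply: smoothC_V U_open _ smoothC_chi => y; exact: chi_neq0. Qed.

Lemma conn_traceless G u x : preserves_eps U G -> U x -> conn G u x j1 j1 = - conn G u x j0 j0.
Proof.
move=> epsG Ux; rewrite /conn -sumrN; apply: eq_bigr => a _.
have := epsG x a j0 j1 Ux; rewrite !sum_ord2 !eps2E => H.
by rewrite -mulrN; congr (_ * _); apply: subr0_eq; rewrite -[RHS]H; ring.
Qed.

Lemma frame_free x (k : 'I_2 -> 'I_2 -> R[i]) : U x ->
  (forall b, \sum_B \sum_B' k B B' * s x b B B' = 0) -> forall A A', k A A' = 0.
Proof.
move=> Ux H A A'.
transitivity (\sum_b inv_frame g s x b A A' * \sum_B \sum_B' k B B' * s x b B B'); last first.
  by apply: big1 => b _; rewrite H mulr0.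
transitivity (\sum_B \sum_B' k B B' * \sum_b inv_frame g s x b A A' * s x b B B').
  under eq_bigr do under eq_bigr do rewrite (frame_dual (metric_unit g_metric Ux)
    (metric_sym g_metric Ux) (frame_metric s_frame Ux)).
  by rewrite !sum_ord2; elim/ord2_ind: A; elim/ord2_ind: A';
    rewrite /= ?(mulr0, mulr1, addr0, add0r).
rewrite !sum_ord2 !mulr_sumr -!big_split; apply: eq_bigr => b _ /=.
by rewrite !sum_ord2; ring.
Qed.

Lemma frame_free4 x (k0 k1 k2 k3 : R[i]) : U x ->
  (forall b, k0 * s x b j0 j0 + k1 * s x b j0 j1 + k2 * s x b j1 j0 + k3 * s x b j1 j1 = 0) ->
  [/\ k0 = 0, k1 = 0, k2 = 0 & k3 = 0].
Proof.
move=> Ux H; pose k (B B' : 'I_2) :=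
  if B == j0 then if B' == j0 then k0 else k1 else if B' == j0 then k2 else k3.
have kz A A' : k A A' = 0.
  by apply: (frame_free (k := k) Ux) => b; rewrite !sum_ord2 -[RHS](H b) /k /=; ring.
by split; [exact: (kz j0 j0)|exact: (kz j0 j1)|exact: (kz j1 j0)|exact: (kz j1 j1)].
Qed.

(** The connection takes values in su(2), that is, it commutes with [dagger]. The Christoffel part
    of the derivative of the frame satisfies the same reality condition as the frame; conjugating it
    and comparing coefficients in the independent frame gives relations between [Gam], [Gam'] and
    their conjugates. *)
Let Gam_real x a : U x -> (Gam x a j0 j0)^*%C = - Gam x a j0 j0 /\
  (Gam x a j1 j0)^*%C = - Gam x a j0 j1.
Proof.
move=> Ux; have [epsG epsG' H] := Gam_LC.
have tr G : preserves_eps U G -> G x a j1 j1 = - G x a j0 j0.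
  move=> /(_ x a j0 j1 Ux); rewrite !sum_ord2 !eps2E => H'.
  by apply: subr0_eq; rewrite -[RHS]H'; ring.
have {}tr' := tr _ epsG'; have {}tr := tr _ epsG.
pose T b A A' := pdC a (fun y => s y b A A') x
        - \sum_c (christoffel g x c a b)%:C * s x c A A'.
have {}H b A A' : T b A A' = - (\sum_B Gam x a A B * s x b B A') -
    \sum_B' Gam' x a A' B' * s x b A B'.
  by apply: subr0_eq; rewrite -[RHS](H x a b A A' Ux) /T; ring.
have [s0 s1] : (forall b, (T b j0 j0)^*%C = T b j1 j1) /\
    forall b, (T b j0 j1)^*%C = - T b j1 j0.
  have sE c := s_realE (frame_real s_frame Ux) c.
  have chrE (f h : 'I_4 -> R[i]) b : (forall c, (f c)^*%C = h c) ->
      (\sum_c (christoffel g x c a b)%:C * f c)^*%C =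
      \sum_c (christoffel g x c a b)%:C * h c.
    by move=> fh; rewrite conjc_sum; apply: eq_bigr => c _; rewrite conjcM conjc_real fh.
  have pdE b B B' (h : 'rV[R]_4 -> R[i]) : (forall y, U y -> (s y b B B')^*%C = h y) ->
      (pdC a (fun y => s y b B B') x)^*%C = pdC a h x.
    move=> fh; rewrite -(pdC_conj a (smoothC_diffC (smoothC_frame s_frame b B B') Ux)).
    exact: (pdC_eq a U_open Ux fh).
  split=> b; rewrite /T conjcD conjcN.
    rewrite (pdE b j0 j0 (fun y => s y b j1 j1)); last first.
      by move=> y Uy; have [-> _] := s_realE (frame_real s_frame Uy) b.
    rewrite (chrE (fun c => s x c j0 j0) (fun c => s x c j1 j1)) // => c.
    by have [-> _] := sE c.
  rewrite (pdE b j0 j1 (fun y => - s y b j1 j0)); last first.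
    by move=> y Uy; have [_ [-> _]] := s_realE (frame_real s_frame Uy) b.
  rewrite (chrE (fun c => s x c j0 j1) (fun c => - s x c j1 j0)); last first.
    by move=> c; have [_ [-> _]] := sE c.
  rewrite (pdC_N a (smoothC_diffC (smoothC_frame s_frame b j1 j0) Ux)) opprD.
  by congr (_ + _); rewrite opprK -sumrN; apply: eq_bigr => c _; rewrite mulrN opprK.
have [_ k1 _ k3] : [/\ 0 = 0 :> R[i], (Gam x a j0 j1)^*%C + Gam x a j1 j0 = 0,
    (Gam' x a j0 j1)^*%C + Gam' x a j1 j0 = 0 &
    - (Gam x a j0 j0)^*%C - (Gam' x a j0 j0)^*%C - Gam x a j0 j0 - Gam' x a j0 j0 = 0].
  apply: (frame_free4 Ux) => b; have [e0 [e1 [e2 e3]]] := s_realE (frame_real s_frame Ux) b.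
  have /eqP := s0 b; rewrite -subr_eq0 => /eqP e; rewrite -[RHS]e !H !sum_ord2.
  by rewrite !(conjcN, conjcD, conjcM) e0 e1 e2 tr tr'; ring.
have [l0 _ l2 _] : [/\ (Gam x a j0 j1)^*%C + Gam x a j1 j0 = 0, 0 = 0 :> R[i],
    - (Gam x a j0 j0)^*%C + (Gam' x a j0 j0)^*%C - Gam x a j0 j0 + Gam' x a j0 j0 = 0 &
    (Gam' x a j1 j0)^*%C + Gam' x a j0 j1 = 0].
  apply: (frame_free4 Ux) => b; have [e0 [e1 [e2 e3]]] := s_realE (frame_real s_frame Ux) b.
  have /eqP := s1 b; rewrite -subr_eq0 => /eqP e; rewrite -[RHS]oppr0 -[in RHS]e !H !sum_ord2.
  by rewrite !(conjcN, conjcD, conjcM) e0 e1 e3 tr tr' conjcN; ring.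
split.
  apply/eqP; rewrite -subr_eq0 opprK; apply/eqP.
  (* One relation gives the sum of the real parts of [Gam] and [Gam'], the other their difference;
     together they separate the two connections. *)
  have : ((Gam x a j0 j0)^*%C + Gam x a j0 j0) *+ 2 = 0.
    by rewrite -[RHS]oppr0 -[X in - X](addr0 0) -{1}k3 -l2 mulr2n; ring.
  by move/eqP; rewrite mulrn_eq0 => /eqP.
apply: (canRL opprK); rewrite -conjcN; apply: (canLR (@conjcK _)).
by apply/eqP; rewrite eq_sym -addr_eq0 l0.
Qed.

Lemma conn_real u x : U x ->
  (conn Gam u x j0 j0)^*%C = - conn Gam (fun a => (u a)^*%C) x j0 j0 /\
  (conn Gam u x j1 j0)^*%C = - conn Gam (fun a => (u a)^*%C) x j0 j1.
Proof.
move=> Ux; rewrite /conn !conjc_sum -!sumrN.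
by split; apply: eq_bigr => a _; have [e0 e1] := Gam_real a Ux;
  rewrite conjcM ?e0 ?e1 mulrN.
Qed.

Definition nab u (psi : 'rV[R]_4 -> 'I_2 -> R[i]) x B : R[i] :=
  dirC u (fun y => psi y B) x + \sum_C conn Gam u x B C * psi x C.

Lemma nabN u psi x B : nab (fun a => - u a) psi x B = - nab u psi x B.
Proof.
have cN C : conn Gam (fun a => - u a) x B C = - conn Gam u x B C.
  by rewrite /conn -sumrN; apply: eq_bigr => a _; rewrite mulNr.
rewrite /nab !sum_ord2 !cN (_ : dirC _ _ _ = - dirC u (fun y => psi y B) x); first by ring.
by rewrite /dirC -sumrN; apply: eq_bigr => a _; rewrite mulNr.
Qed.

(** The scaling condition with the index raised; as [Gam] is trace-free, raising and lowering
    commute with the derivative. *)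
Lemma nab_o x A' B : U x -> nab (tv (o x) x A') o x B = 0.
Proof.
move=> Ux; have H C := o_scaling A' C Ux.
have {}H C : \sum_a tv (o x) x A' a * nabla_low Gam (fun y => lower (o y)) x a C = 0.
  rewrite -[RHS](H C) exchange_big /=; apply: eq_bigr => a _.
  by rewrite /spinor_vec mulr_suml.
move: (tv _ _ _) H => u H.
have [epsG _ _] := Gam_LC; have tr := conn_traceless u epsG Ux.
have {}H C : dirC u (fun y => lower (o y) C) x - \sum_D conn Gam u x D C * lower (o x) D = 0.
  rewrite -[RHS](H C) /nabla_low /dirC.
  rewrite (_ : \sum_D conn Gam u x D C * lower (o x) D = \sum_a u a * \sum_D Gam x a D C * lower (o x) D).
    by rewrite -sumrB; apply: eq_bigr => a _; rewrite mulrBr.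
  transitivity (\sum_D \sum_a u a * Gam x a D C * lower (o x) D).
    by apply: eq_bigr => D _; rewrite mulr_suml.
  rewrite exchange_big /=.
  by apply: eq_bigr => a _; rewrite mulr_sumr; apply: eq_bigr => D _; rewrite mulrA.
have [l0 l1] := lowerE (o x).
have [H0 H1] := (H j0, H j1); move: H0 H1; rewrite !sum_ord2 l0 l1.
rewrite (dirC_eq (h := fun y => - o y j1) u U_open Ux); last first.
  by move=> y _; have [-> _] := lowerE (o y).
rewrite (dirC_eq (f := fun y => lower (o y) j1) (h := fun y => o y j0) u U_open Ux); last first.
  by move=> y _; have [_ ->] := lowerE (o y).
rewrite (dirC_N u (o_smooth j1) Ux) tr => H0 H1.
rewrite /nab; elim/ord2_ind: B; rewrite sum_ord2 ?tr.
  by rewrite -[RHS]H1; ring.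
by rewrite -[RHS]oppr0 -H0; ring.
Qed.

Lemma nab_dagger u x : U x -> nab u io x =1 dagger (nab (fun a => (u a)^*%C) o x).
Proof.
move=> Ux; pose v a := ((u a)^*)%C.
have uE : u = fun a => ((v a)^*)%C by apply/funext => a; rewrite conjcK.
have [c0 c1] := conn_real v Ux; rewrite -uE in c0 c1.
have [epsG _ _] := Gam_LC; have trv := conn_traceless v epsG Ux.
have tru := conn_traceless u epsG Ux.
have [d0 d1] := daggerE (o x); have [e0 e1] := daggerE (nab v o x).
rewrite -/v; apply: ord2_ind; rewrite /nab ?e0 ?e1 /nab !sum_ord2 d0 d1 !conjcD !conjcM.
  rewrite trv conjcN c0 c1 (dirC_eq (h := fun y => - ((o y j1)^*)%C) u U_open Ux) //.
  rewrite (dirC_N u (smoothC_conj U_open (o_smooth j1)) Ux) (dirC_conj u (o_smooth j1) Ux).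
  by rewrite -/v; ring.
have c2 : (conn Gam v x j0 j1)^*%C = - conn Gam u x j1 j0.
  have [_ /(congr1 (fun z => - (z^*)%C))] := conn_real u Ux.
  by rewrite conjcN opprK conjcK => <-.
rewrite c0 c2 tru (dirC_eq (h := fun y => ((o y j0)^*)%C) u U_open Ux) //.
rewrite (dirC_conj u (o_smooth j0) Ux) -/v; ring.
Qed.

(** Conjugation takes o^A e_A0' to iota^A e_A1' and o^A e_A1' to -iota^A e_A0', so this is the
    conjugate of [nab_o] with the primed index exchanged. *)
Lemma nab_io x A' B : U x -> nab (tv (io x) x A') io x B = 0.
Proof.
move=> Ux; rewrite nab_dagger // (_ : nab _ o x = fun=> 0).
  by elim/ord2_ind: B; rewrite /dagger /= ?num_conjE ?conjc0 ?oppr0.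
apply/funext => C; elim/ord2_ind: A'.
  rewrite (_ : (fun a => _) = fun a => - tv (o x) x j1 a); last first.
    apply/funext => a; have [_ e] := spinor_vec_conj (o x) a Ux.
    by rewrite -[tv (io x) x j0 a]opprK -e conjcN conjcK.
  by rewrite nabN nab_o // oppr0.
rewrite (_ : (fun a => _) = tv (o x) x j0) ?nab_o //.
apply/funext => a; have [e _] := spinor_vec_conj (o x) a Ux.
by rewrite -e conjcK.
Qed.

End SpinorCalculus.

(** * Exterior derivatives of the one-forms beta_A f_A' *)

Section SpinorOneForms.
Context {R : realType}.
Variables (U : set 'rV[R]_4) (g J : 'rV[R]_4 -> 'M[R]_4).
Variables (s Gam Gam' : 'rV[R]_4 -> 'I_4 -> 'M[R[i]]_2) (o : 'rV[R]_4 -> 'I_2 -> R[i]).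
Hypothesis U_open : open U.
Hypothesis g_metric : riemannian_metric U g.
Hypothesis J_orthogonal : orthogonal_almost_complex U g J.
Hypothesis s_frame : spin_frame U g s.
Hypothesis Gam_LC : spin_connection U g s Gam Gam'.
Hypothesis o_smooth : forall A, smoothC U (fun x => o x A).
Hypothesis o_J : represents U g J s o.
Hypothesis o_scaling : shear_scaled U g s Gam o.
Implicit Types (u w : 'I_4 -> R[i]) (x : 'rV[R]_4) (a b c d : 'I_4) (A B : 'I_2).
Notation j0 := (ord0 : 'I_2).
Notation j1 := (ord_max : 'I_2).
Notation io := (fun x => dagger (o x)).
Notation tv := (spinor_vec g s).
Notation fv := (frame_vec s).
Notation nab := (nab Gam).
Let chi0 := chi_neq0 J_orthogonal o_J.
Let s_io := smoothC_dagger U_open o_smooth.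
Let s_ichi := smoothC_invchi U_open J_orthogonal o_smooth o_J.

(* o^A beta_A = 1 and iota^A beta_A = 0, so that the potentials of the theorem
   are the beta_A f_A'. *)
Definition beta x B : R[i] := - (chi o x)^-1 * lower (io x) B.

Lemma betaE x : beta x j0 = (chi o x)^-1 * io x j1 /\ beta x j1 = - (chi o x)^-1 * io x j0.
Proof. by rewrite /beta; have [-> ->] := lowerE (io x); split=> //; ring. Qed.

Lemma beta_o x : U x -> \sum_B o x B * beta x B = 1.
Proof.
move=> Ux; rewrite sum_ord2; have [-> ->] := betaE x.
by rewrite -(mulVf (chi0 Ux)) chiE; ring.
Qed.

Lemma beta_io x : \sum_B io x B * beta x B = 0.
Proof. by rewrite sum_ord2; have [-> ->] := betaE x; ring. Qed.

Lemma smoothC_beta B : smoothC U (fun x => beta x B).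
Proof.
elim/ord2_ind: B.
  apply: (smoothC_eq U_open _ (smoothC_M U_open s_ichi (s_io j1))) => y _.
  by have [-> _] := betaE y.
apply: (smoothC_eq U_open _ (smoothC_N U_open (smoothC_M U_open s_ichi (s_io j0)))) => y _.
by have [_ ->] := betaE y; ring.
Qed.

(** Minus the coefficient of o in nabla_u psi; when psi^B beta_B is constant it equals psi^B nabla_u
    beta_B. *)
Definition beta_nab u (psi : 'rV[R]_4 -> 'I_2 -> R[i]) x : R[i] :=
  - \sum_B beta x B * nab u psi x B.

Definition nab' u (f : 'rV[R]_4 -> 'I_2 -> R[i]) x B' : R[i] :=
  dirC u (fun y => f y B') x - \sum_C' conn Gam' u x C' B' * f x C'.

Lemma sum_frame_spinor_vec x psi D' (k : 'I_2 -> 'I_2 -> R[i]) : U x ->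
  \sum_B \sum_C' fv (tv psi x D') x B C' * k B C' = \sum_B psi B * k B D'.
Proof.
move=> Ux; apply: eq_bigr => B _.
rewrite sum_ord2 !(frame_spinor_vec g_metric s_frame) //.
by elim/ord2_ind: D'; rewrite /= ?mulr1 ?mulr0 ?mul0r ?addr0 ?add0r.
Qed.

(* The covariant derivative of beta_B f_B' contracted with psi^B, when
   psi^B beta_B is a constant k: the derivative falls on psi. *)
Lemma nab_beta_mul u x psi k f B' : U x ->
  (forall B, smoothC U (fun y => psi y B)) -> (forall B', smoothC U (fun y => f y B')) ->
  (forall y, U y -> \sum_B psi y B * beta y B = k) ->
  \sum_B psi x B * (dirC u (fun y => beta y B * f y B') x
    - \sum_C conn Gam u x C B * (beta x C * f x B')
    - \sum_C' conn Gam' u x C' B' * (beta x B * f x C')) =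
  beta_nab u psi x * f x B' + k * nab' u f x B'.
Proof.
move=> Ux sp sf psik.
have : dirC u (fun y => psi y j0 * beta y j0 + psi y j1 * beta y j1) x = 0.
  rewrite -(dirC_cst u k x); apply: (dirC_eq u U_open Ux) => y Uy.
  by rewrite -(psik y Uy) sum_ord2.
rewrite (dirC_D u (smoothC_M U_open (sp j0) (smoothC_beta j0))
  (smoothC_M U_open (sp j1) (smoothC_beta j1)) Ux).
rewrite (dirC_M u (sp j0) (smoothC_beta j0) Ux) (dirC_M u (sp j1) (smoothC_beta j1) Ux).
rewrite -{1}(psik x Ux) /beta_nab /nab' /nab !sum_ord2.
rewrite (dirC_M u (smoothC_beta j0) (sf B') Ux) (dirC_M u (smoothC_beta j1) (sf B') Ux).
move: (dirC u (fun y => beta y j0) x) (dirC u (fun y => beta y j1) x)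
  (dirC u (fun y => psi y j0) x) (dirC u (fun y => psi y j1) x)
  (dirC u (fun y => f y B') x) (beta x j0) (beta x j1) (psi x j0) (psi x j1)
  => d0 d1 e0 e1 d b0 b1 p0 p1 H.
set r := (X in _ = X).
rewrite -[RHS]addr0 -[X in _ = _ + X](mulr0 (f x B')) -H /r; ring.
Qed.

(** [rho] and [tau] are the coefficients along o of the mixed derivatives, of iota along L_A' and of
    o along N_A', which the scaling of o leaves free. *)
Definition rho x A' := beta_nab (tv (o x) x A') io x.
Definition tau x A' := beta_nab (tv (io x) x A') o x.

Lemma beta_nab_o x A' : U x -> beta_nab (tv (o x) x A') o x = 0.
Proof.
move=> Ux; rewrite /beta_nab big1 ?oppr0// => B _.
by rewrite (nab_o U_open Gam_LC o_smooth o_scaling _ _ Ux) mulr0.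
Qed.

Lemma beta_nab_io x A' : U x -> beta_nab (tv (io x) x A') io x = 0.
Proof.
move=> Ux; rewrite /beta_nab big1 ?oppr0// => B _.
by rewrite (nab_io U_open g_metric s_frame Gam_LC o_smooth o_scaling _ _ Ux) mulr0.
Qed.

Section OneForm.
Variable f : 'rV[R]_4 -> 'I_2 -> R[i].
Hypothesis sf : forall B', smoothC U (fun y => f y B').
Let P b y := \sum_B \sum_B' s y b B B' * (beta y B * f y B').
Let dP x a b := pdC a (P b) x - pdC b (P a) x.

Let dP_spinor x psi1 psi2 k1 k2 A' B' : U x ->
  (forall B, smoothC U (fun y => psi1 y B)) -> (forall B, smoothC U (fun y => psi2 y B)) ->
  (forall y, U y -> \sum_B psi1 y B * beta y B = k1) ->
  (forall y, U y -> \sum_B psi2 y B * beta y B = k2) ->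
  contract (dP x) (tv (psi1 x) x A') (tv (psi2 x) x B') =
  (beta_nab (tv (psi1 x) x A') psi2 x * f x B' + k2 * nab' (tv (psi1 x) x A') f x B') -
  (beta_nab (tv (psi2 x) x B') psi1 x * f x A' + k1 * nab' (tv (psi2 x) x B') f x A').
Proof.
move=> Ux sp1 sp2 k1E k2E.
rewrite -(nab_beta_mul _ B' Ux sp2 sf k2E) -(nab_beta_mul _ A' Ux sp1 sf k1E).
have sp B C' : smoothC U (fun y => beta y B * f y C').
  exact: smoothC_M U_open (smoothC_beta B) (sf C').
pose nb v B C' := dirC v (fun y => beta y B * f y C') x
  - (\sum_C conn Gam v x C B * (beta x C * f x C'))
  - \sum_D' conn Gam' v x D' C' * (beta x B * f x D').
have -> : contract (dP x) (tv (psi1 x) x A') (tv (psi2 x) x B') =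
    (\sum_B \sum_C' fv (tv (psi2 x) x B') x B C' * nb (tv (psi1 x) x A') B C') -
    \sum_B \sum_C' fv (tv (psi1 x) x A') x B C' * nb (tv (psi2 x) x B') B C'.
  exact: (exterior_derivative U_open g_metric s_frame Gam_LC _ _ Ux sp).
by rewrite !sum_frame_spinor_vec.
Qed.

Lemma d_beta_LL x A' B' : U x ->
  contract (dP x) (tv (o x) x A') (tv (o x) x B') =
  nab' (tv (o x) x A') f x B' - nab' (tv (o x) x B') f x A'.
Proof.
move=> Ux; rewrite (dP_spinor _ _ Ux o_smooth o_smooth beta_o beta_o).
by rewrite !beta_nab_o // !mul0r !mul1r !add0r.
Qed.

Lemma d_beta_NN x A' B' : U x ->
  contract (dP x) (tv (io x) x A') (tv (io x) x B') = 0.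
Proof.
move=> Ux; have b0 y : U y -> \sum_B io y B * beta y B = 0 by move=> _; exact: beta_io.
rewrite (dP_spinor _ _ Ux s_io s_io b0 b0).
by rewrite !beta_nab_io // !mul0r !add0r oppr0.
Qed.

Lemma d_beta_LN x A' B' : U x ->
  contract (dP x) (tv (o x) x A') (tv (io x) x B') =
  rho x A' * f x B' - tau x B' * f x A' - nab' (tv (io x) x B') f x A'.
Proof.
move=> Ux; have b0 y : U y -> \sum_B io y B * beta y B = 0 by move=> _; exact: beta_io.
rewrite (dP_spinor _ _ Ux o_smooth s_io beta_o b0).
by rewrite mul0r addr0 mul1r opprD addrA.
Qed.

End OneForm.

Section Clairaut2.
Variable F : 'rV[R]_4 -> R[i].
Hypothesis sF : smoothC U F.
Let q y B B' := \sum_a inv_frame g s y a B B' * pdC a F y.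
Let f y B' := dirC (tv (o y) y B') F y.

(** The identity d(dF) = 0 on the pair L_A', L_B': as o is parallel along these vectors, it can be
    moved inside the covariant derivative of the components [q] of dF. *)
Lemma nab_dir_spinor_sym x A' B' : U x ->
  nab' (tv (o x) x A') f x B' = nab' (tv (o x) x B') f x A'.
Proof.
move=> Ux.
have sq B C' : smoothC U (fun y => q y B C').
  apply: smoothC_sum => // a _; apply: smoothC_M => //; last exact: smoothC_pdC.
  exact: (smoothC_inv_frame U_open g_metric s_frame).
have fE y C' : f y C' = \sum_B o y B * q y B C'.
  rewrite /f /q /dirC /spinor_vec !sum_ord2 !mulr_sumr -big_split.
  by apply: eq_bigr => a _ /=; rewrite !sum_ord2; ring.
have PE b y : U y -> \sum_B \sum_B' s y b B B' * q y B B' = pdC b F y.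
  move=> Uy; transitivity (\sum_a (b == a)%:R * pdC a F y); last first.
    rewrite (bigD1 b)//= eqxx mul1r big1 ?addr0// => a ab.
    by rewrite eq_sym (negPf ab) mul0r.
  under [RHS]eq_bigr do rewrite -(frame_complete (metric_unit g_metric Uy)
    (metric_sym g_metric Uy) (frame_metric s_frame Uy)).
  rewrite /q !sum_ord2 !mulr_sumr -!big_split; apply: eq_bigr => a _ /=.
  by rewrite !sum_ord2; ring.
pose nb v B C' := dirC v (fun y => q y B C') x
  - (\sum_C conn Gam v x C B * q x C C')
  - \sum_D' conn Gam' v x D' C' * q x B D'.
have nbE C' D' : \sum_B o x B * nb (tv (o x) x C') B D' = nab' (tv (o x) x C') f x D'.
  have n B := nab_o U_open Gam_LC o_smooth o_scaling C' B Ux.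
  move: (tv _ _ _) n => u n.
  rewrite /nab' (dirC_eq (h := fun y => o y j0 * q y j0 D' + o y j1 * q y j1 D') u U_open Ux);
    last by move=> y _; rewrite fE sum_ord2.
  rewrite (dirC_D u (smoothC_M U_open (o_smooth j0) (sq j0 D'))
    (smoothC_M U_open (o_smooth j1) (sq j1 D')) Ux).
  rewrite (dirC_M u (o_smooth j0) (sq j0 D') Ux) (dirC_M u (o_smooth j1) (sq j1 D') Ux).
  have [n0 n1] := (n j0, n j1); move: n0 n1; rewrite /nab /nb !sum_ord2 !fE !sum_ord2.
  move: (dirC u (fun y => q y j0 D') x) (dirC u (fun y => q y j1 D') x)
    (dirC u (fun y => o y j0) x) (dirC u (fun y => o y j1) x) (q x j0 j0) (q x j0 j1)
    (q x j1 j0) (q x j1 j1) (q x j0 D') (q x j1 D')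
    (conn Gam u x) (conn Gam' u x) (o x j0) (o x j1)
    => d0 d1 e0 e1 q00 q01 q10 q11 q0 q1 c c' o0 o1 n0 n1.
  (* The two sides differ by the terms with a derivative of o, which are multiples of the components
     of nabla o = 0. *)
  rewrite -[LHS]addr0 -[X in _ + X](mulr0 q0) -n0 -[LHS]addr0 -[X in _ + X](mulr0 q1) -n1.
  by ring.
apply/eqP; rewrite -subr_eq0 -!nbE; apply/eqP.
rewrite -(sum_frame_spinor_vec _ B' (nb (tv (o x) x A')) Ux).
rewrite -(sum_frame_spinor_vec _ A' (nb (tv (o x) x B')) Ux).
rewrite -[LHS](exterior_derivative U_open g_metric s_frame Gam_LC _ _ Ux sq).
rewrite /contract big1 // => a _; rewrite big1 // => b _.
rewrite (pdC_eq a U_open Ux (PE b)) (pdC_eq b U_open Ux (PE a)).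
by rewrite (pdC_comm a b U_open sF Ux) subrr mulr0.
Qed.

End Clairaut2.
End SpinorOneForms.

(** * Closedness of phi^2 kappa and the derivatives of chi and phi *)

Section ConformalFactor.
Context {R : realType}.
Variables (U : set 'rV[R]_4) (g J : 'rV[R]_4 -> 'M[R]_4) (phi : 'rV[R]_4 -> R).
Variables (s Gam Gam' : 'rV[R]_4 -> 'I_4 -> 'M[R[i]]_2) (o : 'rV[R]_4 -> 'I_2 -> R[i]).
Hypothesis U_open : open U.
Hypothesis g_metric : riemannian_metric U g.
Hypothesis J_orthogonal : orthogonal_almost_complex U g J.
Hypothesis phi_kahler : conformally_kahler_factor U g J phi.
Hypothesis s_frame : spin_frame U g s.
Hypothesis Gam_LC : spin_connection U g s Gam Gam'.
Hypothesis o_smooth : forall A, smoothC U (fun x => o x A).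
Hypothesis o_J : represents U g J s o.
Hypothesis o_scaling : shear_scaled U g s Gam o.
Implicit Types (u v w : 'I_4 -> R[i]) (x : 'rV[R]_4) (a b c d : 'I_4) (A B C D : 'I_2).
Notation j0 := (ord0 : 'I_2).
Notation j1 := (ord_max : 'I_2).
Notation io := (fun x => dagger (o x)).
Notation tv := (spinor_vec g s).
Notation fv := (frame_vec s).
Notation nab := (nab Gam).
Notation beta_nab := (beta_nab Gam o).
Let chi0 := chi_neq0 J_orthogonal o_J.
Let s_chi := smoothC_chi U_open o_smooth.
Let s_io := smoothC_dagger U_open o_smooth.
Let s_ichi := smoothC_invchi U_open J_orthogonal o_smooth o_J.
Let s_s := smoothC_frame s_frame.

Section TwoForm.
Variable K : 'rV[R]_4 -> 'I_2 -> 'I_2 -> R[i].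
Hypothesis sK : forall B C, smoothC U (fun y => K y B C).

Let k y b c := \sum_B \sum_C K y B C * (s y b B j0 * s y c C j1 - s y b B j1 * s y c C j0).

Let T x a b c := pdC a (fun y => k y b c) x
  - (\sum_d (christoffel g x d a b)%:C * k x d c)
  - \sum_d (christoffel g x d a c)%:C * k x b d.

Let nabK x a B C := pdC a (fun y => K y B C) x
  - (\sum_D Gam x a D B * K x D C) - \sum_D Gam x a D C * K x B D.

(** [T] is nabla_a k_bc and [nabK] is nabla_a K_BC: the frame is parallel, and the trace-free [Gam']
    preserves the factor eps_B'C'. *)
Let T_nabK x a b c : U x -> T x a b c =
  \sum_B \sum_C nabK x a B C * (s x b B j0 * s x c C j1 - s x b B j1 * s x c C j0).
Proof.
move=> Ux; have [_ epsG' H] := Gam_LC.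
have tr' : Gam' x a j1 j1 = - Gam' x a j0 j0.
  have := epsG' x a j0 j1 Ux; rewrite !sum_ord2 !eps2E => H'.
  by apply: subr0_eq; rewrite -[RHS]H'; ring.
pose X b B B' := \sum_c (christoffel g x c a b)%:C * s x c B B'.
have {}H e B B' : pdC a (fun y => s y e B B') x = X e B B' -
    (\sum_C Gam x a B C * s x e C B') - \sum_C' Gam' x a B' C' * s x e B C'.
  by apply: subr0_eq; rewrite -[RHS](H x a e B B' Ux) /X; ring.
have d3 B C B' C' : pdC a (fun y => K y B C * (s y b B B' * s y c C C')) x =
    pdC a (fun y => K y B C) x * (s x b B B' * s x c C C') + K x B C *
    (pdC a (fun y => s y b B B') x * s x c C C' + s x b B B' * pdC a (fun y => s y c C C') x).
  have sm := smoothC_M U_open (s_s b B B') (s_s c C C').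
  rewrite (pdC_M a (smoothC_diffC (sK B C) Ux) (smoothC_diffC sm Ux)); congr (_ + _ * _).
  exact: (pdC_M a (smoothC_diffC (s_s b B B') Ux) (smoothC_diffC (s_s c C C') Ux)).
have dd B C B' C' : diffC (fun y => K y B C * (s y b B B' * s y c C C')) x.
  apply: (diffC_M (smoothC_diffC (sK B C) Ux)).
  exact: (diffC_M (smoothC_diffC (s_s b B B') Ux) (smoothC_diffC (s_s c C C') Ux)).
have dk : pdC a (fun y => k y b c) x = \sum_B \sum_C
    (pdC a (fun y => K y B C * (s y b B j0 * s y c C j1)) x -
     pdC a (fun y => K y B C * (s y b B j1 * s y c C j0)) x).
  transitivity (pdC a (fun y => \sum_B \sum_C (K y B C * (s y b B j0 * s y c C j1) +
      - (K y B C * (s y b B j1 * s y c C j0)))) x).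
    apply: (pdC_eq a U_open Ux) => y _; apply: eq_bigr => B _; apply: eq_bigr => C _.
    by rewrite mulrBr.
  rewrite pdC_sum => [|B _].
    apply: eq_bigr => B _; rewrite pdC_sum => [|C _].
      apply: eq_bigr => C _; rewrite (pdC_D a (dd _ _ _ _) (diffC_N (dd _ _ _ _))).
      by rewrite (pdC_N a (dd _ _ _ _)).
    exact: (diffC_D (dd _ _ _ _) (diffC_N (dd _ _ _ _))).
  apply: diffC_sum => C _; exact: (diffC_D (dd _ _ _ _) (diffC_N (dd _ _ _ _))).
have X1 : \sum_d (christoffel g x d a b)%:C * k x d c =
    \sum_B \sum_C K x B C * (X b B j0 * s x c C j1 - X b B j1 * s x c C j0).
  rewrite /k /X !sum_ord2 !mulr_suml -!sumrB !mulr_sumr -!big_split.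
  by apply: eq_bigr => d _; rewrite !sum_ord2 /=; ring.
have X2 : \sum_d (christoffel g x d a c)%:C * k x b d =
    \sum_B \sum_C K x B C * (s x b B j0 * X c C j1 - s x b B j1 * X c C j0).
  rewrite /k /X !sum_ord2 !mulr_sumr -!sumrB !mulr_sumr -!big_split.
  by apply: eq_bigr => d _; rewrite !sum_ord2 /=; ring.
rewrite /T dk X1 X2 /nabK.
under eq_bigr do under eq_bigr do rewrite !d3 !H.
rewrite !sum_ord2 !tr'.
move: (X b) (X c) (s x b) (s x c) (Gam x a) (Gam' x a) => Xb Xc sb sc G G'.
move: (pdC a (fun y => K y j0 j0) x) (pdC a (fun y => K y j0 j1) x)
  (pdC a (fun y => K y j1 j0) x) (pdC a (fun y => K y j1 j1) x) => k0 k1 k2 k3.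
move: (K x j0 j0) (K x j0 j1) (K x j1 j0) (K x j1 j1) => K0 K1 K2 K3.
move: (sb j0 j0) (sb j0 j1) (sb j1 j0) (sb j1 j1) => b0 b1 b2 b3.
move: (sc j0 j0) (sc j0 j1) (sc j1 j0) (sc j1 j1) => c0 c1 c2 c3.
move: (Xb j0 j0) (Xb j0 j1) (Xb j1 j0) (Xb j1 j1) => X0 X1' X2' X3.
move: (Xc j0 j0) (Xc j0 j1) (Xc j1 j0) (Xc j1 j1) => Y0 Y1 Y2 Y3.
move: (G j0 j0) (G j0 j1) (G j1 j0) (G j1 j1) => G0 G1 G2 G3.
move: (G' j0 j0) (G' j0 j1) (G' j1 j0) => H0 H1 H2.
ring.
Qed.

Hypothesis K_sym : forall y B C, K y B C = K y C B.
Hypothesis k_closed : forall x a b c, U x ->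
  pdC a (fun y => k y b c) x + pdC b (fun y => k y c a) x + pdC c (fun y => k y a b) x = 0.

Let kN y b c : k y b c = - k y c b.
Proof. by rewrite /k !sum_ord2 !(K_sym y j1 j0); ring. Qed.

(** For a symmetric connection, the cyclic sum of nabla k agrees with that of the partial
    derivatives, the Christoffel terms cancelling in pairs. *)
Let T_cyclic x a b c : U x -> T x a b c + T x b c a + T x c a b = 0.
Proof.
move=> Ux; have cs d e f := christoffel_sym U_open g_metric d e f Ux.
have aux (p1 p2 p3 s1 s2 s3 s4 s5 s6 : R[i]) : p1 + p2 + p3 = 0 ->
    s1 + s2 + s3 + s4 + s5 + s6 = 0 ->
    p1 - s1 - s2 + (p2 - s3 - s4) + (p3 - s5 - s6) = 0.
  by move=> p0 s0; rewrite -[RHS]subr0 -{1}p0 -s0; ring.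
apply: (aux _ _ _ _ _ _ _ _ _ (k_closed a b c Ux)).
rewrite -!big_split big1 // => d _ /=.
rewrite (cs d b a) (cs d c a) (cs d c b) (kN x c d) (kN x b d) (kN x a d).
move: (k x d c) (k x d b) (k x d a) => k1 k2 k3; ring.
Qed.

Definition nab2 u x B C := dirC u (fun y => K y B C) x
  - (\sum_D conn Gam u x D B * K x D C) - \sum_D conn Gam u x D C * K x B D.

Let contractZ e k' u w : contract (fun a b => e * k' a b) u w = e * contract k' u w.
Proof.
rewrite /contract mulr_sumr; apply: eq_bigr => a _; rewrite mulr_sumr.
by apply: eq_bigr => b _; rewrite mulrCA.
Qed.

Let T_contract x u v w : U x ->
  \sum_a u a * contract (T x a) v w =
  \sum_B \sum_C nab2 u x B C * (fv v x B j0 * fv w x C j1 - fv v x B j1 * fv w x C j0).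
Proof.
move=> Ux.
have nE B C : nab2 u x B C = \sum_a u a * nabK x a B C.
  rewrite /nab2 /dirC /conn !sum_ord2 !mulr_suml -!big_split -!sumrB /=.
  by apply: eq_bigr => a _; rewrite /nabK !sum_ord2; ring.
under [RHS]eq_bigr do under eq_bigr do rewrite nE.
transitivity (\sum_a u a * \sum_B \sum_C nabK x a B C *
    (fv v x B j0 * fv w x C j1 - fv v x B j1 * fv w x C j0)).
  apply: eq_bigr => a _; congr (_ * _).
  rewrite (_ : T x a = fun b c => \sum_B \sum_C nabK x a B C *
      (s x b B j0 * s x c C j1 - s x b B j1 * s x c C j0)); last first.
    by apply/funext => b; apply/funext => c; rewrite T_nabK.
  rewrite contract_sum; apply: eq_bigr => B _; rewrite contract_sum; apply: eq_bigr => C _.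
  by rewrite contractZ contractB !contract_rank1.
move: (fv v x) (fv w x) => V W.
rewrite !sum_ord2 !mulr_suml -!big_split; apply: eq_bigr => a _ /=.
by rewrite !sum_ord2; ring.
Qed.

Lemma nab2_cyclic x u v w : U x ->
  let F u v w := \sum_B \sum_C
    nab2 u x B C * (fv v x B j0 * fv w x C j1 - fv v x B j1 * fv w x C j0) in
  F u v w + F v w u + F w u v = 0.
Proof.
move=> Ux /=; rewrite -!T_contract // /contract.
have E (f : 'I_4 -> 'I_4 -> 'I_4 -> R[i]) : \sum_a \sum_b \sum_c f a b c = \sum_c \sum_a \sum_b f a b c.
  by rewrite exchange_big /=; under eq_bigr do rewrite exchange_big /=; rewrite exchange_big /=;
    under eq_bigr do rewrite exchange_big /=.
have e1 : \sum_b v b * \sum_c \sum_a w c * u a * T x b c a =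
    \sum_a \sum_b \sum_c v b * (w c * u a * T x b c a).
  rewrite -E; apply: eq_bigr => b _; rewrite mulr_sumr; apply: eq_bigr => c _.
  by rewrite mulr_sumr.
have e2 : \sum_c w c * \sum_a \sum_b u a * v b * T x c a b =
    \sum_a \sum_b \sum_c w c * (u a * v b * T x c a b).
  rewrite E; apply: eq_bigr => c _; rewrite mulr_sumr; apply: eq_bigr => a _.
  by rewrite mulr_sumr.
rewrite e1 e2 -!big_split big1 // => a _ /=; rewrite mulr_sumr -!big_split big1 // => b _ /=.
rewrite !mulr_sumr -!big_split big1 // => c _ /=.
move: (T x a b c) (T x b c a) (T x c a b) (T_cyclic a b c Ux) => t1 t2 t3 t0.
by rewrite -[RHS](mulr0 (u a * v b * w c)) -t0; ring.
Qed.

Lemma nab2_leibniz x u psi xi : U x ->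
  (forall B, smoothC U (fun y => psi y B)) -> (forall B, smoothC U (fun y => xi y B)) ->
  \sum_B \sum_C psi x B * xi x C * nab2 u x B C =
  dirC u (fun y => \sum_B \sum_C psi y B * xi y C * K y B C) x
  - (\sum_B \sum_C nab u psi x B * xi x C * K x B C)
  - \sum_B \sum_C psi x B * nab u xi x C * K x B C.
Proof.
move=> Ux sp sx.
have sm B C := smoothC_M U_open (sp B) (sx C).
have sm3 B C := smoothC_M U_open (sm B C) (sK B C).
have dE B C : dirC u (fun y => psi y B * xi y C * K y B C) x =
    (dirC u (fun y => psi y B) x * xi x C + psi x B * dirC u (fun y => xi y C) x) * K x B C
    + psi x B * xi x C * dirC u (fun y => K y B C) x.
  by rewrite (dirC_M u (sm B C) (sK B C) Ux) (dirC_M u (sp B) (sx C) Ux).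
have -> : dirC u (fun y => \sum_B \sum_C psi y B * xi y C * K y B C) x =
    \sum_B \sum_C dirC u (fun y => psi y B * xi y C * K y B C) x.
  rewrite !sum_ord2 -(dirC_D u (sm3 j0 j0) (sm3 j0 j1) Ux) -(dirC_D u (sm3 j1 j0) (sm3 j1 j1) Ux).
  rewrite -(dirC_D u (smoothC_D U_open (sm3 j0 j0) (sm3 j0 j1))
     (smoothC_D U_open (sm3 j1 j0) (sm3 j1 j1)) Ux).
  by apply: (dirC_eq u U_open Ux) => y _; rewrite !sum_ord2.
under [X in _ = X - _ - _]eq_bigr do under eq_bigr do rewrite dE.
rewrite /nab2 /nab !sum_ord2.
move: (dirC u (fun y => K y j0 j0) x) (dirC u (fun y => K y j0 j1) x)
  (dirC u (fun y => K y j1 j0) x) (dirC u (fun y => K y j1 j1) x)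
  (dirC u (fun y => psi y j0) x) (dirC u (fun y => psi y j1) x)
  (dirC u (fun y => xi y j0) x) (dirC u (fun y => xi y j1) x)
  (conn Gam u x) (K x) (psi x) (xi x) => k0 k1 k2 k3 p0 p1 x0 x1 c K' p q.
ring.
Qed.

End TwoForm.

Let phi_smooth : smoothC U (fun y => (phi y)%:C).
Proof. by apply: smoothC_real; have [] := phi_kahler. Qed.

(** [h] is the scale of the symmetric spinor K_BC = h (o_B iota_C + iota_B o_C) for which phi^2
    kappa = K_BC eps_B'C', as [kappaE] verifies. *)
Let h y : R[i] := 'i * ((phi y)%:C * (phi y)%:C) * (chi o y)^-1.

Let K y B C := h y * (lower (o y) B * lower (io y) C + lower (io y) B * lower (o y) C).

Let s_h : smoothC U h.
Proof.
apply: (smoothC_M U_open _ s_ichi); apply: (smoothC_M U_open (smoothC_cst _ _)).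
exact: smoothC_M.
Qed.

Lemma smoothC_lower (psi : 'rV[R]_4 -> 'I_2 -> R[i]) B :
  (forall A, smoothC U (fun y => psi y A)) -> smoothC U (fun y => lower (psi y) B).
Proof.
by move=> sp; apply: smoothC_sum => // A _; apply: (smoothC_M U_open (sp A) (smoothC_cst _ _)).
Qed.

Let s_K B C : smoothC U (fun y => K y B C).
Proof.
have lo D := smoothC_lower D o_smooth; have li D := smoothC_lower D s_io.
apply: (smoothC_M U_open s_h); apply: (smoothC_D U_open).
  exact: (smoothC_M U_open (lo B) (li C)).
exact: (smoothC_M U_open (li B) (lo C)).
Qed.

Lemma lower_frame y A A' b : U y -> \sum_c inv_frame g s y c A A' * (g y c b)%:C =
  \sum_D \sum_D' eps2 A D * eps2 A' D' * s y b D D'.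
Proof.
move=> Uy; under eq_bigr do rewrite (frame_metric s_frame Uy).
transitivity (\sum_C \sum_C' \sum_D \sum_D' eps2 C D * eps2 C' D' * s y b D D' *
   \sum_c inv_frame g s y c A A' * s y c C C').
  rewrite !sum_ord2 !mulr_sumr -!big_split; apply: eq_bigr => c _ /=.
  by rewrite !sum_ord2 !eps2E; ring.
under eq_bigr do under eq_bigr do under eq_bigr do under eq_bigr do rewrite
  (frame_dual (metric_unit g_metric Uy) (metric_sym g_metric Uy) (frame_metric s_frame Uy)).
rewrite !sum_ord2; elim/ord2_ind: A; elim/ord2_ind: A'; rewrite /= !eps2E; ring.
Qed.

Let kappaE y b c : U y -> (phi y ^+ 2 * fundamental_form g J y b c)%:C =
  \sum_B \sum_C K y B C * (s y b B j0 * s y c C j1 - s y b B j1 * s y c C j0).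
Proof.
move=> Uy.
pose M A B := 'i * (chi o y)^-1 * (o y A * lower (io y) B + io y A * lower (o y) B).
have Je d : (J y d b)%:C = \sum_A \sum_A' inv_frame g s y d A A' *
    \sum_B M A B * s y b B A'.
  rewrite (o_J d b Uy) /M !sum_ord2 /=; ring.
have -> : (phi y ^+ 2 * fundamental_form g J y b c)%:C = (phi y)%:C * (phi y)%:C *
    \sum_A \sum_A' (\sum_B M A B * s y b B A') *
      \sum_d inv_frame g s y d A A' * (g y d c)%:C.
  rewrite expr2 !rmorphM /=; congr (_ * _).
  rewrite (rmorph_sum (real_complex R)) /= !sum_ord2 !mulr_sumr -!big_split.
  apply: eq_bigr => d _; rewrite rmorphM /= Je !sum_ord2.
  move: (M j0 j0) (M j0 j1) (M j1 j0) (M j1 j1) => *; ring.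
under eq_bigr do under eq_bigr do rewrite (lower_frame _ _ _ Uy).
rewrite !sum_ord2 !eps2E /M /K /h.
have [-> ->] := lowerE (o y); have [-> ->] := lowerE (io y); ring.
Qed.

Let k_closed x a b c : U x ->
  let k y b c := \sum_B \sum_C K y B C * (s y b B j0 * s y c C j1 - s y b B j1 * s y c C j0) in
  pdC a (fun y => k y b c) x + pdC b (fun y => k y c a) x + pdC c (fun y => k y a b) x = 0.
Proof.
move=> Ux /=; have [_ _ /(_ x a b c Ux) cl] := phi_kahler.
rewrite -(pdC_eq a U_open Ux (fun y => @kappaE y b c)).
rewrite -(pdC_eq b U_open Ux (fun y => @kappaE y c a)).
rewrite -(pdC_eq c U_open Ux (fun y => @kappaE y a b)).
by rewrite !pdC_real -!rmorphD /= cl.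
Qed.

(* Closedness of phi^2 kappa contracted with iota^A e_AA', o^A e_AA' and
   iota^A e_AC', where the last pairing eps_A'A' kills the third term. *)
Let nab2_NL x A' C' : U x -> A' != C' ->
  \sum_B \sum_C o x B * io x C * nab2 K (tv (io x) x A') x B C =
  \sum_B \sum_C io x B * io x C * nab2 K (tv (o x) x A') x B C.
Proof.
move=> Ux AC.
have Ksym y B C : K y B C = K y C B by rewrite /K addrC [_ * lower _ _]mulrC
  [X in _ * (_ + X)]mulrC.
have := nab2_cyclic s_K Ksym k_closed (tv (io x) x A') (tv (o x) x A') (tv (io x) x C') Ux.
rewrite /= !sum_ord2 !(frame_spinor_vec g_metric s_frame) //.
move: (nab2 K _ x) (nab2 K _ x) (nab2 K _ x) => n1 n2 n3.
by move: AC; elim/ord2_ind: A'; elim/ord2_ind: C' => // _ /= E; apply: subr0_eq;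
  [rewrite -[RHS]E|rewrite -[RHS]oppr0 -[in RHS]E]; ring.
Qed.

Let K_contract y (p q : 'I_2 -> R[i]) : \sum_B \sum_C p B * q C * K y B C =
  h y * ((\sum_B p B * lower (o y) B) * (\sum_C q C * lower (io y) C)
       + (\sum_B p B * lower (io y) B) * (\sum_C q C * lower (o y) C)).
Proof. rewrite /K !sum_ord2; move: (h y) => h'; ring. Qed.

Let o_lower_o y : \sum_B o y B * lower (o y) B = 0.
Proof. by rewrite sum_ord2; have [-> ->] := lowerE (o y); ring. Qed.

Let io_lower_io y : \sum_B io y B * lower (io y) B = 0.
Proof. by rewrite sum_ord2; have [-> ->] := lowerE (io y); ring. Qed.

Let o_lower_io y : \sum_B o y B * lower (io y) B = - chi o y.
Proof. by rewrite chiE sum_ord2; have [-> ->] := lowerE (io y); ring. Qed.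

Let io_lower_o y : \sum_B io y B * lower (o y) B = chi o y.
Proof. by rewrite chiE sum_ord2; have [-> ->] := lowerE (o y); ring. Qed.

Let nab_lower_io u x psi : U x ->
  \sum_B nab u psi x B * lower (io x) B = chi o x * beta_nab u psi x.
Proof.
move=> Ux; rewrite /beta_nab !sum_ord2 /beta.
move: (nab u psi x) (lower (io x)) => n l.
rewrite -[LHS]mul1r -{1}(mulfV (chi0 Ux)); ring.
Qed.

(** In chi = o_A iota^A the factor iota is parallel along N_A', so only the coefficient of nabla o
    along o contributes. *)
Lemma dir_chi x A' : U x ->
  dirC (tv (io x) x A') (chi o) x = - chi o x * tau g s Gam o x A'.
Proof.
move=> Ux; have tr := conn_traceless (tv (io x) x A') (let: And3 e _ _ := Gam_LC in e) Ux.
have n B := nab_io U_open g_metric s_frame Gam_LC o_smooth o_scaling A' B Ux.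
rewrite /tau mulNr -(nab_lower_io _ _ Ux).
move: (tv _ _ _) tr n => u tr n.
rewrite (dirC_eq (h := fun y => o y j0 * io y j1 + - (o y j1 * io y j0)) u U_open Ux);
  last by move=> y _; rewrite chiE.
have s01 := smoothC_M U_open (o_smooth j0) (s_io j1).
have s10 := smoothC_M U_open (o_smooth j1) (s_io j0).
rewrite (dirC_D u s01 (smoothC_N U_open s10) Ux) (dirC_N u s10 Ux).
rewrite (dirC_M u (o_smooth j0) (s_io j1) Ux) (dirC_M u (o_smooth j1) (s_io j0) Ux).
have [n0 n1] := (n j0, n j1); move: n0 n1; rewrite /nab !sum_ord2.
have [-> ->] := lowerE (io x); rewrite tr.
move: (dirC u (fun y => o y j0) x) (dirC u (fun y => o y j1) x)
  (dirC u (fun y => io y j0) x) (dirC u (fun y => io y j1) x) (conn Gam u x)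
  (o x) (io x) => d0 d1 e0 e1 c o' i' n0 n1.
rewrite -[RHS]addr0 -[X in _ = _ + X](mulr0 (o' j0)) -n1.
by rewrite -[RHS]subr0 -[X in _ = _ - X](mulr0 (o' j1)) -n0; ring.
Qed.

(** Leibniz turns both sides of [nab2_NL] into scalars: K(o, iota) = -i phi^2 chi and K(iota, iota)
    = 0. Writing N for the derivative along N_A', the identity reads N(phi^2 chi) + phi^2 chi tau =
    2 phi^2 chi rho, and the value of N(chi) cancels tau. *)
Lemma dir_phi x A' : U x ->
  dirC (tv (io x) x A') (fun y => (phi y)%:C) x = (phi x)%:C * rho g s Gam o x A'.
Proof.
move=> Ux; have [C' AC] : exists C', A' != C' by elim/ord2_ind: A'; [exists j1|exists j0].
have n B := nab_io U_open g_metric s_frame Gam_LC o_smooth o_scaling A' B Ux.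
have Nchi := dir_chi A' Ux.
have := nab2_NL Ux AC.
rewrite (nab2_leibniz s_K _ Ux o_smooth s_io) (nab2_leibniz s_K _ Ux s_io s_io).
rewrite (_ : \sum_B \sum_C o x B * nab (tv (io x) x A') io x C * K x B C = 0); last first.
  by rewrite big1 // => B _; rewrite big1 // => C _; rewrite n mulr0 mul0r.
rewrite !K_contract io_lower_o io_lower_io !nab_lower_io //.
rewrite -/(tau g s Gam o x A') -/(rho g s Gam o x A').
 move: (tv (io x) x A') (tv (o x) x A') Nchi => u v Nchi.
rewrite (dirC_eq (h := fun=> 0) v U_open Ux); last first.
  by move=> y Uy; rewrite K_contract io_lower_io; ring.
rewrite dirC_cst.
pose p y := (phi y)%:C.
have spp := smoothC_M U_open phi_smooth phi_smooth.
have sip := smoothC_M U_open (smoothC_cst U (- 'i : R[i])) spp.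
rewrite (dirC_eq (h := fun y => - 'i * ((phi y)%:C * (phi y)%:C) * chi o y) u U_open Ux);
  last first.
  move=> y Uy; rewrite K_contract o_lower_o o_lower_io io_lower_o /h.
  by move: (chi o y) (chi0 Uy) (phi y)%:C => c c0 q; rewrite mul0r add0r; field.
rewrite (dirC_M u sip s_chi Ux) (dirC_M u (smoothC_cst U (- 'i : R[i])) spp Ux) dirC_cst.
rewrite (dirC_M u phi_smooth phi_smooth Ux) Nchi /h.
move: (dirC u _ x) (tau _ _ _ _ _ _) (rho _ _ _ _ _ _) (chi o x) (chi0 Ux) => D t r c c0.
have p0 : (phi x)%:C != 0 :> R[i].
  by have [_ /(_ x Ux)/lt0r_neq0 + _] := phi_kahler => p0; rewrite (fmorph_eq0 (real_complex R)).
move: (phi x)%:C p0 => q q0 E.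
have i0 : 'i != 0 :> R[i] by rewrite eq_complex /= eqxx oner_eq0.
(* The common factor 2 i phi chi is cancelled. *)
have m0 : 2%:R * 'i * q * c != 0 :> R[i] by rewrite !mulf_neq0 // pnatr_eq0.
move/eqP: E; rewrite -subr_eq0 => /eqP E.
by apply: (mulfI m0); apply: subr0_eq; rewrite -[RHS]oppr0 -E; field.
Qed.

Lemma dir_r x A' : U x ->
  dirC (tv (io x) x A') (fun y => (chi o y)^-1 * (phi y)%:C) x =
  (chi o x)^-1 * (phi x)%:C * (rho g s Gam o x A' + tau g s Gam o x A').
Proof.
move=> Ux; rewrite (dirC_M _ s_ichi phi_smooth Ux) (dir_phi A' Ux).
rewrite (dirC_V _ U_open chi0 s_chi Ux) (dir_chi A' Ux).
move: (rho _ _ _ _ _ _) (tau _ _ _ _ _ _) (chi o x) (chi0 Ux) (phi x)%:C => r t c c0 p.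
by field.
Qed.

End ConformalFactor.

(** * Self-duality in the basis (o, iota) *)

Section YangMillsSpinors.
Context {R : realType} {n : nat}.
Variables (U : set 'rV[R]_4) (g J : 'rV[R]_4 -> 'M[R]_4).
Variables (s : 'rV[R]_4 -> 'I_4 -> 'M[R[i]]_2) (o : 'rV[R]_4 -> 'I_2 -> R[i]).
Hypothesis g_metric : riemannian_metric U g.
Hypothesis J_orthogonal : orthogonal_almost_complex U g J.
Hypothesis s_frame : spin_frame U g s.
Hypothesis o_J : represents U g J s o.
Implicit Types (u v w : 'I_4 -> R[i]) (x : 'rV[R]_4) (a b c d : 'I_4) (A B C D : 'I_2).
Notation j0 := (ord0 : 'I_2).
Notation j1 := (ord_max : 'I_2).
Notation io := (fun x => dagger (o x)).
Notation tv := (spinor_vec g s).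
Let chi0 := chi_neq0 J_orthogonal o_J.


Let mu x (Ux : U x) := metric_unit g_metric Ux.
Let msym x (Ux : U x) := metric_sym g_metric Ux.
Let fm x (Ux : U x) := frame_metric s_frame Ux.

(** Completeness of the basis (o, iota), whose determinant is chi. *)
Lemma spinor_delta x A C : U x ->
  (chi o x)^-1 * (io x C * lower (o x) A - o x C * lower (io x) A) = (A == C)%:R.
Proof.
move=> Ux; have c0 := chi0 Ux; have := chiE o x.
have [l0 l1] := lowerE (o x); have [m0 m1] := lowerE (io x).
move: (chi o x) c0 => c c0 cE.
have cV : c^-1 * c = 1 by rewrite mulVf.
elim/ord2_ind: A; elim/ord2_ind: C; rewrite ?l0 ?l1 ?m0 ?m1 /= ?mulr1n ?mulr0n -?cV ?cE; ring.
Qed.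

(** The projection (1 + i J)/2 acts on the unprimed index only, where it is the rank one map o^C
    beta_A. *)
Lemma dbar_spinor (f : 'rV[R]_4 -> R[i]) x A A' : U x ->
  \sum_a inv_frame g s x a A A' * dbar J f x a =
  beta o x A * dirC (tv (o x) x A') f x.
Proof.
move=> Ux.
pose M C B := 'i * (chi o x)^-1 * (o x C * lower (io x) B + io x C * lower (o x) B).
have Je d : \sum_a inv_frame g s x a A A' * (J x d a)%:C = \sum_C inv_frame g s x d C A' * M C A.
  transitivity (\sum_C \sum_C' inv_frame g s x d C C' * \sum_B M C B *
      \sum_a inv_frame g s x a A A' * s x a B C').
    transitivity (\sum_a inv_frame g s x a A A' * \sum_C \sum_C' inv_frame g s x d C C' *
        \sum_B M C B * s x a B C').
      apply: eq_bigr => a _; congr (_ * _); rewrite (o_J d a Ux) /M !sum_ord2 /=; ring.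
    move: (inv_frame g s x) (M) => E M'; rewrite !sum_ord2 !mulr_sumr -!big_split !mulr_sumr -!big_split.
    by apply: eq_bigr => a _ /=; rewrite !sum_ord2 /=; ring.
  under eq_bigr do under eq_bigr do under eq_bigr do rewrite (frame_dual (mu Ux) (msym Ux) (fm Ux)).
  by rewrite !sum_ord2; move: (M) => M'; elim/ord2_ind: A; elim/ord2_ind: A'; rewrite /=; ring.
transitivity (\sum_d 2^-1 * (inv_frame g s x d A A' +
    'i * \sum_a inv_frame g s x a A A' * (J x d a)%:C) * pdC d f x).
  transitivity (\sum_a (2^-1 * inv_frame g s x a A A' * pdC a f x +
     \sum_d 2^-1 * 'i * inv_frame g s x a A A' * (J x d a)%:C * pdC d f x)).
    move: (inv_frame g s x) => E.
    apply: eq_bigr => a _; rewrite /dbar mulrDr mulrDr !mulr_sumr; congr (_ + _); first by ring.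
    by apply: eq_bigr => d _; ring.
  move: (inv_frame g s x) => E.
  rewrite big_split /= exchange_big -big_split /=; apply: eq_bigr => d _.
  rewrite mulrDr mulrDl; congr (_ + _).
  by rewrite !mulr_sumr mulr_suml; apply: eq_bigr => a _; ring.
rewrite /dirC mulr_sumr; apply: eq_bigr => d _; rewrite Je mulrA; congr (_ * _).
(* With the identity expanded in o and iota, the terms in iota^C o_A cancel against those of [J] and
   the terms in o^C iota_A double. *)
have e0 := spinor_delta A j0 Ux; have e1 := spinor_delta A j1 Ux.
have eA : inv_frame g s x d A A' = (A == j0)%:R * inv_frame g s x d j0 A' +
    (A == j1)%:R * inv_frame g s x d j1 A'.
  by clear Je e0 e1; elim/ord2_ind: A; rewrite /=; ring.
rewrite eA -e0 -e1 /spinor_vec /beta /M !sum_ord2.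
have ii : 'i * 'i = -1 :> R[i] by rewrite -expr2 sqr_i.
move: (chi o x)^-1 => ci; set lo := lower (o x) A; set li := lower _ A.
rewrite -[LHS]addr0 -[X in _ + X](mulr0 (2^-1 * ci * (inv_frame g s x d j0 A' *
  (o x j0 * li + io x j0 * lo) + inv_frame g s x d j1 A' * (o x j1 * li + io x j1 * lo)))).
by rewrite -(subrr (-1)) -{2}ii; field.
Qed.

Lemma contractM_spinor (F : 'I_4 -> 'I_4 -> 'M[R[i]]_n) x psi xi A' B' :
  contractM F (tv psi x A') (tv xi x B') = \sum_A \sum_B (psi A * xi B) *:
    contractM F (fun a => inv_frame g s x a A A') (fun a => inv_frame g s x a B B').
Proof.
apply/matrixP => i j; rewrite contractM_entry !sum_ord2 !mxE !contractM_entry /contract.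
rewrite !mulr_sumr -!big_split; apply: eq_bigr => a _ /=; rewrite !mulr_sumr -!big_split.
by apply: eq_bigr => b _ /=; rewrite /spinor_vec !sum_ord2; ring.
Qed.

(** The contractions are the values on (o, o), (iota, iota) and (o, iota), the last one doubled, of
    the symmetric unprimed spinor of F; it vanishes in this basis iff it vanishes in the standard
    one. *)
Lemma hodgeM_self_dual_spinorP x (F : 'I_4 -> 'I_4 -> 'M[R[i]]_n) : U x ->
  (forall a b, F a b = - F b a) ->
  (forall a b, hodgeM g x F a b = F a b) <->
  [/\ contractM F (tv (o x) x j0) (tv (o x) x j1) = 0,
      contractM F (tv (io x) x j0) (tv (io x) x j1) = 0 &
      contractM F (tv (o x) x j0) (tv (io x) x j1) =
      contractM F (tv (o x) x j1) (tv (io x) x j0)].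
Proof.
move=> Ux FN; rewrite (hodgeM_self_dualP g_metric s_frame Ux FN) /=.
rewrite !contractM_spinor !sum_ord2.
set f := fun A A' B B' => contractM F (fun a => inv_frame g s x a A A')
  (fun a => inv_frame g s x a B B').
have fN A A' B B' : f A A' B B' = - f B B' A A'.
  apply/matrixP => i j; rewrite mxE !contractM_entry; apply: frame_compN => a b.
  by rewrite (FN a b) mxE.
rewrite -!/(f _ _ _ _) (fN j0 j1 j0 j0) (fN j0 j1 j1 j0) (fN j1 j1 j0 j0) (fN j1 j1 j1 j0).
have cE := chiE o x; have c0 := chi0 Ux; rewrite cE in c0.
move: (f j0 j0 j0 j1) (f j0 j0 j1 j1) (f j1 j0 j0 j1) (f j1 j0 j1 j1) => f0 f1 f2 f3.
move: (o x j0) (o x j1) (io x j0) (io x j1) c0 => p0 p1 q0 q1 c0.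
split=> [[-> -> e]|[e1 e2 e3]].
  split; apply/matrixP => i j; have := congr1 (fun N : 'M[R[i]]_n => N i j) e; rewrite !mxE => ->; ring.
have E i j : [/\ f0 i j = 0, f3 i j = 0 & f1 i j = - f2 i j].
  have := congr1 (fun N : 'M[R[i]]_n => N i j) e1; have := congr1 (fun N : 'M[R[i]]_n => N i j) e2.
  have := congr1 (fun N : 'M[R[i]]_n => N i j) e3; rewrite !mxE.
  move: (f0 i j) (f1 i j) (f2 i j) (f3 i j) => a b c d /eqP; rewrite -subr_eq0 => /eqP h3 h2 h1.
  (* Each unknown times chi^2 is an explicit combination of the three equations, by inverting the
     action of the change of basis on symmetric pairs. *)
  have cc : (p0 * q1 - p1 * q0) ^+ 2 != 0 by rewrite expf_neq0.
  split; apply: (mulfI cc).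
  - rewrite mulr0 -[RHS](mulr0 (q1 * q1)) -h1 -[RHS]addr0 -[X in _ = _ + X](mulr0 (p1 * p1)) -h2.
    rewrite -[RHS]subr0 -[X in _ = _ - X](mulr0 (p1 * q1)) -h3; ring.
  - rewrite mulr0 -[RHS](mulr0 (q0 * q0)) -h1 -[RHS]addr0 -[X in _ = _ + X](mulr0 (p0 * p0)) -h2.
    rewrite -[RHS]subr0 -[X in _ = _ - X](mulr0 (p0 * q0)) -h3; ring.
  - apply: subr0_eq; rewrite -[RHS](mulr0 (-2%:R * q0 * q1)) -h1 -[RHS]addr0
      -[X in _ = _ + X](mulr0 (-2%:R * p0 * p1)) -h2.
    rewrite -[RHS]addr0 -[X in _ = _ + X](mulr0 (p0 * q1 + p1 * q0)) -h3; ring.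
by split; apply/matrixP => i j; have [E0 E3 E1] := E i j; rewrite !mxE.
Qed.

End YangMillsSpinors.

(** * The curvature of a potential beta_A f_A' and the current equation *)

Section SelfDuality.
Context {R : realType} {n : nat}.
Variables (U : set 'rV[R]_4) (g J : 'rV[R]_4 -> 'M[R]_4) (phi : 'rV[R]_4 -> R).
Variables (s Gam Gam' : 'rV[R]_4 -> 'I_4 -> 'M[R[i]]_2) (o : 'rV[R]_4 -> 'I_2 -> R[i]).
Hypothesis U_open : open U.
Hypothesis g_metric : riemannian_metric U g.
Hypothesis J_orthogonal : orthogonal_almost_complex U g J.
Hypothesis phi_kahler : conformally_kahler_factor U g J phi.
Hypothesis s_frame : spin_frame U g s.
Hypothesis Gam_LC : spin_connection U g s Gam Gam'.
Hypothesis o_smooth : forall A, smoothC U (fun x => o x A).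
Hypothesis o_J : represents U g J s o.
Hypothesis o_scaling : shear_scaled U g s Gam o.
Implicit Types (u v w : 'I_4 -> R[i]) (x : 'rV[R]_4) (a b c d : 'I_4) (A B C D : 'I_2).
Notation j0 := (ord0 : 'I_2).
Notation j1 := (ord_max : 'I_2).
Notation io := (fun x => dagger (o x)).
Notation tv := (spinor_vec g s).
Let chi0 := chi_neq0 J_orthogonal o_J.
Let s_ichi := smoothC_invchi U_open J_orthogonal o_smooth o_J.


Definition nabM' u (f : 'rV[R]_4 -> 'I_2 -> 'M[R[i]]_n) x B' : 'M[R[i]]_n :=
  dirM u (fun y => f y B') x - \sum_C' conn Gam' u x C' B' *: f x C'.

Lemma nabM'_entry u f x B' i j :
  nabM' u f x B' i j = nab' Gam' u (fun y C' => f y C' i j) x B'.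
Proof.
rewrite /nabM' /nab' mxE [X in _ + X]mxE dirM_entry summxE; congr (_ - _).
by apply: eq_bigr => C' _; rewrite mxE.
Qed.

Lemma potential_frame (P : 'rV[R]_4 -> 'I_4 -> 'M[R[i]]_n) x a : U x ->
  P x a = \sum_A \sum_A' s x a A A' *: spinor_components g s P x A A'.
Proof.
move=> Ux; transitivity (\sum_b (a == b)%:R *: P x b).
  rewrite (bigD1 a)//= eqxx scale1r big1 ?addr0// => b ba.
  by rewrite eq_sym (negPf ba) scale0r.
under eq_bigr do rewrite -(frame_complete (metric_unit g_metric Ux)
  (metric_sym g_metric Ux) (frame_metric s_frame Ux)).
rewrite /spinor_components; apply/matrixP => i j; rewrite !sum_ord2 !mxE !summxE.
rewrite !mulr_sumr -!big_split; apply: eq_bigr => b _ /=; rewrite !mxE !sum_ord2; ring.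
Qed.

Definition pair_form (P : 'I_4 -> 'M[R[i]]_n) u : 'M[R[i]]_n := \sum_a u a *: P a.

Lemma pair_spinor (P : 'rV[R]_4 -> 'I_4 -> 'M[R[i]]_n) x psi A' :
  pair_form (P x) (tv psi x A') = \sum_A psi A *: spinor_components g s P x A A'.
Proof.
rewrite /pair_form /spinor_components sum_ord2 !scaler_sumr -big_split.
by apply: eq_bigr => a _ /=; rewrite /spinor_vec sum_ord2 !scalerA -scalerDl.
Qed.

Lemma contract_curvature (P : 'rV[R]_4 -> 'I_4 -> 'M[R[i]]_n) x u w :
  contractM (curvature P x) u w =
  contractM (fun a b => pdM a (fun y => P y b) x - pdM b (fun y => P y a) x) u w +
  (pair_form (P x) u *m pair_form (P x) w - pair_form (P x) w *m pair_form (P x) u).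
Proof.
have e v z : pair_form (P x) v *m pair_form (P x) z =
    \sum_a \sum_b (v a * z b) *: (P x a *m P x b).
  rewrite /pair_form mulmx_suml; apply: eq_bigr => a _; rewrite mulmx_sumr.
  by apply: eq_bigr => b _; rewrite -scalemxAl -scalemxAr scalerA.
rewrite e (e w u) [X in _ - X]exchange_big -sumrB /contractM -big_split; apply: eq_bigr => a _ /=.
rewrite -sumrB -big_split; apply: eq_bigr => b _ /=.
by rewrite [w b * _]mulrC -scalerBr -scalerDr.
Qed.

Section Potential.
Variables (P : 'rV[R]_4 -> 'I_4 -> 'M[R[i]]_n) (f : 'rV[R]_4 -> 'I_2 -> 'M[R[i]]_n).
Hypothesis sf : forall B', smoothM U (fun y => f y B').
Hypothesis Pf : forall x A A', U x -> spinor_components g s P x A A' = beta o x A *: f x A'.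

Let dPE x u w i j : U x ->
  contractM (fun a b => pdM a (fun y => P y b) x - pdM b (fun y => P y a) x) u w i j =
  contract (fun a b =>
    pdC a (fun y => \sum_B \sum_B' s y b B B' * (beta o y B * f y B' i j)) x -
    pdC b (fun y => \sum_B \sum_B' s y a B B' * (beta o y B * f y B' i j)) x) u w.
Proof.
move=> Ux; rewrite contractM_entry; congr contract; apply/funext => a; apply/funext => b.
have E c y : U y -> P y c i j = \sum_B \sum_B' s y c B B' * (beta o y B * f y B' i j).
  move=> Uy; rewrite (potential_frame _ _ Uy) summxE; apply: eq_bigr => B _.
  by rewrite summxE; apply: eq_bigr => B' _; rewrite mxE Pf // mxE.
rewrite !mxE (pdC_eq a U_open Ux (E b)); congr (_ - _); exact: (pdC_eq b U_open Ux (E a)).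
Qed.

Let pair_o x A' : U x -> pair_form (P x) (tv (o x) x A') = f x A'.
Proof.
move=> Ux; rewrite pair_spinor; under eq_bigr do rewrite Pf // scalerA.
by rewrite -scaler_suml (beta_o J_orthogonal o_J Ux) scale1r.
Qed.

Let pair_io x A' : U x -> pair_form (P x) (tv (io x) x A') = 0.
Proof.
move=> Ux; rewrite pair_spinor; under eq_bigr do rewrite Pf // scalerA.
by rewrite -scaler_suml beta_io scale0r.
Qed.

Let sfe i j B' : smoothC U (fun y => f y B' i j). Proof. exact: sf. Qed.

Lemma curvature_oo x A' B' : U x ->
  contractM (curvature P x) (tv (o x) x A') (tv (o x) x B') =
  nabM' (tv (o x) x A') f x B' - nabM' (tv (o x) x B') f x A' + (f x A' *m f x B' - f x B' *m f x A').
Proof.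
move=> Ux; rewrite contract_curvature !pair_o //; congr (_ + _); apply/matrixP => i j.
rewrite (dPE _ _ _ _ Ux).
rewrite (d_beta_LL U_open g_metric J_orthogonal s_frame Gam_LC o_smooth o_J o_scaling (sfe i j)) //.
by rewrite [RHS]mxE [X in _ = _ + X]mxE !nabM'_entry.
Qed.

Lemma curvature_ii x A' B' : U x ->
  contractM (curvature P x) (tv (io x) x A') (tv (io x) x B') = 0.
Proof.
move=> Ux; rewrite contract_curvature !pair_io // mul0mx subrr addr0; apply/matrixP => i j.
rewrite (dPE _ _ _ _ Ux) mxE.
by rewrite (d_beta_NN U_open g_metric J_orthogonal s_frame Gam_LC o_smooth o_J o_scaling (sfe i j)).
Qed.

(** No commutator appears, as the potential vanishes on the vectors built from iota. *)
Lemma curvature_oi x A' B' : U x ->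
  contractM (curvature P x) (tv (o x) x A') (tv (io x) x B') =
  rho g s Gam o x A' *: f x B' - tau g s Gam o x B' *: f x A' - nabM' (tv (io x) x B') f x A'.
Proof.
move=> Ux; rewrite contract_curvature pair_o // pair_io // mul0mx mulmx0 subrr addr0.
apply/matrixP => i j; rewrite (dPE _ _ _ _ Ux).
rewrite (d_beta_LN U_open g_metric J_orthogonal s_frame Gam_LC o_smooth o_J (sfe i j)) //.
have mxB (X Z : 'M[R[i]]_n) : (X - Z) i j = X i j - Z i j by rewrite !mxE.
have mxZ k (X : 'M[R[i]]_n) : (k *: X) i j = k * X i j by rewrite mxE.
by rewrite (mxB _ (nabM' _ _ _ _)) (mxB (_ *: _)) !mxZ nabM'_entry.
Qed.

Lemma curvature_antisym x a b : curvature P x a b = - curvature P x b a.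
Proof. by rewrite /curvature opprD !opprB. Qed.

End Potential.

Variable Y : 'rV[R]_4 -> 'M[R[i]]_n.
Hypothesis sY : smoothGL U Y.

Let f y B' : 'M[R[i]]_n := invmx (Y y) *m dirM (tv (o y) y B') Y y.

Lemma sum_nablaM x psi A' : \sum_B psi B *: nablaM g s Y x B A' = dirM (tv psi x A') Y x.
Proof.
rewrite /nablaM /dirM sum_ord2 !scaler_sumr -big_split.
by apply: eq_bigr => a _ /=; rewrite /spinor_vec sum_ord2 !scalerA -scalerDl.
Qed.

Lemma dbar_components x A A' : U x ->
  spinor_components g s (dbar_potential J Y) x A A' = beta o x A *: f x A'.
Proof.
move=> Ux; rewrite /spinor_components /dbar_potential /f.
under eq_bigr do rewrite scalemxAr; rewrite -mulmx_sumr scalemxAr; congr (_ *m _).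
apply/matrixP => i j; rewrite summxE mxE dirM_entry -(dbar_spinor g_metric J_orthogonal s_frame o_J _ _ _ Ux).
by apply: eq_bigr => a _; rewrite !mxE.
Qed.

Lemma spinor_potentialE x A A' :
  spinor_potential g s o Y x A A' = beta o x A *: f x A'.
Proof. by rewrite /spinor_potential sum_nablaM /beta /f mulNr. Qed.

Lemma scaled_currentE x A' : scaled_current g s o phi Y x A' =
  ((chi o x)^-1 * (phi x)%:C) *: f x A'.
Proof. by rewrite /scaled_current sum_nablaM. Qed.

Let s_Y : smoothM U Y. Proof. by case: sY. Qed.
Let u_Y x : U x -> Y x \in unitmx. Proof. by case: sY => _; exact. Qed.
Let s_YV : smoothM U (fun y => invmx (Y y)). Proof. exact: (smoothM_inv U_open s_Y u_Y). Qed.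

Let s_dirY B' : smoothM U (fun y => dirM (tv (o y) y B') Y y).
Proof.
rewrite /dirM; apply: (smoothM_sum _ U_open) => a; apply: (smoothM_scale U_open); last exact: smoothM_pdM.
apply: (smoothC_sum _ U_open) => A _; apply: (smoothC_M U_open (o_smooth A)).
exact: (smoothC_inv_frame U_open g_metric s_frame).
Qed.

Let s_f B' : smoothM U (fun y => f y B').
Proof. exact: (smoothM_mul U_open s_YV (s_dirY B')). Qed.

Let dirY_sym x A' B' : U x ->
  nabM' (tv (o x) x A') (fun y C' => dirM (tv (o y) y C') Y y) x B' =
  nabM' (tv (o x) x B') (fun y C' => dirM (tv (o y) y C') Y y) x A'.
Proof.
move=> Ux; apply/matrixP => i j; rewrite !nabM'_entry.
have -> : (fun y C' => dirM (tv (o y) y C') Y y i j) =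
    fun y C' => dirC (tv (o y) y C') (fun z => Y z i j) y.
  by apply/funext => y; apply/funext => C'; rewrite dirM_entry.
exact: (nab_dir_spinor_sym U_open g_metric s_frame Gam_LC o_smooth o_scaling (s_Y i j) _ _ Ux).
Qed.

Let nabM'_f u x B' : U x -> nabM' u f x B' =
  invmx (Y x) *m nabM' u (fun y C' => dirM (tv (o y) y C') Y y) x B' -
  invmx (Y x) *m dirM u Y x *m f x B'.
Proof.
move=> Ux; rewrite /nabM' (dirM_mul u s_YV (s_dirY B') Ux).
rewrite (dirM_inv u U_open s_Y u_Y Ux) /f.
move: (dirM u Y x) (dirM u _ x) (dirM _ Y x) => D1 D2 D3.
have S (D : 'I_2 -> 'M[R[i]]_n) : invmx (Y x) *m (\sum_C' conn Gam' u x C' B' *: D C') =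
    \sum_C' conn Gam' u x C' B' *: (invmx (Y x) *m D C').
  by rewrite mulmx_sumr; apply: eq_bigr => C' _; rewrite -scalemxAr.
rewrite mulNmx -!mulmxA mulmxBr (S (fun C' => dirM (tv (o x) x C') Y x)).
by rewrite [- _ + _]addrC addrAC.
Qed.

(** With f = Y^-1 L Y, the symmetric second derivatives of Y cancel and the derivatives of Y^-1
    produce exactly minus the commutator. *)
Lemma dbar_curvature_oo x A' B' : U x ->
  contractM (curvature (dbar_potential J Y) x) (tv (o x) x A') (tv (o x) x B') = 0.
Proof.
move=> Ux; rewrite (curvature_oo s_f dbar_components _ _ Ux) !nabM'_f // (dirY_sym A' B') //.
rewrite -!/(f x _); move: (_ *m nabM' _ _ _ _) (f x A' *m f x B') (f x B' *m f x A') => Z P Q.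
by apply/matrixP => i j; rewrite !mxE; ring.
Qed.

Let nabM'_scale (r : 'rV[R]_4 -> R[i]) (G : 'rV[R]_4 -> 'I_2 -> 'M[R[i]]_n) u x B' :
  smoothC U r -> (forall C', smoothM U (fun y => G y C')) -> U x ->
  nabM' u (fun y C' => r y *: G y C') x B' = dirC u r x *: G x B' + r x *: nabM' u G x B'.
Proof.
move=> sr sG Ux; apply/matrixP => i j.
rewrite nabM'_entry [RHS]mxE [X in _ = X + _]mxE [X in _ = _ + X]mxE nabM'_entry /nab'.
rewrite (_ : (fun y => (r y *: G y B') i j) = fun y => r y * G y B' i j); last first.
  by apply/funext => y; rewrite mxE.
rewrite (dirC_M u sr (sG B' i j) Ux); move: (dirC u r x) (dirC u _ x) => D0 D1.
rewrite mulrBr addrA; congr (_ - _); rewrite mulr_sumr.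
by apply: eq_bigr => C' _; rewrite mxE; ring.
Qed.

(** Differentiating the factor r along N_B' gives r (rho + tau), by [dir_r]. The part needed from
    each index is already in [curvature_oi], and the remaining rho and tau terms match in the
    difference over the two orders of the primed indices. *)
Lemma current_equationE x : U x ->
  \sum_A' \sum_B' \sum_A \sum_a
      (eps2 A' B' * io x A * inv_frame g s x a A B') *:
        nabla_lowM Gam' (scaled_current g s o phi Y) x a A' =
  - ((chi o x)^-1 * (phi x)%:C) *:
    (contractM (curvature (dbar_potential J Y) x) (tv (o x) x j0) (tv (io x) x j1) -
     contractM (curvature (dbar_potential J Y) x) (tv (o x) x j1) (tv (io x) x j0)).
Proof.
move=> Ux.
have sr : smoothC U (fun y => (chi o y)^-1 * (phi y)%:C).
  by apply: (smoothC_M U_open s_ichi); apply: smoothC_real; have [] := phi_kahler.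
transitivity (\sum_A' \sum_B' eps2 A' B' *:
    nabM' (tv (io x) x B') (scaled_current g s o phi Y) x A').
  apply: eq_bigr => A' _; apply: eq_bigr => B' _.
  rewrite exchange_big /nabM' scalerBr /dirM scaler_sumr scaler_sumr.
  rewrite [X in _ = _ - X](eq_bigr (fun C' => \sum_a (eps2 A' B' * (tv (io x) x B' a * Gam' x a C' A')) *:
     scaled_current g s o phi Y x C')); last first.
    by move=> C' _; rewrite scalerA /conn mulr_sumr scaler_suml.
  rewrite [X in _ = _ - X]exchange_big -sumrB /=; apply: eq_bigr => a _.
  rewrite -scaler_suml -(_ : eps2 A' B' * tv (io x) x B' a =
    \sum_A eps2 A' B' * io x A * inv_frame g s x a A B'); last first.
    by rewrite /spinor_vec mulr_sumr; apply: eq_bigr => A _; rewrite mulrA.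
  rewrite /nabla_lowM scalerBr scalerA scaler_sumr; congr (_ - _).
  by apply: eq_bigr => C' _; rewrite scalerA mulrA.
have -> : scaled_current g s o phi Y = fun y C' => ((chi o y)^-1 * (phi y)%:C) *: f y C'.
  by apply/funext => y; apply/funext => C'; rewrite scaled_currentE.
rewrite !sum_ord2 !eps2E !scale0r !scale1r scaleN1r addr0 add0r.
rewrite !(nabM'_scale _ _ sr s_f Ux).
rewrite !(dir_r U_open g_metric J_orthogonal phi_kahler s_frame Gam_LC o_smooth o_J o_scaling _ Ux).
rewrite !(curvature_oi s_f dbar_components _ _ Ux).
move: (chi o x)^-1 (phi x)%:C (nabM' _ _ _ _) (nabM' _ _ _ _) (rho _ _ _ _ _ j0) (rho _ _ _ _ _ j1)
  (tau _ _ _ _ _ j0) (tau _ _ _ _ _ j1) (f x j0) (f x j1) => c p N0 N1 r0 r1 t0 t1 f0 f1.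
apply/matrixP => i j; rewrite !mxE; ring.
Qed.

Lemma dbar_self_dualP :
  self_dual_YM U g (dbar_potential J Y) <-> current_equation U g s Gam' o phi Y.
Proof.
have r0 x : U x -> (chi o x)^-1 * (phi x)%:C != 0 :> R[i].
  move=> Ux; rewrite mulf_neq0 ?invr_eq0 ?chi0// (fmorph_eq0 (real_complex R)).
  by have [_ /(_ x Ux)/lt0r_neq0] := phi_kahler.
have sd x := hodgeM_self_dual_spinorP g_metric J_orthogonal s_frame o_J
  (x := x) (F := curvature (dbar_potential J Y) x).
split=> [H x Ux|H x a b Ux].
  rewrite current_equationE //.
  have [/(_ (fun a b => H x a b Ux))[_ _ ->] _] := sd x Ux (curvature_antisym _ _).
  by rewrite subrr scaler0.
have [_ ->] // := sd x Ux (curvature_antisym _ _).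
split; first exact: dbar_curvature_oo.
  exact: (curvature_ii s_f dbar_components).
have /eqP := H x Ux; rewrite current_equationE // scaler_eq0 oppr_eq0 (negPf (r0 x Ux)) /=.
by rewrite subr_eq0 => /eqP.
Qed.

End SelfDuality.

(** * Frames parallel in the (0,1) directions *)

Section FrobeniusType01.
Context {R : realType} {n : nat}.
Implicit Types (U V W : set 'rV[R]_4) (x y : 'rV[R]_4) (u v w X Z : 'I_4 -> R[i]).
Implicit Types (J : 'rV[R]_4 -> 'M[R]_4) (F : 'rV[R]_4 -> 'M[R[i]]_n).

Lemma dirM_scale U u (f : 'rV[R]_4 -> R[i]) F x : smoothC U f -> smoothM U F -> U x ->
  dirM u (fun y => f y *: F y) x = dirC u f x *: F x + f x *: dirM u F x.
Proof.
move=> sf sF Ux; rewrite /dirM /dirC scaler_suml scaler_sumr -big_split.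
apply: eq_bigr => a _ /=.
rewrite (pdM_scale a (smoothC_diffC sf Ux) (smoothM_diffM sF Ux)) scalerDr !scalerA.
by rewrite [u a * f x]mulrC.
Qed.

Lemma dirM_sum U (I : Type) (r : seq I) u (F : I -> 'rV[R]_4 -> 'M[R[i]]_n) x :
  (forall i, smoothM U (F i)) -> U x ->
  dirM u (fun y => \sum_(i <- r) F i y) x = \sum_(i <- r) dirM u (F i) x.
Proof.
move=> sF Ux; rewrite /dirM [RHS]exchange_big /=; apply: eq_bigr => a _.
by rewrite (pdM_sum _ a (fun i => smoothM_diffM (sF i) Ux)) scaler_sumr.
Qed.

Lemma dirC_comm U u w (f : 'rV[R]_4 -> R[i]) x : open U -> smoothC U f -> U x ->
  dirC u (dirC w f) x = dirC w (dirC u f) x.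
Proof.
move=> oU sf Ux.
have E v z : dirC v (dirC z f) x = \sum_a \sum_b v a * z b * pdC a (pdC b f) x.
  rewrite /dirC; apply: eq_bigr => a _.
  rewrite (@pdC_sum _ _ _ _ (fun b y => z b * pdC b f y)) => [|b _]; last first.
    by apply: diffC_M; [exact: diffC_cst|exact: smoothC_diffC (smoothC_pdC b sf) Ux].
  rewrite mulr_sumr; apply: eq_bigr => b _.
  rewrite (pdC_M a (diffC_cst (z b) x) (smoothC_diffC (smoothC_pdC b sf) Ux)) pdC_cst.
  by rewrite mul0r add0r mulrA.
rewrite !E [RHS]exchange_big /=; apply: eq_bigr => a _; apply: eq_bigr => b _.
by rewrite (pdC_comm a b oU sf Ux) [u a * _]mulrC.
Qed.

Lemma pdC_comp_rV U V (f : 'rV[R]_4 -> R[i]) (G : 'rV[R]_4 -> 'rV[R]_4) x a :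
  (forall b, smooth U (fun y => G y ord0 b)) -> smoothC V f -> U x -> V (G x) ->
  pdC a (fun y => f (G y)) x =
  \sum_b pdC a (fun y => (G y ord0 b)%:C) x * pdC b f (G x).
Proof.
move=> sG [sr si] Ux Vx; have dG b := smooth_differentiable (sG b) Ux.
rewrite [LHS]/pdC (pd_comp_rV a dG (smooth_differentiable sr Vx))
  (pd_comp_rV a dG (smooth_differentiable si Vx)).
apply: complex_eq.
  rewrite [RHS](raddf_sum (@complex.Re R)); apply: eq_bigr => b _.
  by rewrite pdC_real [RHS]Re_M /= mul0r subr0.
rewrite [RHS](raddf_sum (@complex.Im R)); apply: eq_bigr => b _.
by rewrite pdC_real [RHS]Im_M /= mul0r addr0.
Qed.

Lemma dirC_comp_rV U V u (f : 'rV[R]_4 -> R[i]) (G : 'rV[R]_4 -> 'rV[R]_4) x :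
  (forall b, smooth U (fun y => G y ord0 b)) -> smoothC V f -> U x -> V (G x) ->
  dirC u (fun y => f (G y)) x = dirC (fun b => dirC u (fun y => (G y ord0 b)%:C) x) f (G x).
Proof.
move=> sG sf Ux Vx; rewrite /dirC; under eq_bigr do rewrite (pdC_comp_rV _ sG sf Ux Vx) mulr_sumr.
rewrite exchange_big /=; apply: eq_bigr => b _; rewrite mulr_suml.
by apply: eq_bigr => a _; rewrite mulrA.
Qed.

Lemma dirM_comp_rV U V u F (G : 'rV[R]_4 -> 'rV[R]_4) x :
  (forall b, smooth U (fun y => G y ord0 b)) -> smoothM V F -> U x -> V (G x) ->
  dirM u (fun y => F (G y)) x = dirM (fun b => dirC u (fun y => (G y ord0 b)%:C) x) F (G x).
Proof.
move=> sG sF Ux Vx; apply/matrixP => i j; rewrite !dirM_entry.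
exact: (dirC_comp_rV u sG (sF i j) Ux Vx).
Qed.

Lemma smoothM_comp_rV U V F (G : 'rV[R]_4 -> 'rV[R]_4) :
  open U -> (forall b, smooth U (fun y => G y ord0 b)) ->
  (forall x, U x -> V (G x)) -> smoothM V F -> smoothM U (fun y => F (G y)).
Proof.
move=> oU sG UV sF i j; have [sr si] := sF i j.
by split; [exact: (smooth_comp_rV oU sG UV sr)|exact: (smooth_comp_rV oU sG UV si)].
Qed.

(** Complex tangent vectors in the eigenspace of [J] for -i; no spin frame enters in the integration
    along them. *)
Definition type01 J x X := forall b, \sum_a (J x b a)%:C * X a = - 'i * X b.

Lemma smooth_coord_map V (z w : 'rV[R]_4 -> R[i]) m : smoothC V z -> smoothC V w ->
  smooth V (fun x => coord_map z w x ord0 m).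
Proof.
move=> [zr zi] [wr wi]; rewrite /coord_map.
case: m => [[|[|[|[|//]]]] i]; under eq_fun do rewrite mxE /=; done.
Qed.

Section Chart.
Variables (V : set 'rV[R]_4) (J : 'rV[R]_4 -> 'M[R]_4) (z w : 'rV[R]_4 -> R[i]).
Variable psi : 'rV[R]_4 -> 'rV[R]_4.
Hypotheses (oV : open V) (hz : holomorphic V J z) (hw : holomorphic V J w).
Notation c := (coord_map z w).
Notation W := (c @` V).
Hypothesis oW : open W.
Hypothesis s_psi : forall a, smooth W (fun y => psi y ord0 a).
Hypothesis psiK : forall x, V x -> psi (c x) = x.
Notation cC m := (fun x => (c x ord0 m)%:C : R[i]).
Notation psiC a := (fun y => (psi y ord0 a)%:C : R[i]).

Let c_smooth m : smooth V (fun x => c x ord0 m).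
Proof. by case: hz hw => sz _ [sw _]; exact: smooth_coord_map. Qed.

Let V_W x : V x -> W (c x). Proof. by move=> Vx; exists x. Qed.

Let W_V y : W y -> V (psi y) /\ c (psi y) = y.
Proof. by case=> x Vx <-; rewrite psiK. Qed.

Let dir_coord X x a : dirC X (fun y => (y ord0 a)%:C) x = X a.
Proof.
rewrite /dirC (bigD1 a)//= pdC_real pd_coord eqxx rmorph1 mulr1 big1 ?addr0// => b ba.
by rewrite pdC_real pd_coord (negPf ba) rmorph0 mulr0.
Qed.

(** The image of the constant vector [v] of the chart under the differential of the inverse
    chart. *)
Let push v y : 'I_4 -> R[i] := fun a => dirC v (psiC a) y.

Let chart_vec X x a : V x -> X a = push (fun m => dirC X (cC m) x) (c x) a.
Proof.
move=> Vx; rewrite /push -(dirC_comp_rV X c_smooth (smoothC_real (s_psi a)) Vx (V_W Vx)).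
rewrite -[LHS](dir_coord X x a); apply: (dirC_eq X oV Vx) => y Vy.
by rewrite psiK.
Qed.

Let chart_push v y m : W y -> dirC (push v y) (cC m) (psi y) = v m.
Proof.
move=> Wy; have [Vy _] := W_V Wy.
rewrite -(dirC_comp_rV v s_psi (smoothC_real (c_smooth m)) Wy Vy).
rewrite -[RHS](dir_coord v y m); apply: (dirC_eq v oW Wy) => y' /W_V[_ e].
by rewrite e.
Qed.

Let hol_dir f X x : holomorphic V J f -> V x ->
  dirC (fun b => \sum_a (J x b a)%:C * X a) f x = 'i * dirC X f x /\
  dirC (fun b => \sum_a (J x b a)%:C * X a) (fun y => (f y)^*%C) x =
  - 'i * dirC X (fun y => (f y)^*%C) x.
Proof.
move=> [sf hf] Vx; have df := smoothC_diffC sf Vx; rewrite /dirC; split.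
  rewrite mulr_sumr; under eq_bigr do rewrite mulr_suml; rewrite exchange_big /=.
  apply: eq_bigr => a _; rewrite mulrCA -(hf x a Vx) mulr_sumr.
  by apply: eq_bigr => b _; ring.
rewrite mulr_sumr; under eq_bigr do rewrite mulr_suml; rewrite exchange_big /=.
apply: eq_bigr => a _; rewrite mulrCA (pdC_conj a df).
have -> : - 'i * (pdC a f x)^*%C = ('i * pdC a f x)^*%C.
  by rewrite conjcM; congr (_ * _); apply/eqP; rewrite eq_complex /= oppr0 !eqxx.
rewrite -(hf x a Vx) conjc_sum mulr_sumr; apply: eq_bigr => b _.
by rewrite conjcM conjc_real (pdC_conj b df); ring.
Qed.

Let o1 : 'I_4 := inord 1.
Let o2 : 'I_4 := inord 2.
Let o3 : 'I_4 := inord 3.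

Let sum4 (M : nmodType) (f : 'I_4 -> M) : \sum_m f m = f ord0 + f o1 + f o2 + f o3.
Proof.
rewrite !big_ord_recl big_ord0 addr0 !addrA.
by congr (_ + _ + _ + _); congr f; apply: val_inj; rewrite /= ?inordK.
Qed.

Let zE x : z x = (c x ord0 ord0)%:C + 'i * (c x ord0 o1)%:C.
Proof. by rewrite !mxE inordK //= [LHS]complexE. Qed.

Let wE x : w x = (c x ord0 o2)%:C + 'i * (c x ord0 o3)%:C.
Proof. by rewrite !mxE !inordK //= [LHS]complexE. Qed.

Let s_cC m : smoothC V (cC m). Proof. exact: smoothC_real. Qed.

Let s_icC m : smoothC V (fun x => 'i * (c x ord0 m)%:C).
Proof. exact: (smoothC_M oV (smoothC_cst _ _) (s_cC m)). Qed.

Let dir_z X x : V x -> dirC X z x = dirC X (cC ord0) x + 'i * dirC X (cC o1) x.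
Proof.
move=> Vx; rewrite (dirC_eq X oV Vx (fun y _ => zE y)) (dirC_D X (s_cC _) (s_icC _) Vx).
by rewrite (dirC_M X (smoothC_cst _ _) (s_cC _) Vx) dirC_cst mul0r add0r.
Qed.

Let dir_w X x : V x -> dirC X w x = dirC X (cC o2) x + 'i * dirC X (cC o3) x.
Proof.
move=> Vx; rewrite (dirC_eq X oV Vx (fun y _ => wE y)) (dirC_D X (s_cC _) (s_icC _) Vx).
by rewrite (dirC_M X (smoothC_cst _ _) (s_cC _) Vx) dirC_cst mul0r add0r.
Qed.

Let i2_neq0 : 2%:R * 'i != 0 :> R[i].
Proof. by rewrite mulf_neq0 ?pnatr_eq0// eq_complex /= eqxx oner_eq0. Qed.

(** The derivative of [f] along J X is both i X f and -i X f. *)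
Let type01_hol f X x : holomorphic V J f -> V x -> type01 J x X -> dirC X f x = 0.
Proof.
move=> hf Vx tX; have [e _] := hol_dir X hf Vx.
apply: (mulfI i2_neq0); rewrite mulr0; apply/eqP.
rewrite -mulrA mulr_natl mulr2n -{1}e; apply/eqP.
rewrite /dirC mulr_sumr -big_split big1 // => b _ /=; rewrite tX; ring.
Qed.

(** The vector X' = J X + i X annihilates z, w and their conjugates, hence all four real
    coordinates, so it is zero. *)
Let hol_type01 X x : V x -> dirC X z x = 0 -> dirC X w x = 0 -> type01 J x X.
Proof.
move=> Vx Xz Xw b.
pose X' b := \sum_a (J x b a)%:C * X a + 'i * X b.
suff X'0 m : dirC X' (cC m) x = 0.
  apply: subr0_eq; rewrite mulNr opprK -[LHS]/(X' b) (chart_vec X' b Vx) /push.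
  by rewrite /dirC big1 // => m _; rewrite [X in X * _]X'0 mul0r.
have re (d0 d1 : R[i]) : d0 + 'i * d1 = 0 -> d0 + - 'i * d1 = 0 -> d0 = 0 /\ d1 = 0.
  move=> e1 e2; split; apply: (mulfI i2_neq0); rewrite mulr0.
    transitivity ('i * ((d0 + 'i * d1) + (d0 + - 'i * d1))); first by ring.
    by rewrite e1 e2 addr0 mulr0.
  transitivity ((d0 + 'i * d1) - (d0 + - 'i * d1)); first by ring.
  by rewrite e1 e2 subrr.
have d f : holomorphic V J f -> dirC X f x = 0 -> dirC X' f x = 0 /\ dirC X' (fun y => (f y)^*%C) x = 0.
  move=> hf Xf; have [e1 e2] := hol_dir X hf Vx.
  by rewrite /X' !dirC_linear e1 e2 Xf; split; ring.
have cj (k l : 'I_4) (f : 'rV[R]_4 -> R[i]) : (forall y, f y = (c y ord0 k)%:C + 'i * (c y ord0 l)%:C) ->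
    dirC X' (fun y => (f y)^*%C) x = dirC X' (cC k) x + - 'i * dirC X' (cC l) x.
  move=> fE; have sNi : smoothC V (fun y => - 'i * (c y ord0 l)%:C).
    exact: (smoothC_M oV (smoothC_cst _ _) (s_cC l)).
  rewrite (dirC_eq (h := fun y => (c y ord0 k)%:C + - 'i * (c y ord0 l)%:C) X' oV Vx).
    rewrite (dirC_D X' (s_cC _) sNi Vx).
    by rewrite (dirC_M X' (smoothC_cst _ _) (s_cC _) Vx) dirC_cst mul0r add0r.
  move=> y _; rewrite fE conjcD conjcM !conjc_real; congr (_ + _ * _).
  by apply/eqP; rewrite eq_complex /= oppr0 !eqxx.
have [z0 z1] := d z hz Xz; have [w0 w1] := d w hw Xw.
rewrite (dir_z X' Vx) in z0; rewrite (cj _ _ _ zE) in z1.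
rewrite (dir_w X' Vx) in w0; rewrite (cj _ _ _ wE) in w1.
have [r0 r1] := re _ _ z0 z1; have [r2 r3] := re _ _ w0 w1.
case: m => [[|[|[|[|//]]]] i].
- by rewrite (_ : Ordinal i = ord0) //; exact: val_inj.
- by rewrite (_ : Ordinal i = o1) //; apply: val_inj; rewrite /= inordK.
- by rewrite (_ : Ordinal i = o2) //; apply: val_inj; rewrite /= inordK.
- by rewrite (_ : Ordinal i = o3) //; apply: val_inj; rewrite /= inordK.
Qed.

Variable P : 'rV[R]_4 -> 'I_4 -> 'M[R[i]]_n.
Hypothesis sP : forall a, smoothM V (fun x => P x a).
Hypothesis P_flat : forall x X Z, V x -> type01 J x X -> type01 J x Z ->
  contractM (curvature P x) X Z = 0.

(** The pull-back of the potential to the chart, evaluated on the constant vector [v]. *)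
Let Q v y : 'M[R[i]]_n := pair_form (P (psi y)) (push v y).

Let s_push v a : smoothC W (fun y => push v y a).
Proof.
apply: (smoothC_sum _ oW) => b _; apply: (smoothC_M oW (smoothC_cst _ _)).
exact: (smoothC_pdC b (smoothC_real (s_psi a))).
Qed.

Let s_P a : smoothM W (fun y => P (psi y) a).
Proof. by apply: (smoothM_comp_rV oW s_psi _ (sP a)) => y /W_V[]. Qed.

Let s_Q v : smoothM W (Q v).
Proof.
apply: (smoothM_sum _ oW) => a.
exact: (smoothM_scale oW (s_push v a) (s_P a)).
Qed.

Let dir_Q u v y : W y -> dirM u (Q v) y =
  (\sum_a dirC u (dirC v (psiC a)) y *: P (psi y) a) +
  \sum_a push v y a *: dirM (push u y) (fun x => P x a) (psi y).
Proof.
move=> Wy; rewrite /Q /pair_form.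
rewrite (dirM_sum _ u (fun a => smoothM_scale oW (s_push v a) (s_P a)) Wy) -big_split.
apply: eq_bigr => a _ /=; rewrite (dirM_scale u (s_push v a) (s_P a) Wy); congr (_ + _ *: _).
by have [Vy _] := W_V Wy; exact: (dirM_comp_rV u s_psi (sP a) Wy Vy).
Qed.

(** Naturality of the curvature: the second derivatives of the inverse chart cancel, and constant
    fields commute. *)
Let curl_Q u v y : W y -> dirM u (Q v) y - dirM v (Q u) y + (Q u y *m Q v y - Q v y *m Q u y) =
  contractM (curvature P (psi y)) (push u y) (push v y).
Proof.
move=> Wy; rewrite contract_curvature !dir_Q //; congr (_ + _).
rewrite (_ : \sum_a dirC u (dirC v (psiC a)) y *: P (psi y) a =
  \sum_a dirC v (dirC u (psiC a)) y *: P (psi y) a); last first.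
  by apply: eq_bigr => a _; rewrite (dirC_comm u v oW (smoothC_real (s_psi a)) Wy).
rewrite opprD addrACA subrr add0r /contractM.
have -> : \sum_a push v y a *: dirM (push u y) (fun x => P x a) (psi y) =
    \sum_a \sum_b (push u y a * push v y b) *: pdM a (fun x => P x b) (psi y).
  rewrite exchange_big /=; apply: eq_bigr => a _; rewrite /dirM scaler_sumr.
  by apply: eq_bigr => b _; rewrite scalerA mulrC.
have -> : \sum_a push u y a *: dirM (push v y) (fun x => P x a) (psi y) =
    \sum_a \sum_b (push u y a * push v y b) *: pdM b (fun x => P x a) (psi y).
  apply: eq_bigr => a _; rewrite /dirM scaler_sumr.
  by apply: eq_bigr => b _; rewrite scalerA.
rewrite -sumrB; apply: eq_bigr => a _; rewrite -sumrB; apply: eq_bigr => b _.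
by rewrite scalerBr.
Qed.

(* Twice the coordinate fields of zbar and wbar. *)
Let v1 : 'I_4 -> R[i] := fun m => [:: 1; 'i; 0; 0]`_m.
Let v2 : 'I_4 -> R[i] := fun m => [:: 0; 0; 1; 'i]`_m.

Let ii : 'i * 'i = -1 :> R[i]. Proof. by rewrite -expr2 sqr_i. Qed.

Let v1E : [/\ v1 ord0 = 1, v1 o1 = 'i%R, v1 o2 = 0 & v1 o3 = 0].
Proof. by rewrite /v1; split; rewrite ?inordK. Qed.

Let v2E : [/\ v2 ord0 = 0, v2 o1 = 0, v2 o2 = 1 & v2 o3 = 'i%R].
Proof. by rewrite /v2; split; rewrite ?inordK. Qed.

Let sum_v1 (G : 'I_4 -> 'M[R[i]]_n) : \sum_m v1 m *: G m = G ord0 + 'i *: G o1.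
Proof. by rewrite sum4; case: v1E => -> -> -> ->; rewrite scale1r !scale0r !addr0. Qed.

Let sum_v2 (G : 'I_4 -> 'M[R[i]]_n) : \sum_m v2 m *: G m = G o2 + 'i *: G o3.
Proof. by rewrite sum4; case: v2E => -> -> -> ->; rewrite scale1r !scale0r !add0r. Qed.

Let dirM_v1 F y : dirM v1 F y = pdMi ord0 o1 F y.
Proof. exact: (sum_v1 (fun m => pdM m F y)). Qed.

Let dirM_v2 F y : dirM v2 F y = pdMi o2 o3 F y.
Proof. exact: (sum_v2 (fun m => pdM m F y)). Qed.

Let type01_push v y : W y -> v ord0 + 'i * v o1 = 0 -> v o2 + 'i * v o3 = 0 ->
  type01 J (psi y) (push v y).
Proof.
move=> Wy e1 e2; have [Vy _] := W_V Wy.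
by apply: hol_type01 => //; rewrite ?(dir_z _ Vy) ?(dir_w _ Vy) !chart_push.
Qed.

Let type01_v1 y : W y -> type01 J (psi y) (push v1 y).
Proof. by move=> Wy; apply: type01_push => //; case: v1E => a b c d;
  rewrite ?a ?b ?c ?d ?mulr0 ?addr0 // ii subrr. Qed.

Let type01_v2 y : W y -> type01 J (psi y) (push v2 y).
Proof. by move=> Wy; apply: type01_push => //; case: v2E => a b c d;
  rewrite ?a ?b ?c ?d ?mulr0 ?addr0 // ii subrr. Qed.

(** In the chart the (0,1) directions become two constant fields in complementary pairs of
    coordinates, flatness becomes the compatibility condition of [koszul_malgrange] for the
    coefficients -Q, and the solution is pulled back by the chart. *)
Lemma flat_type01 x0 : V x0 -> exists V', [/\ open V', V' x0, V' `<=` V &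
  exists k : 'rV[R]_4 -> 'M[R[i]]_n, [/\ smoothM V' k, forall x, V' x -> k x \in unitmx &
    forall x X, V' x -> type01 J x X -> dirM X k x + pair_form (P x) X *m k x = 0]].
Proof.
move=> Vx0.
have sN v : smoothM W (fun y => - Q v y).
  apply: (@smoothM_eq _ _ _ _ (fun y => (- 1) *: Q v y) _ oW) => [y _|]; first by rewrite scaleN1r.
  exact: (smoothM_scale oW (smoothC_cst _ _) (s_Q v)).
have dN u v y : W y -> dirM u (fun y => - Q v y) y = - dirM u (Q v) y.
  move=> Wy; rewrite -(_ : (fun y => (- 1) *: Q v y) = fun y => - Q v y); last first.
    by apply/funext => y'; rewrite scaleN1r.
  by rewrite (dirM_scale u (smoothC_cst _ _) (s_Q v) Wy) dirC_cst scale0r add0r scaleN1r.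
have n01 : ord0 != o1 by rewrite -val_eqE /= inordK.
have n23 : o2 != o3 by rewrite -val_eqE /= !inordK.
have n02 : ord0 != o2 by rewrite -val_eqE /= inordK.
have n03 : ord0 != o3 by rewrite -val_eqE /= inordK.
have n12 : o1 != o2 by rewrite -val_eqE /= !inordK.
have n13 : o1 != o3 by rewrite -val_eqE /= !inordK.
have compat y : W y -> pdMi ord0 o1 (fun y => - Q v2 y) y + (- Q v2 y) *m (- Q v1 y) =
    pdMi o2 o3 (fun y => - Q v1 y) y + (- Q v1 y) *m (- Q v2 y).
  move=> Wy; rewrite -(dirM_v1 _ y) -(dirM_v2 _ y) (dN _ _ _ Wy) (dN _ _ _ Wy) !mulmxN !mulNmx !opprK.
  have [Vy _] := W_V Wy.
  have := curl_Q v1 v2 Wy; rewrite (P_flat Vy (type01_v1 Wy) (type01_v2 Wy)).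
  move: (dirM v1 _ y) (dirM v2 _ y) (Q v1 y *m Q v2 y) (Q v2 y *m Q v1 y) => A B C D e.
  apply/eqP; rewrite -subr_eq0 -oppr_eq0 -e; apply/eqP/matrixP => i j; rewrite !mxE; ring.
have [V1 [oV1 V1c V1W [h [sh uh h1 h2]]]] :=
  koszul_malgrange n01 n23 n02 n03 n12 n13 oW (V_W Vx0) (sN v1) (sN v2) compat.
have oV' : V `&` c @^-1` V1 `<=` (V `&` c @^-1` V1)^°.
  move=> x [Vx V1x].
  have cc : {for x, continuous c}.
    apply: differentiable_continuous; apply: differentiable_rV => b.
    exact: smooth_differentiable (c_smooth b) Vx.
  apply: filterI; first exact: open_nbhs_nbhs.
  by apply: cc; exact: open_nbhs_nbhs.
exists (V `&` c @^-1` V1); split.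
- by rewrite openE.
- by split.
- by move=> x [].
pose k x := h (c x); exists k; split.
- apply: (smoothM_comp_rV _ _ _ sh); last by move=> x [].
    by rewrite openE; exact: oV'.
  by move=> b; apply: smoothS (c_smooth b) => x [].
- by move=> x [_ V1x]; exact: uh.
move=> x X [Vx V1x] tX.
have sh' : smoothM V1 h by [].
have -> : dirM X k x = dirM (fun m => dirC X (cC m) x) h (c x).
  have sm b : smooth (V `&` c @^-1` V1) (fun y => c y ord0 b) by apply: smoothS (c_smooth b) => y [].
  exact: (dirM_comp_rV X sm sh (conj Vx V1x) V1x).
pose xi m := dirC X (cC m) x; rewrite -/xi.
(* A (0,1) vector annihilates z and w, so its chart components are a combination of [v1] and [v2]
   with coefficients [xi ord0] and [xi o2]. *)
have i_solve (p q : R[i]) : p + 'i * q = 0 -> q = 'i * p.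
  move=> e; apply: subr0_eq; rewrite -[RHS](mulr0 (- 'i)) -e mulrDr mulrA !mulNr ii.
  by rewrite mulN1r opprK addrC.
have xi1 : xi o1 = 'i * xi ord0.
  have := type01_hol hz Vx tX; rewrite (dir_z X Vx); exact: i_solve.
have xi3 : xi o3 = 'i * xi o2.
  have := type01_hol hw Vx tX; rewrite (dir_w X Vx); exact: i_solve.
have alg (G : 'I_4 -> R[i]) : \sum_m xi m * G m =
    xi ord0 * (\sum_m v1 m * G m) + xi o2 * (\sum_m v2 m * G m).
  rewrite !sum4 xi1 xi3; move: (xi ord0) (xi o2) => x0' x2.
  by case: v1E => -> -> -> ->; case: v2E => -> -> -> ->; ring.
have -> : pair_form (P x) X = xi ord0 *: Q v1 (c x) + xi o2 *: Q v2 (c x).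
  rewrite /Q psiK // /pair_form !scaler_sumr -big_split; apply: eq_bigr => a _ /=.
  rewrite !scalerA -scalerDl; congr (_ *: _); rewrite (chart_vec X a Vx) -/xi.
  exact: (alg (fun m => pdC m (psiC a) (c x))).
have -> : dirM xi h (c x) = xi ord0 *: pdMi ord0 o1 h (c x) + xi o2 *: pdMi o2 o3 h (c x).
  have algM (G : 'I_4 -> 'M[R[i]]_n) : \sum_m xi m *: G m =
      xi ord0 *: (G ord0 + 'i *: G o1) + xi o2 *: (G o2 + 'i *: G o3).
    rewrite sum4 xi1 xi3 !scalerDr !scalerA !addrA.
    by rewrite ['i * xi ord0]mulrC ['i * xi o2]mulrC.
  exact: (algM (fun m => pdM m h (c x))).
rewrite (h1 _ V1x) (h2 _ V1x) /k mulmxDl -!scalemxAl.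
by rewrite !mulNmx !scalerN -opprD addNr.
Qed.

End Chart.

End FrobeniusType01.

(** * Gauge transformations and conjugate connections *)

Section Gauge.
Context {R : realType} {n : nat}.
Variables (V : set 'rV[R]_4) (P : 'rV[R]_4 -> 'I_4 -> 'M[R[i]]_n).
Hypothesis oV : open V.
Hypothesis sP : forall a, smoothM V (fun x => P x a).
Implicit Types (x : 'rV[R]_4) (a b : 'I_4) (u X Z : 'I_4 -> R[i]).

Lemma curvature_eq (Q : 'rV[R]_4 -> 'I_4 -> 'M[R[i]]_n) x a b : V x ->
  (forall y a, V y -> P y a = Q y a) -> curvature P x a b = curvature Q x a b.
Proof.
move=> Vx PQ; rewrite /curvature (PQ x a Vx) (PQ x b Vx).
by rewrite (pdM_eq a oV Vx (fun y Vy => PQ y b Vy)) (pdM_eq b oV Vx (fun y Vy => PQ y a Vy)).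
Qed.

Lemma hodgeM_conjugate (g : 'rV[R]_4 -> 'M[R]_4) x (F : 'I_4 -> 'I_4 -> 'M[R[i]]_n)
    (K H : 'M[R[i]]_n) a b :
  hodgeM g x (fun a b => K *m F a b *m H) a b = K *m hodgeM g x F a b *m H.
Proof.
rewrite /hodgeM mulmx_sumr mulmx_suml; apply: eq_bigr => c _.
rewrite mulmx_sumr mulmx_suml; apply: eq_bigr => d _.
by rewrite -scalemxAr -scalemxAl.
Qed.

Lemma gauge_algebra (K H Pa Pb Ha Hb Pab Pba Hab : 'M[R[i]]_n) : H *m K = 1%:M ->
  ((- (K *m Ha *m K) *m Pb + K *m Pab) *m H + K *m Pb *m Ha + (- (K *m Ha *m K) *m Hb + K *m Hab))
  - ((- (K *m Hb *m K) *m Pa + K *m Pba) *m H + K *m Pa *m Hb + (- (K *m Hb *m K) *m Ha + K *m Hab))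
  + ((K *m Pa *m H + K *m Ha) *m (K *m Pb *m H + K *m Hb)
     - (K *m Pb *m H + K *m Hb) *m (K *m Pa *m H + K *m Ha)) =
  K *m (Pab - Pba + (Pa *m Pb - Pb *m Pa)) *m H.
Proof.
move=> HK; have hk (X : 'M[R[i]]_n) : X *m H *m K = X by rewrite -mulmxA HK mulmx1.
rewrite !(mulmxDl, mulmxDr, mulNmx, mulmxN, mulmxA) !hk.
(* Once every product H K has been cancelled the noncommutative monomials become atoms, and the
   identity is linear in them. *)
move: (K *m Ha *m K *m Pb *m H) (K *m Pab *m H) (K *m Pb *m Ha) (K *m Ha *m K *m Hb) (K *m Hab)
  (K *m Hb *m K *m Pa *m H) (K *m Pba *m H) (K *m Pa *m Hb) (K *m Hb *m K *m Ha)
  (K *m Pa *m Pb *m H) (K *m Pb *m Pa *m H).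
move=> M1 M2 M3 M4 M5 M6 M7 M8 M9 M10 M11; apply/matrixP => i j; rewrite !mxE; ring.
Qed.

Lemma curvature_gauge h x a b : smoothGL V h -> V x ->
  curvature (gauge_transform h P) x a b = invmx (h x) *m curvature P x a b *m h x.
Proof.
move=> [sh uh] Vx; have shV := smoothM_inv oV sh uh.
have hh : h x *m invmx (h x) = 1%:M by rewrite mulmxV ?uh.
have dg c d : pdM c (fun y => gauge_transform h P y d) x =
    (- (invmx (h x) *m pdM c h x *m invmx (h x)) *m P x d
      + invmx (h x) *m pdM c (fun y => P y d) x) *m h x + invmx (h x) *m P x d *m pdM c h x
    + (- (invmx (h x) *m pdM c h x *m invmx (h x)) *m pdM d h x
      + invmx (h x) *m pdM c (pdM d h) x).
  have s1 := smoothM_mul oV shV (sP d).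
  have s2 := smoothM_mul oV s1 sh.
  have s3 := smoothM_mul oV shV (smoothM_pdM d sh).
  rewrite (pdM_D c (smoothM_diffM s2 Vx) (smoothM_diffM s3 Vx)).
  rewrite (pdM_mul c (smoothM_diffM s1 Vx) (smoothM_diffM sh Vx)).
  rewrite (pdM_mul c (smoothM_diffM shV Vx) (smoothM_diffM (sP d) Vx)).
  rewrite (pdM_mul c (smoothM_diffM shV Vx) (smoothM_diffM (smoothM_pdM d sh) Vx)).
  by rewrite (pdM_inv c oV sh uh Vx).
rewrite /curvature (dg a b) (dg b a) (pdM_comm b a oV sh Vx) /gauge_transform.
exact: gauge_algebra.
Qed.

Definition conjM (M : 'M[R[i]]_n) : 'M[R[i]]_n := map_mx (@conjc R) M.

Lemma conjMK : involutive conjM.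
Proof. by move=> M; apply/matrixP => i j; rewrite !mxE conjcK. Qed.

Lemma conjM_mul (M N : 'M[R[i]]_n) : conjM (M *m N) = conjM M *m conjM N.
Proof. exact: map_mxM. Qed.

Lemma conjM_D (M N : 'M[R[i]]_n) : conjM (M + N) = conjM M + conjM N.
Proof. exact: map_mxD. Qed.

Lemma conjM_N (M : 'M[R[i]]_n) : conjM (- M) = - conjM M.
Proof. exact: map_mxN. Qed.

Lemma conjM_lin (z : R[i]) (M : 'M[R[i]]_n) : conjM (z *: M) = z^*%C *: conjM M.
Proof. exact: map_mxZ. Qed.

Lemma conjM_sum (I : finType) (F : I -> 'M[R[i]]_n) : conjM (\sum_i F i) = \sum_i conjM (F i).
Proof. exact: (raddf_sum (map_mx (@conjc R))). Qed.

Lemma conjM_pdM a F x : smoothM V F -> V x -> pdM a (fun y => conjM (F y)) x = conjM (pdM a F x).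
Proof.
move=> sF Vx; apply/matrixP => i j; rewrite !mxE.
rewrite -(pdC_conj a (smoothC_diffC (sF i j) Vx)); apply: (pdC_eq a oV Vx) => y _.
by rewrite mxE.
Qed.

Lemma smoothM_conj F : smoothM V F -> smoothM V (fun y => conjM (F y)).
Proof.
move=> sF i j; apply: (smoothC_eq oV _ (smoothC_conj oV (sF i j))) => y _.
by rewrite mxE.
Qed.

Lemma dirM_conj u F x : smoothM V F -> V x ->
  dirM u (fun y => conjM (F y)) x = conjM (dirM (fun a => (u a)^*%C) F x).
Proof.
move=> sF Vx; rewrite /dirM conjM_sum; apply: eq_bigr => a _.
by rewrite conjM_lin conjcK conjM_pdM.
Qed.

Lemma pair_form_conj (Q : 'I_4 -> 'M[R[i]]_n) u :
  pair_form (fun a => conjM (Q a)) u = conjM (pair_form Q (fun a => (u a)^*%C)).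
Proof.
by rewrite /pair_form conjM_sum; apply: eq_bigr => a _; rewrite conjM_lin conjcK.
Qed.

Lemma contractM_curvature_conj x X Z : V x ->
  contractM (curvature (fun y a => conjM (P y a)) x) X Z =
  conjM (contractM (curvature P x) (fun a => (X a)^*%C) (fun a => (Z a)^*%C)).
Proof.
move=> Vx; rewrite /contractM conjM_sum; apply: eq_bigr => a _; rewrite conjM_sum.
apply: eq_bigr => b _; rewrite conjM_lin conjcM !conjcK; congr (_ *: _).
rewrite /curvature !(conjM_pdM _ (sP _) Vx) -!conjM_mul.
by rewrite conjM_D conjM_D conjM_D !conjM_N.
Qed.

Lemma contractM_lin (F : 'I_4 -> 'I_4 -> 'M[R[i]]_n) (I : finType) (L : I -> 'I_4 -> R[i]) xi ze X Z :
  (forall a, X a = \sum_i xi i * L i a) -> (forall a, Z a = \sum_i ze i * L i a) ->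
  (forall i j, contractM F (L i) (L j) = 0) -> contractM F X Z = 0.
Proof.
move=> XE ZE F0; transitivity (\sum_i \sum_j (xi i * ze j) *: contractM F (L i) (L j)); last first.
  by rewrite big1 // => i _; rewrite big1 // => j _; rewrite F0 scaler0.
have -> : X = fun a => \sum_i xi i * L i a by exact/funext.
have -> : Z = fun a => \sum_i ze i * L i a by exact/funext.
rewrite /contractM.
transitivity (\sum_i \sum_a \sum_b \sum_j (xi i * ze j) *: ((L i a * L j b) *: F a b)).
  rewrite [RHS]exchange_big /=; apply: eq_bigr => a _.
  rewrite [RHS]exchange_big /=; apply: eq_bigr => b _.
  rewrite mulr_suml scaler_suml; apply: eq_bigr => i _; rewrite mulr_sumr scaler_suml.
  by apply: eq_bigr => j _; rewrite scalerA; congr (_ *: _); ring.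
apply: eq_bigr => i _.
transitivity (\sum_a \sum_j \sum_b (xi i * ze j) *: ((L i a * L j b) *: F a b)).
  by apply: eq_bigr => a _; rewrite exchange_big.
rewrite exchange_big /=; apply: eq_bigr => j _; rewrite scaler_sumr; apply: eq_bigr => a _.
by rewrite scaler_sumr.
Qed.

End Gauge.

(** * Self-dual connections in a parallel gauge *)

Section Converse.
Context {R : realType} {n : nat}.
Variables (U : set 'rV[R]_4) (g J : 'rV[R]_4 -> 'M[R]_4).
Variables (s : 'rV[R]_4 -> 'I_4 -> 'M[R[i]]_2) (o : 'rV[R]_4 -> 'I_2 -> R[i]).
Hypothesis U_open : open U.
Hypothesis g_metric : riemannian_metric U g.
Hypothesis J_orthogonal : orthogonal_almost_complex U g J.
Hypothesis s_frame : spin_frame U g s.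
Hypothesis o_J : represents U g J s o.
Implicit Types (u v w : 'I_4 -> R[i]) (x : 'rV[R]_4) (a b c d : 'I_4) (A B C D : 'I_2).
Notation j0 := (ord0 : 'I_2).
Notation j1 := (ord_max : 'I_2).
Notation io := (fun x => dagger (o x)).
Notation tv := (spinor_vec g s).
Notation fv := (frame_vec s).


Lemma frame_vec_expand x X a : U x -> X a = \sum_A \sum_A' fv X x A A' * inv_frame g s x a A A'.
Proof.
move=> Ux; transitivity (\sum_b X b * (b == a)%:R).
  by rewrite (bigD1 a)//= eqxx mulr1 big1 ?addr0// => b /negPf ->; rewrite mulr0.
under eq_bigr do rewrite -(frame_complete (metric_unit g_metric Ux)
  (metric_sym g_metric Ux) (frame_metric s_frame Ux)).
rewrite /frame_vec !sum_ord2 !mulr_suml -!big_split; apply: eq_bigr => b _ /=.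
by rewrite !sum_ord2; ring.
Qed.

(** [dbar_spinor] applied to the coordinate function x^d reads off the d-th component of the
    projection of the frame vector. *)
Lemma proj01 x A A' d : U x ->
  2^-1 * (inv_frame g s x d A A' + 'i * \sum_a (J x d a)%:C * inv_frame g s x a A A') =
  beta o x A * tv (o x) x A' d.
Proof.
move=> Ux; have cE u y : dirC u (fun y => (y ord0 d)%:C) y = u d.
  rewrite /dirC (bigD1 d)//= pdC_real pd_coord eqxx rmorph1 mulr1 big1 ?addr0// => b bd.
  by rewrite pdC_real pd_coord (negPf bd) rmorph0 mulr0.
rewrite -[X in _ = _ * X](cE _ x).
rewrite -(dbar_spinor g_metric J_orthogonal s_frame o_J _ _ _ Ux) /dbar.
have pE a : pdC a (fun y : 'rV[R]_4 => (y ord0 d)%:C) x = (a == d)%:R.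
  by rewrite pdC_real pd_coord; case: (a == d).
transitivity (\sum_a (2^-1 * (inv_frame g s x a A A' * (a == d)%:R) +
    2^-1 * 'i * ((J x d a)%:C * inv_frame g s x a A A'))).
  rewrite big_split /= -!mulr_sumr mulrDr mulrA; congr (_ * _ + _).
  by rewrite (bigD1 d)//= eqxx mulr1 big1 ?addr0// => b /negPf ->; rewrite mulr0.
apply: eq_bigr => a _; rewrite pE.
have -> : \sum_b pdC b (fun y : 'rV[R]_4 => (y ord0 d)%:C) x * (J x b a)%:C = (J x d a)%:C.
  rewrite (bigD1 d)//= pE eqxx mul1r big1 ?addr0// => b /negPf bd.
  by rewrite pE bd mul0r.
by ring.
Qed.

Let ii : 'i * 'i = -1 :> R[i]. Proof. by rewrite -expr2 sqr_i. Qed.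

(** A vector of type (0,1) is fixed by the projection (1 + i J)/2, whose image on each frame vector
    is a multiple of some L_A'. *)
Lemma type01_span x X : U x -> type01 J x X ->
  forall d, X d = \sum_A' (\sum_A fv X x A A' * beta o x A) * tv (o x) x A' d.
Proof.
move=> Ux tX d.
transitivity (2^-1 * (X d + 'i * \sum_a (J x d a)%:C * X a)).
  by rewrite tX mulrA mulrN ii opprK mul1r -mulr2n -[X d *+ 2]mulr_natl mulrA mulVf ?mul1r // pnatr_eq0.
transitivity (\sum_A \sum_A' fv X x A A' * (2^-1 * (inv_frame g s x d A A' +
   'i * \sum_a (J x d a)%:C * inv_frame g s x a A A'))).
  have -> : \sum_a (J x d a)%:C * X a = \sum_A \sum_A' fv X x A A' *
      \sum_a (J x d a)%:C * inv_frame g s x a A A'.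
    move: (frame_vec_expand (x := x) X) => fE.
    rewrite !sum_ord2 !mulr_sumr -!big_split; apply: eq_bigr => a _ /=.
    by rewrite {1}(fE a Ux) !sum_ord2; ring.
  by rewrite {1}(frame_vec_expand X d Ux) !sum_ord2; ring.
under eq_bigr do under eq_bigr do rewrite proj01 //.
move: (fv X x) (beta o x) (tv (o x) x) => v b t.
by rewrite !sum_ord2; ring.
Qed.

Lemma type01_spinor x A' : U x -> type01 J x (tv (o x) x A').
Proof.
move=> Ux b.
have e : tv (o x) x A' b = 2^-1 * (tv (o x) x A' b + 'i * \sum_a (J x b a)%:C * tv (o x) x A' a).
  transitivity ((\sum_B o x B * beta o x B) * tv (o x) x A' b).
    by rewrite (beta_o J_orthogonal o_J Ux) mul1r.
  rewrite mulr_suml.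
  under eq_bigr do rewrite -mulrA -proj01 //.
  rewrite /spinor_vec.
  have -> : \sum_a (J x b a)%:C * (\sum_A o x A * inv_frame g s x a A A') =
     \sum_A o x A * \sum_a (J x b a)%:C * inv_frame g s x a A A'.
    move: (inv_frame g s x) => E.
    rewrite sum_ord2 !mulr_sumr -big_split; apply: eq_bigr => a _ /=.
    by rewrite sum_ord2; ring.
  by rewrite !sum_ord2; ring.
move: (\sum_a _) e => S; move: (tv _ _ _ _) => t e.
have {}e : t = 'i * S.
  have : 2%:R * t = 2%:R * (2^-1 * (t + 'i * S)) by rewrite -e.
  rewrite mulrA mulfV ?pnatr_eq0 // mul1r mulr_natl mulr2n.
  exact: addrI.
by rewrite e mulrA mulNr ii opprK mul1r.
Qed.

Variable P : 'rV[R]_4 -> 'I_4 -> 'M[R[i]]_n.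
Hypothesis sP : forall a, smoothM U (fun x => P x a).
Hypothesis P_sd : self_dual_YM U g P.

Lemma contractM_antisym (F : 'I_4 -> 'I_4 -> 'M[R[i]]_n) X Z :
  (forall a b, F a b = - F b a) -> contractM F X Z = - contractM F Z X.
Proof.
move=> FN; rewrite /contractM exchange_big -sumrN /=; apply: eq_bigr => a _.
by rewrite -sumrN; apply: eq_bigr => b _; rewrite (FN b a) scalerN mulrC.
Qed.

Let antisym2 (C : 'I_2 -> 'I_2 -> 'M[R[i]]_n) : (forall A B, C A B = - C B A) ->
  C j0 j1 = 0 -> forall A B, C A B = 0.
Proof.
move=> CN C01; have C0 A : C A A = 0.
  apply/matrixP => i j; rewrite mxE; apply: eq_opp0.
  by have := congr1 (fun N : 'M[R[i]]_n => N i j) (CN A A); rewrite mxE.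
by move=> A B; elim/ord2_ind: A; elim/ord2_ind: B => //; rewrite CN C01 oppr0.
Qed.

Lemma self_dual_oo x A' B' : U x ->
  contractM (curvature P x) (tv (o x) x A') (tv (o x) x B') = 0.
Proof.
move=> Ux; pose C A B := contractM (curvature P x) (tv (o x) x A) (tv (o x) x B).
apply: (antisym2 (C := C)).
  by move=> A B; apply: contractM_antisym; exact: curvature_antisym.
by have [/(_ (fun a b => P_sd a b Ux))[]] := hodgeM_self_dual_spinorP g_metric J_orthogonal s_frame o_J
  Ux (curvature_antisym P x).
Qed.

Lemma self_dual_ii x A' B' : U x ->
  contractM (curvature P x) (tv (io x) x A') (tv (io x) x B') = 0.
Proof.
move=> Ux; pose C A B := contractM (curvature P x) (tv (io x) x A) (tv (io x) x B).
apply: (antisym2 (C := C)).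
  by move=> A B; apply: contractM_antisym; exact: curvature_antisym.
by have [/(_ (fun a b => P_sd a b Ux))[]] := hodgeM_self_dual_spinorP g_metric J_orthogonal s_frame o_J
  Ux (curvature_antisym P x).
Qed.

Let Pc : 'rV[R]_4 -> 'I_4 -> 'M[R[i]]_n := fun x a => conjM (P x a).

Let P_flat x X Z : U x -> type01 J x X -> type01 J x Z ->
  contractM (curvature P x) X Z = 0.
Proof.
move=> Ux tX tZ; apply: (contractM_lin (type01_span Ux tX) (type01_span Ux tZ)) => A' B'.
exact: self_dual_oo.
Qed.

(** Conjugating the potential exchanges the types: its curvature on (0,1) vectors is the conjugate
    of that of [P] on their conjugates, which are spanned by the N_A'. *)
Let Pc_flat x X Z : U x -> type01 J x X -> type01 J x Z ->
  contractM (curvature Pc x) X Z = 0.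
Proof.
move=> Ux tX tZ; rewrite (contractM_curvature_conj U_open sP _ _ Ux).
have cE X' : type01 J x X' -> exists eta : 'I_2 -> R[i], forall d, (X' d)^*%C =
    \sum_A' eta A' * tv (io x) x A' d.
  move=> tX'; have [xi XE] : exists xi : 'I_2 -> R[i], forall d, X' d =
      \sum_A' xi A' * tv (o x) x A' d by eexists; exact: (type01_span Ux tX').
  (* Conjugation maps L_0', L_1' to N_1', -N_0', which exchanges the coefficients and puts the sign
     on the first. *)
  exists (fun A' => if A' == j0 then - (xi j1)^*%C else (xi j0)^*%C) => d.
  rewrite XE !sum_ord2 /= conjcD !conjcM.
  have [-> ->] := spinor_vec_conj s_frame (o x) d Ux; ring.
have [eta XE] := cE X tX; have [eta' ZE] := cE Z tZ.
rewrite (contractM_lin XE ZE); last by move=> A' B'; exact: self_dual_ii.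
by apply/matrixP => i j; rewrite !mxE conjc0.
Qed.

Hypothesis J_integrable : integrable_structure U J.

(* k2 trivialises the (0,1) part of the connection and k1 the (1,0) part, the
   latter being the conjugate of the (0,1) part of the conjugate potential. *)
Lemma self_dual_frames x0 : U x0 -> exists V, [/\ open V, V x0, V `<=` U &
  exists k1 k2 : 'rV[R]_4 -> 'M[R[i]]_n, [/\ smoothGL V k1, smoothGL V k2,
    forall x A', V x -> dirM (tv (io x) x A') k1 x +
      pair_form (P x) (tv (io x) x A') *m k1 x = 0 &
    forall x A', V x -> dirM (tv (o x) x A') k2 x +
      pair_form (P x) (tv (o x) x A') *m k2 x = 0]].
Proof.
move=> Ux0; have [V0 [z [w [V0x V0U [oV0 hz hw oW [psi [s_psi psiK]]]]]]] := J_integrable Ux0.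
have sPc a : smoothM U (fun x => Pc x a) by exact: (smoothM_conj U_open (sP a)).
have [V2 [oV2 V2x V2U [k2 [sk2 uk2 k2E]]]] := flat_type01 oV0 hz hw oW s_psi psiK
  (fun a => smoothMS V0U (sP a)) (fun x X Z V0x => P_flat (V0U x V0x)) V0x.
have [V1 [oV1 V1x V1U [kc [skc ukc kcE]]]] := flat_type01 oV0 hz hw oW s_psi psiK
  (fun a => smoothMS V0U (sPc a)) (fun x X Z V0x => Pc_flat (V0U x V0x)) V0x.
have V12 : V1 `&` V2 `<=` U by move=> x [/V1U/V0U].
exists (V1 `&` V2); split => //; first exact: openI.
exists (fun x => conjM (kc x)), k2; split.
- split; first by apply: (smoothM_conj (openI oV1 oV2)); apply: smoothMS skc => x [].
  by move=> x [V1x' _]; rewrite /conjM map_unitmx ukc.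
- split; first by apply: smoothMS sk2 => x [].
  by move=> x [_ V2x']; exact: uk2.
- move=> x A' [V1x' V2x']; have Ux := V0U _ (V1U _ V1x').
  have E B' : conjM (dirM (tv (o x) x B') kc x + pair_form (Pc x) (tv (o x) x B') *m kc x) = 0.
    rewrite (kcE _ _ V1x' (type01_spinor B' Ux)).
    by apply/matrixP => i j; rewrite !mxE conjc0.
  have {}E B' : dirM (fun a => (tv (o x) x B' a)^*%C) (fun y => conjM (kc y)) x +
      pair_form (P x) (fun a => (tv (o x) x B' a)^*%C) *m conjM (kc x) = 0.
    rewrite -(E B') conjM_D conjM_mul (dirM_conj oV1 _ skc V1x').
    rewrite (_ : (fun a => _) = tv (o x) x B'); last by apply/funext => a; rewrite conjcK.
    congr (_ + _ *m _); rewrite /Pc pair_form_conj conjMK.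
    by [].
  elim/ord2_ind: A'.
    have := E j1; rewrite (_ : (fun a => _) = fun a => - tv (io x) x j0 a); last first.
      by apply/funext => a; have [_ ->] := spinor_vec_conj s_frame (o x) a Ux.
    have -> : dirM (fun a => - tv (io x) x j0 a) (fun y => conjM (kc y)) x =
        - dirM (tv (io x) x j0) (fun y => conjM (kc y)) x.
      by rewrite /dirM -sumrN; apply: eq_bigr => a _; rewrite scaleNr.
    have -> : pair_form (P x) (fun a => - tv (io x) x j0 a) = - pair_form (P x) (tv (io x) x j0).
      by rewrite /pair_form -sumrN; apply: eq_bigr => a _; rewrite scaleNr.
    by rewrite mulNmx -opprD => /eqP; rewrite oppr_eq0 => /eqP.
  have := E j0; rewrite (_ : (fun a => _) = tv (io x) x j1) //.
  by apply/funext => a; have [-> _] := spinor_vec_conj s_frame (o x) a Ux.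
- by move=> x A' [V1x' V2x']; apply: k2E => //; apply: type01_spinor; exact: V0U (V2U _ V2x').
Qed.

(** An unprimed covector that vanishes on iota is beta times its value on o, so it suffices to
    evaluate the transformed potential on the vectors of both types. *)
Lemma gauge_components V k1 k2 x A A' : open V -> V `<=` U -> smoothGL V k1 -> smoothGL V k2 ->
  (forall x A', V x -> dirM (tv (io x) x A') k1 x +
      pair_form (P x) (tv (io x) x A') *m k1 x = 0) ->
  (forall x A', V x -> dirM (tv (o x) x A') k2 x +
      pair_form (P x) (tv (o x) x A') *m k2 x = 0) -> V x ->
  spinor_components g s (gauge_transform k1 P) x A A' =
  spinor_potential g s o (fun y => invmx (k2 y) *m k1 y) x A A'.
Proof.
move=> oV VU [sk1 uk1] [sk2 uk2] E1 E2 Vx; have Ux := VU _ Vx.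
pose q B := spinor_components g s (gauge_transform k1 P) x B A'.
have pg u : pair_form (gauge_transform k1 P x) u =
    invmx (k1 x) *m (dirM u k1 x + pair_form (P x) u *m k1 x).
  rewrite /pair_form /gauge_transform mulmxDr addrC mulmx_suml !mulmx_sumr -big_split.
  by apply: eq_bigr => a _ /=; rewrite scalerDr -scalemxAl -!scalemxAr mulmxA.
have q0 : \sum_B io x B *: q B = 0.
  by rewrite -pair_spinor pg E1 // mulmx0.
have qL : \sum_B o x B *: q B = invmx (invmx (k2 x) *m k1 x) *m
    dirM (tv (o x) x A') (fun y => invmx (k2 y) *m k1 y) x.
  rewrite -pair_spinor pg.
  have uY : invmx (k2 x) *m k1 x \in unitmx by rewrite unitmx_mul unitmx_inv uk2 // uk1.
  apply: (canRL (mulKmx uY)); rewrite -mulmxA mulKVmx ?uk1 //.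
  rewrite (dirM_mul _ (smoothM_inv oV sk2 uk2) sk1 Vx) (dirM_inv _ oV sk2 uk2 Vx).
  have /eqP := E2 x A' Vx; rewrite addr_eq0 => /eqP ->.
  rewrite mulmxDr addrC; congr (_ + _).
  by rewrite mulmxN !mulNmx opprK -!mulmxA mulKVmx ?uk2.
have spE : spinor_potential g s o (fun y => invmx (k2 y) *m k1 y) x A A' =
    beta o x A *: \sum_B o x B *: q B.
  by rewrite qL /spinor_potential sum_nablaM /beta mulNr.
rewrite spE -[LHS]/(q A).
have -> : q A = (A == j0)%:R *: q j0 + (A == j1)%:R *: q j1.
  by elim/ord2_ind: A {spE}; rewrite /= scale1r scale0r ?addr0 ?add0r.
(* Expansion of the component [q A] in the basis (o, iota). *)
rewrite -(spinor_delta J_orthogonal o_J A j0 Ux) -(spinor_delta J_orthogonal o_J A j1 Ux).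
transitivity (((chi o x)^-1 * lower (o x) A) *: (\sum_B io x B *: q B) +
  beta o x A *: \sum_B o x B *: q B); last by rewrite q0 scaler0 add0r.
rewrite /beta !sum_ord2; move: (q j0) (q j1) (chi o x)^-1 (lower _ A) (lower _ A) => q0' q1 c l l'.
by apply/matrixP => i j; rewrite !mxE; ring.
Qed.

End Converse.

Local Close Scope complex_scope.
Theorem proposition1 (R : realType) (n : nat) (U : set 'rV[R]_4)
    (g J : 'rV[R]_4 -> 'M[R]_4) (phi : 'rV[R]_4 -> R)
    (s Gam Gam' : 'rV[R]_4 -> 'I_4 -> 'M[R[i]]_2)
    (o : 'rV[R]_4 -> 'I_2 -> R[i])
    (U_open : open U)
    (g_metric : riemannian_metric U g)
    (J_orthogonal : orthogonal_almost_complex U g J)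
    (J_integrable : integrable_structure U J)
    (kappa_asd : antiselfdual_fundamental_form U g J)
    (phi_kahler : conformally_kahler_factor U g J phi)
    (s_frame : spin_frame U g s)
    (Gam_LC : spin_connection U g s Gam Gam')
    (o_smooth : forall A, smoothC U (fun x => o x A))
    (o_J : represents U g J s o)
    (o_scaling : shear_scaled U g s Gam o) :
  (forall Y : 'rV[R]_4 -> 'M[R[i]]_n, smoothGL U Y ->
     (forall x A A', U x ->
        spinor_components g s (dbar_potential J Y) x A A' =
        spinor_potential g s o Y x A A') /\
     (self_dual_YM U g (dbar_potential J Y) <->
      current_equation U g s Gam' o phi Y)) /\
  (forall P : 'rV[R]_4 -> 'I_4 -> 'M[R[i]]_n,
     (forall a, smoothM U (fun x => P x a)) -> self_dual_YM U g P ->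
     forall x0, U x0 -> exists V : set 'rV[R]_4,
       [/\ open V, V x0, V `<=` U &
       exists h Y : 'rV[R]_4 -> 'M[R[i]]_n,
         [/\ smoothGL V h, smoothGL V Y,
             forall x A A', V x ->
               spinor_components g s (gauge_transform h P) x A A' =
               spinor_potential g s o Y x A A' &
             current_equation V g s Gam' o phi Y]]).

Proof.
split.
  move=> Y sY; split.
    move=> x A A' Ux.
    rewrite (dbar_components g_metric J_orthogonal s_frame o_J _ _ _ Ux).
    by rewrite spinor_potentialE.
  exact: (dbar_self_dualP U_open g_metric J_orthogonal phi_kahler s_frame Gam_LC
    o_smooth o_J o_scaling sY).
move=> P sP P_sd x0 Ux0.
have [V [oV Vx0 VU [k1 [k2 [sk1 sk2 E1 E2]]]]] := self_dual_frames U_open g_metric J_orthogonal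
  s_frame o_J sP P_sd J_integrable Ux0.
pose Y y := invmx (k2 y) *m k1 y.
have sY : smoothGL V Y.
  have [[s1 u1] [s2 u2]] := (sk1, sk2); split.
    exact: (smoothM_mul oV (smoothM_inv oV s2 u2) s1).
  by move=> x Vx; rewrite unitmx_mul unitmx_inv u2 // u1.
have comp x A A' : V x -> spinor_components g s (gauge_transform k1 P) x A A' =
    spinor_potential g s o Y x A A'.
  move=> Vx; exact: (gauge_components J_orthogonal o_J A A' oV VU sk1 sk2 E1 E2 Vx).
(* The geometric data are restricted to [V] so that the equivalence of the direct part can be
   applied there. *)
have gV : riemannian_metric V g.
  by have [sg pg] := g_metric; split=> [a b|x /VU]; [exact: smoothS (sg a b)|exact: pg].
have JV : orthogonal_almost_complex V g J.
  by have [sJ pJ] := J_orthogonal; split=> [a b|x /VU]; [exact: smoothS (sJ a b)|exact: pJ].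
have phiV : conformally_kahler_factor V g J phi.
  have [sphi pphi cphi] := phi_kahler; split; first exact: smoothS sphi.
    by move=> x /VU; exact: pphi.
  by move=> x a b c /VU; exact: cphi.
have sV : spin_frame V g s.
  by have [ss ps] := s_frame; split=> [a|x /VU]; [exact: smoothMS (ss a)|exact: ps].
have GV : spin_connection V g s Gam Gam'.
  have [e e' fe] := Gam_LC; split.
  - by move=> x a A B /VU; exact: e.
  - by move=> x a A B /VU; exact: e'.
  - by move=> x a b A A' /VU; exact: fe.
have oVs A : smoothC V (fun x => o x A) by exact: smoothCS (o_smooth A).
have oJV : represents V g J s o by move=> x a b /VU; exact: o_J.
have scV : shear_scaled V g s Gam o by move=> x A' B /VU; exact: o_scaling.
exists V; split=> //; exists k1, Y; split=> //.
(* The current equation is obtained from self-duality of Y^-1 dbar Y. That potential coincides on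
   [V] with the gauge transform of [P], so its curvature is conjugate to that of [P], and the star
   commutes with this conjugation. *)
apply/(dbar_self_dualP oV gV JV phiV sV GV oVs oJV scV sY) => x a b Vx.
have PE y c : V y -> dbar_potential J Y y c = gauge_transform k1 P y c.
  move=> Vy; rewrite (potential_frame gV sV _ _ Vy) [RHS](potential_frame gV sV _ _ Vy).
  apply: eq_bigr => A _; apply: eq_bigr => A' _; congr (_ *: _).
  by rewrite comp // spinor_potentialE (dbar_components gV JV sV oJV _ _ _ Vy).
have sPV c : smoothM V (fun x => P x c) by exact: smoothMS VU (sP c).
have FE c d : curvature (dbar_potential J Y) x c d =
    invmx (k1 x) *m curvature P x c d *m k1 x.
  by rewrite (curvature_eq oV c d Vx PE) (curvature_gauge oV sPV c d sk1 Vx).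
have -> : curvature (dbar_potential J Y) x = fun c d => invmx (k1 x) *m curvature P x c d *m k1 x.
  by apply/funext => c; apply/funext => d.
by rewrite hodgeM_conjugate (P_sd _ _ _ (VU _ Vx)).
Qed.
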